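(* In the setting below, suppose Assumptions A and B hold. For any $\alpha>1$ let $k=\alpha\sigma^{2/3}/L_F$, $\omega=\max(2\sigma^2,(16L_F^2k)^3)$ and $c=\frac{\sigma^2}{14L_Fk^3}+130L_F^4$, and set $\eta_t=k/(\omega+t\sigma^2)^{1/3}$, $\beta_t=c\eta_t^2$. Running ASCDRO for $T$ iterations and returning $\mathbf x_\tau$ with $\tau$ uniform on $\{1,\dots,T\}$ gives $$\mathbb E\big[\operatorname{dist}(0,\hat\partial\bar F(\mathbf x_\tau))^2\big]\le\mathcal O\Big(\frac{\log T}{T^{2/3}}\Big).$$
   Context: Setting. $\mathcal W\subset\mathbb R^d$ is nonempty closed convex; $\ell_1,\dots,\ell_n:\mathbb R^d\to\mathbb R$ are twice differentiable losses with $\ell_i\ge0$ on $\mathcal W$; $\lambda_0>0,\rho>0$. For $\mathbf x=(\mathbf w^\top,\lambda)^\top$, $\lambda>0$: $g_i(\mathbf x)=\exp(\ell_i(\mathbf w)/\lambda)$, $g(\mathbf x)=\frac1n\sum_ig_i(\mathbf x)$, $F(\mathbf x)=\lambda\log g(\mathbf x)+\lambda\rho$, $\nabla g_i=(\partial_{\mathbf w}g_i^\top,\partial_\lambda g_i)^\top$, and $\nabla f_\lambda(s)=\lambda/s$. Assumption A: (a) $\|\mathbf w\|\le R$ for all $\mathbf w\in\mathcal W$; (b) $\|\nabla\ell_i(\mathbf w)\|\le G$ and $|\ell_i(\mathbf w)|\le C$ on $\mathcal W$, all $i$; (c) $\|\nabla\ell_i(\mathbf w_1)-\nabla\ell_i(\mathbf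 w_2)\|\le L\|\mathbf w_1-\mathbf w_2\|$ on $\mathcal W$; (d) $F(\mathbf w_1,\lambda_1)-\min_{\mathbf w\in\mathcal W,\lambda\ge\lambda_0}F(\mathbf w,\lambda)\le\Delta<\infty$ for the initial point $\mathbf x_1=(\mathbf w_1,\lambda_1)\in\mathcal X$. $\tilde\lambda=\lambda_0+C/\rho$, $\mathcal X=\{\mathbf x:\mathbf w\in\mathcal W,\lambda_0\le\lambda\le\tilde\lambda\}$, $\Pi_{\mathcal X}$ Euclidean projection, $\delta_{\mathcal X}$ indicator of $\mathcal X$, $\bar F=F+\delta_{\mathcal X}$. Assumption B: for $i$ uniform on $\{1,\dots,n\}$ and all $\mathbf x\in\mathcal X$, $\mathbb E|g_i(\mathbf x)-g(\mathbf x)|^2\le\sigma_g^2$, $\mathbb E\|\nabla g_i(\mathbf x)-\nabla g(\mathbf x)\|^2\le\sigma_{\nabla g}^2$; $\sigma^2:=\max\{\sigma_g^2,\sigma_{\nabla g}^2\}$. $L_F=\tilde\lambda L_g^2+2L_g+\tilde\lambda L_{\nabla g}+1+\tilde\lambda$ with $L_g=e^{C/\lambda_0}(\frac G{\lambda_0}+\frac C{\lambda_0^2})$, $L_{\nabla g}=\sqrt{L_A^2+L_B^2+L_C^2+L_D^2}$, $L_A=e^{C/\lambda_0}(\frac{G^2}{\lambda_0^2}+\frac L{\lambda_0})$, $L_B=e^{C/\lambda_0}(\frac{CG}{\lambda_0^3}+\frac G{\lambda_0^2})$, $L_C=e^{C/\lambda_0}\frac{CG+\lambda_0G}{\lambda_0^3}$,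 $L_D=e^{C/\lambda_0}\frac{C^2+2\lambda_0C}{\lambda_0^4}$. Regular subgradient: $\mathbf v\in\hat\partial\Phi(\bar{\mathbf x})$ iff $\liminf_{\mathbf x\to\bar{\mathbf x}}\frac{\Phi(\mathbf x)-\Phi(\bar{\mathbf x})-\mathbf v^\top(\mathbf x-\bar{\mathbf x})}{\|\mathbf x-\bar{\mathbf x}\|}\ge0$; $\operatorname{dist}(0,S)=\inf_{\mathbf v\in S}\|\mathbf v\|$. ASCDRO (indices $i$ i.i.d. uniform on $\{1,\dots,n\}$): draw $i$, set $s_1=g_i(\mathbf x_1)$, $\mathbf v_1=\partial_{\mathbf w}g_i(\mathbf x_1)$, $u_1=\partial_\lambda g_i(\mathbf x_1)$. For $t=1,\dots,T$: $\mathbf z_t=(\nabla f_{\lambda_t}(s_t)\mathbf v_t^\top,\ \nabla f_{\lambda_t}(s_t)u_t+\log s_t+\rho)^\top$, $\mathbf x_{t+1}=\Pi_{\mathcal X}(\mathbf x_t-\eta_t\mathbf z_t)$; draw a fresh $i$ and set $\mathbf v_{t+1}=\partial_{\mathbf w}g_i(\mathbf x_{t+1})+(1-\beta_t)(\mathbf v_t-\partial_{\mathbf w}g_i(\mathbf x_t))$, $u_{t+1}=\partial_\lambda g_i(\mathbf x_{t+1})+(1-\beta_t)(u_t-\partial_\lambda g_i(\mathbf x_t))$, $s_{t+1}=g_i(\mathbf x_{t+1})+(1-\beta_t)(s_t-g_i(\mathbf x_t))$. Output $(\mathbf x_\tau,\mathbf v_\tau,u_\tau,s_\tau)$ with $\tau$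 uniform on $\{1,\dots,T\}$. The $\mathcal O(\cdot)$ hides constants independent of $T$. *)

(* Defs.v *)
From HB Require Import structures.
From mathcomp Require Import all_boot all_order all_algebra.
From mathcomp Require Import all_classical all_reals all_analysis.
Set Implicit Arguments. Unset Strict Implicit. Unset Printing Implicit Defensive.
Import Order.TTheory GRing.Theory Num.Theory.
Import numFieldNormedType.Exports.
Local Open Scope classical_set_scope.
Local Open Scope ring_scope.

Definition dotv {R : realType} {d : nat} (a b : 'rV[R]_d) : R :=
  \sum_(j < d) a ord0 j * b ord0 j.
Definition enorm {R : realType} {d : nat} (a : 'rV[R]_d) : R := Num.sqrt (dotv a a).

(* points x = (w, lambda) of R^{d+1} *)
Definition dotX {R : realType} {d : nat} (a b : 'rV[R]_d * R) : R :=
  dotv a.1 b.1 + a.2 * b.2.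
Definition enormX {R : realType} {d : nat} (a : 'rV[R]_d * R) : R :=
  Num.sqrt (dotX a a).

Definition is_gradient {R : realType} {d : nat} (f : 'rV[R]_d -> R)
  (gl : 'rV[R]_d -> 'rV[R]_d) : Prop :=
  forall w, differentiable f w /\ forall h, 'd f w h = dotv (gl w) h.

Section Obj.
Context {R : realType} {d n : nat}.
Variables (ell : 'I_n -> 'rV[R]_d -> R) (gl : 'I_n -> 'rV[R]_d -> 'rV[R]_d).

Definition gi (i : 'I_n) (x : 'rV[R]_d * R) : R := expR (ell i x.1 / x.2).
(* partial_w g_i and partial_lambda g_i (chain rule) *)
Definition gwi (i : 'I_n) (x : 'rV[R]_d * R) : 'rV[R]_d :=
  (gi i x / x.2) *: gl i x.1.
Definition gli (i : 'I_n) (x : 'rV[R]_d * R) : R :=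
  - (gi i x * ell i x.1 / x.2 ^+ 2).
Definition gavg (x : 'rV[R]_d * R) : R := n%:R^-1 * \sum_(i < n) gi i x.
Definition gwavg (x : 'rV[R]_d * R) : 'rV[R]_d := n%:R^-1 *: \sum_(i < n) gwi i x.
Definition glavg (x : 'rV[R]_d * R) : R := n%:R^-1 * \sum_(i < n) gli i x.
Definition Fobj (rho : R) (x : 'rV[R]_d * R) : R := x.2 * ln (gavg x) + x.2 * rho.
End Obj.

Definition Xset {R : realType} {d : nat} (W : set 'rV[R]_d) (lam0 lamt : R) :
  set ('rV[R]_d * R) := [set x | W x.1 /\ lam0 <= x.2 <= lamt].

Definition Fbar {R : realType} {d : nat} (F : 'rV[R]_d * R -> R)
  (X : set ('rV[R]_d * R)) (x : 'rV[R]_d * R) : \bar R :=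
  if x \in X then (F x)%:E else +oo%E.

(* regular (Frechet) subdifferential, the liminf condition unfolded *)
Definition reg_subdiff {R : realType} {d : nat} (Phi : 'rV[R]_d * R -> \bar R)
  (xb : 'rV[R]_d * R) : set ('rV[R]_d * R) :=
  [set v | Phi xb \is a fin_num /\
     forall eps : R, 0 < eps -> exists2 del : R, 0 < del &
       forall x, 0 < enormX (x - xb) < del ->
         ((- (eps * enormX (x - xb)))%:E <=
            Phi x - Phi xb - (dotX v (x - xb))%:E)%E].

(* dist(0,S)^2, with inf over the empty set = +oo *)
Definition dist0_sq {R : realType} {d : nat} (S : set ('rV[R]_d * R)) : \bar R :=
  let e := ereal_inf [set (enormX v)%:E | v in S] in (e * e)%E.

Section Consts.
Context {R : realType}.
Variables (G C L lam0 rho : R).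
Definition lamt : R := lam0 + C / rho.
Definition eC : R := expR (C / lam0).
Definition Lg : R := eC * (G / lam0 + C / lam0 ^+ 2).
Definition LA : R := eC * (G ^+ 2 / lam0 ^+ 2 + L / lam0).
Definition LB : R := eC * (C * G / lam0 ^+ 3 + G / lam0 ^+ 2).
Definition LC : R := eC * ((C * G + lam0 * G) / lam0 ^+ 3).
Definition LD : R := eC * ((C ^+ 2 + 2 * lam0 * C) / lam0 ^+ 4).
Definition Lng : R := Num.sqrt (LA ^+ 2 + LB ^+ 2 + LC ^+ 2 + LD ^+ 2).
Definition LF : R := lamt * Lg ^+ 2 + 2 * Lg + lamt * Lng + 1 + lamt.
End Consts.

Section Alg.
Context {R : realType} {d n : nat}.
Variables (ell : 'I_n -> 'rV[R]_d -> R) (gl : 'I_n -> 'rV[R]_d -> 'rV[R]_d)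
  (rho : R) (projX : 'rV[R]_d * R -> 'rV[R]_d * R) (x1 : 'rV[R]_d * R)
  (eta beta : nat -> R).

(* state (x_t, v_t, u_t, s_t); [ascdro idx t] is the paper's iterate t+1;
   idx j is the index drawn when forming iterate j+1 (idx 0: initialisation). *)
Fixpoint ascdro (idx : nat -> 'I_n) (t : nat) :
    ('rV[R]_d * R) * 'rV[R]_d * R * R :=
  match t with
  | 0 => let i := idx 0%N in (x1, gwi ell gl i x1, gli ell i x1, gi ell i x1)
  | t'.+1 =>
    let: (x, v, u, s) := ascdro idx t' in
    let p := t'.+1 in (* paper step index t = p *)
    let zw := (x.2 / s) *: v in
    let zl := x.2 / s * u + ln s + rho in
    let x' := projX (x.1 - eta p *: zw, x.2 - eta p * zl) in
    let i := idx p in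
    (x',
     gwi ell gl i x' + (1 - beta p) *: (v - gwi ell gl i x),
     gli ell i x' + (1 - beta p) * (u - gli ell i x),
     gi ell i x' + (1 - beta p) * (s - gi ell i x))
  end.
End Alg.

(* E over i.i.d. uniform indices (T+1 draws) and tau uniform on {1..T}
   of h(x_tau). *)
Definition expect_tau {R : realType} {d n : nat} (T : nat)
  (xs : (nat -> 'I_n) -> nat -> 'rV[R]_d * R)
  (h : 'rV[R]_d * R -> \bar R) : \bar R :=
  ((T%:R^-1 * (n%:R ^- T.+1))%:E *
    \sum_(f : {ffun 'I_T.+1 -> 'I_n}) \sum_(tau < T)
       h (xs (fun j => f (inord j)) tau))%E.

(* Main.v *)
(** The estimate [s] of [g(x) >= 1] may become nonpositive, and then the search
    direction [z] carries no information on the gradient, so the usual energy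
    argument has to be complemented by a proof that such phases do not last.
    Let [e = s - g(x)], let [p] be the error of the estimate [(v,u)] of the
    gradient of [g], [P] a weighted norm of [(p,e)] and [D] the length of one
    step.  With [beta = c eta^2], one step gives [E e' = (1 - beta) e] and
    [E P'^2 = (1 - beta)^2 P^2 + O(D^2 + eta^4)].

    While [P^2 <= 1/16] one has [s >= 3/4], the projected step decreases [F] up to
    an error [eta P^2], and the square of the energy [V = F + a P^2 / eta] is a
    supermartingale up to [O(eta^3)], with gain [eta (D^2 / eta^2 + P^2)].

    Otherwise one uses bounded submartingales which together cover all values of
    [(e, P)]: [(1/4 + e)_+^4] divided by the cube of an affine function of [P^2]
    and [F]; a power of [1 + P^2] times the positive part of
    [1/8 + e - th (e^2 + b eta p.x + K (eta P)^2)], where the drift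
    [E p.(x' - x) <= - k D^2 / eta + ...] compensates the noise caused by large
    steps; and, for large [|e|], the function
    [(K0 + |e|)^-1 + (K0 + |e|)^-z - t (eta P)^2].  If [S] is their maximum,
    suitably scaled, and [W] a small multiple of [(eta P)^2], then
    [J = 2 sup S - S + W] decreases, and
    [min (V^2, M J / eta^2)] is a Lyapunov function on the whole state space: it
    equals [V^2] for [P^2 < 1/64] and the other term for [P^2 > 1/16].  Its gain
    dominates [eta] times the squared distance at the next iterate of [0] to the
    subdifferential.  Summing over [t], with [eta_t^3] of order [1/t] and
    [1 / eta_T] of order [T^(1/3)], gives the rate. *)

Require Import Defs.
From HB Require Import structures.
From mathcomp Require Import all_boot all_order all_algebra.
From mathcomp Require Import all_classical all_reals all_analysis.
From mathcomp Require Import ring lra.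
Import Order.TTheory GRing.Theory Num.Theory.
Import numFieldNormedType.Exports.
Local Open Scope classical_set_scope.
Local Open Scope ring_scope.
Set Implicit Arguments.
Unset Strict Implicit.
Unset Printing Implicit Defensive.

(** The powers of [eta] are forced as follows. Where [s] may be nonpositive, the only drift
    available is [E e' = (1 - beta) e], of order [eta^2], while a step may be as long as the
    diameter of the domain, so that [P] can grow to order [1 / eta]. At that size a score decaying
    like [P^(-1 + 2 oz)] is as small as [eta^(1 - 2 oz)], and the gain that can be guaranteed is
    only of order [eta^(3 - oz)]. The gain required is [eta], because there the distance is merely
    bounded. Hence the division of [J] by [eta^2], and hence the square of the energy, which for [P]
    of order 1 is of order [1 / eta^2] as well and can be compared with it. Dividing by the
    decreasing [eta^2] costs a relative [O(eta^3)] per step; [oz > 0] is what lets the gain beat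
    this cost. The minimum of the two functions needs no smoothing: they decrease on overlapping
    ranges of [P], and each is the smaller one where the other is not known to decrease. Likewise a
    maximum of scores grows in mean wherever the score attaining it does. *)

Ltac nonneg := repeat first
  [ assumption | by [] | apply: ltW; assumption | apply: addr_ge0
  | apply: sqr_ge0 | apply: mulr_ge0 | rewrite invr_ge0 | apply: exprn_ge0 ].

(** * Averages and tangent inequalities *)

Section Average.
Context {R : realType} {n : nat}.
Implicit Types f g : 'I_n -> R.

Definition avg f : R := n%:R^-1 * \sum_(i < n) f i.

Lemma avgD f g : avg (fun i => f i + g i) = avg f + avg g.
Proof. by rewrite /avg big_split mulrDr. Qed.

Lemma avgZ k f : avg (fun i => k * f i) = k * avg f.
Proof. by rewrite /avg -mulr_sumr mulrCA. Qed.

Lemma avgN f : avg (fun i => - f i) = - avg f.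
Proof. by rewrite /avg sumrN mulrN. Qed.

Lemma avgB f g : avg (fun i => f i - g i) = avg f - avg g.
Proof. by rewrite avgD avgN. Qed.

Lemma eq_avg f g : f =1 g -> avg f = avg g.
Proof. by move=> fg; rewrite /avg; congr (_ * _); apply: eq_bigr. Qed.

Lemma avg_le f g : (forall i, f i <= g i) -> avg f <= avg g.
Proof.
by move=> fg; rewrite /avg ler_wpM2l ?invr_ge0 ?ler0n//; apply: ler_sum.
Qed.

Lemma avg_cst k : (0 < n)%N -> avg (fun=> k) = k.
Proof.
move=> n0; rewrite /avg sumr_const card_ord -[k *+ n]mulr_natl mulrA mulVf ?mul1r//.
by rewrite pnatr_eq0 -lt0n.
Qed.

Lemma avg_ge0 f : (forall i, 0 <= f i) -> 0 <= avg f.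
Proof.
by move=> f0; rewrite /avg mulr_ge0 ?invr_ge0 ?ler0n//; apply: sumr_ge0.
Qed.

Lemma avg_bound f k : (0 < n)%N -> (forall i, f i <= k) -> avg f <= k.
Proof. by move=> n0 fk; rewrite -[leRHS](avg_cst _ n0); apply: avg_le. Qed.

End Average.

Section Tangents.
Context {R : realType}.
Implicit Types (y V k u z : R).

(** [y^4 / V^3] is the perspective of [y^4]: jointly convex and homogeneous of degree one. Its
    supporting plane at slope [k] is therefore linear without constant term and can be averaged
    through the conditional means alone. *)
Lemma perspective4_tangent y V k : 0 < V -> 
  4 * k ^+ 3 * y - 3 * k ^+ 4 * V <= y ^+ 4 / V ^+ 3.
Proof.
move=> V0; rewrite ler_pdivlMr ?exprn_gt0// -subr_ge0.
suff -> : y ^+ 4 - (4 * k ^+ 3 * y - 3 * k ^+ 4 * V) * V ^+ 3 =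
   (y - k * V) ^+ 2 * ((y + k * V) ^+ 2 + 2 * (k * V) ^+ 2).
  by rewrite mulr_ge0 ?sqr_ge0// addr_ge0 ?sqr_ge0// mulr_ge0// sqr_ge0.
by ring.
Qed.

(** Supporting line of the convex function [u^(-z)], obtained from [exp x >= 1 + x] and
    [ln r <= r - 1] instead of derivatives. *)
Lemma powR_tangent u (u0 : R) z : 0 < u -> 0 < u0 -> 0 <= z ->
  u0 `^ (- z) * (1 - z * (u - u0) / u0) <= u `^ (- z).
Proof.
move=> up u0p z0.
have -> : u `^ (- z) = u0 `^ (- z) * (u / u0) `^ (- z).
  by rewrite -powRM ?divr_ge0 ?ltW// mulrC divfK ?gt_eqF.
have uu0 : 0 < u / u0 by rewrite divr_gt0.
rewrite ler_wpM2l ?powR_ge0//.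
rewrite /powR (gt_eqF uu0).
apply: le_trans (expR_ge1Dx _).
have -> : 1 - z * (u - u0) / u0 = 1 - z * (u / u0 - 1).
  by rewrite -mulrA mulrBl divff ?gt_eqF.
rewrite lerD2l mulNr lerN2 ler_wpM2l//.
have := @le_ln1Dx R (u / u0 - 1).
rewrite [1 + _]addrC subrK; apply.
by rewrite ltrBrDr addrC subrr.
Qed.

Lemma inv_tangent u (u0 : R) : 0 < u -> 0 < u0 ->
  u0^-1 * (1 - (u - u0) / u0) <= u^-1.
Proof.
move=> up u0p; rewrite -subr_ge0.
have -> : u^-1 - u0^-1 * (1 - (u - u0) / u0) = (u - u0) ^+ 2 / (u * u0 ^+ 2).
  by field; rewrite !gt_eqF.
by rewrite divr_ge0 ?sqr_ge0// mulr_ge0 ?sqr_ge0// ltW.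
Qed.

End Tangents.

Section Perspective.
Context {R : realType} {n : nat}.
Hypothesis n_gt0 : (0 < n)%N.

(** Along the supporting plane the numerator loses [4 b] and the denominator returns [3 * 29/20 b];
    the difference is the [7/20] of the conclusion. With the contraction rate [29/20], a quotient
    [y^m / V^(m-1)] gains [(m - 1) * 29/20 - m], and 4 is the smallest integer [m] for which this is
    positive. *)
Lemma perspective_submartingale (d b e V : R) (e' V' : 'I_n -> R) :
  0 <= d -> 0 <= b -> 0 < V -> (forall i, 0 < V' i) ->
  avg e' = (1 - b) * e -> avg V' <= (1 - 29 / 20 * b) * V ->
  (1 + 7 / 20 * b) * (Num.max 0 (d + e) ^+ 4 / V ^+ 3) <=
  avg (fun i => Num.max 0 (d + e' i) ^+ 4 / V' i ^+ 3).
Proof.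
move=> d0 b0 V0 V'0 e'E V'E.
have [y0|y0] := leP (d + e) 0.
  rewrite expr0n mul0r mulr0; apply: avg_ge0 => i.
  by rewrite divr_ge0 ?exprn_ge0 ?le_max ?lexx// (ltW (V'0 i)).
set y := d + e.
have [k k0 yE] : exists2 k, 0 < k & y = k * V.
  by exists (y / V); rewrite ?divr_gt0// divfK ?gt_eqF.
have pt i : 4 * k ^+ 3 * d + (4 * k ^+ 3 * e' i - 3 * k ^+ 4 * V' i) <=
    Num.max 0 (d + e' i) ^+ 4 / V' i ^+ 3.
  apply: le_trans (perspective4_tangent _ k (V'0 i)).
  rewrite addrA lerD2r -mulrDr ler_wpM2l ?mulr_ge0 ?exprn_ge0 ?(ltW k0)//.
  by rewrite le_max lexx orbT.
apply: le_trans (avg_le pt).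
rewrite avgD avgB !avgZ avg_cst// e'E.
have -> : y ^+ 4 / V ^+ 3 = k ^+ 3 * y.
  by rewrite yE; field; rewrite gt_eqF.
have : 3 * k ^+ 4 * avg V' <= 3 * k ^+ 4 * ((1 - 29 / 20 * b) * V).
  by rewrite ler_wpM2l// mulr_ge0 ?exprn_ge0 ?(ltW k0).
have -> : 3 * k ^+ 4 * ((1 - 29 / 20 * b) * V) =
    k ^+ 3 * (3 * (1 - 29 / 20 * b) * y) by rewrite yE; ring.
move=> h.
have kd : 0 <= k ^+ 3 * (b * d) by rewrite !mulr_ge0 ?exprn_ge0 ?(ltW k0).
rewrite -/y.
have -> : e = y - d by rewrite /y addrC addKr.
lra.
Qed.

End Perspective.

(** Merges finitely many smallness conditions: [M * eta <= 1] yields [x * eta <= 1] for every listed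
    [x], and [1 <= M] yields [eta <= 1]. *)
Lemma upper_const {R : realType} (s : seq R) :
  exists2 M : R, 1 <= M & forall x, x \in s -> x <= M.
Proof.
elim: s => [|a s [M M1 MP]]; first by exists 1.
exists (Num.max M a); first by rewrite le_max M1.
move=> x; rewrite inE => /orP[/eqP ->|/MP xM]; rewrite le_max ?lexx ?orbT//.
by rewrite xM.
Qed.

(** * The scalar recursion of the estimation errors *)

(* [kB], [kL], [kC] bound the noise, [kD] the step length, [kX] the norm of the
   iterates, [kF] the objective; [kc] is the factor of [eta^2] in [beta]; [ka] is
   the weight of the estimation error in the energy. *)
Record storm_consts (R : realType) := StormConsts {
  kB : R;
  kD : R;
  kX : R;
  kc : R;
  kL : R;
  kC : R;
  kp : R;
  kF : R;
  kZ : R;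
  kT : R;
  kG : R;
  kE : R;
  kS : R;
  kR : R;
  ka : R;
  kB_ge0 : 0 <= kB;
  kD_ge0 : 0 <= kD;
  kX_ge0 : 0 <= kX;
  kc_gt0 : 0 < kc;
  kL_gt0 : 0 < kL;
  kC_ge0 : 0 <= kC;
  kp_gt0 : 0 < kp;
  kF_ge1 : 1 <= kF;
  kZ_ge0 : 0 <= kZ;
  kT_ge0 : 0 <= kT;
  kG_ge0 : 0 <= kG;
  kE_ge0 : 0 <= kE;
  kS_ge0 : 0 <= kS;
  kR_ge0 : 0 <= kR;
  ka_gt0 : 0 < ka;
  ka_kL : ka * kL <= 1 / 16;
  ka_kc : 4 <= ka * kc }.

#[local] Hint Resolve kB_ge0 kD_ge0 kX_ge0 kc_gt0 kL_gt0 kC_ge0 kp_gt0 kF_ge1 kZ_ge0 kT_ge0 kG_ge0 kE_ge0 kS_ge0 kR_ge0 : core.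

(* One step seen through scalars only: [e], [P] are the error of the estimate [s]
   and the weighted norm of all estimation errors, [Pi] is the inner product of
   the gradient error with the iterate, [F] the shifted objective.  Primed
   functions of [i] are the values after the fresh index [i] is drawn, [xi i]
   is the norm of the noise, [D] the length of the step and [dpi] the inner
   product of the gradient error with the step. *)
Record storm_step (R : realType) (n : nat) (k : storm_consts R)
    (eta eta' e P Pi F : R) (e' P' Pi' xi : 'I_n -> R)
    (F' D dpi : R) : Prop := StormStep {
  ss_eta'_gt0 : 0 < eta';
  ss_eta'_le : eta' <= eta;
  ss_eta_slow : eta <= eta' * (1 + kT k * eta ^+ 3);
  ss_P_ge0 : 0 <= P;
  ss_P'_ge0 : forall i, 0 <= P' i;
  ss_e_le : `|e| <= P;
  ss_e'_le : forall i, `|e' i| <= P' i;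
  ss_Pi_le : `|Pi| <= kX k * P;
  ss_F_ge1 : 1 <= F;
  ss_F_le : F <= kF k;
  ss_F'_ge1 : 1 <= F';
  ss_F'_le : F' <= kF k;
  ss_D_ge0 : 0 <= D;
  ss_D_le : D <= kD k;
  ss_dpi_le : `|dpi| <= P * D;
  ss_avg_e : avg e' = (1 - kc k * eta ^+ 2) * e;
  ss_avg_P : avg (fun i => P' i ^+ 2) =
    (1 - kc k * eta ^+ 2) ^+ 2 * P ^+ 2 + avg (fun i => xi i ^+ 2);
  ss_avg_Pi : avg Pi' = (1 - kc k * eta ^+ 2) * (Pi + dpi);
  ss_xi_ge0 : forall i, 0 <= xi i;
  ss_xi_le : forall i, xi i <= kB k * (D + eta ^+ 2);
  ss_noise : avg (fun i => xi i ^+ 2) <= kL k * D ^+ 2 + kC k * eta ^+ 4;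
  ss_dev_e : forall i, `|e' i - (1 - kc k * eta ^+ 2) * e| <= xi i;
  ss_dev_P : forall i, `|P' i ^+ 2 - (1 - kc k * eta ^+ 2) ^+ 2 * P ^+ 2| <=
    xi i * (2 * P + xi i);
  ss_dev_Pi : forall i, `|Pi' i - (1 - kc k * eta ^+ 2) * (Pi + dpi)| <=
    kX k * xi i;
  ss_descent : - (1 / 4) <= e ->
    eta * F' <= eta * F - 7 / 16 * D ^+ 2 + 16 / 9 * eta ^+ 2 * P ^+ 2;
  ss_drift : - (1 / 4) <= e ->
    eta * dpi <= - (kp k * D ^+ 2) + eta ^+ 2 * (kG k + kE k * e ^+ 2);
  ss_far : (kR k) <= `|e| -> `|e| * D ^+ 2 <= kS k * (1 + eta ^+ 2 * P ^+ 2);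
  ss_near : P ^+ 2 <= 1 / 16 -> D <= kZ k * eta }.

(* [lth] must be chosen after [lb] and [lK]: the coefficients of the quadratic
   correction in [lin_form] are [lth], [lth * lb] and [lth * lK]. *)
Record linear_consts (R : realType) (k : storm_consts R) := LinearConsts {
  lb : R; lK : R; lth : R;
  lb_gt0 : 0 < lb; lb_kp : 24 * kL k <= lb * kp k; lb_kE : lb * kE k <= kc k / 4;
  lK_gt0 : 0 < lK; lK_ge : lb ^+ 2 * kX k ^+ 2 <= lK;
  lth_gt0 : 0 < lth; lth_le : lth <= 1 / 8;
  lth_small : lth * (3 + lb * kG k / kc k) <= 1 / 32 }.

#[local] Hint Resolve lb_gt0 lK_gt0 lth_gt0 lK_ge lth_le lb_kp lb_kE : core.

(** * The quadratic form behind the score for moderate errors *)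

Definition lin_form (R : realType) (k : storm_consts R) (l : linear_consts k)
    (eta e P Pi : R) : R :=
  1 / 8 + e - lth l * (e ^+ 2 + lb l * (eta * Pi) + lK l * (eta * P) ^+ 2).

(** Completing the square: [lK_ge] lets the quadratic term absorb the linear one, at the price of
    the constant 1/4. It is applied with [p = eta * P] and [x = eta * Pi]. *)
Lemma lin_quad_ge (R : realType) (k : storm_consts R) (l : linear_consts k)
    (p x : R) : 0 <= p -> `|x| <= kX k * p ->
  - (1 / 4) <= lb l * x + lK l * p ^+ 2.
Proof.
have th0 := lth_gt0 l; have th1 := lth_le l; have b0 := lb_gt0 l.
have K0 := lK_gt0 l; have hK := lK_ge l; have kc0 := kc_gt0 k; have kX0 := kX_ge0 k.
move=> p0 xp.
have h1 : - (lb l * (kX k * p)) <= lb l * x.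
  rewrite -mulrN ler_wpM2l ?(ltW (lb_gt0 l))//.
  by have := ler_normlP _ _ xp => -[]; lra.
have h2 : lb l ^+ 2 * kX k ^+ 2 * p ^+ 2 <= lK l * p ^+ 2 by rewrite ler_wpM2r ?sqr_ge0.
have := sqr_ge0 (lb l * kX k * p - 1 / 2); lra.
Qed.

(** Keeping half of the quadratic term allows [eta * P] to be bounded where [lin_form] is
    positive. *)
Lemma lin_quad_ge2 (R : realType) (k : storm_consts R) (l : linear_consts k)
    (p x : R) : 0 <= p -> `|x| <= kX k * p ->
  lK l * p ^+ 2 / 2 - 1 / 2 <= lb l * x + lK l * p ^+ 2.
Proof.
have th0 := lth_gt0 l; have th1 := lth_le l; have b0 := lb_gt0 l.
have K0 := lK_gt0 l; have hK := lK_ge l; have kc0 := kc_gt0 k; have kX0 := kX_ge0 k.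
move=> p0 xp.
have h1 : - (lb l * (kX k * p)) <= lb l * x.
  rewrite -mulrN ler_wpM2l ?(ltW (lb_gt0 l))//.
  by have := ler_normlP _ _ xp => -[]; lra.
have h2 : lb l ^+ 2 * kX k ^+ 2 * p ^+ 2 <= lK l * p ^+ 2 by rewrite ler_wpM2r ?sqr_ge0.
have := sqr_ge0 (lb l * kX k * p - 1); lra.
Qed.

(** Bound on [eta * P] wherever [lin_form] is positive: the quotient bounds its square, and the
    final 1 serves the estimate [p <= p^2 + 1]. *)
Definition radius_bound (R : realType) (k : storm_consts R) (l : linear_consts k)
    : R := (2 / lth l ^+ 2 + 1) / lK l + 1.

Lemma lin_form_le (R : realType) (k : storm_consts R) (l : linear_consts k)
    (eta e P Pi : R) : 0 < eta -> 0 <= P -> `|Pi| <= kX k * P ->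
  lin_form l eta e P Pi <= 1 / 8 + e - lth l * e ^+ 2 + lth l / 4.
Proof.
have th0 := lth_gt0 l; have th1 := lth_le l; have b0 := lb_gt0 l.
have K0 := lK_gt0 l; have hK := lK_ge l; have kc0 := kc_gt0 k; have kX0 := kX_ge0 k.
move=> eta0 P0 PiP.
have := @lin_quad_ge _ _ l (eta * P) (eta * Pi).
have -> : `|eta * Pi| = eta * `|Pi| by rewrite normrM gtr0_norm.
have -> : eta * `|Pi| <= kX k * (eta * P) by rewrite mulrCA ler_pM2l.
rewrite mulr_ge0 ?(ltW eta0)// => /(_ isT isT) h.
rewrite /lin_form.
have : lth l * - (1 / 4) <= lth l * (lb l * (eta * Pi) + lK l * (eta * P) ^+ 2).
  by rewrite ler_wpM2l// ltW.
lra.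
Qed.

Lemma inv_th (R : realType) (k : storm_consts R) (l : linear_consts k)
    : lth l * (lth l)^-1 = 1.
Proof. by rewrite divff// gt_eqF// lth_gt0. Qed.

Lemma inv_th_ge (R : realType) (k : storm_consts R) (l : linear_consts k)
    : 8 <= (lth l)^-1.
Proof.
have th0 := lth_gt0 l; have th1 := lth_le l; have b0 := lb_gt0 l.
have K0 := lK_gt0 l; have hK := lK_ge l; have kc0 := kc_gt0 k; have kX0 := kX_ge0 k.
rewrite -[8]invrK lef_pV2 ?posrE//.
by have := (lth_le l); lra.
Qed.

Lemma lin_form_le_th (R : realType) (k : storm_consts R) (l : linear_consts k)
    (eta e P Pi : R) : 0 < eta -> 0 <= P -> `|Pi| <= kX k * P ->
  lin_form l eta e P Pi <= (lth l)^-1.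
Proof.
have th0 := lth_gt0 l; have th1 := lth_le l; have b0 := lb_gt0 l.
have K0 := lK_gt0 l; have hK := lK_ge l; have kc0 := kc_gt0 k; have kX0 := kX_ge0 k.
move=> eta0 P0 PiP; apply: le_trans (lin_form_le l e eta0 P0 PiP) _.
have := inv_th_ge l; have := inv_th l; have := (lth_le l); have := (lth_gt0 l).
have : 0 <= lth l * (e - (lth l)^-1 / 2) ^+ 2 by rewrite mulr_ge0 ?sqr_ge0// ltW.
set t := (lth l)^-1.
have -> : lth l * (e - t / 2) ^+ 2 = lth l * e ^+ 2 - (lth l * t) * e + (lth l * t) * t / 4.
  by field.
move=> h1 h2 h3 h4; rewrite h4 in h1; lra.
Qed.

(** Positivity confines all arguments: below [- 1/4] the term [1/8 + e] is too negative, beyond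
    [2 / lth] the term [lth * e^2] exceeds [1/8 + e] with room to spare, and [eta * P] is held by
    the remaining quadratic term. In particular the descent and drift inequalities are available
    there. *)
Lemma lin_form_gt0 (R : realType) (k : storm_consts R) (l : linear_consts k)
    (eta e P Pi : R) : 0 < eta -> 0 <= P -> `|Pi| <= kX k * P ->
  0 < lin_form l eta e P Pi -> [/\ - (1 / 4) <= e, `|e| <= 2 / lth l & eta * P <= (radius_bound l)].
Proof.
have th0 := lth_gt0 l; have th1 := lth_le l; have b0 := lb_gt0 l.
have K0 := lK_gt0 l; have hK := lK_ge l; have kc0 := kc_gt0 k; have kX0 := kX_ge0 k.
move=> eta0 P0 PiP y0.
have y1 := lin_form_le l e eta0 P0 PiP.
have e2 : 0 <= lth l * e ^+ 2 by rewrite mulr_ge0 ?sqr_ge0// ltW.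
have ege : - (1 / 4) <= e by have := (lth_le l); lra.
have ti := inv_th l; have tg := inv_th_ge l.
have ele : e <= 2 * (lth l)^-1.
  rewrite leNgt; apply/negP => eg.
  have : lth l * (2 * (lth l)^-1) * e <= lth l * e * e.
    by apply: ler_wpM2r; [lra|rewrite ler_wpM2l ?(ltW (lth_gt0 l))// ltW].
  have -> : lth l * (2 * (lth l)^-1) * e = 2 * (lth l * (lth l)^-1) * e by ring.
  rewrite ti -[(lth l) * e * e]mulrA -expr2; have := (lth_le l); lra.
split=> //; first by rewrite ler_norml; apply/andP; split; lra.
have := @lin_quad_ge2 _ _ l (eta * P) (eta * Pi).
have -> : `|eta * Pi| = eta * `|Pi| by rewrite normrM gtr0_norm.
have -> : eta * `|Pi| <= kX k * (eta * P) by rewrite mulrCA ler_pM2l.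
have p0 : 0 <= eta * P by rewrite mulr_ge0 ?(ltW eta0).
move=> /(_ p0 isT) h.
set p := eta * P in p0 h *.
have h2 : lth l * (lK l * p ^+ 2 / 2 - 1 / 2) <= 1 / 8 + e - lth l * e ^+ 2.
  have : lth l * (lK l * p ^+ 2 / 2 - 1 / 2) <=
    lth l * (lb l * (eta * Pi) + lK l * p ^+ 2) by rewrite ler_pM2l.
  by move: y0; rewrite /lin_form -/p; lra.
have h3 : 1 / 8 + e - lth l * e ^+ 2 <= (lth l)^-1.
  have : 0 <= lth l * (e - (lth l)^-1 / 2) ^+ 2 by rewrite mulr_ge0 ?sqr_ge0// ltW.
  have -> : lth l * (e - (lth l)^-1 / 2) ^+ 2 =
    lth l * e ^+ 2 - (lth l * (lth l)^-1) * e + (lth l * (lth l)^-1) * (lth l)^-1 / 4 by field; rewrite gt_eqF.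
  by rewrite ti; lra.
have h4 : lK l * p ^+ 2 <= 2 / lth l ^+ 2 + 1.
  have : (lth l)^-1 * (lth l * (lK l * p ^+ 2 / 2 - 1 / 2)) <= (lth l)^-1 * (lth l)^-1.
    by rewrite ler_pM2l ?invr_gt0//; lra.
  rewrite mulrA [(lth l)^-1 * lth l]mulrC ti mul1r -expr2 exprVn; lra.
have h5 : p ^+ 2 <= (2 / lth l ^+ 2 + 1) / lK l by rewrite ler_pdivlMr// mulrC.
by rewrite /radius_bound; have := sqr_ge0 (p - 1 / 2); lra.
Qed.

(** The next value of [lin_form] with the noise removed: [e'] and [Pi'] are replaced by their
    conditional means, and the variance is dropped from [P'^2]. *)
Definition lin_form_mean (R : realType) (k : storm_consts R) (l : linear_consts k)
    (eta eta' e P Pi dpi : R) : R :=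
  let g := 1 - kc k * eta ^+ 2 in
  1 / 8 + g * e - lth l * ((g * e) ^+ 2 + lb l * (eta' * (g * (Pi + dpi))) +
    lK l * (eta' ^+ 2 * (g ^+ 2 * P ^+ 2))).

(** The proof rests on [lin_form_mean = (1 - be) * lin_form + be / 8 + lth * (1 - be) * br]. The
    constant 1/8 does not contract with the rest and leaves [be / 8]; the bracket [br] contains
    [- lb * (eta' * dpi)], which the drift turns into a positive multiple of [D^2], to be set
    against the noise caused by the step. *)
Lemma lin_form_mean_ge (R : realType) (k : storm_consts R) (l : linear_consts k)
    (n : nat) (eta eta' e P Pi F : R)
    (e' P' Pi' xi : 'I_n -> R) (F' D dpi : R) :
  storm_step k eta eta' e P Pi F e' P' Pi' xi F' D dpi -> - (1 / 4) <= e ->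
  kc k * eta ^+ 2 <= 1 / 2 -> kT k * eta ^+ 3 <= 1 ->
  lb l * kT k * kX k * eta <= kc k * (lK l / 4) -> lb l * kT k * kX k * eta <= kc k ->
  (1 - kc k * eta ^+ 2) * lin_form l eta e P Pi + kc k * eta ^+ 2 / 8 +
    lth l * (lb l * kp k / 4 * D ^+ 2 - kc k * eta ^+ 2 * (1 + lb l * kG k / kc k))
  <= lin_form_mean l eta eta' e P Pi dpi.
Proof.
have th0 := lth_gt0 l; have th1 := lth_le l; have b0 := lb_gt0 l.
have K0 := lK_gt0 l; have hK := lK_ge l; have kc0 := kc_gt0 k; have kX0 := kX_ge0 k.
have kT0 := kT_ge0 k; have kp0 := kp_gt0 k; have kG0 := kG_ge0 k.
have kE0 := kE_ge0 k; have hbE := lb_kE l; have hkp := lb_kp l.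
move=> st ege be_le t_le c1 c2.
have eta'0 := ss_eta'_gt0 st; have eta'le := ss_eta'_le st.
have eta0 : 0 < eta by exact: lt_le_trans eta'le.
have P0 := ss_P_ge0 st.
set be := kc k * eta ^+ 2 in be_le *.
have be0 : 0 <= be by rewrite mulr_ge0 ?sqr_ge0// ltW.
have slow := ss_eta_slow st.
have half : eta <= 2 * eta'.
  have : eta' * (1 + kT k * eta ^+ 3) <= eta' * 2 by rewrite ler_pM2l//; lra.
  lra.
have dif : eta - eta' <= kT k * eta ^+ 4.
  have : eta' * (kT k * eta ^+ 3) <= eta * (kT k * eta ^+ 3).
    by rewrite ler_wpM2r// mulr_ge0// exprn_ge0// ltW.
  rewrite exprS; lra.
have dr : eta' * dpi <= - (kp k * D ^+ 2) / 2 + eta ^+ 2 * (kG k + kE k * e ^+ 2).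
  have h := ss_drift st ege.
  (* The drift is known for [eta * dpi]. Scaling by [r = eta' / eta] keeps at least half of the
     negative term and at most all of the positive one. *)
  have [r [r0 r1 rE]] : exists r, [/\ 1 / 2 <= r, r <= 1 & eta' = r * eta].
    exists (eta' / eta); rewrite divfK ?gt_eqF//; split=> //.
      by rewrite ler_pdivlMr//; lra.
    by rewrite ler_pdivrMr// mul1r.
  rewrite rE -mulrA.
  have : r * (eta * dpi) <=
      r * (- (kp k * D ^+ 2) + eta ^+ 2 * (kG k + kE k * e ^+ 2)).
    by rewrite ler_wpM2l//; lra.
  have u0 : 0 <= kp k * D ^+ 2 by rewrite mulr_ge0 ?sqr_ge0// ltW.
  have v0 : 0 <= eta ^+ 2 * (kG k + kE k * e ^+ 2).
    by rewrite mulr_ge0 ?sqr_ge0// addr_ge0// mulr_ge0 ?sqr_ge0.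
  have : r * (eta ^+ 2 * (kG k + kE k * e ^+ 2)) <= 1 * (eta ^+ 2 * (kG k + kE k * e ^+ 2)).
    by rewrite ler_wpM2r.
  have : 1 / 2 * (kp k * D ^+ 2) <= r * (kp k * D ^+ 2) by rewrite ler_wpM2r.
  lra.
have bdr : lb l * (eta' * dpi) <= lb l * (- (kp k * D ^+ 2) / 2 +
    eta ^+ 2 * (kG k + kE k * e ^+ 2)) by rewrite ler_pM2l.
have bkE : lb l * kE k * (eta ^+ 2 * e ^+ 2) <= kc k / 4 * (eta ^+ 2 * e ^+ 2).
  by rewrite ler_wpM2r// mulr_ge0 ?sqr_ge0.
have bdif : - (lb l * kT k * kX k * eta * eta ^+ 2 * (eta * P)) <= lb l * ((eta - eta') * Pi).
  have : `|(eta - eta') * Pi| <= kT k * eta ^+ 4 * (kX k * P).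
    by rewrite normrM; apply: ler_pM => //; [rewrite ger0_norm//; lra|exact: ss_Pi_le st].
  move=> /ler_normlP[h _].
  have : lb l * - (kT k * eta ^+ 4 * (kX k * P)) <= lb l * ((eta - eta') * Pi).
    by rewrite ler_pM2l//; lra.
  lra.
have bdif2 : lb l * kT k * kX k * eta * eta ^+ 2 * (eta * P) <=
   be * (lK l / 4 * (eta * P) ^+ 2 + 1).
  have p0 : 0 <= eta * P by rewrite mulr_ge0// ltW.
  have z0 : 0 <= lb l * kT k * kX k * eta by rewrite !mulr_ge0// ltW.
  have pp : eta * P <= (eta * P) ^+ 2 + 1 by have := sqr_ge0 (eta * P - 1 / 2); lra.
  have : lb l * kT k * kX k * eta * (eta * P) <= lb l * kT k * kX k * eta * ((eta * P) ^+ 2 + 1).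
    by rewrite ler_wpM2l.
  have : lb l * kT k * kX k * eta * (eta * P) ^+ 2 <= kc k * (lK l / 4) * (eta * P) ^+ 2.
    by rewrite ler_wpM2r ?sqr_ge0.
  move=> h1 h2.
  have : eta ^+ 2 * (lb l * kT k * kX k * eta * (eta * P)) <=
     eta ^+ 2 * (kc k * (lK l / 4) * (eta * P) ^+ 2 + kc k).
    by rewrite ler_wpM2l ?sqr_ge0//; lra.
  rewrite /be; lra.
have Kq : lK l * P ^+ 2 * ((eta' ^+ 2) * (1 - be)) <= lK l * P ^+ 2 * (eta ^+ 2 * (1 - be)).
  rewrite ler_wpM2l// ?mulr_ge0 ?sqr_ge0 ?(ltW (lK_gt0 l))//.
  by rewrite ler_wpM2r ?ler_sqr ?nnegrE//; lra.
have kG_e : lb l * (eta ^+ 2 * kG k) = be * (lb l * kG k / kc k).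
  by rewrite /be; field; rewrite gt_eqF.
set br := e ^+ 2 - (1 - be) * e ^+ 2 + lb l * ((eta - eta') * Pi) - lb l * (eta' * dpi)
  + (lK l * P ^+ 2 * eta ^+ 2 - lK l * P ^+ 2 * (eta' ^+ 2 * (1 - be))).
have br_ge : lb l * kp k / 2 * D ^+ 2 - be * (1 + lb l * kG k / kc k) <= br.
  have e20 : 0 <= be * e ^+ 2 by rewrite mulr_ge0 ?sqr_ge0.
  have q0 : 0 <= be * (lK l * (eta * P) ^+ 2).
    by rewrite !mulr_ge0 ?sqr_ge0// ltW.
  have -> : br = be * e ^+ 2 + lb l * ((eta - eta') * Pi) - lb l * (eta' * dpi)
    + (lK l * P ^+ 2 * (eta ^+ 2 * (1 - be)) - lK l * P ^+ 2 * (eta' ^+ 2 * (1 - be)))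
    + be * (lK l * (eta * P) ^+ 2) by rewrite /br; ring.
  have : lb l * kE k * (eta ^+ 2 * e ^+ 2) <= be * e ^+ 2 / 4.
    by move: bkE; rewrite /be; lra.
  lra.
have -> : lin_form_mean l eta eta' e P Pi dpi = (1 - be) * lin_form l eta e P Pi + be / 8
   + lth l * ((1 - be) * br) by rewrite /lin_form_mean -/be /lin_form /br; field.
rewrite lerD2l ler_pM2l//.
have : (1 - be) * (lb l * kp k / 2 * D ^+ 2 - be * (1 + lb l * kG k / kc k)) <= (1 - be) * br.
  by rewrite ler_wpM2l//; lra.
have D0 : 0 <= lb l * kp k * D ^+ 2.
  by rewrite mulr_ge0 ?sqr_ge0// mulr_ge0// ltW.
have : 0 <= (1 / 2 - be) * (lb l * kp k * D ^+ 2) by rewrite mulr_ge0 ?subr_ge0.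
have G0 : 0 <= lb l * kG k / kc k by rewrite divr_ge0 ?mulr_ge0// ltW.
have : 0 <= be * (be * (1 + lb l * kG k / kc k)) by rewrite mulr_ge0// mulr_ge0// addr_ge0.
lra.
Qed.

(* The exponent is slightly above [- 1 / 2]; the margin [lth / 64] is the exponent
   [oz] of the scores for large [|e|]. *)
Definition score_lin (R : realType) (k : storm_consts R) (l : linear_consts k)
    (eta e P Pi : R) : R :=
  Num.max 0 (lin_form l eta e P Pi) * (1 + P ^+ 2) `^ (- (1 / 2 - lth l / 64)).

Definition noise_max (R : realType) (k : storm_consts R) : R := kB k * (kD k + 1).

Definition lin_form_mean_max (R : realType) (k : storm_consts R) (l : linear_consts k) : R :=
  1 + 2 / lth l + lth l * (4 / lth l ^+ 2 +
  lb l * (kX k * radius_bound l + radius_bound l * kD k) + lK l * radius_bound l ^+ 2).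

Lemma noise_max_ge0 (R : realType) (k : storm_consts R) : 0 <= noise_max k.
Proof.
have h1 := kB_ge0 k; have h2 := kD_ge0 k.
by rewrite /noise_max; nonneg.
Qed.

Lemma radius_bound_ge0 (R : realType) (k : storm_consts R) (l : linear_consts k) : 0 <= radius_bound l.
Proof. by have h := lK_gt0 l; rewrite /radius_bound; nonneg. Qed.

Lemma lin_form_mean_max_ge0 (R : realType) (k : storm_consts R) (l : linear_consts k) :
  0 <= lin_form_mean_max l.
Proof.
have h1 := kX_ge0 k; have h2 := kD_ge0 k; have h3 := lK_gt0 l.
have h4 := lth_gt0 l; have h5 := lb_gt0 l; have h6 := radius_bound_ge0 l.
by rewrite /lin_form_mean_max; nonneg.
Qed.

Lemma lin_form_mean_le (R : realType) (k : storm_consts R) (l : linear_consts k)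
    (eta eta' e P Pi dpi D : R) :
  0 < eta' -> eta' <= eta -> eta <= 1 -> kc k * eta ^+ 2 <= 1 / 2 ->
  0 <= P -> `|e| <= 2 / lth l -> eta * P <= radius_bound l -> `|Pi| <= kX k * P ->
  `|dpi| <= P * D -> 0 <= D -> D <= kD k ->
  `|lin_form_mean l eta eta' e P Pi dpi| <= lin_form_mean_max l.
Proof.
move=> e'0 e'le e1 be_le P0 eh ph Pih dh D0 Dh.
have th0 := lth_gt0 l; have K0 := lK_gt0 l; have kc0 := kc_gt0 k.
have kX0 := kX_ge0 k; have kD0 := kD_ge0 k; have b0 := lb_gt0 l.
have e0 : 0 < eta by exact: lt_le_trans e'le.
rewrite /lin_form_mean; set be := kc k * eta ^+ 2 in be_le *.
have be0 : 0 <= be by rewrite mulr_ge0 ?sqr_ge0// ltW.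
set g := 1 - be.
have g0 : 0 <= g by rewrite /g; clear -be_le; lra.
have g1 : g <= 1 by rewrite /g; clear -be0; lra.
have pt0 := radius_bound_ge0 l.
have ge : `|g * e| <= 2 / lth l.
  rewrite normrM (ger0_norm g0); apply: le_trans eh.
  by rewrite ler_piMl.
have i0 : 0 <= (lth l)^-1 by rewrite invr_ge0 ltW.
have sq : (g * e) ^+ 2 <= 4 / lth l ^+ 2.
  rewrite -(real_normK (num_real (g * e))).
  have -> : 4 / lth l ^+ 2 = (2 / lth l) ^+ 2 by field; rewrite gt_eqF.
  by rewrite ler_sqr ?nnegrE ?normr_ge0// mulr_ge0.
have h1 : `|eta' * (g * (Pi + dpi))| <= kX k * radius_bound l + radius_bound l * kD k.
  rewrite normrM (gtr0_norm e'0) normrM (ger0_norm g0).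
  have h : `|Pi + dpi| <= kX k * P + P * kD k.
    apply: le_trans (ler_normD _ _) _; apply: lerD => //.
    by apply: le_trans dh _; rewrite ler_wpM2l.
  apply: (@le_trans _ _ (eta * (kX k * P + P * kD k))).
    apply: ler_pM => //; rewrite ?mulr_ge0 ?(ltW e'0)//.
    by apply: le_trans h; rewrite ler_piMl.
  have h1 : kX k * (eta * P) <= kX k * radius_bound l by rewrite ler_wpM2l.
  have h2 : eta * P * kD k <= radius_bound l * kD k by rewrite ler_wpM2r.
  by clear -h1 h2; lra.
have h2 : 0 <= eta' ^+ 2 * (g ^+ 2 * P ^+ 2) <= radius_bound l ^+ 2.
  rewrite -!exprMn sqr_ge0 ler_sqr ?nnegrE ?mulr_ge0 ?(ltW e'0)//.
  apply: le_trans ph; apply: ler_pM => //; rewrite ?mulr_ge0 ?(ltW e'0)//.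
  by rewrite ler_piMl.
move/andP: h2 => [h2 h3].
move/ler_normlP: h1 => [h11 h12].
have k1 : lb l * (eta' * (g * (Pi + dpi))) <= lb l * (kX k * radius_bound l + radius_bound l * kD k).
  by rewrite ler_pM2l.
have k2 : lb l * - (kX k * radius_bound l + radius_bound l * kD k) <= lb l * (eta' * (g * (Pi + dpi))).
  by rewrite ler_pM2l//; rewrite lerNl.
have k3 : lK l * (eta' ^+ 2 * (g ^+ 2 * P ^+ 2)) <= lK l * radius_bound l ^+ 2 by rewrite ler_pM2l.
have k4 : 0 <= lK l * (eta' ^+ 2 * (g ^+ 2 * P ^+ 2)) by rewrite mulr_ge0// ltW.
have k5 := sqr_ge0 (g * e).
rewrite /lin_form_mean_max.
set u := _ + _ + lK l * (eta' ^+ 2 * _).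
set v := _ + _ + lK l * radius_bound l ^+ 2.
have uv : `|u| <= v.
  rewrite ler_norml /u /v; clear -sq k1 k2 k3 k4 k5.
  by apply/andP; split; lra.
have : `|lth l * u| <= lth l * v by rewrite normrM gtr0_norm// ler_pM2l.
move/ler_normlP => [m1 m2]; move/ler_normlP: ge => [g2 g3].
by rewrite ler_norml; clear -m1 m2 g2 g3; apply/andP; split; lra.
Qed.

(** * Effect of the noise on the linear score *)

Section Deviations.
Variables (R : realType) (n : nat) (k : storm_consts R) (l : linear_consts k).

(** Every contribution is linear in [xi]: 5 from [e'] and the derivative of its square, [noise_max]
    from the square of the deviation, and 1 each from the [Pi] and [P] terms, whose coefficients
    carry enough powers of [eta] to offset a [P] of order [1 / eta]. *)
Lemma lin_form_dev (eta eta' e P Pi dpi e' P' Pi' xi : R) :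
  let g := 1 - kc k * eta ^+ 2 in
  0 < eta' -> eta' <= eta -> eta <= 1 -> kc k * eta ^+ 2 <= 1 / 2 -> 0 <= P ->
  `|e| <= 2 / lth l -> eta * P <= radius_bound l -> 0 <= xi -> xi <= noise_max k ->
  lb l * kX k * eta' <= 1 ->
  lK l * (2 * radius_bound l + noise_max k) * eta <= 1 ->
  `|e' - g * e| <= xi -> `|Pi' - g * (Pi + dpi)| <= kX k * xi ->
  `|P' ^+ 2 - g ^+ 2 * P ^+ 2| <= xi * (2 * P + xi) ->
  `|lin_form l eta' e' P' Pi' - lin_form_mean l eta eta' e P Pi dpi| <= (7 + noise_max k) * xi.
Proof.
move=> g eta'0 eta'le e1 be_le P0 eh ph xi0 xil s6 s7 d1 d2 d3.
have th0 := lth_gt0 l; have th1 := lth_le l.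
have K0 := lK_gt0 l; have b0 := lb_gt0 l.
have kX0 := kX_ge0 k; have xm0 := noise_max_ge0 k.
have eta0 : 0 < eta by exact: lt_le_trans eta'le.
have ee : eta ^+ 2 <= eta by rewrite expr2 ler_piMl// ltW.
have be0 : 0 <= kc k * eta ^+ 2 by rewrite mulr_ge0 ?sqr_ge0 ?(ltW (kc_gt0 k)).
have -> : lin_form l eta' e' P' Pi' - lin_form_mean l eta eta' e P Pi dpi
   = (e' - g * e) * (1 - lth l * (2 * (g * e)))
    - lth l * (e' - g * e) ^+ 2 - lth l * lb l * eta' * (Pi' - g * (Pi + dpi))
    - lth l * lK l * eta' ^+ 2 * (P' ^+ 2 - g ^+ 2 * P ^+ 2).
  by rewrite /lin_form /lin_form_mean -/g; ring.
have g0 : 0 <= g by rewrite /g; clear -be_le; lra.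
have g1 : g <= 1 by rewrite /g; clear -be0; lra.
have w1 : `|1 - lth l * (2 * (g * e))| <= 5.
  apply: le_trans (ler_normB _ _) _; rewrite normr1 normrM (gtr0_norm th0).
  rewrite normrM (ger0_norm (_ : 0 <= 2))// normrM (ger0_norm g0).
  have : lth l * (g * `|e|) <= lth l * (2 / lth l).
    by rewrite ler_pM2l//; apply: le_trans eh; rewrite ler_piMl.
  rewrite [lth l * (2 / _)]mulrCA divff ?gt_eqF// => h.
  by clear -h; lra.
have u1 : `|(e' - g * e) * (1 - lth l * (2 * (g * e)))| <= xi * 5.
  by rewrite normrM; apply: ler_pM.
have u2 : `|lth l * (e' - g * e) ^+ 2| <= xi * noise_max k.
  rewrite normrM (gtr0_norm th0) normrX.
  have h : `|e' - g * e| ^+ 2 <= xi * noise_max k.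
    by rewrite expr2; apply: ler_pM => //; apply: le_trans d1 _.
  apply: le_trans h; rewrite ler_piMl ?sqr_ge0//.
  by clear -th1; lra.
have u3 : `|lth l * lb l * eta' * (Pi' - g * (Pi + dpi))| <= xi.
  rewrite normrM ger0_norm; last by nonneg.
  apply: (@le_trans _ _ (lth l * lb l * eta' * (kX k * xi))).
    by rewrite ler_wpM2l//; nonneg.
  have -> : lth l * lb l * eta' * (kX k * xi) = lth l * (lb l * kX k * eta') * xi by ring.
  rewrite ler_piMl// mulr_ile1//; try by nonneg.
  by clear -th1; lra.
have u4 : `|lth l * lK l * eta' ^+ 2 * (P' ^+ 2 - g ^+ 2 * P ^+ 2)| <= xi.
  rewrite normrM ger0_norm; last by nonneg.
  apply: (@le_trans _ _ (lth l * lK l * eta' ^+ 2 * (xi * (2 * P + xi)))).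
    by rewrite ler_wpM2l//; nonneg.
  have -> : lth l * lK l * eta' ^+ 2 * (xi * (2 * P + xi)) =
    lth l * (lK l * (eta' ^+ 2 * (2 * P + xi))) * xi by ring.
  have h : lK l * (eta' ^+ 2 * (2 * P + xi)) <= 1.
    apply: le_trans s7; rewrite -mulrA ler_wpM2l ?(ltW K0)//.
    apply: (@le_trans _ _ (eta ^+ 2 * (2 * P + noise_max k))).
      apply: ler_pM; rewrite ?sqr_ge0//; try by nonneg.
        by rewrite ler_sqr ?nnegrE// ltW.
      by rewrite lerD2l.
    have h1 : eta * (eta * P) <= eta * radius_bound l by rewrite ler_pM2l.
    have h2 : eta ^+ 2 * noise_max k <= eta * noise_max k by rewrite ler_wpM2r.
    by clear -h1 h2; lra.
  rewrite ler_piMl// mulr_ile1//; try by nonneg.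
  by clear -th1; lra.
apply: le_trans (ler_normB _ _) _.
apply: (@le_trans _ _ (xi * 5 + xi * noise_max k + xi + xi)); last first.
  by rewrite le_eqVlt; apply/orP; left; apply/eqP; ring.
apply: lerD => //; apply: le_trans (ler_normB _ _) _.
apply: lerD => //; apply: le_trans (ler_normB _ _) _.
exact: lerD.
Qed.

(** The tangent of [X^(-r)] is multiplied by the form, and [y' * Z] is split as
    [Y * Z + (y' - Y) * Z]. The mean of [Z] is the variance of the noise and the second product is
    of order [xi^2], so nothing of first order in the noise survives averaging. [H] carries the gain
    from the contraction of [P^2]. *)
Lemma score_lin_pointwise (eta eta' e P Pi dpi e' P' Pi' xi Y : R) :
  let X := 1 + P ^+ 2 in let r := 1 / 2 - lth l / 64 in
  let g := 1 - kc k * eta ^+ 2 in let Z := P' ^+ 2 - g ^+ 2 * P ^+ 2 in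
  let H := 1 + r * (1 - g ^+ 2) * P ^+ 2 / X in
  kc k * eta ^+ 2 <= 1 / 2 -> 0 <= P -> 0 <= xi -> xi <= noise_max k ->
  (2 * P + noise_max k) * noise_max k <= X ->
  `|lin_form l eta' e' P' Pi' - Y| <= (7 + noise_max k) * xi ->
  `|Z| <= xi * (2 * P + xi) ->
  X `^ (- r) * (H * lin_form l eta' e' P' Pi' - r / X * (Y * Z) -
    X^-1 * ((7 + noise_max k) * (2 * P + noise_max k) * xi ^+ 2))
  <= score_lin l eta' e' P' Pi'.
Proof.
move=> X r g Z H be_le P0 xi0 xil q2 dev Zi.
have th0 := lth_gt0 l; have th1 := lth_le l; have xm0 := noise_max_ge0 k.
have r0 : 0 <= r by rewrite /r; clear -th1; lra.
have r1 : r <= 1 by rewrite /r; clear -th0; lra.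
have X0 : 0 < X by rewrite /X ltr_pwDl// sqr_ge0.
have be0 : 0 <= kc k * eta ^+ 2 by rewrite mulr_ge0 ?sqr_ge0 ?(ltW (kc_gt0 k)).
have X'0 : 0 < 1 + P' ^+ 2 by rewrite ltr_pwDl// sqr_ge0.
have ZX : `|Z| <= X.
  apply: le_trans Zi _; apply: le_trans q2; rewrite mulrC.
  by apply: ler_pM => //; rewrite ?addr_ge0 ?mulr_ge0// lerD2l.
have tg := powR_tangent X'0 X0 r0.
set h := 1 - _ in tg.
have hE : h = H - r / X * Z.
  by rewrite /h /H /Z /X; field; rewrite -/X gt_eqF.
(* The sign of the tangent factor is what allows the positive part of [y'] to be replaced by [y']
   itself. *)
have h0 : 0 <= h.
  have h1 : r / X * Z <= r.
    rewrite mulrAC ler_pdivrMr// ler_wpM2l//.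
    exact: le_trans (ler_norm _) ZX.
  have h2 : 0 <= r * (1 - g ^+ 2) * P ^+ 2 / X.
    rewrite divr_ge0 ?(ltW X0)// mulr_ge0 ?sqr_ge0// mulr_ge0//.
    rewrite /g; have -> : 1 - (1 - kc k * eta ^+ 2) ^+ 2 =
       kc k * eta ^+ 2 * (2 - kc k * eta ^+ 2) by ring.
    by rewrite mulr_ge0//; clear -be_le; lra.
  by rewrite hE /H; clear -h1 h2 r1; lra.
rewrite /score_lin; set y' := lin_form _ _ _ _ _ in dev *.
have ymax : y' <= Num.max 0 y' by rewrite le_max lexx orbT.
have : X `^ (- r) * h * y' <= Num.max 0 y' * (1 + P' ^+ 2) `^ (- r).
  rewrite mulrC; apply: (@le_trans _ _ (Num.max 0 y' * (X `^ (- r) * h))).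
    by rewrite ler_wpM2r// mulr_ge0 ?powR_ge0.
  by rewrite ler_wpM2l// le_max lexx.
apply: le_trans; rewrite -[X `^ (- r) * h * y']mulrA ler_wpM2l ?powR_ge0// hE.
have -> : (H - r / X * Z) * y' = H * y' - r / X * (Y * Z) -
   X^-1 * (r * ((y' - Y) * Z)) by ring.
rewrite lerD2l lerN2 ler_wpM2l ?invr_ge0 ?(ltW X0)//.
apply: (@le_trans _ _ `|(y' - Y) * Z|).
  by apply: le_trans (ler_norm _) _; rewrite normrM (ger0_norm r0) ler_piMl.
rewrite normrM.
apply: (@le_trans _ _ ((7 + noise_max k) * xi * (xi * (2 * P + xi)))).
  exact: ler_pM.
have -> : (7 + noise_max k) * xi * (xi * (2 * P + xi)) =
  (7 + noise_max k) * (2 * P + xi) * xi ^+ 2 by ring.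
rewrite ler_wpM2r ?sqr_ge0// ler_wpM2l ?addr_ge0//.
by rewrite lerD2l.
Qed.

End Deviations.

Section LinearSubmartingale.
Variables (R : realType) (n : nat) (k : storm_consts R) (l : linear_consts k).

(** Here [D] stands for [kL * D^2] and [G] for [lb * kG / kc]. The budget is the [be / 8] left by
    the constant of the form. As [y <= 1 / th], the claimed growth takes [be / 32] and the shortfall
    of [HH] below [be] takes [be / 16]; the last [be / 32] covers [th * (3 + G)], which includes the
    terms of order [be^2]. The noise, at most [5 * th * N], is paid by [6 * th * D]. *)
Lemma score_lin_arith (be th G y Y HH r X N D Cq Chat ay : R) :
  0 < th -> th * (3 + G) <= 1 / 32 -> 0 <= G -> 0 < y -> y <= th^-1 ->
  0 <= be -> be <= 1 / 2 -> 2 * be * (th^-1 + 1) <= th -> 0 <= N -> 0 < X ->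
  0 <= r -> r <= 1 -> `|Y| <= Chat -> Chat + Cq <= th * X ->
  0 <= HH -> HH <= be ->
  2 * be * (1 / 2 - th / 64 - be / 2 - th / 64) <= HH ->
  (1 - be) * y + be / 8 + th * (6 * D - be * (1 + G)) <= Y ->
  0 <= D -> 5 * N <= 5 * D + be ->
  Y - 2 * th * N <= ay ->
  (1 + be * (th / 32)) * y <= (1 + HH) * ay - r / X * (Y * N) - X^-1 * (Cq * N).
Proof.
move=> th0 thG G0 y0 yti be0 be2 s10 N0 X0 r0 r1 Yb q1 HH0 HH1 HHge yh D0 s8 ayl.
have Xi0 : 0 < X^-1 by rewrite invr_gt0.
have hX : X^-1 * (Chat + Cq) <= th by rewrite mulrC ler_pdivrMr.
have hN : X^-1 * (Chat + Cq) * N <= th * N by rewrite ler_wpM2r.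
have t1 : r / X * (Y * N) <= X^-1 * (Chat * N).
  have : r * (Y * N) <= Chat * N.
    apply: le_trans (ler_norm _) _; rewrite normrM (ger0_norm r0) normrM (ger0_norm N0).
    rewrite -[leRHS]mul1r; apply: ler_pM => //; first by rewrite mulr_ge0.
    by rewrite ler_wpM2r.
  by move=> h; rewrite mulrAC mulrC ler_pM2l.
have t2 : (1 + HH) * (Y - 2 * th * N) <= (1 + HH) * ay.
  by rewrite ler_wpM2l ?addr_ge0.
have t3 : HH * (th * N) <= 1 * (th * N).
  by rewrite ler_wpM2r ?mulr_ge0 ?(ltW th0)//; clear -HH1 be2; lra.
have t4 : th * (5 * N) <= th * (5 * D + be) by rewrite ler_pM2l.
have t5 : HH * ((1 - be) * y - th * be * (1 + G)) <= HH * Y.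
  rewrite ler_wpM2l//; apply: le_trans yh.
  have h : 0 <= th * D by rewrite mulr_ge0// ltW.
  by clear -h be0; lra.
have b1 : HH * (be * y) <= be * (be * th^-1).
  apply: ler_pM => //; first by rewrite mulr_ge0// ltW.
  by rewrite ler_wpM2l.
have b2 : HH * (th * be * (1 + G)) <= be * (be * (1 / 32)).
  have h : th * (1 + G) <= 1 / 32 by clear -thG th0; lra.
  apply: ler_pM => //; first by rewrite !mulr_ge0 ?addr_ge0// ltW.
  by rewrite -mulrA mulrCA ler_wpM2l.
have b3 : 2 * be * (1 / 2 - th / 64 - be / 2 - th / 64) * y <= HH * y.
  by rewrite ler_wpM2r// ltW.
have b4 : be * (th * y) <= be * 1.
  rewrite ler_wpM2l//; have : th * y <= th / th by rewrite ler_pM2l.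
  by rewrite divff ?gt_eqF.
have b5 : be * be * y <= be * be * th^-1 by rewrite ler_wpM2l ?mulr_ge0.
have b6 : be * (2 * be * (th^-1 + 1)) <= be * th by rewrite ler_wpM2l.
have b7 : be * (th * (3 + G)) <= be * (1 / 32) by rewrite ler_wpM2l.
have b8 : 0 <= be * be by rewrite mulr_ge0.
have b9 : 0 <= th * D by rewrite mulr_ge0// ltW.
clear -hN t1 t2 t3 t4 t5 b1 b2 b3 b4 b5 b6 b7 b8 b9 yh be0.
lra.
Qed.

(** The cross terms between the form and [X^(-r)] carry a factor of order [P / X]; beyond the
    threshold [P0] they are at most [th * N] and the drift pays for them. Below it the quartic score
    takes over. *)
Lemma score_lin_submartingale : (0 < n)%N ->
  exists M P0 : R, forall eta eta' e P Pi F (e' P' Pi' xi : 'I_n -> R) F' D dpi,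
  storm_step k eta eta' e P Pi F e' P' Pi' xi F' D dpi ->
  M * eta <= 1 -> P0 <= P ->
  (1 + kc k * eta ^+ 2 * (lth l / 32)) * score_lin l eta e P Pi <=
  avg (fun i => score_lin l eta' (e' i) (P' i) (Pi' i)).
Proof.
move=> n_gt0.
have th0 := lth_gt0 l; have th1 := lth_le l; have b0 := lb_gt0 l.
have K0 := lK_gt0 l; have kc0 := kc_gt0 k; have kX0 := kX_ge0 k.
have kT0 := kT_ge0 k; have kC0 := kC_ge0 k; have kG0 := kG_ge0 k.
have kD0 := kD_ge0 k; have kL0 := kL_gt0 k; have kB0 := kB_ge0 k.
have pt0 := radius_bound_ge0 l; have Chat0 := lin_form_mean_max_ge0 l; have xm0 := noise_max_ge0 k.
set b := lb l in b0; set K := lK l in K0; set th := lth l in th0 th1 *.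
set xm := noise_max k in xm0; set Chat := lin_form_mean_max l in Chat0.
have Cy0 : 0 <= 7 + xm by rewrite addr_ge0.
have [M1 M1ge M1P] := upper_const [:: 2 * kc k; kT k; 4 * (b * kT k * kX k) / (kc k * K);
  b * kT k * kX k / kc k; K; b * kX k; K * (2 * radius_bound l + xm); 5 * kC k / kc k;
  2 * kc k * (th^-1 + 1) / th].
have [P1 P1ge P1P] := upper_const [:: (Chat + (7 + xm) * xm + 2 * (7 + xm)) / th;
  2 * xm + xm ^+ 2; 64 / th].
exists M1, P1 => eta eta' e P Pi F e' P' Pi' xi F' D dpi st eta_le P_ge.
have eta'0 := ss_eta'_gt0 st; have eta'le := ss_eta'_le st.
have eta0 : 0 < eta by exact: lt_le_trans eta'le.
have P0 := ss_P_ge0 st; have PiP := ss_Pi_le st.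
have [y0|y0] := leP (lin_form l eta e P Pi) 0.
  rewrite {1}/score_lin max_l// mul0r mulr0; apply: avg_ge0 => i.
  by rewrite mulr_ge0 ?powR_ge0// le_max lexx.
have [ege eh ph] := lin_form_gt0 eta0 P0 PiP y0.
have small C : C <= M1 -> C * eta <= 1.
  by move=> CM; apply: le_trans eta_le; rewrite ler_pM2r.
have e1 : eta <= 1 by rewrite -[eta]mul1r small.
have ee : eta ^+ 2 <= eta by rewrite expr2 ler_piMl// ltW.
set be := kc k * eta ^+ 2.
have be0 : 0 <= be by rewrite mulr_ge0 ?sqr_ge0// ltW.
have be_eta : be <= kc k * eta by rewrite ler_pM2l.
have s1 : 2 * kc k * eta <= 1 by apply: small; apply: M1P; rewrite !inE eqxx ?orbT.
have be2 : be <= 1 / 2 by clear -be_eta s1; lra.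
have s2 : kT k * eta ^+ 3 <= 1.
  apply: (@le_trans _ _ (kT k * eta)).
    by rewrite ler_wpM2l// exprS ler_piMr ?(ltW eta0)//; apply: le_trans ee _.
  by apply: small; apply: M1P; rewrite !inE eqxx ?orbT.
have s3 : b * kT k * kX k * eta <= kc k * (K / 4).
  have : 4 * (b * kT k * kX k) / (kc k * K) * eta <= 1.
    by apply: small; apply: M1P; rewrite !inE eqxx ?orbT.
  by rewrite mulrAC ler_pdivrMr ?mulr_gt0// => h; clear -h; lra.
have s4 : b * kT k * kX k * eta <= kc k.
  have : b * kT k * kX k / kc k * eta <= 1.
    by apply: small; apply: M1P; rewrite !inE eqxx ?orbT.
  by rewrite mulrAC ler_pdivrMr// mul1r.
have s5 : K * eta' ^+ 2 <= 1.
  apply: (@le_trans _ _ (K * eta)); last first.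
    by apply: small; apply: M1P; rewrite !inE eqxx ?orbT.
  by rewrite ler_wpM2l ?(ltW K0)//; apply: le_trans ee; rewrite ler_sqr ?nnegrE// ltW.
have s6 : b * kX k * eta' <= 1.
  apply: (@le_trans _ _ (b * kX k * eta)).
    by rewrite ler_wpM2l// mulr_ge0// ltW.
  by apply: small; apply: M1P; rewrite !inE eqxx ?orbT.
have s7 : K * (2 * radius_bound l + xm) * eta <= 1.
  by apply: small; apply: M1P; rewrite !inE eqxx ?orbT.
have s8 : 5 * kC k * eta ^+ 2 <= kc k.
  have : 5 * kC k / kc k * eta <= 1 by apply: small; apply: M1P; rewrite !inE eqxx ?orbT.
  rewrite mulrAC ler_pdivrMr// mul1r => h; apply: le_trans h.
  by rewrite ler_wpM2l// mulr_ge0.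
have s10 : 2 * be * (th^-1 + 1) <= th.
  have : 2 * kc k * (th^-1 + 1) / th * eta <= 1.
    by apply: small; apply: M1P; rewrite !inE eqxx ?orbT.
  rewrite mulrAC ler_pdivrMr// mul1r; apply: le_trans.
  rewrite -[leRHS]mulrAC ler_wpM2r//; first by rewrite addr_ge0// invr_ge0 ltW.
  by rewrite -mulrA ler_pM2l.
have yh := lin_form_mean_ge st ege be2 s2 s3 s4; rewrite -/be -/b -/th in yh.
have D0 := ss_D_ge0 st; have DD := ss_D_le st.
have yhb : `|lin_form_mean l eta eta' e P Pi dpi| <= Chat.
  by apply: (lin_form_mean_le eta'0 eta'le e1 be2 P0 eh ph PiP (ss_dpi_le st) D0 DD).
have xi0 := ss_xi_ge0 st.
have xil i : xi i <= xm.
  apply: le_trans (ss_xi_le st i) _; rewrite /xm /noise_max ler_wpM2l//.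
  by apply: lerD => //; apply: le_trans e1; exact: ee.
set N := avg (fun i => xi i ^+ 2).
have N0 : 0 <= N by apply: avg_ge0 => i; exact: sqr_ge0.
pose X := 1 + P ^+ 2; pose r := 1 / 2 - th / 64; pose g := 1 - be.
have r0 : 0 <= r by rewrite /r; clear -th1; lra.
have r1 : r <= 1 / 2 by rewrite /r; clear -th0; lra.
have Pge1 : 1 <= P by exact: le_trans P_ge.
have Pm1 : 0 <= P - 1 by rewrite subr_ge0.
have X0 : 0 < X by rewrite /X ltr_pwDl// sqr_ge0.
have P2 : P <= P ^+ 2 by rewrite expr2 ler_peMl.
(* [q1] bounds the cross terms, [q2] keeps the tangent factor nonnegative, and [q3] makes [P^2 / X]
   at least [1 - th / 64]. *)
have q1 : Chat + (7 + xm) * (2 * P + xm) <= th * X.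
  have : (Chat + (7 + xm) * xm + 2 * (7 + xm)) / th <= P.
    by apply: le_trans P_ge; apply: P1P; rewrite !inE eqxx ?orbT.
  rewrite ler_pdivrMr// => h.
  have h1 : (Chat + (7 + xm) * xm + 2 * (7 + xm)) * P <= P * th * P by rewrite ler_wpM2r.
  have h2 : 0 <= (P - 1) * (Chat + (7 + xm) * xm) by nonneg.
  by rewrite /X; clear -h1 h2 th0; lra.
have q2 : (2 * P + xm) * xm <= X.
  have h : 2 * xm + xm ^+ 2 <= P.
    by apply: le_trans P_ge; apply: P1P; rewrite !inE eqxx ?orbT.
  have h1 : (2 * xm + xm ^+ 2) * P <= P * P by rewrite ler_wpM2r.
  have h2 : 0 <= (P - 1) * xm ^+ 2 by nonneg.
  by rewrite /X; clear -h1 h2; lra.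
have q3 : 1 <= th / 64 * X.
  have : 64 / th <= P by apply: le_trans P_ge; apply: P1P; rewrite !inE eqxx ?orbT.
  rewrite ler_pdivrMr// => h.
  have h1 : th * P <= th * P ^+ 2 by rewrite ler_pM2l.
  by rewrite /X; clear -h h1 th0; lra.
set Y := lin_form_mean _ _ _ _ _ _ _ in yh yhb.
pose Z i := P' i ^+ 2 - g ^+ 2 * P ^+ 2.
pose y' i := lin_form l eta' (e' i) (P' i) (Pi' i).
pose H := 1 + r * (1 - g ^+ 2) * P ^+ 2 / X.
have pt i : X `^ (- r) * (H * y' i - r / X * (Y * Z i) -
    X^-1 * ((7 + xm) * (2 * P + xm) * xi i ^+ 2)) <= score_lin l eta' (e' i) (P' i) (Pi' i).
  apply: score_lin_pointwise => //; last exact: (ss_dev_P st i).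
  apply: lin_form_dev => //; [exact: (ss_dev_e st i)|exact: (ss_dev_Pi st i)|].
  exact: (ss_dev_P st i).
apply: le_trans (avg_le pt).
rewrite avgZ !avgB !avgZ -/N.
have aZ : avg Z = N.
  by rewrite /Z avgB avg_cst// (ss_avg_P st) -/N -/be -/g; ring.
rewrite aZ.
have ae2 : avg (fun i => e' i ^+ 2) <= (g * e) ^+ 2 + N.
  have -> : (g * e) ^+ 2 + N = avg (fun i => (2 * (g * e)) * e' i
      + (xi i ^+ 2 + - (g * e) ^+ 2)).
    by rewrite !avgD avgZ avg_cst// (ss_avg_e st) -/be -/g -/N; ring.
  apply: avg_le => i.
  have : `|e' i - g * e| ^+ 2 <= xi i ^+ 2.
    by rewrite ler_sqr ?nnegrE//; exact: (ss_dev_e st i).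
  by rewrite real_normK ?num_real// => h; clear -h; lra.
have ay : Y - 2 * th * N <= avg y'.
  have -> : avg y' = 1 / 8 + avg e' - th * (avg (fun i => e' i ^+ 2)
       + b * (eta' * avg Pi') + K * (eta' ^+ 2 * avg (fun i => P' i ^+ 2))).
    rewrite (@eq_avg _ _ y' (fun i => (1 / 8 + e' i) - th * ((e' i ^+ 2
      + b * (eta' * Pi' i)) + K * (eta' ^+ 2 * P' i ^+ 2)))).
      by rewrite avgB avgD avg_cst// avgZ !avgD !avgZ.
    by move=> i; rewrite /y' /lin_form exprMn.
  rewrite (ss_avg_e st) (ss_avg_Pi st) (ss_avg_P st) -/N -/be -/g.
  have h1 : th * avg (fun i => e' i ^+ 2) <= th * ((g * e) ^+ 2 + N) by rewrite ler_pM2l.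
  have h2 : th * (K * eta' ^+ 2 * N) <= th * (1 * N) by rewrite ler_pM2l// ler_wpM2r.
  by rewrite /Y /lin_form_mean -/be -/g -/b -/K -/th; clear -h1 h2; lra.
pose HH := r * (be * (2 - be)) * P ^+ 2 / X.
have HE : H = 1 + HH by rewrite /HH /H /g; field; rewrite gt_eqF.
have HH0 : 0 <= HH.
  rewrite /HH divr_ge0 ?(ltW X0)// mulr_ge0 ?sqr_ge0// mulr_ge0// mulr_ge0//.
  by clear -be2; lra.
have PX : P ^+ 2 / X = 1 - X^-1 by rewrite /X; field; rewrite -/X gt_eqF.
have Xi0 : 0 < X^-1 by rewrite invr_gt0.
have b2 : 0 <= 2 - be by clear -be2; lra.
have HH1 : HH <= be.
  rewrite /HH -mulrA PX.
  apply: (@le_trans _ _ (r * (be * (2 - be)))).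
    rewrite ler_piMr; [by []| |].
      by rewrite mulr_ge0// mulr_ge0.
    by clear -Xi0; lra.
  have h : r * (be * (2 - be)) <= 1 / 2 * (be * (2 - be)).
    by rewrite ler_wpM2r// mulr_ge0.
  by have h2 := sqr_ge0 be; clear -h h2; lra.
have HHge : 2 * be * (1 / 2 - th / 64 - be / 2 - th / 64) <= HH.
  rewrite /HH -[leRHS]mulrA PX /r.
  have Xi : X^-1 <= th / 64 by rewrite -[X^-1]mul1r ler_pdivrMr.
  have u : (1 / 2 - th / 64) * (2 - be) * (1 - th / 64) <= (1 / 2 - th / 64) * (2 - be) * (1 - X^-1).
    rewrite ler_wpM2l//; first by rewrite mulr_ge0.
    by rewrite lerD2l lerN2.
  have u2 : be * ((1 / 2 - th / 64) * (2 - be) * (1 - th / 64)) <=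
    be * ((1 / 2 - th / 64) * (2 - be) * (1 - X^-1)) by rewrite ler_wpM2l.
  have u3 : 0 <= be * ((1 / 2 - th / 64) * (2 - be) * (1 - th / 64) -
      2 * (1 / 2 - th / 64 - be / 2 - th / 64)).
    rewrite mulr_ge0//.
    have v1 : 0 <= th * th by rewrite mulr_ge0// ltW.
    have v2 : 0 <= th * be by rewrite mulr_ge0// ltW.
    have v3 : 0 <= th * th * (1 - be) by rewrite mulr_ge0//; clear -be2; lra.
    by clear -v1 v2 v3 th0 be0; lra.
  by clear -u2 u3; lra.
rewrite {1}/score_lin max_r ?(ltW y0)// -/X -/th -/r -/be [leRHS]mulrC.
have yti : lin_form l eta e P Pi <= th^-1 by exact: lin_form_le_th.
rewrite [leLHS]mulrA ler_wpM2r ?powR_ge0// HE.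
have N_le := ss_noise st; rewrite -/N in N_le.
apply: (@score_lin_arith be th (b * kG k / kc k) _ Y HH r X N (kL k * D ^+ 2) _ Chat) => //.
- exact: lth_small.
- by nonneg.
- by clear -r1; lra.
- apply: le_trans yh; rewrite lerD2l ler_pM2l// lerD2r.
  have h : 24 * kL k * D ^+ 2 <= b * kp k * D ^+ 2.
    by rewrite ler_wpM2r ?sqr_ge0//; exact: lb_kp.
  by clear -h; lra.
- by rewrite mulr_ge0 ?sqr_ge0// ltW.
- have h : 5 * kC k * eta ^+ 2 * eta ^+ 2 <= kc k * eta ^+ 2 by rewrite ler_wpM2r ?sqr_ge0.
  by rewrite /be; clear -h N_le; lra.
Qed.

End LinearSubmartingale.

(** * The energy while the estimates are accurate *)

Section Energy.
Variables (R : realType) (n : nat) (k : storm_consts R).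

(** [eta] times the energy, plus a constant that keeps it away from 0. The constant is
    [ka * P^2 / 50] at [P^2 = 1/64], so beyond that value it hardly slows the contraction. *)
Definition quart_scale (eta P F : R) : R := ka k * P ^+ 2 + eta * F + ka k / 50 / 64.

Definition score_quart (eta e P F : R) : R :=
  Num.max 0 (1 / 4 + e) ^+ 4 / quart_scale eta P F ^+ 3.

Lemma quart_scale_gt0 eta P F : 0 < eta -> 0 <= F -> 0 < quart_scale eta P F.
Proof.
move=> eta0 F0; have a0 := ka_gt0 k.
by rewrite /quart_scale ltr_pwDr// ?divr_gt0// addr_ge0// mulr_ge0 ?sqr_ge0// ltW.
Qed.

(** Contraction of [quart_scale] at rate [29/20]: the square of [1 - be] gives about 2, of which the
    error term [16/9 * eta^2 * P^2] of the descent takes back [4/9] because [4 <= ka * kc]. The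
    noise [ka * kL * D^2 <= D^2 / 16] is paid by the decrease of [eta * F], and [P^2 >= 1/64] makes
    the parts that do not contract a small fraction of the whole. *)
Lemma score_quart_submartingale : (0 < n)%N ->
  exists M : R, forall eta eta' e P Pi F (e' P' Pi' xi : 'I_n -> R) F' D dpi,
  storm_step k eta eta' e P Pi F e' P' Pi' xi F' D dpi ->
  M * eta <= 1 -> 1 / 64 <= P ^+ 2 ->
  (1 + 7 / 20 * (kc k * eta ^+ 2)) * score_quart eta e P F <=
  avg (fun i => score_quart eta' (e' i) (P' i) F').
Proof.
move=> n_gt0.
have kc0 := kc_gt0 k; have kC0 := kC_ge0 k; have a0 := ka_gt0 k.
have hkL := ka_kL k; have hkc := ka_kc k; have kF1 := kF_ge1 k.
have kF0 : 0 <= kF k by apply: le_trans kF1.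
have [M1 M1ge M1P] := upper_const [:: 200 * kc k; 100 * 100 * kC k / kc k; 40 * 100 * kF k / ka k].
exists M1 => eta eta' e P Pi F e' P' Pi' xi F' D dpi st eta_le P_ge.
have eta'0 := ss_eta'_gt0 st; have eta'le := ss_eta'_le st.
have eta0 : 0 < eta by exact: lt_le_trans eta'le.
have small C : C <= M1 -> C * eta <= 1.
  by move=> CM; apply: le_trans eta_le; rewrite ler_pM2r.
have e1 : eta <= 1 by rewrite -[eta]mul1r small.
have ee : eta ^+ 2 <= eta by rewrite expr2 ler_piMl// ltW.
have s1 : 200 * kc k * eta <= 1 by apply: small; apply: M1P; rewrite !inE eqxx ?orbT.
have s2 : 100 * 100 * kC k * eta ^+ 2 <= kc k.
  have : 100 * 100 * kC k / kc k * eta <= 1 by apply: small; apply: M1P; rewrite !inE eqxx ?orbT.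
  rewrite mulrAC ler_pdivrMr// mul1r => h; apply: le_trans h.
  by rewrite ler_wpM2l// mulr_ge0.
have s3 : 40 * 100 * kF k * eta <= ka k.
  have : 40 * 100 * kF k / ka k * eta <= 1 by apply: small; apply: M1P; rewrite !inE eqxx ?orbT.
  by rewrite mulrAC ler_pdivrMr// mul1r.
set be := kc k * eta ^+ 2.
have be0 : 0 <= be by rewrite mulr_ge0 ?sqr_ge0// ltW.
have be2 : 200 * be <= 1.
  by apply: le_trans s1; rewrite /be -!mulrA ler_pM2l// ler_pM2l.
have F1 := ss_F_ge1 st; have F2 := ss_F_le st; have F'1 := ss_F'_ge1 st.
have D0 := ss_D_ge0 st; have P0 := ss_P_ge0 st.
have [y0|y0] := leP (1 / 4 + e) 0.
  rewrite {1}/score_quart max_l// expr0n mul0r mulr0; apply: avg_ge0 => i.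
  rewrite /score_quart divr_ge0// ?exprn_ge0 ?le_max ?lexx//.
  by apply/ltW/quart_scale_gt0 => //; apply: le_trans F'1.
apply: perspective_submartingale => //.
- by apply: quart_scale_gt0 => //; apply: le_trans F1.
- by move=> i; apply: quart_scale_gt0 => //; apply: le_trans F'1.
- exact: (ss_avg_e st).
have -> : avg (fun i => quart_scale eta' (P' i) F') =
   ka k * ((1 - be) ^+ 2 * P ^+ 2 + avg (fun i => xi i ^+ 2)) + eta' * F' + ka k / 50 / 64.
  rewrite (@eq_avg _ _ _ (fun i => ka k * P' i ^+ 2 + (eta' * F' + ka k / 50 / 64))).
    by rewrite avgD avgZ avg_cst// (ss_avg_P st) addrA.
  by move=> i; rewrite /quart_scale addrA.
have N_le := ss_noise st; set N := avg _ in N_le *.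
have desc := ss_descent st _.
have ege : - (1 / 4) <= e by clear -y0; lra.
have {}desc := desc ege.
have h1 : eta' * F' <= eta * F' by rewrite ler_wpM2r//; apply: le_trans F'1.
have h2 : ka k * N <= ka k * (kL k * D ^+ 2 + kC k * eta ^+ 4) by rewrite ler_pM2l.
have h3 : ka k * kL k * D ^+ 2 <= 1 / 16 * D ^+ 2 by rewrite ler_wpM2r ?sqr_ge0.
have h4 : 4 * (eta ^+ 2 * P ^+ 2) <= ka k * kc k * (eta ^+ 2 * P ^+ 2).
  by rewrite ler_wpM2r// mulr_ge0 ?sqr_ge0.
pose w := ka k * be; have w0 : 0 <= w by rewrite /w mulr_ge0// ltW.
have h5 : 100 * (100 * (ka k * kC k * eta ^+ 4)) <= w.
  have : ka k * eta ^+ 2 * (100 * 100 * kC k * eta ^+ 2) <= ka k * eta ^+ 2 * kc k.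
    by rewrite ler_wpM2l// mulr_ge0 ?sqr_ge0// ltW.
  by rewrite /w /be => h; clear -h; lra.
have h6 : be * (eta * F) * (40 * 100) <= w.
  have : be * (40 * 100 * kF k * eta) <= be * ka k by rewrite ler_wpM2l.
  have : be * eta * F <= be * eta * kF k by rewrite ler_wpM2l// mulr_ge0// ltW.
  by move=> u v; rewrite /w; clear -u v; lra.
have h7 : w * (1 / 64) <= w * P ^+ 2 by rewrite ler_wpM2l.
have h8 : 200 * be * (w * P ^+ 2) <= 1 * (w * P ^+ 2) by rewrite ler_wpM2r// mulr_ge0 ?sqr_ge0.
have h9 := sqr_ge0 D.
rewrite /quart_scale; rewrite /w /be in h5 h6 h7 h8 w0 *.
clear -desc h1 h2 h3 h4 h5 h6 h7 h8 h9 w0.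
lra.
Qed.

Definition energy (eta P F : R) : R := F + ka k * P ^+ 2 / eta.

Lemma energy_ge1 eta P F : 0 < eta -> 1 <= F -> 1 <= energy eta P F.
Proof.
move=> eta0 F1; have a0 := ka_gt0 k.
by rewrite /energy -[1]addr0 lerD// divr_ge0 ?(ltW eta0)// mulr_ge0 ?sqr_ge0// ltW.
Qed.

(* [d2] stands for [D^2 / eta], [h] for [a / eta'], [Q] for [P^2]. *)
Lemma energy_arith (a kcc kLL kCC eta h t be Q N d2 F F' V A Z2 Bn : R) :
  0 < eta -> 0 < a -> 4 <= a * kcc -> be = kcc * eta ^+ 2 ->
  a * kLL <= 1 / 16 -> 0 <= kLL -> 0 <= kCC -> 0 <= kcc ->
  a <= h * eta -> h * eta <= a * (1 + t) -> 0 <= t -> t <= 1 / 100 ->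
  t <= be / 40 -> be <= 1 / 40 ->
  0 <= Q -> Q <= 1 / 16 -> 0 <= N -> N <= kLL * (eta * d2) + kCC * eta ^+ 4 ->
  0 <= d2 -> 7 / 16 * d2 + 6 * eta * Q <= 1 / 100 ->
  1 <= F -> 1 <= F' -> F' <= F - 7 / 16 * d2 + 16 / 9 * eta * Q ->
  V = F + a * Q / eta -> A = F' + h * ((1 - be) ^+ 2 * Q) ->
  Z2 <= (5 * Q + 5 * Bn) * N -> 0 <= Bn -> h * Bn <= 1 / 100 ->
  A ^+ 2 + 2 * A * h * N + h ^+ 2 * Z2 <=
  V ^+ 2 - 2 / 5 * d2 * V - 10 * eta * Q * V + 15 * a * kCC * eta ^+ 3 * V.
Proof.
move=> eta0 a0 hkc beE hkL kL0 kC0 kc0 h_ge h_le t0 t1 t2 be1 Q0 Q1 N0 Nle d0 Xle F1 F'1 desc VE AE Z2le B0 B1.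
have h0 : 0 < h by rewrite -(pmulr_lgt0 _ eta0); apply: lt_le_trans h_ge.
have be0 : 0 <= be by rewrite beE mulr_ge0 ?sqr_ge0.
have ei0 : 0 < eta^-1 by rewrite invr_gt0.
set X := 7 / 16 * d2 + 6 * eta * Q in Xle.
have X0 : 0 <= X by rewrite /X; nonneg.
have aQ0 : 0 <= a * Q / eta by nonneg.
have energy : 1 <= V by rewrite VE; clear -F1 aQ0; lra.
have hE : h <= a / eta * (1 + t) by rewrite mulrAC ler_pdivlMr.
have g2 : 0 <= (1 - be) ^+ 2 <= 1.
  rewrite sqr_ge0/=; have -> : (1 - be) ^+ 2 = 1 - be * (2 - be) by ring.
  by rewrite gerBl mulr_ge0//; clear -be1; lra.
have [g20 g21] := andP g2.
have hQ : h * ((1 - be) ^+ 2 * Q) <= a * Q / eta * (1 - 2 * be + be ^+ 2 + t).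
  have u : h * ((1 - be) ^+ 2 * Q) <= a / eta * (1 + t) * ((1 - be) ^+ 2 * Q).
    by rewrite ler_wpM2r// mulr_ge0.
  apply: le_trans u _.
  have -> : a / eta * (1 + t) * ((1 - be) ^+ 2 * Q) = a * Q / eta * ((1 + t) * (1 - be) ^+ 2).
    by ring.
  rewrite ler_wpM2l//.
  have : t * (1 - be) ^+ 2 <= t * 1 by rewrite ler_wpM2l.
  by move=> v; clear -v; lra.
(* Here [4 <= a * kcc] is used: the rate [39/20 * be] on [a * Q / eta] yields [7.8 * eta * Q], just
   above [6 + 16/9]. *)
have dec : 6 * eta * Q + 16 / 9 * eta * Q <= a * Q / eta * (2 * be - be ^+ 2 - t).
  have u1 : 39 / 20 * be <= 2 * be - be ^+ 2 - t.
    have : be * be <= be * (1 / 40) by rewrite ler_wpM2l.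
    by move=> v; clear -v t2; lra.
  have u2 : a * Q / eta * (39 / 20 * be) <= a * Q / eta * (2 * be - be ^+ 2 - t).
    by rewrite ler_wpM2l.
  apply: le_trans u2.
  have -> : a * Q / eta * (39 / 20 * be) = 39 / 20 * (a * kcc) * (eta * Q).
    by rewrite beE; field; rewrite gt_eqF.
  have u3 : 4 * (eta * Q) <= a * kcc * (eta * Q) by rewrite ler_wpM2r// mulr_ge0// ltW.
  have u4 : 0 <= eta * Q by rewrite mulr_ge0// ltW.
  by clear -u3 u4; lra.
have AX : A <= V - X.
  by rewrite AE VE /X; clear -hQ dec desc; lra.
have A0 : 0 <= A by rewrite AE addr_ge0 ?(le_trans _ F'1)// mulr_ge0 ?(ltW h0)// mulr_ge0.
have A2 : A ^+ 2 <= V ^+ 2 - 199 / 100 * V * X.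
  have u : A ^+ 2 <= (V - X) ^+ 2.
    by rewrite ler_sqr ?nnegrE//; apply: le_trans AX.
  have v : X * X <= X * (1 / 100 * V) by rewrite ler_wpM2l//; clear -Xle energy; lra.
  by clear -u v; lra.
pose n0 := h * N.
have n00 : 0 <= n0 by rewrite mulr_ge0// ltW.
have ac0 : 0 <= a * kCC * eta ^+ 3 by nonneg.
have n0le : n0 <= 101 / 1600 * d2 + 2 * (a * kCC * eta ^+ 3).
  have u1 : h * N <= a / eta * (1 + t) * (kLL * (eta * d2) + kCC * eta ^+ 4).
    by apply: ler_pM => //; exact: ltW.
  apply: le_trans u1 _.
  have -> : a / eta * (1 + t) * (kLL * (eta * d2) + kCC * eta ^+ 4) =
    (1 + t) * (a * kLL * d2 + a * kCC * eta ^+ 3) by field; rewrite gt_eqF.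
  have u2 : a * kLL * d2 <= 1 / 16 * d2 by rewrite ler_wpM2r.
  have u3 : (1 + t) * (a * kLL * d2 + a * kCC * eta ^+ 3) <=
     101 / 100 * (1 / 16 * d2 + a * kCC * eta ^+ 3).
    apply: ler_pM.
    - by rewrite addr_ge0.
    - rewrite addr_ge0//.
      by rewrite mulr_ge0// mulr_ge0// ltW.
    - by clear -t1; lra.
    - by rewrite lerD2r.
  by clear -u3 ac0; lra.
have AhN : 2 * A * h * N <= 2 * V * n0.
  rewrite -[leLHS]mulrA -/n0 ler_wpM2r//; clear -AX X0; lra.
have hZ : h ^+ 2 * Z2 <= 51 / 10 * V * n0.
  have u1 : h ^+ 2 * Z2 <= h ^+ 2 * ((5 * Q + 5 * Bn) * N).
    by rewrite ler_wpM2l ?sqr_ge0.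
  have u2 : h * (5 * Q + 5 * Bn) <= 51 / 10 * V.
    have w1 : h * Q <= a / eta * (1 + t) * Q by rewrite ler_wpM2r.
    have w2 : a * Q / eta * t <= a * Q / eta * (1 / 100) by rewrite ler_wpM2l.
    have w3 : 5 * (h * Q) <= 5 * (101 / 100 * (a * Q / eta)) by clear -w1 w2; lra.
    by rewrite VE; clear -w3 B1 F1 aQ0; lra.
  have u3 : h * (5 * Q + 5 * Bn) * n0 <= 51 / 10 * V * n0 by rewrite ler_wpM2r.
  by apply: le_trans u1 _; apply: le_trans u3; rewrite /n0; clear; lra.
have V0 : 0 <= V by apply: le_trans energy.
have vn : V * n0 <= V * (101 / 1600 * d2 + 2 * (a * kCC * eta ^+ 3)) by rewrite ler_wpM2l.
have vd : 0 <= V * d2 by rewrite mulr_ge0.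
have vq : 0 <= V * (eta * Q) by rewrite !mulr_ge0// ltW.
have va : 0 <= V * (a * kCC * eta ^+ 3) by rewrite mulr_ge0.
rewrite /X in A2.
clear -A2 AhN hZ vn vd vq va.
lra.
Qed.

(** With [P'^2 = g^2 P^2 + Z] the next energy is [A + h * Z], where [A] does not depend on the fresh
    index. The mean of [Z] is [N] and that of [Z^2] is [O(P^2 + eta^2) * N]; as [h * (P^2 + eta^2)]
    is [O(V)] for the current energy [V], squaring costs [O(V) * h * N]. The decrease of the energy
    is multiplied by about [2 V] in turn and covers this. *)
Lemma energy_sq_supermartingale : (0 < n)%N ->
  exists M C : R, forall eta eta' e P Pi F (e' P' Pi' xi : 'I_n -> R) F' D dpi,
  storm_step k eta eta' e P Pi F e' P' Pi' xi F' D dpi ->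
  M * eta <= 1 -> P ^+ 2 <= 1 / 16 ->
  avg (fun i => energy eta' (P' i) F' ^+ 2) <=
  energy eta P F ^+ 2 - 2 / 5 * (D ^+ 2 / eta) - eta * P ^+ 2 + C * eta ^+ 3.
Proof.
move=> n_gt0.
have kc0 := kc_gt0 k; have kC0 := kC_ge0 k; have a0 := ka_gt0 k.
have hkL := ka_kL k; have hkc := ka_kc k; have kF1 := kF_ge1 k.
have kT0 := kT_ge0 k; have kZ0 := kZ_ge0 k; have kB0 := kB_ge0 k.
have kF0 : 0 <= kF k by apply: le_trans kF1.
set B2 := kB k * (kZ k + 1).
have B20 : 0 <= B2 by rewrite /B2; nonneg.
have [M1 M1ge M1P] := upper_const [:: 40 * kc k; 40 * kT k / kc k; 100 * (kZ k ^+ 2 + 1);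
  200 * ka k * B2 ^+ 2; 15 * ka k ^+ 2 * kC k; 100 * kT k].
exists M1, (15 * ka k * kC k * kF k).
move=> eta eta' e P Pi F e' P' Pi' xi F' D dpi st eta_le P_le.
have eta'0 := ss_eta'_gt0 st; have eta'le := ss_eta'_le st.
have eta0 : 0 < eta by exact: lt_le_trans eta'le.
have small C : C <= M1 -> C * eta <= 1.
  by move=> CM; apply: le_trans eta_le; rewrite ler_pM2r.
have e1 : eta <= 1 by rewrite -[eta]mul1r small.
have ee : eta ^+ 2 <= eta by rewrite expr2 ler_piMl// ltW.
have s1 : 40 * kc k * eta <= 1 by apply: small; apply: M1P; rewrite !inE eqxx ?orbT.
have s2 : 40 * kT k * eta <= kc k.
  have : 40 * kT k / kc k * eta <= 1 by apply: small; apply: M1P; rewrite !inE eqxx ?orbT.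
  by rewrite mulrAC ler_pdivrMr// mul1r.
have s3 : 100 * (kZ k ^+ 2 + 1) * eta <= 1.
  by apply: small; apply: M1P; rewrite !inE eqxx ?orbT.
have s4 : 200 * ka k * B2 ^+ 2 * eta <= 1.
  by apply: small; apply: M1P; rewrite !inE eqxx ?orbT.
have s5 : 15 * ka k ^+ 2 * kC k * eta <= 1.
  by apply: small; apply: M1P; rewrite !inE eqxx ?orbT.
have s6 : 100 * kT k * eta <= 1 by apply: small; apply: M1P; rewrite !inE eqxx ?orbT.
set be := kc k * eta ^+ 2.
have be_eta : be <= kc k * eta by rewrite ler_pM2l.
have be1 : be <= 1 / 40 by clear -be_eta s1; lra.
have F1 := ss_F_ge1 st; have F2 := ss_F_le st; have F'1 := ss_F'_ge1 st.
have D0 := ss_D_ge0 st; have P0 := ss_P_ge0 st.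
have Ple : P <= 1 / 4.
  rewrite -ler_sqr ?nnegrE//.
  by clear -P_le; lra.
have ege : - (1 / 4) <= e.
  by have /ler_normlP[h _] := ss_e_le st; clear -h Ple; lra.
have desc := ss_descent st ege.
have DZ := ss_near st P_le.
set d2 := D ^+ 2 / eta.
have Dd : D ^+ 2 = eta * d2 by rewrite /d2 mulrCA divff ?mulr1// gt_eqF.
have d20 : 0 <= d2 by rewrite /d2 divr_ge0 ?sqr_ge0// ltW.
have d2Z : d2 <= kZ k ^+ 2 * eta.
  rewrite /d2 ler_pdivrMr//.
  have : D ^+ 2 <= (kZ k * eta) ^+ 2 by rewrite ler_sqr ?nnegrE// mulr_ge0// ltW.
  by move=> h; clear -h; lra.
have eta20 : 0 <= eta ^+ 2 by rewrite sqr_ge0.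
set h := ka k / eta'.
have ea : ka k <= h * eta.
  by rewrite /h mulrAC ler_pdivlMr// ler_pM2l.
have ea2 : h * eta <= ka k * (1 + kT k * eta ^+ 3).
  rewrite /h mulrAC ler_pdivrMr// -mulrA ler_pM2l// mulrC; exact: (ss_eta_slow st).
have te : kT k * eta ^+ 3 = kT k * eta * eta ^+ 2 by rewrite exprS mulrA.
have t1 : kT k * eta ^+ 3 <= 1 / 100.
  have u : kT k * eta * eta ^+ 2 <= kT k * eta * 1.
    by rewrite ler_wpM2l ?mulr_ge0 ?(ltW eta0)//; apply: le_trans ee _.
  by rewrite te; clear -u s6; lra.
have t2 : kT k * eta ^+ 3 <= be / 40.
  have u : 40 * kT k * eta * eta ^+ 2 <= kc k * eta ^+ 2 by rewrite ler_wpM2r.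
  by rewrite te /be; clear -u; lra.
have xi0 := ss_xi_ge0 st.
have xil i : xi i <= B2 * eta.
  apply: le_trans (ss_xi_le st i) _; rewrite /B2 -mulrA ler_wpM2l//.
  by rewrite mulrDl mul1r lerD.
pose g := 1 - be.
pose Z i := P' i ^+ 2 - g ^+ 2 * P ^+ 2.
have N_le := ss_noise st; set N := avg _ in N_le.
have N0 : 0 <= N by apply: avg_ge0 => i; exact: sqr_ge0.
have aZ : avg Z = N.
  by rewrite /Z avgB avg_cst// (ss_avg_P st) -/N -/be -/g; ring.
have aZ2 : avg (fun i => Z i ^+ 2) <= (5 * P ^+ 2 + 5 * (B2 * eta) ^+ 2) * N.
  rewrite -avgZ; apply: avg_le => i.
  have zi : `|Z i| <= xi i * (2 * P + xi i) := ss_dev_P st i.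
  have : `|Z i| ^+ 2 <= (xi i * (2 * P + xi i)) ^+ 2.
    by rewrite ler_sqr ?nnegrE// mulr_ge0// addr_ge0// mulr_ge0.
  rewrite real_normK ?num_real// => zz; apply: le_trans zz _.
  rewrite exprMn mulrC ler_wpM2r ?sqr_ge0//.
  have x2 : xi i ^+ 2 <= (B2 * eta) ^+ 2.
    by rewrite ler_sqr ?nnegrE// mulr_ge0// ltW.
  by have x3 := sqr_ge0 (P - 2 * xi i); clear -x2 x3; lra.
set A := F' + h * (g ^+ 2 * P ^+ 2).
have -> : avg (fun i => energy eta' (P' i) F' ^+ 2) =
   A ^+ 2 + 2 * A * h * N + h ^+ 2 * avg (fun i => Z i ^+ 2).
  rewrite (@eq_avg _ _ _ (fun i => A ^+ 2 + 2 * A * h * Z i + h ^+ 2 * Z i ^+ 2)).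
    by rewrite !avgD avg_cst// !avgZ aZ.
  move=> i; have -> : energy eta' (P' i) F' = A + h * Z i by rewrite /energy /A /Z /h; ring.
  by ring.
have Q0 := sqr_ge0 P.
apply: (@le_trans _ _ (energy eta P F ^+ 2 - 2 / 5 * d2 * energy eta P F -
    10 * eta * P ^+ 2 * energy eta P F + 15 * ka k * kC k * eta ^+ 3 * energy eta P F)).
  apply: (@energy_arith (ka k) (kc k) (kL k) (kC k) eta h (kT k * eta ^+ 3) be (P ^+ 2) N d2 F F' _ A
    _ ((B2 * eta) ^+ 2)) => //; rewrite ?sqr_ge0 ?(ltW (kL_gt0 k)) ?(ltW kc0)//.
  - by rewrite mulr_ge0// exprn_ge0// ltW.
  - by rewrite -Dd.
  - have u : eta * P ^+ 2 <= eta * (1 / 16) by rewrite ler_wpM2l// ltW.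
    by clear -u d2Z s3 d20 eta0; lra.
  - have u : eta * F' <= eta * (F - 7 / 16 * d2 + 16 / 9 * eta * P ^+ 2).
      by apply: le_trans desc _; rewrite Dd; clear; lra.
    by rewrite ler_pM2l in u.
  - have -> : h * (B2 * eta) ^+ 2 = h * eta * (B2 ^+ 2 * eta) by ring.
    have u1 : ka k * (kT k * eta ^+ 3) <= ka k * (1 / 100) by rewrite ler_wpM2l// ltW.
    have u2 : h * eta * (B2 ^+ 2 * eta) <= (2 * ka k) * (B2 ^+ 2 * eta).
      apply: ler_wpM2r; last by clear -u1 ea2 a0; lra.
      by apply: mulr_ge0; [exact: sqr_ge0|exact: ltW].
    by clear -u2 s4; lra.
have W1 := energy_ge1 P eta0 F1.
set V := energy eta P F in W1 *.
have VE : V = F + ka k * P ^+ 2 / eta by [].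
have v1 : d2 * 1 <= d2 * V by rewrite ler_wpM2l.
have v2 : eta * P ^+ 2 * 1 <= eta * P ^+ 2 * V by rewrite ler_wpM2l// mulr_ge0// ltW.
(* The noise of order [eta^3] is multiplied by the energy, which is unbounded through [P^2 / eta];
   that part is charged to the gain [eta * P^2]. *)
have v3 : 15 * ka k * kC k * eta ^+ 3 * V <= 15 * ka k * kC k * kF k * eta ^+ 3 + eta * P ^+ 2.
  have -> : 15 * ka k * kC k * eta ^+ 3 * V =
    15 * ka k * kC k * eta ^+ 3 * F + 15 * ka k ^+ 2 * kC k * eta * (eta * P ^+ 2).
    by rewrite VE; field; rewrite gt_eqF.
  have u1 : 15 * ka k * kC k * eta ^+ 3 * F <= 15 * ka k * kC k * eta ^+ 3 * kF k.
    by rewrite ler_wpM2l//; nonneg.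
  have u2 : 15 * ka k ^+ 2 * kC k * eta * (eta * P ^+ 2) <= 1 * (eta * P ^+ 2).
    by rewrite ler_wpM2r// mulr_ge0// ltW.
  by clear -u1 u2; lra.
have v4 : 0 <= eta * P ^+ 2 by rewrite mulr_ge0// ltW.
clear -v1 v2 v3 v4; lra.
Qed.

End Energy.

(** * The score when the estimate of g is far off *)

(** From [sg * e >= 0] one step leads to [sg * e' >= - noise_max], so with this shift the argument
    of the convex terms stays at least 2. *)
Definition outer_shift (R : realType) (k : storm_consts R) : R := noise_max k + 2.

Definition outer_far (R : realType) (k : storm_consts R) : R :=
  Num.max (kR k) (outer_shift k).

(** Lower bound of [a / (outer_shift + a)] for [a >= 1/16], the range of [|e|] where the outer
    scores are used. *)
Definition outer_slope (R : realType) (k : storm_consts R) : R :=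
  1 / 16 / (outer_shift k + 1 / 16).

Record outer_consts (R : realType) (k : storm_consts R) := OuterConsts {
  ot : R; oz : R;
  ot_gt0 : 0 < ot; ot_le1 : ot <= 1; oz_gt0 : 0 < oz; oz_le1 : oz <= 1;
  o_kS : 72 * kL k * kS k <= kc k;
  ot_near : ot * (2 * kL k * kD k ^+ 2 * (outer_shift k + outer_far k)) <=
    kc k * outer_slope k;
  ot_W : ot * (4 * (kL k * kD k ^+ 2 + kC k)) <= kc k }.

Section Outer.
Variables (R : realType) (n : nat) (k : storm_consts R) (o : outer_consts k).
Local Notation K0 := (outer_shift k).

(* The two convex terms gain [kc * eta^2 * sg * e] times their slopes, which pays
   for the growth of [P] caused by the step; the second one leaves a gain of
   order [eta^(2 + oz)]. *)
Definition outer (Y sg eta e P : R) : R :=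
  Y + ((K0 + sg * e)^-1 + (K0 + sg * e) `^ (- oz o)) - ot o * (eta ^+ 2 * P ^+ 2).

Lemma outer_shift_ge2 : 2 <= K0.
Proof. by rewrite /outer_shift lerDr noise_max_ge0. Qed.

Lemma powRN_le1 (x z : R) : 1 <= x -> 0 <= z -> x `^ (- z) <= 1.
Proof.
move=> x1 z0; rewrite powRN invf_le1.
  by rewrite -[1](powRr0 x) ler_powR.
by apply: lt_le_trans ltr01 _; rewrite -[1](powRr0 x) ler_powR.
Qed.

Lemma outer_le Y sg eta e P : 1 <= K0 + sg * e ->
  outer Y sg eta e P <= Y + 2 - ot o * (eta ^+ 2 * P ^+ 2).
Proof.
move=> h; rewrite /outer lerB// lerD2l.
rewrite -[2]/(1 + 1) lerD//.
  by rewrite invf_le1 ?(lt_le_trans ltr01 h).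
by rewrite powRN_le1// ltW// oz_gt0.
Qed.

Lemma outer_ge Y sg eta e P : 1 <= K0 + sg * e ->
  Y - ot o * (eta ^+ 2 * P ^+ 2) <= outer Y sg eta e P.
Proof.
move=> h; rewrite /outer lerB// -[leLHS]addr0 lerD2l addr_ge0 ?powR_ge0//.
by rewrite invr_ge0 (le_trans _ h).
Qed.

Lemma outer_step_shift (sg eta eta' e P Pi F F' D dpi : R) (e' P' Pi' xi : 'I_n -> R) i :
  storm_step k eta eta' e P Pi F e' P' Pi' xi F' D dpi ->
  eta <= 1 -> kc k * eta ^+ 2 <= 1 / 2 -> `|sg| = 1 -> 0 <= sg * e ->
  - noise_max k <= sg * e' i.
Proof.
move=> st e1 be2 sg1 sge.
have eta'0 := ss_eta'_gt0 st; have eta'le := ss_eta'_le st.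
have eta0 : 0 < eta by exact: lt_le_trans eta'le.
have ee : eta ^+ 2 <= 1 by rewrite expr_le1// ltW.
have xil : xi i <= noise_max k.
  apply: le_trans (ss_xi_le st i) _; rewrite /noise_max ler_wpM2l ?kB_ge0//.
  by rewrite lerD// (ss_D_le st).
have : `|sg * e' i - (1 - kc k * eta ^+ 2) * (sg * e)| <= noise_max k.
  have -> : sg * e' i - (1 - kc k * eta ^+ 2) * (sg * e) =
    sg * (e' i - (1 - kc k * eta ^+ 2) * e) by ring.
  by rewrite normrM sg1 mul1r; apply: le_trans (ss_dev_e st i) _.
move/ler_normlP => [h _].
have : 0 <= (1 - kc k * eta ^+ 2) * (sg * e).
  by rewrite mulr_ge0//; clear -be2; lra.
by move=> u; clear -h u; lra.
Qed.

(** Two regimes. For [a >= far] the product [a * D^2] is at most [kSS * (1 + q)], and the inverse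
    term gains at least [1 / (4 a)]; the constant 72 is [2 * 9 * 4], from the doubled noise,
    [th * (1 + q) <= 9] and [(a u)^2 >= 1/4]. For smaller [a] the step is merely bounded and the
    smallness of [th] is used. The residual noise of order [eta^4] takes half of the gain of the
    power term. *)
Lemma outer_arith (a u w th vt zz kcc kLL kSS kCC D N eta q d1 c5 far : R) :
  0 < eta -> eta <= 1 -> 0 < th -> th <= 1 -> 0 <= vt -> vt <= th -> 0 < kcc ->
  0 <= kLL -> 0 <= kSS -> 0 <= kCC -> 0 < zz -> 0 <= q -> th * q <= 8 ->
  0 <= N -> N <= kLL * D ^+ 2 + kCC * eta ^+ 4 -> 0 < d1 ->
  d1 <= a * u -> 0 < u -> 0 < a -> 72 * kLL * kSS <= kcc ->
  (far <= a -> a * D ^+ 2 <= kSS * (1 + q) /\ 1 / 2 <= a * u) ->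
  (a <= far -> th * (2 * kLL * D ^+ 2) <= kcc * d1 * u) ->
  c5 * eta <= w -> 0 < c5 -> 2 * kCC * eta <= kcc * zz * d1 * c5 / 2 ->
  (vt + th) * (eta ^+ 2 * N) <=
   kcc * eta ^+ 2 * a * (u ^+ 2 + zz * (u * w)) - kcc * eta ^+ 2 * (zz * d1 * w / 2).
Proof.
move=> eta0 eta1 th0 th1 vt0 vt1 kc0 kL0 kS0 kC0 z0 q0 q8 N0 Nle d10 d1le u0 a0 hS hfar hnear hw c50 hC.
have w0 : 0 < w by apply: lt_le_trans hw; rewrite mulr_gt0.
have D20 := sqr_ge0 D.
have main : th * (2 * kLL * D ^+ 2) <= kcc * (a * u ^+ 2).
  have [fa|af] := leP far a; last first.
    apply: le_trans (hnear (ltW af)) _.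
    rewrite -mulrA ler_pM2l// expr2 [a * (u * u)]mulrA ler_wpM2r//; exact: ltW.
  have [h1 h2] := hfar fa.
  have h3 : 4 * (a * u * (a * u)) >= 1.
    have : 1 / 2 * (1 / 2) <= a * u * (a * u).
      by apply: ler_pM.
    by move=> h; clear -h; lra.
  have h4 : th * (1 + q) <= 9 by rewrite mulrDr mulr1; clear -th1 q8; lra.
  rewrite -(ler_pM2l a0).
  have -> : a * (th * (2 * kLL * D ^+ 2)) = 2 * kLL * th * (a * D ^+ 2) by ring.
  apply: (@le_trans _ _ (2 * kLL * th * (kSS * (1 + q)))).
    by rewrite ler_wpM2l// mulr_ge0 ?(ltW th0)// mulr_ge0.
  have -> : 2 * kLL * th * (kSS * (1 + q)) = 2 * kLL * kSS * (th * (1 + q)) by ring.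
  apply: (@le_trans _ _ (2 * kLL * kSS * 9)).
    by rewrite ler_wpM2l// mulr_ge0// mulr_ge0.
  have h5 : kcc * 1 <= kcc * (4 * (a * u * (a * u))) by rewrite ler_pM2l.
  by clear -h5 hS; lra.
have e20 : 0 <= eta ^+ 2 by rewrite sqr_ge0.
have m1 : (vt + th) * (eta ^+ 2 * N) <= 2 * th * (eta ^+ 2 * (kLL * D ^+ 2 + kCC * eta ^+ 4)).
  apply: ler_pM; first (by rewrite addr_ge0// ltW); first by rewrite mulr_ge0.
    by clear -vt1; lra.
  by rewrite ler_wpM2l.
have m2 : eta ^+ 2 * (th * (2 * kLL * D ^+ 2)) <= eta ^+ 2 * (kcc * (a * u ^+ 2)).
  by rewrite ler_wpM2l.
have m3 : th * (2 * kCC * eta ^+ 4) <= kcc * zz * d1 * w / 2.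
  apply: (@le_trans _ _ (1 * (2 * kCC * eta ^+ 2))).
    apply: ler_pM => //; rewrite ?(ltW th0)//; first by nonneg.
    rewrite ler_wpM2l ?mulr_ge0// -[4%N]/(2 + 2)%N exprD ler_piMl//.
    by rewrite expr_le1// ltW.
  have v1 : 2 * kCC * eta * eta <= kcc * zz * d1 * c5 / 2 * eta by rewrite ler_pM2r.
  have v2 : kcc * zz * d1 / 2 * (c5 * eta) <= kcc * zz * d1 / 2 * w.
    by rewrite ler_wpM2l//; nonneg.
  by clear -v1 v2; lra.
have m4 : eta ^+ 2 * (th * (2 * kCC * eta ^+ 4)) <= eta ^+ 2 * (kcc * zz * d1 * w / 2).
  by rewrite ler_wpM2l.
have m5 : kcc * eta ^+ 2 * (zz * w) * d1 <= kcc * eta ^+ 2 * (zz * w) * (a * u).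
  by rewrite ler_wpM2l//; nonneg.
clear -m1 m2 m4 m5.
lra.
Qed.

Lemma powRN_anti (x y z : R) : 0 < x -> x <= y -> 0 <= z -> y `^ (- z) <= x `^ (- z).
Proof.
move=> x0 xy z0; rewrite !powRN lef_pV2 ?posrE ?powR_gt0//; last exact: lt_le_trans xy.
by rewrite ge0_ler_powR// nnegrE ltW//; exact: lt_le_trans xy.
Qed.

Lemma powRN_scale (x eta C z : R) : 0 < x -> 0 < eta -> 0 <= z -> x * eta <= C ->
  C `^ (- z) * eta `^ z <= x `^ (- z).
Proof.
move=> x0 eta0 z0 xC.
have h : C `^ (- z) <= x `^ (- z) * eta `^ (- z).
  by rewrite -powRM ?(ltW x0) ?(ltW eta0)//; apply: powRN_anti => //; rewrite mulr_gt0.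
apply: (@le_trans _ _ (x `^ (- z) * eta `^ (- z) * eta `^ z)).
  by rewrite ler_wpM2r ?powR_ge0.
by rewrite -mulrA (powRN eta) mulVf ?mulr1// gt_eqF// powR_gt0.
Qed.

Lemma powR_ge_id (eta z : R) : 0 < eta -> eta <= 1 -> z <= 1 -> eta <= eta `^ z.
Proof.
by move=> e0 e1 z1; rewrite -[leLHS]powRr1 ?(ltW e0)// ger_powR// e0.
Qed.

(** Tangents at the current point turn the pull of [e] towards 0 in mean into a gain. Positivity of
    [outer] bounds [eta * P], hence [eta * (K0 + |e|)], which keeps the power term above a multiple
    of [eta^oz]. The penalty, with weight [vt <= ot], is averaged together with [outer] because it
    pays for the same growth of [P]. *)
Lemma outer_step : (0 < n)%N -> exists M c6 : R, 0 < c6 /\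
  forall eta eta' e P Pi F (e' P' Pi' xi : 'I_n -> R) F' D dpi,
  storm_step k eta eta' e P Pi F e' P' Pi' xi F' D dpi ->
  M * eta <= 1 -> forall sg Y vt, `|sg| = 1 -> Y <= 6 -> 1 / 16 <= sg * e ->
  0 < outer Y sg eta e P -> 0 <= vt -> vt <= ot o ->
  avg (fun i => vt * (eta' ^+ 2 * P' i ^+ 2) - outer Y sg eta' (e' i) (P' i)) <=
  vt * (eta ^+ 2 * P ^+ 2) - outer Y sg eta e P - c6 * (eta ^+ 2 * eta `^ oz o).
Proof.
move=> n_gt0.
have kc0 := kc_gt0 k; have kC0 := kC_ge0 k; have kL0 := kL_gt0 k; have kS0 := kS_ge0 k.
have t0 := ot_gt0 o; have z0 := oz_gt0 o; have t1 := ot_le1 o; have z1 := oz_le1 o.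
have K2 := outer_shift_ge2; have xm0 := noise_max_ge0 k.
have K00 : 0 < K0 by apply: lt_le_trans K2.
set d1 := outer_slope k.
have d10 : 0 < d1 by rewrite /d1 /outer_slope divr_gt0// addr_gt0.
pose C1 := K0 + (8 / ot o + 1).
have t8 : 0 <= 8 / ot o by rewrite divr_ge0// ltW.
have C10 : 0 < C1 by rewrite /C1; clear -t8 K00; lra.
set c5 := C1 `^ (- oz o).
have c50 : 0 < c5 by rewrite /c5 powR_gt0.
have den0 : 0 < kc k * oz o * d1 * c5 by rewrite mulr_gt0// mulr_gt0// mulr_gt0.
have [M1 M1ge M1P] := upper_const [:: 2 * kc k; 4 * kC k / (kc k * oz o * d1 * c5)].
exists M1, (kc k * oz o * d1 * c5 / 2); split; first by rewrite divr_gt0.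
move=> eta eta' e P Pi F e' P' Pi' xi F' D dpi st eta_le sg Y vt sg1 Y6 sge G0 vt0 vt1.
have eta'0 := ss_eta'_gt0 st; have eta'le := ss_eta'_le st.
have eta0 : 0 < eta by exact: lt_le_trans eta'le.
have small C : C <= M1 -> C * eta <= 1.
  by move=> CM; apply: le_trans eta_le; rewrite ler_pM2r.
have e1 : eta <= 1 by rewrite -[eta]mul1r small.
have ee : eta ^+ 2 <= eta by rewrite expr2 ler_piMl// ltW.
have s1 : 2 * kc k * eta <= 1 by apply: small; apply: M1P; rewrite !inE eqxx ?orbT.
have s2 : 4 * kC k * eta <= kc k * oz o * d1 * c5.
  have : 4 * kC k / (kc k * oz o * d1 * c5) * eta <= 1.
    by apply: small; apply: M1P; rewrite !inE eqxx ?orbT.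
  by rewrite mulrAC ler_pdivrMr// mul1r.
set be := kc k * eta ^+ 2.
have be0 : 0 <= be by rewrite mulr_ge0 ?sqr_ge0// ltW.
have be2 : be <= 1 / 2.
  have : be <= kc k * eta by rewrite ler_pM2l.
  by move=> h; clear -h s1; lra.
have P0 := ss_P_ge0 st; have D0 := ss_D_ge0 st.
set a := sg * e in sge.
have a0 : 0 < a by apply: lt_le_trans sge.
have aE : a = `|e| by rewrite -(gtr0_norm a0) /a normrM sg1 mul1r.
have aP : a <= P by rewrite aE; exact: (ss_e_le st).
have Ka0 : 0 < K0 + a by rewrite addr_gt0.
have Ka1 : 1 <= K0 + a by clear -K2 a0; lra.
set q := eta ^+ 2 * P ^+ 2.
have q0 : 0 <= q by rewrite mulr_ge0 ?sqr_ge0.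
have q8 : ot o * q <= 8.
  have := lt_le_trans G0 (outer_le _ _ _ Ka1); rewrite -/q => h.
  by clear -h Y6; lra.
have pe : eta * P <= 8 / ot o + 1.
  have h1 : (eta * P) ^+ 2 <= 8 / ot o by rewrite ler_pdivlMr// mulrC exprMn.
  by have h2 := sqr_ge0 (eta * P - 1 / 2); clear -h1 h2; lra.
set u := (K0 + a)^-1.
have u0 : 0 < u by rewrite invr_gt0.
have d1le : d1 <= a * u.
  have K16 : 0 < K0 + 1 / 16 by clear -K00; lra.
  rewrite /u /d1 /outer_slope ler_pdivlMr// mulrAC ler_pdivrMr//.
  have : K0 * (1 / 16) <= K0 * a by rewrite ler_pM2l.
  by move=> h; clear -h; lra.
pose w := (K0 + a) `^ (- oz o).
have KaC : (K0 + a) * eta <= C1.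
  have h1 : a * eta <= eta * P by rewrite mulrC ler_pM2l.
  have h2 : K0 * eta <= K0 * 1 by rewrite ler_pM2l.
  by rewrite /C1; clear -h1 h2 pe; lra.
have wz : c5 * eta `^ oz o <= w by apply: powRN_scale => //; exact: ltW.
have w_eta : c5 * eta <= w.
  by apply: le_trans wz; rewrite ler_pM2l//; exact: powR_ge_id.
have N_le := ss_noise st; set N := avg _ in N_le.
have N0 : 0 <= N by apply: avg_ge0 => i; exact: sqr_ge0.
pose g := 1 - be.
have key : (vt + ot o) * (eta ^+ 2 * N) <=
    be * a * (u ^+ 2 + oz o * (u * w)) - be * (oz o * d1 * w / 2).
  apply: (@outer_arith a u w (ot o) vt (oz o) (kc k) (kL k) (kS k) (kC k) D N eta q d1 c5
    (outer_far k)) => //; rewrite ?(ltW kL0)//.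
  - exact: (o_kS o).
  - rewrite /outer_far ge_max => /andP[h1 h2]; split.
      rewrite aE; rewrite aE in h1; exact: (ss_far st).
    rewrite /u ler_pdivlMr// mul1r -ler_pdivlMl ?invr_gt0// invrK.
    by clear -h2; lra.
  - move=> aF.
    have Dk : D ^+ 2 <= kD k ^+ 2.
      by rewrite ler_sqr ?nnegrE//; [exact: (ss_D_le st)|exact: kD_ge0].
    rewrite /u ler_pdivlMr//; apply: le_trans (ot_near o).
    rewrite -[leLHS]mulrA ler_pM2l//.
    have kD2 := sqr_ge0 (kD k).
    apply: ler_pM => //; first by nonneg.
    - exact: ltW.
    - by rewrite ler_pM2l// mulr_gt0.
    - by rewrite lerD2l.
  - by clear -s2; lra.
have shift i : 2 <= K0 + sg * e' i.
  have := outer_step_shift i st e1 be2 sg1 (ltW a0).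
  by rewrite /outer_shift => h; clear -h; lra.
have pt i : vt * (eta' ^+ 2 * P' i ^+ 2) - outer Y sg eta' (e' i) (P' i) <=
   (vt + ot o) * eta ^+ 2 * P' i ^+ 2 - (Y +
    (u * (1 - (K0 + sg * e' i - (K0 + a)) * u) +
     w * (1 - oz o * (K0 + sg * e' i - (K0 + a)) * u))).
  have sh : 0 < K0 + sg * e' i by apply: lt_le_trans (shift i).
  have h1 := inv_tangent sh Ka0.
  have h2 := powR_tangent sh Ka0 (ltW z0).
  have h3 : (vt + ot o) * (eta' ^+ 2 * P' i ^+ 2) <= (vt + ot o) * (eta ^+ 2 * P' i ^+ 2).
    rewrite ler_wpM2l ?addr_ge0 ?(ltW t0)// ler_wpM2r ?sqr_ge0//.
    by rewrite ler_sqr ?nnegrE// ltW.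
  rewrite /outer; rewrite -/u in h1; rewrite -/u -/w in h2.
  by clear -h1 h2 h3; lra.
apply: le_trans (avg_le pt) _.
pose la := - (Y + (u * (1 - (K0 - (K0 + a)) * u) + w * (1 - oz o * (K0 - (K0 + a)) * u))).
rewrite (@eq_avg _ _ _ (fun i => (vt + ot o) * eta ^+ 2 * P' i ^+ 2 +
  ((u * u + w * (oz o * u)) * sg * e' i + la))); last by move=> i; rewrite /la; ring.
rewrite !avgD !avgZ avg_cst// (ss_avg_e st) (ss_avg_P st) -/be -/N.
rewrite /outer -/a -/u -/w -/q /la.
have aa : sg * e = a by [].
have -> : (u * u + w * (oz o * u)) * sg * ((1 - be) * e) =
  (u * u + w * (oz o * u)) * ((1 - be) * a) by rewrite -aa; ring.
have gq : (vt + ot o) * q * (1 - be) ^+ 2 <= (vt + ot o) * q.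
  have p0 : 0 <= (vt + ot o) * q by apply: mulr_ge0 => //; rewrite addr_ge0// ltW.
  rewrite ler_piMr//.
  have -> : (1 - be) ^+ 2 = 1 - be * (2 - be) by ring.
  by rewrite gerBl mulr_ge0//; clear -be2; lra.
have wz2 : be * (oz o * d1 / 2) * (c5 * eta `^ oz o) <= be * (oz o * d1 / 2) * w.
  by rewrite ler_wpM2l//; nonneg.
rewrite /be in gq wz2 key *; rewrite /q in gq *.
clear -gq wz2 key.
lra.
Qed.

End Outer.

(** * Gluing the scores *)

Lemma powR_small (R : realType) (C z : R) : 0 <= C -> 0 < z ->
  exists2 M, 0 <= M & forall eta : R, 0 < eta -> M * eta <= 1 -> C * eta `^ z <= 1.
Proof.
move=> C0 z0; exists ((C + 1) `^ z^-1); first exact: powR_ge0.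
have C1 : 0 < C + 1 by rewrite ltr_wpDl.
move=> eta e0 h.
have : ((C + 1) `^ z^-1 * eta) `^ z <= 1 `^ z.
  by rewrite ge0_ler_powR ?nnegrE ?mulr_ge0 ?powR_ge0 ?(ltW e0) ?(ltW z0).
rewrite powR1 powRM ?powR_ge0 ?(ltW e0)// -powRrM mulVf ?gt_eqF// powRr1 ?(ltW C1)//.
by apply: le_trans; rewrite ler_wpM2r ?powR_ge0// lerDl.
Qed.

Lemma powR_sqrt_small (R : realType) (C eta z : R) : 0 <= C -> 0 < eta -> eta <= 1 ->
  z <= 1 / 2 -> C ^+ 2 * eta <= 1 -> C * eta <= eta `^ z.
Proof.
move=> C0 e0 e1 z1 h.
apply: (@le_trans _ _ (eta `^ (1 / 2))); last by rewrite ger_powR// e0.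
rewrite div1r powR12_sqrt ?(ltW e0)// -ler_sqr ?nnegrE ?mulr_ge0 ?(ltW e0) ?sqrtr_ge0//.
rewrite sqr_sqrtr ?(ltW e0)// exprMn [eta ^+ 2]expr2 mulrA.
by rewrite ler_piMl// ltW.
Qed.

(** From beyond this value one step cannot bring [e] below 1: it loses at most the factor 1/2 and
    then [noise_max]. *)
Definition mid_edge (R : realType) (k : storm_consts R) : R := 2 * (1 + noise_max k).

(** On the gluing range the form is at least 1/32 and the outer scores are at most [8 * weight],
    hence the divisor [8 * 32]. *)
Definition glue_const (R : realType) (k : storm_consts R) (o : outer_consts k) : R :=
  (1 + 8 / ot o) `^ (- (1 / 2 - oz o)) / 256.

(* The order of the choices is [ot], then [lth] (hence [oz]), then [cvt] and [cep],
   and last the threshold [cP] and [cM], which depend on [score_lin_submartingale]. *)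
Record cost_consts (R : realType) (k : storm_consts R) := CostConsts {
  co : outer_consts k; cl : linear_consts k; cM : R; cep : R; cvt : R; cP : R;
  oz_lth : oz co = lth cl / 64;
  lth_mid : lth cl * (mid_edge k ^+ 2 + lb cl * (kX k * (8 / ot co + 1)) +
     lK cl * (8 / ot co + 1) ^+ 2) <= 1 / 32;
  ep_gt0 : 0 < cep; cM_gt0 : 0 < cM; vt_gt0 : 0 < cvt; vt_le : cvt <= ot co;
  vt_small : cvt * (kL k * kD k ^+ 2 + kC k) <= lth cl / 32 * kc k / 4;
  ep_le : cep <= glue_const co;
  cP_ge0 : 0 <= cP;
  cM_ge : (ka k * cP ^+ 2 + kF k + ka k) ^+ 3 * (32 / 3) ^+ 3 <= cM }.

Section Cost.
Variables (R : realType) (n : nat) (k : storm_consts R) (c : cost_consts k).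
Local Notation o := (co c).
Local Notation l := (cl c).
Local Notation CM := (cM c).
Local Notation ep := (cep c).
Local Notation vt := (cvt c).
Local Notation mid_edge := (mid_edge k).
Local Notation ep_gt0 := (ep_gt0 c).
Local Notation oz_lth := (oz_lth c).
Local Notation lth_mid := (lth_mid c).

(* [eta^(1 - 2 oz)] is the order of [score_lin] when [eta * P] is bounded, so that
   the scores can be glued along [e = - 1 / 16] and [e = mid_edge]. *)
Definition weight (eta : R) : R := ep * eta `^ (1 - 2 * oz o).

(** The truncation at [noise_max] is inactive one step after [e <= - 1/16]. For other [e] it keeps
    the argument of the convex terms at least 1, so that this score is bounded below by
    [weight * (1 - ot * q)] everywhere. *)
Definition score_neg (eta e P : R) : R :=
  weight eta * Num.max 0 (outer o 1 (-1) eta (Num.min e (noise_max k)) P).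

(** The jump at [e = 1] is harmless: up to [mid_edge] this score is dominated by [score_lin], and
    from beyond [mid_edge] one step stays above 1. The offset 6, against 1 on the negative side,
    makes it exceed [score_neg] for [e >= 1]. *)
Definition score_pos (eta e P : R) : R :=
  if 1 <= e then weight eta * Num.max 0 (outer o 6 1 eta e P) else 0.

Definition score (eta e P Pi F : R) : R :=
  Num.max (Num.max (score_lin l eta e P Pi) (CM * score_quart k eta e P F))
    (Num.max (score_neg eta e P) (score_pos eta e P)).

(** Its contraction supplies a decrease where [eta * P] is large and all scores may vanish. *)
Definition penalty (eta P : R) : R := weight eta * (vt * (eta ^+ 2 * P ^+ 2)).

Lemma weight_gt0 eta : 0 < eta -> 0 < weight eta.
Proof. by move=> e0; rewrite /weight mulr_gt0 ?ep_gt0 ?powR_gt0. Qed.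

Lemma oz_small : oz o <= 1 / 8.
Proof. by rewrite oz_lth; have := lth_le l; lra. Qed.

Lemma weight_le eta eta' : 0 < eta' -> eta' <= eta -> weight eta' <= weight eta.
Proof.
move=> e0 ee; rewrite /weight ler_pM2l ?ep_gt0//.
rewrite ge0_ler_powR ?nnegrE ?(ltW e0) ?(le_trans (ltW e0) ee)//.
by have := oz_small; lra.
Qed.

Lemma weight_slow eta eta' t : 0 < eta' -> eta' <= eta -> 0 <= t ->
  eta <= eta' * (1 + t) -> weight eta * (1 - t) <= weight eta'.
Proof.
move=> e0 ee t0 slow; have e0' : 0 < eta by exact: lt_le_trans ee.
rewrite /weight -mulrA ler_pM2l ?ep_gt0//.
have -> : eta' = eta * (eta' / eta) by rewrite mulrCA divff ?mulr1// gt_eqF.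
have r0 : 0 < eta' / eta by rewrite divr_gt0.
rewrite powRM ?(ltW e0') ?(ltW r0)// ler_wpM2l ?powR_ge0//.
apply: (@le_trans _ _ (eta' / eta)).
  rewrite ler_pdivlMr//.
  have h1 : (1 - t) * eta <= (1 - t) * (eta' * (1 + t)) \/ 1 <= t.
    case: (leP 1 t) => [|t1]; [by right|left].
    by rewrite ler_wpM2l// subr_ge0 ltW.
  case: h1 => [h1|h1].
    apply: le_trans h1 _; have h2 : 0 <= eta' * t ^+ 2 by rewrite mulr_ge0 ?sqr_ge0// ltW.
    by clear -h2; lra.
  by apply: le_trans (ltW e0); rewrite mulr_le0_ge0 ?subr_le0 ?(ltW e0').
apply: powR_ge_id => //; first by rewrite ler_pdivrMr// mul1r.
by have := oz_gt0 o; lra.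
Qed.

Lemma weight_le_ep eta : 0 < eta -> eta <= 1 -> weight eta <= ep.
Proof.
move=> e0 e1; rewrite /weight ler_piMr ?(ltW ep_gt0)//.
apply: (@le_trans _ _ (1 `^ (1 - 2 * oz o))); last by rewrite powR1.
by rewrite ge0_ler_powR ?nnegrE ?(ltW e0)//; have := oz_small; lra.
Qed.

Lemma score_lin_ge0 eta e P Pi : 0 <= score_lin l eta e P Pi.
Proof. by rewrite /score_lin mulr_ge0 ?powR_ge0// le_max lexx. Qed.

Lemma score_lin_le_y eta e P Pi : score_lin l eta e P Pi <= Num.max 0 (lin_form l eta e P Pi).
Proof.
rewrite /score_lin ler_piMr ?le_max ?lexx//.
apply: powRN_le1; first by rewrite lerDl sqr_ge0.
by have := lth_le l; lra.
Qed.

Lemma score_neg_ge0 eta e P : 0 < eta -> 0 <= score_neg eta e P.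
Proof. by move=> e0; rewrite /score_neg mulr_ge0 ?(ltW (weight_gt0 e0))// le_max lexx. Qed.

Lemma score_ge0 eta e P Pi F : 0 <= score eta e P Pi F.
Proof. by rewrite /score !le_max score_lin_ge0. Qed.

Lemma score_neg_shift e : 1 <= outer_shift k + -1 * Num.min e (noise_max k).
Proof.
have : Num.min e (noise_max k) <= noise_max k by rewrite ge_min lexx orbT.
by rewrite /outer_shift => h; lra.
Qed.

Lemma score_neg_ge eta e P : 0 < eta ->
  weight eta * (1 - ot o * (eta ^+ 2 * P ^+ 2)) <= score_neg eta e P.
Proof.
move=> e0; rewrite /score_neg ler_pM2l ?weight_gt0// le_max.
by rewrite (outer_ge o 1 eta P (score_neg_shift e)) orbT.
Qed.

Lemma score_neg_le eta e P : 0 < eta ->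
  score_neg eta e P <= weight eta * Num.max 0 (3 - ot o * (eta ^+ 2 * P ^+ 2)).
Proof.
move=> e0; rewrite /score_neg ler_pM2l ?weight_gt0//.
have := outer_le o 1 eta P (score_neg_shift e).
have -> : 1 + 2 = 3 :> R by lra.
by rewrite ge_max => h; rewrite !le_max lexx h orbT.
Qed.

Lemma score_pos_le eta e P : 0 < eta ->
  score_pos eta e P <= weight eta * Num.max 0 (8 - ot o * (eta ^+ 2 * P ^+ 2)).
Proof.
move=> e0; rewrite /score_pos; case: ifP => [e1|_]; last first.
  by rewrite mulr_ge0 ?(ltW (weight_gt0 e0))// le_max lexx.
rewrite ler_pM2l ?weight_gt0//.
have sh : 1 <= outer_shift k + 1 * e.
  by have := outer_shift_ge2 k; lra.
have := outer_le o 6 eta P sh.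
have -> : 6 + 2 = 8 :> R by lra.
by rewrite ge_max => h; rewrite !le_max lexx h orbT.
Qed.

Lemma score_pos_ge_neg eta e P : 0 < eta -> 1 <= e -> score_neg eta e P <= score_pos eta e P.
Proof.
move=> e0 e1; apply: le_trans (score_neg_le _ _ e0) _.
rewrite /score_pos e1 ler_pM2l ?weight_gt0//.
have sh : 1 <= outer_shift k + 1 * e.
  by have := outer_shift_ge2 k; lra.
have := outer_ge o 6 eta P sh; rewrite ge_max => h.
by rewrite !le_max lexx/=; apply/orP; right; lra.
Qed.

(** If [ot * q >= 8] the outer scores vanish. Otherwise [eta * P] is bounded, the correction in the
    form is at most 1/32 by the choice of [lth], and the form is at least [1/8 - 1/16 - 1/32];
    moreover [1 + P^2 = O(eta^(-2))], which produces the power of [eta] in [weight]. *)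
Lemma score_lin_dominates eta e P Pi : 0 < eta -> eta <= 1 -> 0 <= P -> `|Pi| <= kX k * P ->
  - (1 / 16) <= e -> e <= mid_edge ->
  score_neg eta e P <= score_lin l eta e P Pi /\ score_pos eta e P <= score_lin l eta e P Pi.
Proof.
move=> e0 e1 P0 PiP el eh.
have w0 := weight_gt0 e0; have t0 := ot_gt0 o.
set q := eta ^+ 2 * P ^+ 2.
have q0 : 0 <= q by rewrite mulr_ge0 ?sqr_ge0.
suff h : weight eta * Num.max 0 (8 - ot o * q) <= score_lin l eta e P Pi.
  split; apply: le_trans h; last exact: score_pos_le.
  apply: le_trans (score_neg_le _ _ e0) _; rewrite ler_pM2l// ge_max !le_max lexx/=.
  by apply/orP; right; rewrite lerD2r; lra.
have [q8|q8] := leP 8 (ot o * q).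
  by rewrite max_l ?subr_le0// mulr0 score_lin_ge0.
have qle : q <= 8 / ot o by rewrite ler_pdivlMr// mulrC ltW.
have xm0 := noise_max_ge0 k.
have th0 := lth_gt0 l; have K0 := lK_gt0 l; have b0 := lb_gt0 l; have kX0 := kX_ge0 k.
have t8 : 0 <= 8 / ot o by rewrite divr_ge0// ltW.
have pe : eta * P <= 8 / ot o + 1.
  have h1 : (eta * P) ^+ 2 <= 8 / ot o by rewrite exprMn.
  by have h2 := sqr_ge0 (eta * P - 1 / 2); clear -h1 h2; lra.
have p0 : 0 <= eta * P by rewrite mulr_ge0// ltW.
have ysmall : e ^+ 2 + lb l * (eta * Pi) + lK l * (eta * P) ^+ 2 <=
   mid_edge ^+ 2 + lb l * (kX k * (8 / ot o + 1)) + lK l * (8 / ot o + 1) ^+ 2.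
  apply: lerD; first apply: lerD.
  - rewrite -[e ^+ 2]real_normK ?num_real// ler_sqr ?nnegrE ?normr_ge0//; last first.
      by rewrite /mid_edge mulr_ge0// addr_ge0.
    by rewrite ler_norml eh andbT /mid_edge; clear -el xm0; lra.
  - rewrite ler_pM2l//.
    have : Pi <= kX k * P by apply: le_trans PiP; exact: ler_norm.
    move=> h; apply: (@le_trans _ _ (eta * (kX k * P))); first by rewrite ler_pM2l.
    by rewrite mulrCA ler_wpM2l.
  - by rewrite ler_pM2l// ler_sqr ?nnegrE ?addr_ge0.
have y32 : 1 / 32 <= lin_form l eta e P Pi.
  rewrite /lin_form.
  have := ler_wpM2l (ltW th0) ysmall.
  by move=> h; have h2 := lth_mid; clear -h h2 el; lra.
have Xb : (1 + P ^+ 2) * eta ^+ 2 <= 1 + 8 / ot o.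
  rewrite mulrDl mul1r; apply: lerD; last by rewrite mulrC.
  by rewrite expr_le1// ltW.
have oz8 := oz_small; have oz0 := oz_gt0 o.
have r0 : 0 <= 1 / 2 - oz o by clear -oz8; lra.
have Xp : 0 < 1 + P ^+ 2 by rewrite ltr_pwDl// sqr_ge0.
have e2p : 0 < eta ^+ 2 by rewrite exprn_gt0.
have sc := powRN_scale Xp e2p r0 Xb.
rewrite /score_lin -oz_lth.
have e2r : (eta ^+ 2) `^ (1 / 2 - oz o) = eta `^ (1 - 2 * oz o).
  by rewrite -powR_mulrn ?(ltW e0)// -powRrM; congr (_ `^ _); field.
rewrite e2r in sc.
apply: (@le_trans _ _ (1 / 32 * ((1 + 8 / ot o) `^ (- (1 / 2 - oz o)) * eta `^ (1 - 2 * oz o)))).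
  rewrite /weight.
  have m8 : Num.max 0 (8 - ot o * q) <= 8.
    by rewrite ge_max gerBl mulr_ge0// ?(ltW t0)// andbT.
  have ez0 := powR_ge0 eta (1 - 2 * oz o).
  apply: (@le_trans _ _ (glue_const o * eta `^ (1 - 2 * oz o) * 8)).
    apply: ler_pM => //; first by rewrite mulr_ge0// ltW// ep_gt0.
      by rewrite le_max lexx.
    by rewrite ler_wpM2r// ep_le.
  by rewrite /glue_const; set u := _ `^ (- _); lra.
apply: ler_pM => //; first by rewrite mulr_ge0 ?powR_ge0.
by rewrite le_max y32 orbT.
Qed.

End Cost.

(** * Decrease of the cost in one step *)

Section CostStep.
Variables (R : realType) (n : nat) (k : storm_consts R) (c : cost_consts k).
Local Notation o := (co c).
Local Notation l := (cl c).
Local Notation vt := (cvt c).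

(** The offset 1/4 of the quartic score exceeds the 1/8 of the form, so positivity of the form gives
    [1/4 + e >= 3/32]. For bounded [P] the quartic score is then bounded below relative to the form,
    and the factor [cM] does the rest. *)
Lemma score_quart_dominates eta e P Pi F : 0 < eta -> eta <= 1 -> 0 <= P -> P <= cP c ->
  `|Pi| <= kX k * P -> 0 <= F -> F <= kF k ->
  score_lin l eta e P Pi <= cM c * score_quart k eta e P F.
Proof.
move=> e0 e1 P0 PP PiP F0 F1.
have a0 := ka_gt0 k; have c0 := cM_gt0 c; have th1 := lth_le l.
have V0 := quart_scale_gt0 k P e0 F0.
have SM0 : 0 <= score_quart k eta e P F.
  by rewrite /score_quart divr_ge0 ?exprn_ge0 ?le_max ?lexx// ltW.
apply: le_trans (score_lin_le_y _ _ _ _ _) _.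
rewrite ge_max mulr_ge0 ?(ltW c0)//=.
have [y0|y0] := leP (lin_form l eta e P Pi) 0.
  by apply: le_trans y0 _; rewrite mulr_ge0// ltW.
have yl := lin_form_le l e e0 P0 PiP.
have e2 : 0 <= lth l * e ^+ 2 by rewrite mulr_ge0 ?sqr_ge0// ltW// lth_gt0.
set s := 1 / 4 + e.
have sy : lin_form l eta e P Pi + 3 / 32 <= s by rewrite /s; clear -yl e2 th1; lra.
have s0 : 0 < s by clear -sy y0; lra.
rewrite /score_quart max_r ?(ltW s0)// -/s.
set Vm := ka k * cP c ^+ 2 + kF k + ka k.
have VVm : quart_scale k eta P F <= Vm.
  rewrite /quart_scale /Vm.
  have h1 : ka k * P ^+ 2 <= ka k * cP c ^+ 2.
    by rewrite ler_pM2l// ler_sqr ?nnegrE// cP_ge0.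
  have h2 : eta * F <= 1 * kF k by apply: ler_pM => //; exact: ltW.
  by clear -h1 h2 a0; lra.
have V30 : 0 < quart_scale k eta P F ^+ 3 by rewrite exprn_gt0.
rewrite mulrA ler_pdivlMr//.
have V3 : quart_scale k eta P F ^+ 3 <= Vm ^+ 3.
  by rewrite lerXn2r ?nnegrE ?(ltW V0)// (le_trans (ltW V0)).
have Vm0 : 0 <= Vm by exact: le_trans (ltW V0) VVm.
have u1 : (32 / 3) ^+ 3 * s ^+ 3 >= 1.
  rewrite -exprMn exprn_ege1//; clear -sy y0; lra.
apply: (@le_trans _ _ (s * Vm ^+ 3)).
  apply: ler_pM => //; rewrite ?(ltW y0) ?exprn_ge0 ?(ltW V0)//.
  by clear -sy; lra.
apply: (@le_trans _ _ (Vm ^+ 3 * (32 / 3) ^+ 3 * s ^+ 4)); last first.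
  by rewrite ler_wpM2r ?exprn_ge0 ?(ltW s0)//; exact: cM_ge.
have -> : Vm ^+ 3 * (32 / 3) ^+ 3 * s ^+ 4 = s * Vm ^+ 3 * ((32 / 3) ^+ 3 * s ^+ 3) by ring.
by rewrite ler_peMr// mulr_ge0 ?exprn_ge0// ltW.
Qed.

(** For the quartic score, the numerator is [O(1 + P^4)], hence [O(V^2)] for the denominator base
    [V = quart_scale], which is itself bounded below. *)
Lemma score_bounded : exists2 Sm : R, 0 < Sm &
  forall eta e P Pi F, 0 < eta -> eta <= 1 -> 0 <= P -> `|e| <= P ->
    `|Pi| <= kX k * P -> 0 <= F -> score c eta e P Pi F <= Sm.
Proof.
have a0 := ka_gt0 k; have c0 := cM_gt0 c; have th0 := lth_gt0 l; have ep0 := ep_gt0 c.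
set v := ka k / 50 / 64.
have v0 : 0 < v by rewrite /v !divr_gt0.
set C1 := (ka k)^-1 + v^-1.
have ai : 0 < (ka k)^-1 by rewrite invr_gt0.
have vi : 0 < v^-1 by rewrite invr_gt0.
have C10 : 0 < C1 by rewrite /C1 addr_gt0.
have [M M1 MP] := upper_const [:: (lth l)^-1; cM c * (4 * C1 ^+ 2 / v); 8 * cep c].
exists M; first by apply: lt_le_trans M1.
move=> eta e P Pi F e0 e1 P0 eP PiP F0.
have w1 := weight_le_ep c e0 e1; have w0 := weight_gt0 c e0; have t0 := ot_gt0 o.
have m8 Y : Y <= 8 -> Num.max 0 (Y - ot o * (eta ^+ 2 * P ^+ 2)) <= 8.
  move=> Y8; rewrite ge_max ler0n/=.
  have h : 0 <= ot o * (eta ^+ 2 * P ^+ 2).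
    by rewrite mulr_ge0 ?(ltW t0)// mulr_ge0 ?sqr_ge0.
  by clear -h Y8; lra.
have w8 Y : Y <= 8 -> weight c eta * Num.max 0 (Y - ot o * (eta ^+ 2 * P ^+ 2)) <= M.
  move=> Y8; apply: (@le_trans _ _ (8 * cep c)); last by apply: MP; rewrite !inE eqxx ?orbT.
  rewrite mulrC; apply: ler_pM => //; rewrite ?(ltW w0) ?le_max ?lexx//.
  exact: m8.
rewrite /score !ge_max; apply/andP; split; apply/andP; split.
- apply: le_trans (score_lin_le_y _ _ _ _ _) _; rewrite ge_max (le_trans _ M1)//=.
  apply: (@le_trans _ _ (lth l)^-1); first exact: lin_form_le_th.
  by apply: MP; rewrite !inE eqxx ?orbT.
- apply: (@le_trans _ _ (cM c * (4 * C1 ^+ 2 / v))); last by apply: MP; rewrite !inE eqxx ?orbT.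
  rewrite ler_pM2l//.
  have V0 := quart_scale_gt0 k P e0 F0.
  rewrite /score_quart; set V := quart_scale k eta P F in V0 *.
  set s := Num.max 0 (1 / 4 + e).
  have s0 : 0 <= s by rewrite le_max lexx.
  have vV : v <= V by rewrite /V /quart_scale -/v lerDr addr_ge0 ?mulr_ge0 ?sqr_ge0// ltW.
  have aV : ka k * P ^+ 2 <= V.
    by rewrite /V /quart_scale -/v -addrA lerDl addr_ge0 ?mulr_ge0// ltW.
  have sP : s <= 1 / 4 + P.
    rewrite /s ge_max addr_ge0//= lerD2l; exact: le_trans (ler_norm e) eP.
  have P2 : P ^+ 2 <= (ka k)^-1 * V.
    by rewrite ler_pdivlMl.
  have one : 1 <= v^-1 * V.
    by rewrite ler_pdivlMl// mulr1.
  have s2 : s ^+ 2 <= 2 * (C1 * V).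
    have h : s ^+ 2 <= (1 / 4 + P) ^+ 2 by rewrite ler_sqr ?nnegrE// addr_ge0.
    by rewrite /C1; have h2 := sqr_ge0 (P - 1 / 4); clear -h h2 P2 one; lra.
  have s4 : s ^+ 4 <= 4 * C1 ^+ 2 * V ^+ 2.
    have -> : 4 * C1 ^+ 2 * V ^+ 2 = (2 * (C1 * V)) ^+ 2 by ring.
    rewrite -[4%N]/(2 * 2)%N exprM ler_sqr ?nnegrE ?sqr_ge0//.
    by rewrite mulr_ge0// mulr_ge0// ltW.
  rewrite ler_pdivrMr ?exprn_gt0//; apply: le_trans s4 _.
  have -> : 4 * C1 ^+ 2 / v * V ^+ 3 = 4 * C1 ^+ 2 * V ^+ 2 * (V / v) by ring.
  rewrite ler_peMr//; first by rewrite mulr_ge0 ?sqr_ge0// mulr_ge0 ?sqr_ge0.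
  by rewrite ler_pdivlMr// mul1r.
- apply: le_trans (score_neg_le _ _ _ e0) _; apply: w8; lra.
- by apply: le_trans (score_pos_le _ _ _ e0) _; apply: w8.
Qed.

Lemma penalty_avg_le eta eta' e P Pi F (e' P' Pi' xi : 'I_n -> R) F' D dpi :
  storm_step k eta eta' e P Pi F e' P' Pi' xi F' D dpi ->
  kc k * eta ^+ 2 <= 1 / 2 -> eta <= 1 ->
  avg (fun i => penalty c eta' (P' i)) <= penalty c eta P + weight c eta * vt *
   (eta ^+ 2 * (kL k * kD k ^+ 2 + kC k) - kc k * eta ^+ 2 * (eta ^+ 2 * P ^+ 2)).
Proof.
move=> st be2 e1.
have eta'0 := ss_eta'_gt0 st; have eta'le := ss_eta'_le st.
have eta0 : 0 < eta by exact: lt_le_trans eta'le.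
have w0 := weight_gt0 c eta0; have v0 := vt_gt0 c.
have w'0 := weight_gt0 c eta'0; have w' := weight_le c eta'0 eta'le.
have D2 : D ^+ 2 <= kD k ^+ 2.
  by rewrite ler_sqr ?nnegrE ?(ss_D_ge0 st) ?kD_ge0//; exact: (ss_D_le st).
apply: (@le_trans _ _ (avg (fun i => weight c eta * vt * eta ^+ 2 * P' i ^+ 2))).
  apply: avg_le => i; rewrite /penalty.
  have -> : weight c eta * vt * eta ^+ 2 * P' i ^+ 2 = weight c eta * (vt * (eta ^+ 2 * P' i ^+ 2)).
    by ring.
  apply: ler_pM => //; rewrite ?(ltW w'0)//.
    by rewrite mulr_ge0 ?(ltW v0)// mulr_ge0 ?sqr_ge0.
  by rewrite ler_pM2l// ler_wpM2r ?sqr_ge0// ler_sqr ?nnegrE// ltW.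
rewrite avgZ (ss_avg_P st) /penalty.
have N_le := ss_noise st; set N := avg _ in N_le *.
set be := kc k * eta ^+ 2 in be2 *.
have be0 : 0 <= be by rewrite mulr_ge0 ?sqr_ge0// ltW// kc_gt0.
have h1 : kL k * D ^+ 2 <= kL k * kD k ^+ 2 by rewrite ler_pM2l// kL_gt0.
have h2 : kC k * eta ^+ 4 <= kC k * 1.
  by rewrite ler_wpM2l ?kC_ge0// expr_le1// ltW.
have h3 : (1 - be) ^+ 2 * P ^+ 2 <= (1 - be) * P ^+ 2.
  rewrite ler_wpM2r ?sqr_ge0// expr2 ler_piMr//; clear -be0 be2; lra.
have h4 : (1 - be) ^+ 2 * P ^+ 2 + N <= (1 - be) * P ^+ 2 + (kL k * kD k ^+ 2 + kC k).
  by clear -h1 h2 h3 N_le; lra.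
have h5 : weight c eta * vt * eta ^+ 2 * ((1 - be) ^+ 2 * P ^+ 2 + N) <=
  weight c eta * vt * eta ^+ 2 * ((1 - be) * P ^+ 2 + (kL k * kD k ^+ 2 + kC k)).
  by rewrite ler_wpM2l// mulr_ge0 ?sqr_ge0// mulr_ge0 ?ltW.
by clear -h5; lra.
Qed.

(** Either [q >= 1 / (2 ot)], and the contraction of the penalty beats its noise; or [q] is smaller,
    and then [score_neg] forces [S >= weight / 2], so that the relative growth of [S] becomes an
    absolute gain, half of which covers the noise of the penalty. *)
Lemma cost_step_submartingale eta eta' e P Pi F (e' P' Pi' xi : 'I_n -> R) F' D dpi :
  storm_step k eta eta' e P Pi F e' P' Pi' xi F' D dpi ->
  kc k * eta ^+ 2 <= 1 / 2 -> eta <= 1 ->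
  let S := score c eta e P Pi F in let q := eta ^+ 2 * P ^+ 2 in
  let be := kc k * eta ^+ 2 in
  let T := avg (fun i => penalty c eta' (P' i) - score c eta' (e' i) (P' i) (Pi' i) F') in
  (1 + lth l / 32 * be) * S <= avg (fun i => score c eta' (e' i) (P' i) (Pi' i) F') ->
  T <= penalty c eta P - S - Num.min (lth l / 32 / 4) (vt / (4 * ot o)) * (weight c eta * be) /\
  ((2 * ot o)^-1 <= q -> T <= penalty c eta P - S - weight c eta * vt * be * q / 2).
Proof.
move=> st be2 e1 S q be T Sge.
have eta'0 := ss_eta'_gt0 st; have eta'le := ss_eta'_le st.
have eta0 : 0 < eta by exact: lt_le_trans eta'le.
have w0 := weight_gt0 c eta0; have v0 := vt_gt0 c; have t0 := ot_gt0 o.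
have th0 := lth_gt0 l.
have W_le := penalty_avg_le st be2 e1.
set Nm := kL k * kD k ^+ 2 + kC k in W_le.
have Nm0 : 0 <= Nm by rewrite /Nm addr_ge0 ?kC_ge0// mulr_ge0 ?sqr_ge0// ltW// kL_gt0.
have be0 : 0 <= be by rewrite mulr_ge0 ?sqr_ge0// ltW// kc_gt0.
have S0 : 0 <= S by exact: score_ge0.
have q0 : 0 <= q by rewrite mulr_ge0 ?sqr_ge0.
have T_le : T <= penalty c eta P + weight c eta * vt * (eta ^+ 2 * Nm - be * q) -
    (1 + lth l / 32 * be) * S.
  by rewrite /T avgB; rewrite -/be -/q in W_le; clear -W_le Sge; lra.
have gS0 : 0 <= lth l / 32 * be * S.
  by rewrite mulr_ge0// mulr_ge0// divr_ge0// ltW.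
have big : (2 * ot o)^-1 <= q -> T <= penalty c eta P - S - weight c eta * vt * be * q / 2.
  move=> qg.
  have h1 : 2 * Nm <= kc k * q.
    have h2 := ot_W o; rewrite -/Nm in h2.
    have h3 : kc k * (2 * ot o)^-1 <= kc k * q by rewrite ler_pM2l// kc_gt0.
    apply: le_trans h3; rewrite ler_pdivlMr ?mulr_gt0//.
    by clear -h2; lra.
  have h2 : eta ^+ 2 * (2 * Nm) <= eta ^+ 2 * (kc k * q) by rewrite ler_wpM2l ?sqr_ge0.
  have h3 : weight c eta * vt * (eta ^+ 2 * (2 * Nm)) <= weight c eta * vt * (be * q).
    have u : eta ^+ 2 * (2 * Nm) <= be * q by rewrite /be; clear -h2; lra.
    by apply: ler_wpM2l u; rewrite mulr_ge0// ltW.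
  by clear -h3 T_le gS0; lra.
split=> //.
have [qs|qg] := ltP q (2 * ot o)^-1; last first.
  apply: le_trans (big qg) _.
  have h0 : 0 <= weight c eta * be by rewrite mulr_ge0// ltW.
  have h1 : Num.min (lth l / 32 / 4) (vt / (4 * ot o)) <= vt / (4 * ot o).
    by rewrite ge_min lexx orbT.
  have h2 : vt / (4 * ot o) <= vt * q / 2.
    have -> : vt / (4 * ot o) = vt / 2 * (2 * ot o)^-1 by field; rewrite gt_eqF.
    have -> : vt * q / 2 = vt / 2 * q by ring.
    by rewrite ler_wpM2l// divr_ge0// ltW.
  have h3 := ler_wpM2r h0 (le_trans h1 h2).
  by clear -h3; lra.
have Sw : weight c eta / 2 <= S.
  apply: (@le_trans _ _ (score_neg c eta e P)); last by rewrite /S /score !le_max lexx orbT.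
  apply: le_trans (score_neg_ge c e P eta0); rewrite ler_pM2l//.
  have h : ot o * q < ot o * (2 * ot o)^-1 by rewrite ltr_pM2l.
  have ee : ot o * (2 * ot o)^-1 = 1 / 2 by field; rewrite gt_eqF.
  by rewrite ee in h; rewrite -/q; clear -h; lra.
have h1 : lth l / 32 * be * (weight c eta / 2) <= lth l / 32 * be * S.
  by rewrite ler_wpM2l// mulr_ge0// divr_ge0// ltW.
have h2 : weight c eta * eta ^+ 2 * (vt * Nm) <=
    weight c eta * eta ^+ 2 * (lth l / 32 * kc k / 4).
  by rewrite ler_wpM2l ?(vt_small c)// mulr_ge0 ?sqr_ge0// ltW.
have h3 : 0 <= weight c eta * vt * (be * q).
  by apply: mulr_ge0; apply: mulr_ge0 => //; exact: ltW.
have h4 : Num.min (lth l / 32 / 4) (vt / (4 * ot o)) <= lth l / 32 / 4.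
  by rewrite ge_min lexx.
have h5 : 0 <= weight c eta * be by rewrite mulr_ge0// ltW.
have h6 := ler_wpM2r h5 h4.
rewrite /be in T_le h1 h3 h5 h6 *.
by clear -T_le h1 h2 h3 h6; lra.
Qed.

End CostStep.

Section CostDecrease.
Variables (R : realType) (n : nat) (k : storm_consts R) (c : cost_consts k).
Local Notation o := (co c).
Local Notation l := (cl c).
Local Notation vt := (cvt c).

(** The estimate for [outer] is at fixed weight. Passing from [weight eta'] to [weight eta] costs
    [O(weight * eta^3)], at most half of the gain since [eta] is small relative to [eta^oz]. *)
Lemma cost_step_outer c6 eta eta' e P Pi F (e' P' Pi' xi : 'I_n -> R) F' D dpi sg Y :
  storm_step k eta eta' e P Pi F e' P' Pi' xi F' D dpi ->
  eta <= 1 -> 0 < c6 -> `|sg| = 1 -> Y <= 6 -> 1 <= outer_shift k + sg * e ->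
  2 * kT k * (8 + c6) / c6 * eta <= eta `^ oz o ->
  kT k * eta ^+ 3 <= 1 ->
  0 < outer o Y sg eta e P ->
  avg (fun i => vt * (eta' ^+ 2 * P' i ^+ 2) - outer o Y sg eta' (e' i) (P' i)) <=
    vt * (eta ^+ 2 * P ^+ 2) - outer o Y sg eta e P - c6 * (eta ^+ 2 * eta `^ oz o) ->
  score c eta e P Pi F = weight c eta * outer o Y sg eta e P ->
  (forall i, weight c eta' * outer o Y sg eta' (e' i) (P' i) <=
     score c eta' (e' i) (P' i) (Pi' i) F') ->
  avg (fun i => penalty c eta' (P' i) - score c eta' (e' i) (P' i) (Pi' i) F') <=
  penalty c eta P - score c eta e P Pi F - c6 / 2 * (weight c eta * (eta ^+ 2 * eta `^ oz o)).
Proof.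
move=> st e1 c60 sg1 Y6 sh small t3 G0 key SE Sge.
have eta'0 := ss_eta'_gt0 st; have eta'le := ss_eta'_le st.
have eta0 : 0 < eta by exact: lt_le_trans eta'le.
have w0 := weight_gt0 c eta0; have v0 := vt_gt0 c; have t0 := ot_gt0 o.
have w'0 := weight_gt0 c eta'0; have w'le := weight_le c eta'0 eta'le.
have kT0 := kT_ge0 k.
set q := eta ^+ 2 * P ^+ 2 in key *; set G := outer _ _ _ _ _ _ in G0 key SE *.
have q0 : 0 <= q by rewrite mulr_ge0 ?sqr_ge0.
set ez := eta `^ oz o in small key *.
have ez0 : 0 <= ez by exact: powR_ge0.
have ez1 : ez <= 1.
  apply: (@le_trans _ _ (1 `^ oz o)); last by rewrite powR1.
  by rewrite ge0_ler_powR ?nnegrE ?(ltW eta0)// ltW// oz_gt0.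
have e2 : eta ^+ 2 <= 1 by rewrite expr_le1// ltW.
have slow := weight_slow c eta'0 eta'le _ (ss_eta_slow st).
have {}slow := slow (mulr_ge0 kT0 (exprn_ge0 _ (ltW eta0))).
set gain := c6 * (eta ^+ 2 * ez) in key.
have gain1 : gain <= c6.
  by rewrite /gain ler_piMr ?(ltW c60)// mulr_ile1// sqr_ge0.
have gain0 : 0 <= gain by rewrite /gain mulr_ge0 ?(ltW c60)// mulr_ge0 ?sqr_ge0.
have G8 : G <= 8.
  have h := outer_le o Y eta P sh.
  have h2 : 0 <= ot o * q by rewrite mulr_ge0// ltW.
  by rewrite /G; rewrite -/q in h; clear -h h2 Y6; lra.
have T1 : avg (fun i => penalty c eta' (P' i) - score c eta' (e' i) (P' i) (Pi' i) F') <=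
    weight c eta' * (vt * q - G - gain).
  have h := ler_wpM2l (ltW w'0) key; apply: le_trans h.
  rewrite -avgZ; apply: avg_le => i.
  by rewrite /penalty mulrBr lerD2l lerN2.
apply: le_trans T1 _.
have d1 : (weight c eta - weight c eta') * (G + gain - vt * q) <=
   weight c eta * (kT k * eta ^+ 3) * (8 + c6).
  apply: (@le_trans _ _ ((weight c eta - weight c eta') * (8 + c6))).
    have vq : 0 <= vt * q by rewrite mulr_ge0// ltW.
    by rewrite ler_wpM2l ?subr_ge0//; clear -vq G8 gain1; lra.
  by rewrite ler_wpM2r ?addr_ge0 ?(ltW c60)//; clear -slow; lra.
have s2 : 2 * kT k * (8 + c6) * eta <= c6 * ez.
  have : 2 * kT k * (8 + c6) * eta / c6 <= ez by rewrite mulrAC.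
  by rewrite ler_pdivrMr// [ez * c6]mulrC.
have d2 : weight c eta * eta ^+ 2 * (2 * kT k * (8 + c6) * eta) <=
    weight c eta * eta ^+ 2 * (c6 * ez).
  by rewrite ler_wpM2l// mulr_ge0 ?sqr_ge0// ltW.
rewrite SE /penalty -/q /gain; rewrite /gain in d1.
clear -d1 d2.
lra.
Qed.

(** Only the score attaining the maximum has to grow in mean, as the others can only raise the next
    maximum. If [ot * q >= 8] the outer scores vanish, so one of the remaining cases holds and the
    gain is proportional to [q]; this second bound is needed because the penalty is unbounded. *)
Lemma cost_decrease (MSL : R) : (0 < n)%N ->
  (forall eta eta' e P Pi F (e' P' Pi' xi : 'I_n -> R) F' D dpi,
    storm_step k eta eta' e P Pi F e' P' Pi' xi F' D dpi ->
    MSL * eta <= 1 -> cP c <= P ->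
    (1 + kc k * eta ^+ 2 * (lth l / 32)) * score_lin l eta e P Pi <=
    avg (fun i => score_lin l eta' (e' i) (P' i) (Pi' i))) ->
  exists M c7 : R, 0 < c7 /\
  forall eta eta' e P Pi F (e' P' Pi' xi : 'I_n -> R) F' D dpi,
  storm_step k eta eta' e P Pi F e' P' Pi' xi F' D dpi ->
  M * eta <= 1 -> 1 / 64 <= P ^+ 2 ->
  let T := avg (fun i => penalty c eta' (P' i) - score c eta' (e' i) (P' i) (Pi' i) F') in
  let S := score c eta e P Pi F in let q := eta ^+ 2 * P ^+ 2 in
  T <= penalty c eta P - S - c7 * (weight c eta * (eta ^+ 2 * eta `^ oz o)) /\
  (8 / ot o <= q -> T <= penalty c eta P - S - weight c eta * vt * (kc k * eta ^+ 2) * q / 2).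
Proof.
move=> n_gt0 hSL.
have [MSM hSM] := score_quart_submartingale k n_gt0.
have [MO [c6 [c60 hO]]] := outer_step o n_gt0.
have kc0 := kc_gt0 k; have th0 := lth_gt0 l; have th1 := lth_le l; have kT0 := kT_ge0 k.
have t0 := ot_gt0 o; have v0 := vt_gt0 c; have xm0 := noise_max_ge0 k.
set m := Num.min (lth l / 32 / 4) (vt / (4 * ot o)).
have m0 : 0 < m by rewrite /m lt_min !divr_gt0// mulr_gt0.
set Cs := 2 * kT k * (8 + c6) / c6.
have Cs0 : 0 <= Cs by rewrite /Cs divr_ge0 ?(ltW c60)// mulr_ge0 ?mulr_ge0// addr_ge0// ltW.
have [M1 M1ge M1P] := upper_const [:: MSL; MSM; MO; 2 * kc k; kT k; Cs ^+ 2].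
exists M1, (Num.min (m * kc k) (c6 / 2)); split.
  by rewrite lt_min mulr_gt0// divr_gt0.
move=> eta eta' e P Pi F e' P' Pi' xi F' D dpi st eta_le P_ge T S q.
have eta'0 := ss_eta'_gt0 st; have eta'le := ss_eta'_le st.
have eta0 : 0 < eta by exact: lt_le_trans eta'le.
have small C : C <= M1 -> C * eta <= 1.
  by move=> CM; apply: le_trans eta_le; rewrite ler_pM2r.
have e1 : eta <= 1 by rewrite -[eta]mul1r small.
have ee : eta ^+ 2 <= eta by rewrite expr2 ler_piMl// ltW.
have sSL : MSL * eta <= 1 by apply: small; apply: M1P; rewrite !inE eqxx ?orbT.
have sSM : MSM * eta <= 1 by apply: small; apply: M1P; rewrite !inE eqxx ?orbT.
have sO : MO * eta <= 1 by apply: small; apply: M1P; rewrite !inE eqxx ?orbT.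
have s1 : 2 * kc k * eta <= 1 by apply: small; apply: M1P; rewrite !inE eqxx ?orbT.
have s2 : kT k * eta <= 1 by apply: small; apply: M1P; rewrite !inE eqxx ?orbT.
have s3 : Cs ^+ 2 * eta <= 1 by apply: small; apply: M1P; rewrite !inE eqxx ?orbT.
have oz2 : oz o <= 1 / 2 by have := oz_small c; lra.
have s4 : Cs * eta <= eta `^ oz o by exact: powR_sqrt_small.
have s5 : kT k * eta ^+ 3 <= 1.
  apply: le_trans s2; rewrite ler_wpM2l// exprS ler_piMr ?(ltW eta0)//.
  exact: le_trans ee _.
set be := kc k * eta ^+ 2.
have be0 : 0 <= be by rewrite mulr_ge0 ?sqr_ge0// ltW.
have be2 : be <= 1 / 2.
  have : be <= kc k * eta by rewrite ler_pM2l.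
  by move=> h; clear -h s1; lra.
have P0 := ss_P_ge0 st; have PiP := ss_Pi_le st.
have F1 := ss_F_ge1 st; have F2 := ss_F_le st.
have F0 : 0 <= F by apply: le_trans F1.
have w0 := weight_gt0 c eta0; have w'0 := weight_gt0 c eta'0.
have q0 : 0 <= q by rewrite mulr_ge0 ?sqr_ge0.
have ez1 : eta `^ oz o <= 1.
  apply: (@le_trans _ _ (1 `^ oz o)); last by rewrite powR1.
  by rewrite ge0_ler_powR ?nnegrE ?(ltW eta0)// ltW// oz_gt0.
have we0 : 0 <= weight c eta * (eta ^+ 2 * eta `^ oz o).
  by apply: mulr_ge0; [exact: ltW|apply: mulr_ge0; [exact: sqr_ge0|exact: powR_ge0]].
have S0 : 0 <= S by exact: score_ge0.
have case_sub : (1 + lth l / 32 * be) * S <= avg (fun i => score c eta' (e' i) (P' i) (Pi' i) F') ->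
    T <= penalty c eta P - S - Num.min (m * kc k) (c6 / 2) * (weight c eta * (eta ^+ 2 * eta `^ oz o)) /\
    (8 / ot o <= q -> T <= penalty c eta P - S - weight c eta * vt * be * q / 2).
  move=> h; have [h1 h2] := cost_step_submartingale st be2 e1 h; split.
    apply: le_trans h1 _; rewrite lerD2l lerN2 -/m -/be.
    apply: (@le_trans _ _ (m * kc k * (weight c eta * (eta ^+ 2 * eta `^ oz o)))).
      by apply: (ler_wpM2r we0); rewrite ge_min lexx.
    have -> : m * kc k * (weight c eta * (eta ^+ 2 * eta `^ oz o)) =
      m * (weight c eta * be) * eta `^ oz o by rewrite /be; ring.
    rewrite ler_piMr//; apply: mulr_ge0; first exact: ltW.
    by apply: mulr_ge0 => //; exact: ltW.
  move=> qg; apply: h2; apply: le_trans qg.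
  rewrite -[(2 * ot o)^-1]mul1r ler_pdivrMr ?mulr_gt0//.
  have -> : 8 / ot o * (2 * ot o) = 16 by field; rewrite gt_eqF.
  by rewrite -subr_ge0; lra.
have case_outer sg Y : `|sg| = 1 -> Y <= 6 -> 1 / 16 <= sg * e ->
    0 < outer o Y sg eta e P -> S = weight c eta * outer o Y sg eta e P ->
    (forall i, weight c eta' * outer o Y sg eta' (e' i) (P' i) <=
       score c eta' (e' i) (P' i) (Pi' i) F') ->
    T <= penalty c eta P - S - Num.min (m * kc k) (c6 / 2) * (weight c eta * (eta ^+ 2 * eta `^ oz o)) /\
    (8 / ot o <= q -> T <= penalty c eta P - S - weight c eta * vt * be * q / 2).
  move=> sg1 Y6 sge G0 SE Sge.
  have sh : 1 <= outer_shift k + sg * e by have := outer_shift_ge2 k; lra.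
  have key := hO _ _ _ _ _ _ _ _ _ _ _ _ _ st sO sg Y vt sg1 Y6 sge G0 (ltW v0) (vt_le c).
  have res := cost_step_outer st e1 c60 sg1 Y6 sh s4 s5 G0 key SE Sge.
  split.
    apply: le_trans res _; rewrite lerD2l lerN2; apply: (ler_wpM2r we0).
    by rewrite ge_min lexx orbT.
  move=> qg; exfalso.
  have h := lt_le_trans G0 (outer_le o Y eta P sh).
  have : 8 <= ot o * q by rewrite mulrC -ler_pdivrMr.
  by rewrite /q; clear -h Y6; lra.
have score_quart_le i : cM c * score_quart k eta' (e' i) (P' i) F' <= score c eta' (e' i) (P' i) (Pi' i) F'.
  by rewrite /score !le_max lexx ?orbT.
have score_lin_le i : score_lin l eta' (e' i) (P' i) (Pi' i) <= score c eta' (e' i) (P' i) (Pi' i) F'.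
  by rewrite /score !le_max lexx ?orbT.
have thbe : 0 <= lth l / 32 * be by rewrite mulr_ge0// divr_ge0// ltW.
have subSM : S = cM c * score_quart k eta e P F ->
   (1 + lth l / 32 * be) * S <= avg (fun i => score c eta' (e' i) (P' i) (Pi' i) F').
  move=> SE; apply: (@le_trans _ _ (avg (fun i => cM c * score_quart k eta' (e' i) (P' i) F'))); last exact: avg_le.
  rewrite avgZ SE mulrCA ler_pM2l ?cM_gt0//.
  apply: le_trans (hSM _ _ _ _ _ _ _ _ _ _ _ _ _ st sSM P_ge).
  rewrite ler_wpM2r//; last first.
    rewrite lerD2l ler_wpM2r//; clear -th1; lra.
  by rewrite /score_quart divr_ge0 ?exprn_ge0 ?le_max ?lexx// ltW// quart_scale_gt0.
have subSL : cP c <= P -> S = score_lin l eta e P Pi ->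
   (1 + lth l / 32 * be) * S <= avg (fun i => score c eta' (e' i) (P' i) (Pi' i) F').
  move=> PP SE; apply: (@le_trans _ _ (avg (fun i => score_lin l eta' (e' i) (P' i) (Pi' i)))); last exact: avg_le.
  by rewrite SE [lth l / 32 * be]mulrC; apply: (hSL _ _ _ _ _ _ _ _ _ _ _ _ _ st).
have subSLM : S = Num.max (score_lin l eta e P Pi) (cM c * score_quart k eta e P F) ->
   (1 + lth l / 32 * be) * S <= avg (fun i => score c eta' (e' i) (P' i) (Pi' i) F').
  have [PP|PP] := leP P (cP c).
    by rewrite max_r ?score_quart_dominates.
  by rewrite /Num.max; case: ifP => _; [exact: subSM|apply: subSL; exact: ltW].
have sub0 : S = 0 ->
   (1 + lth l / 32 * be) * S <= avg (fun i => score c eta' (e' i) (P' i) (Pi' i) F').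
  by move=> ->; rewrite mulr0; apply: avg_ge0 => i; exact: score_ge0.
have e'_shift sg i : `|sg| = 1 -> 0 <= sg * e -> - noise_max k <= sg * e' i.
  by move=> sg1 sge; exact: (outer_step_shift i st e1 be2 sg1 sge).
have [e16|e16] := leP e (- (1 / 16)).
  have Spos0 : score_pos c eta e P = 0.
    by rewrite /score_pos ifF//; apply/negbTE; rewrite -ltNge; clear -e16; lra.
  have [hle|hlt] := leP (score_neg c eta e P) (Num.max (score_lin l eta e P Pi) (cM c * score_quart k eta e P F)).
    apply/case_sub/subSLM; rewrite /S /score Spos0 [X in Num.max _ X]max_l ?score_neg_ge0//.
    by rewrite max_l.
  have SE : S = score_neg c eta e P.
    by rewrite /S /score Spos0 [X in Num.max _ X]max_l ?score_neg_ge0// max_r// ltW.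
  have mine : Num.min e (noise_max k) = e by rewrite min_l//; clear -e16 xm0; lra.
  have [G0|G0] := leP (outer o 1 (-1) eta e P) 0.
    by apply/case_sub/sub0; rewrite SE /score_neg mine max_l// mulr0.
  apply: (case_outer (-1) 1) => //; rewrite ?normrN1//.
  - by rewrite ler1n.
  - by lra.
  - by rewrite SE /score_neg mine max_r// ltW.
  - move=> i; apply: (@le_trans _ _ (score_neg c eta' (e' i) (P' i))); last first.
      by rewrite /score !le_max lexx ?orbT.
    have := e'_shift (-1) i (normrN1 _) _; rewrite mulN1r oppr_ge0.
    have eneg : e <= 0 by clear -e16; lra.
    move=> /(_ eneg); rewrite mulN1r lerN2 => h.
    by rewrite /score_neg min_l// ler_pM2l// le_max lexx orbT.
have [eE|eE] := leP e (mid_edge k).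
  have [h1 h2] := score_lin_dominates c eta0 e1 P0 PiP (ltW e16) eE.
  apply/case_sub/subSLM; rewrite /S /score max_l//.
  by rewrite ge_max !le_max h1 h2.
have e1' : 1 <= e by move: eE; rewrite /mid_edge => eE; clear -eE xm0; lra.
have SnSp := score_pos_ge_neg c P eta0 e1'.
have [hle|hlt] := leP (score_pos c eta e P) (Num.max (score_lin l eta e P Pi) (cM c * score_quart k eta e P F)).
  apply/case_sub/subSLM; rewrite /S /score [X in Num.max _ X]max_r//.
  by rewrite max_l.
have SE : S = score_pos c eta e P.
  by rewrite /S /score [X in Num.max _ X]max_r// max_r// ltW.
have [G0|G0] := leP (outer o 6 1 eta e P) 0.
  by apply/case_sub/sub0; rewrite SE /score_pos e1' max_l// mulr0.
apply: (case_outer 1 6) => //; rewrite ?normr1//.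
- by rewrite mul1r; clear -e1'; lra.
- by rewrite SE /score_pos e1' max_r// ltW.
- move=> i; apply: (@le_trans _ _ (score_pos c eta' (e' i) (P' i))); last first.
    by rewrite /score !le_max lexx ?orbT.
  have e'1 : 1 <= e' i.
    have xil : xi i <= noise_max k.
      apply: le_trans (ss_xi_le st i) _; rewrite /noise_max ler_wpM2l ?kB_ge0//.
      by apply: lerD; [exact: (ss_D_le st)|exact: le_trans ee _].
    have /ler_normlP[h _] := ss_dev_e st i; rewrite -/be in h.
    have h2 : (1 - 1 / 2) * e <= (1 - be) * e.
      by rewrite ler_wpM2r ?lerB//; clear -e1'; lra.
    by move: eE; rewrite /mid_edge => eE; clear -h h2 xil eE; lra.
  by rewrite /score_pos e'1 ler_pM2l// le_max lexx orbT.
Qed.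

End CostDecrease.

(** * The Lyapunov function *)

Section Lyapunov.
Variables (R : realType) (n : nat) (k : storm_consts R) (c : cost_consts k).
Local Notation o := (co c).
Local Notation l := (cl c).
Local Notation vt := (cvt c).

(** With [2 * Sm] instead of [Sm] the value stays above [Sm], so that after division by [eta^2] it
    exceeds the squared energy for small [P]. *)
Definition deficit (Sm eta e P Pi F : R) : R :=
  2 * Sm - score c eta e P Pi F + penalty c eta P.

(** The factor is fitted to both comparisons with the squared energy. For [P^2 <= 1/64] one has
    [eta * energy <= ka / 32], while the deficit is at least [Sm]; for [P^2 >= 1/16] the deficit is
    at most [32^2 * Sm * P^4], while [eta * energy >= ka * P^2]. *)
Definition scaled_deficit (Sm eta e P Pi F : R) : R :=
  ka k ^+ 2 / (32 ^+ 2 * Sm) / eta ^+ 2 * deficit Sm eta e P Pi F.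

Definition lyapunov (Sm eta e P Pi F : R) : R :=
  Num.min (energy k eta P F ^+ 2) (scaled_deficit Sm eta e P Pi F).

Lemma deficit_le Sm eta e P Pi F : 0 < eta -> 0 <= F ->
  deficit Sm eta e P Pi F <= 2 * Sm + penalty c eta P.
Proof. by move=> e0 F0; rewrite /deficit lerD2r gerBl; exact: score_ge0. Qed.

Lemma penalty_ge0 eta P : 0 < eta -> 0 <= penalty c eta P.
Proof.
move=> e0; rewrite /penalty; have w0 := weight_gt0 c e0; have v0 := vt_gt0 c.
by apply: mulr_ge0; [exact: ltW|rewrite mulr_ge0 ?(ltW v0)// mulr_ge0 ?sqr_ge0].
Qed.

Lemma energy_sq_le_deficit Sm eta e P Pi F : 0 < Sm -> 0 < eta -> 0 <= F -> F <= kF k ->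
  score c eta e P Pi F <= Sm -> P ^+ 2 <= 1 / 64 -> eta * kF k <= ka k / 64 ->
  energy k eta P F ^+ 2 <= scaled_deficit Sm eta e P Pi F.
Proof.
move=> Sm0 e0 F0 FF SS P2 small; have a0 := ka_gt0 k.
have W0 := penalty_ge0 P e0.
have J0 : Sm <= deficit Sm eta e P Pi F by rewrite /deficit; lra.
have e20 : 0 < eta ^+ 2 by rewrite exprn_gt0.
have ie20 : 0 < (eta ^+ 2)^-1 by rewrite invr_gt0.
have h1 : eta * F + ka k * P ^+ 2 <= ka k / 32.
  have u1 : eta * F <= eta * kF k by rewrite ler_pM2l.
  have u2 : ka k * P ^+ 2 <= ka k * (1 / 64) by rewrite ler_pM2l.
  by lra.
have h0 : 0 <= eta * F + ka k * P ^+ 2.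
  by rewrite addr_ge0// mulr_ge0 ?sqr_ge0// ltW.
have -> : energy k eta P F ^+ 2 = (eta * F + ka k * P ^+ 2) ^+ 2 / eta ^+ 2.
  by rewrite /energy; field; rewrite gt_eqF.
apply: (@le_trans _ _ ((ka k / 32) ^+ 2 / eta ^+ 2)).
  by rewrite ler_pM2r// ler_sqr ?nnegrE// divr_ge0// ltW.
have -> : (ka k / 32) ^+ 2 / eta ^+ 2 = ka k ^+ 2 / (32 ^+ 2 * Sm) / eta ^+ 2 * Sm.
  by field; rewrite !gt_eqF.
by rewrite /scaled_deficit ler_wpM2l// ?divr_ge0 ?sqr_ge0// mulr_ge0 ?sqr_ge0// ltW.
Qed.

Lemma scaled_deficit_le_energy_sq Sm eta e P Pi F : 0 < Sm -> 0 < eta -> eta <= 1 -> 0 <= F ->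
  1 / 16 <= P ^+ 2 -> cep c * vt * eta ^+ 2 <= 32 * Sm ->
  scaled_deficit Sm eta e P Pi F <= energy k eta P F ^+ 2.
Proof.
move=> Sm0 e0 e1 F0 P2 small; have a0 := ka_gt0 k.
have e20 : 0 < eta ^+ 2 by rewrite exprn_gt0.
have ie20 : 0 < (eta ^+ 2)^-1 by rewrite invr_gt0.
have v0 := vt_gt0 c; have w1 := weight_le_ep c e0 e1.
have J1 : deficit Sm eta e P Pi F <= 2 * Sm + cep c * vt * eta ^+ 2 * P ^+ 2.
  apply: le_trans (deficit_le _ _ _ _ e0 F0) _; rewrite lerD2l /penalty.
  have -> : cep c * vt * eta ^+ 2 * P ^+ 2 = cep c * (vt * (eta ^+ 2 * P ^+ 2)) by ring.
  by rewrite ler_wpM2r// mulr_ge0 ?(ltW v0)// mulr_ge0 ?sqr_ge0.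
have P4 : 1 / 16 * P ^+ 2 <= P ^+ 2 * P ^+ 2 by rewrite ler_wpM2r ?sqr_ge0.
have J2 : deficit Sm eta e P Pi F <= 32 ^+ 2 * Sm * (P ^+ 2) ^+ 2.
  apply: le_trans J1 _.
  have u1 : cep c * vt * eta ^+ 2 * P ^+ 2 <= 32 * Sm * P ^+ 2 by rewrite ler_wpM2r ?sqr_ge0.
  have Sm32 : 0 <= 16 * (32 * Sm) by rewrite mulr_ge0// mulr_ge0// ltW.
  have u2 := ler_wpM2l Sm32 P4.
  have h : 1 / 16 * (1 / 16) <= P ^+ 2 * P ^+ 2 by apply: ler_pM.
  have u3 := ler_wpM2l Sm32 h.
  by rewrite [_ ^+ 2 ^+ 2]expr2; clear -u1 u2 u3; lra.
apply: (@le_trans _ _ ((ka k * P ^+ 2) ^+ 2 / eta ^+ 2)).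
  rewrite /scaled_deficit.
  have -> : (ka k * P ^+ 2) ^+ 2 / eta ^+ 2 =
    ka k ^+ 2 / (32 ^+ 2 * Sm) / eta ^+ 2 * (32 ^+ 2 * Sm * (P ^+ 2) ^+ 2).
    by field; rewrite !gt_eqF.
  by rewrite ler_wpM2l// !divr_ge0 ?sqr_ge0// mulr_ge0 ?sqr_ge0// ltW.
rewrite -expr_div_n /energy ler_sqr ?nnegrE.
- by rewrite lerDr.
- by rewrite divr_ge0 ?(ltW e0)// mulr_ge0 ?sqr_ge0// ltW.
- by rewrite addr_ge0// divr_ge0 ?(ltW e0)// mulr_ge0 ?sqr_ge0// ltW.
Qed.

Lemma inv_sq_slow (eta eta' t : R) : 0 < eta' -> eta <= eta' * (1 + t) -> 0 < eta ->
  0 <= t -> t <= 1 -> (eta' ^+ 2)^-1 <= (eta ^+ 2)^-1 * (1 + 3 * t).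
Proof.
move=> e'0 slow e0 t0 t1.
have e2 : 0 < eta ^+ 2 by rewrite exprn_gt0.
have e'2 : 0 < eta' ^+ 2 by rewrite exprn_gt0.
rewrite mulrC ler_pdivlMr// mulrC ler_pdivrMr//.
have h1 : eta ^+ 2 <= (eta' * (1 + t)) ^+ 2.
  by rewrite ler_sqr ?nnegrE// ?(ltW e0)// mulr_ge0 ?addr_ge0// ltW.
apply: le_trans h1 _.
have -> : (eta' * (1 + t)) ^+ 2 = (1 + 2 * t + t * t) * eta' ^+ 2 by ring.
rewrite ler_wpM2r ?(ltW e'2)//.
have : t * t <= t by rewrite ler_piMl.
by lra.
Qed.

(** The factor [1 / eta^2] grows by at most [1 + 3 t] with [t = kT * eta^3]. While [q] is bounded so
    is the deficit, and a gain of order [eta^(3 - oz)] dominates [t]; for large [q] the deficit is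
    unbounded through the penalty, and the gain proportional to [q] keeps pace with it. *)
Lemma scaled_deficit_supermartingale (MSL Sm : R) : (0 < n)%N -> 0 < Sm ->
  (forall eta e P Pi F, 0 < eta -> eta <= 1 -> 0 <= P -> `|e| <= P ->
    `|Pi| <= kX k * P -> 0 <= F -> score c eta e P Pi F <= Sm) ->
  (forall eta eta' e P Pi F (e' P' Pi' xi : 'I_n -> R) F' D dpi,
    storm_step k eta eta' e P Pi F e' P' Pi' xi F' D dpi ->
    MSL * eta <= 1 -> cP c <= P ->
    (1 + kc k * eta ^+ 2 * (lth l / 32)) * score_lin l eta e P Pi <=
    avg (fun i => score_lin l eta' (e' i) (P' i) (Pi' i))) ->
  exists M kap : R, 0 < kap /\
  forall eta eta' e P Pi F (e' P' Pi' xi : 'I_n -> R) F' D dpi,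
  storm_step k eta eta' e P Pi F e' P' Pi' xi F' D dpi ->
  (forall i, `|Pi' i| <= kX k * P' i) ->
  M * eta <= 1 -> 1 / 64 <= P ^+ 2 ->
  avg (fun i => scaled_deficit Sm eta' (e' i) (P' i) (Pi' i) F') <=
  scaled_deficit Sm eta e P Pi F - kap * eta.
Proof.
move=> n_gt0 Sm0 hSm hSL.
have [MD [c7 [c70 hD]]] := cost_decrease n_gt0 hSL.
have kc0 := kc_gt0 k; have kT0 := kT_ge0 k; have a0 := ka_gt0 k.
have t0 := ot_gt0 o; have v0 := vt_gt0 c; have ep0 := ep_gt0 c; have z0 := oz_gt0 o.
set Jm := 2 * Sm + 8 * cep c.
have Jm0 : 0 < Jm by rewrite /Jm; lra.
set Cz := 12 * kT k * Jm / (c7 * cep c).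
have Cz0 : 0 <= Cz.
  by rewrite /Cz divr_ge0 ?mulr_ge0// ltW.
have [Mz Mz0 hz] := powR_small Cz0 z0.
set Mq := ka k ^+ 2 / (32 ^+ 2 * Sm).
have Mq0 : 0 < Mq by rewrite /Mq divr_gt0 ?mulr_gt0 ?exprn_gt0.
have [M1 M1ge M1P] := upper_const [:: MD; Mz; 12 * kT k / kc k; kT k].
exists M1, (Mq * (c7 * cep c / 4)); split.
  by apply: mulr_gt0 => //; rewrite divr_gt0// mulr_gt0.
move=> eta eta' e P Pi F e' P' Pi' xi F' D dpi st PiP' eta_le P_ge.
have eta'0 := ss_eta'_gt0 st; have eta'le := ss_eta'_le st.
have eta0 : 0 < eta by exact: lt_le_trans eta'le.
have small C : C <= M1 -> C * eta <= 1.
  by move=> CM; apply: le_trans eta_le; rewrite ler_pM2r.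
have e1 : eta <= 1 by rewrite -[eta]mul1r small.
have ee : eta ^+ 2 <= eta by rewrite expr2 ler_piMl// ltW.
have sD : MD * eta <= 1 by apply: small; apply: M1P; rewrite !inE eqxx ?orbT.
have sz : Mz * eta <= 1 by apply: small; apply: M1P; rewrite !inE eqxx ?orbT.
have s2 : kT k * eta <= 1 by apply: small; apply: M1P; rewrite !inE eqxx ?orbT.
have s3 : 12 * kT k * eta <= kc k.
  have : 12 * kT k / kc k * eta <= 1 by apply: small; apply: M1P; rewrite !inE eqxx ?orbT.
  by rewrite mulrAC ler_pdivrMr// mul1r.
have s4 : Cz * eta `^ oz o <= 1 by exact: hz.
set ez := eta `^ oz o in s4.
have ez0 : 0 < ez by rewrite /ez powR_gt0.
have e20 : 0 < eta ^+ 2 by rewrite exprn_gt0.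
set t := kT k * eta ^+ 3.
have t_ge0 : 0 <= t by rewrite mulr_ge0// exprn_ge0// ltW.
have t_le1 : t <= 1.
  apply: le_trans s2; rewrite /t ler_wpM2l// exprS ler_piMr ?(ltW eta0)//.
  exact: le_trans ee _.
have [T1 T2] := hD _ _ _ _ _ _ _ _ _ _ _ _ _ st sD P_ge.
set S := score c eta e P Pi F in T1 T2 *; set q := eta ^+ 2 * P ^+ 2 in T1 T2 *.
set T := avg _ in T1 T2.
have q0 : 0 <= q by rewrite mulr_ge0 ?sqr_ge0.
have P0 := ss_P_ge0 st.
have F1 := ss_F_ge1 st; have F'1 := ss_F'_ge1 st.
have F0 : 0 <= F by apply: le_trans F1.
have F'0 : 0 <= F' by apply: le_trans F'1.
pose w := weight c eta.
have w0 : 0 < w by exact: weight_gt0.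
have w1 : w <= cep c by exact: weight_le_ep.
(* The exponents add up to [(1 - 2 oz) + 2 oz = 1]. Thus [w * eta^2 * ez] equals [cep * eta^3 / ez],
   which exceeds [eta^3] by the factor [1 / ez], large for small [eta]. *)
have wE : w * ez ^+ 2 = cep c * eta.
  rewrite /w /weight -mulrA; congr (_ * _).
  rewrite /ez -powR_mulrn ?powR_ge0// -powRrM -powRD; last by rewrite (gt_eqF eta0) implybT.
  have -> : 1 - 2 * oz o + oz o * 2%:R = 1 by ring.
  by rewrite powRr1// ltW.
have avgJ : avg (fun i => deficit Sm eta' (e' i) (P' i) (Pi' i) F') = 2 * Sm + T.
  rewrite /T -[2 * Sm in RHS](@avg_cst _ n)// -avgD; apply: eq_avg => i.
  by rewrite /deficit; ring.
have avgJ0 : 0 <= avg (fun i => deficit Sm eta' (e' i) (P' i) (Pi' i) F').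
  apply: avg_ge0 => i; rewrite /deficit.
  have h1 := penalty_ge0 (P' i) eta'0.
  have h2 := hSm eta' (e' i) (P' i) (Pi' i) F' eta'0 (le_trans eta'le e1)
    (ss_P'_ge0 st i) (ss_e'_le st i) (PiP' i) F'0.
  by clear -h1 h2 Sm0; lra.
pose J := deficit Sm eta e P Pi F.
pose g := c7 * (w * (eta ^+ 2 * ez)).
have g0 : 0 < g by rewrite /g; do 3!apply: mulr_gt0 => //.
have J_S : J = 2 * Sm - S + penalty c eta P by [].
have cz : 12 * t * Jm <= g.
  have h1 : 12 * kT k * Jm * ez <= c7 * cep c.
    have : 12 * kT k * Jm * ez / (c7 * cep c) <= 1 by rewrite mulrAC.
    by rewrite ler_pdivrMr ?mulr_gt0// mul1r.
  have h2 := ler_wpM2r (ltW eta0) h1.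
  rewrite -(ler_pM2r ez0) /g /t.
  have -> : c7 * (w * (eta ^+ 2 * ez)) * ez = c7 * eta ^+ 2 * (w * ez ^+ 2) by ring.
  rewrite wE.
  have h3 := ler_wpM2r (ltW e20) h2.
  by clear -h3; lra.
have main : (1 + 3 * t) * (2 * Sm + T) <= J - g / 4.
  have Wle : penalty c eta P = w * vt * q by rewrite /penalty -/w -/q; ring.
  have tS : 0 <= t * S by rewrite mulr_ge0//; exact: score_ge0.
  have tg : 0 <= t * g by rewrite mulr_ge0// ltW.
  have wv0 : 0 <= w * vt by rewrite mulr_ge0// ltW.
  have TJ : 2 * Sm + T <= J - g by rewrite J_S; rewrite -/w -/ez -/g in T1; clear -T1; lra.
  have [qs|qg] := leP (8 / ot o) q.
    have T3 := T2 qs; rewrite -/w in T3.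
    have TJ2 : 2 * Sm + T <= J - w * vt * (kc k * eta ^+ 2) * q / 2.
      by rewrite J_S; clear -T3; lra.
    (* Averaging the two bounds on [T] keeps half of each gain: [g] pays for the bounded part of the
       deficit, the term in [q] for the penalty. *)
    have u1 : (1 + 3 * t) * (2 * Sm + T) <=
        (1 + 3 * t) * (J - g / 2 - w * vt * (kc k * eta ^+ 2) * q / 4).
      rewrite ler_wpM2l//; last by clear -TJ TJ2; lra.
      by clear -t_ge0; lra.
    apply: le_trans u1 _.
    have u2 : t * (w * vt * q) * 12 <= kc k * eta ^+ 2 * (w * vt * q).
      have h := ler_wpM2r (mulr_ge0 (ltW e20) (mulr_ge0 wv0 q0)) s3.
      by rewrite /t; clear -h; lra.
    have u3 : 0 <= t * (w * vt * (kc k * eta ^+ 2) * q).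
      apply: mulr_ge0 => //; apply: mulr_ge0 => //; apply: mulr_ge0 => //.
      by rewrite mulr_ge0 ?sqr_ge0// ltW.
    have u4 : 2 * (t * Sm) <= t * Jm by rewrite /Jm; have := mulr_ge0 t_ge0 (ltW ep0); clear; lra.
    rewrite J_S Wle; clear -u2 u3 u4 cz tS tg; lra.
  have Jle : J <= Jm.
    rewrite J_S /Jm Wle.
    have h : w * vt * q <= cep c * 8.
      have vq : vt * q <= 8.
        apply: (@le_trans _ _ (ot o * (8 / ot o))); last by rewrite mulrC divfK// gt_eqF.
        by rewrite ler_pM ?(ltW v0) ?q0 ?vt_le ?(ltW qg).
      have vq0 : 0 <= vt * q by rewrite mulr_ge0// ltW.
      by rewrite -mulrA; apply: (ler_pM (ltW w0) vq0 w1 vq).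
    have S0 : 0 <= S by exact: score_ge0.
    by clear -h S0; lra.
  have u1 : (1 + 3 * t) * (2 * Sm + T) <= (1 + 3 * t) * (J - g).
    by rewrite ler_wpM2l//; clear -t_ge0; lra.
  have u2 : t * J <= t * Jm by rewrite ler_wpM2l.
  by clear -u1 u2 cz tg g0; lra.
rewrite /scaled_deficit -/Mq.
have -> : avg (fun i => Mq / eta' ^+ 2 * deficit Sm eta' (e' i) (P' i) (Pi' i) F') =
   Mq * ((eta' ^+ 2)^-1 * (2 * Sm + T)) by rewrite avgZ avgJ -mulrA.
have slow := ss_eta_slow st; rewrite -/t in slow.
have isl := inv_sq_slow eta'0 slow eta0 t_ge0 t_le1.
have ge : cep c * eta <= w * ez.
  rewrite -wE ler_pM2l// expr2 ler_piMl ?(ltW ez0)//.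
  apply: (@le_trans _ _ (1 `^ oz o)); last by rewrite powR1.
  by rewrite ge0_ler_powR ?nnegrE ?(ltW eta0)// ltW.
rewrite avgJ in avgJ0.
have f1 : (eta' ^+ 2)^-1 * (2 * Sm + T) <= (eta ^+ 2)^-1 * (J - g / 4).
  apply: (@le_trans _ _ ((eta ^+ 2)^-1 * (1 + 3 * t) * (2 * Sm + T))).
    by rewrite ler_wpM2r.
  by rewrite -mulrA ler_pM2l ?invr_gt0.
have f2 := ler_wpM2l (ltW Mq0) f1.
have gE : Mq * ((eta ^+ 2)^-1 * (J - g / 4)) = Mq / eta ^+ 2 * J - Mq * (c7 * (w * ez)) / 4.
  by rewrite /g; field; rewrite gt_eqF.
rewrite gE in f2; apply: le_trans f2 _; rewrite -/J lerD2l lerN2.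
have f3 : Mq * c7 * (cep c * eta) <= Mq * c7 * (w * ez).
  by rewrite ler_wpM2l// mulr_ge0// ltW.
by clear -f3; lra.
Qed.

(** Up to a constant factor, a bound for the squared distance of 0 to the subdifferential at the
    next iterate. With inaccurate estimates only boundedness is available, hence the value 1. *)
Definition Dist (eta P D : R) : R :=
  if P ^+ 2 <= 1 / 16 then D ^+ 2 / eta ^+ 2 + P ^+ 2 else 1.

Lemma lyapunov_supermartingale (MSL : R) : (0 < n)%N ->
  (forall eta eta' e P Pi F (e' P' Pi' xi : 'I_n -> R) F' D dpi,
    storm_step k eta eta' e P Pi F e' P' Pi' xi F' D dpi ->
    MSL * eta <= 1 -> cP c <= P ->
    (1 + kc k * eta ^+ 2 * (lth l / 32)) * score_lin l eta e P Pi <=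
    avg (fun i => score_lin l eta' (e' i) (P' i) (Pi' i))) ->
  exists Sm M kap C : R, [/\ 0 < kap, 0 <= C,
  forall eta e P Pi F, 0 < eta -> eta <= 1 -> 0 <= P -> `|e| <= P ->
    `|Pi| <= kX k * P -> 0 <= F -> 0 <= lyapunov Sm eta e P Pi F &
  forall eta eta' e P Pi F (e' P' Pi' xi : 'I_n -> R) F' D dpi,
  storm_step k eta eta' e P Pi F e' P' Pi' xi F' D dpi ->
  (forall i, `|Pi' i| <= kX k * P' i) -> M * eta <= 1 ->
  avg (fun i => lyapunov Sm eta' (e' i) (P' i) (Pi' i) F') <=
  lyapunov Sm eta e P Pi F - kap * eta * Dist eta P D + C * eta ^+ 3].
Proof.
move=> n_gt0 hSL.
have [Sm Sm0 hSm] := score_bounded c.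
have [MU [kU [kU0 hU]]] := scaled_deficit_supermartingale n_gt0 Sm0 hSm hSL.
have [MV [CV hV]] := energy_sq_supermartingale k n_gt0.
have a0 := ka_gt0 k; have kF1 := kF_ge1 k; have kZ0 := kZ_ge0 k.
have v0 := vt_gt0 c; have ep0 := ep_gt0 c.
set C := Num.max CV 0.
have CVC : CV <= C by rewrite le_max lexx.
have C0 : 0 <= C by rewrite le_max lexx orbT.
set DZ := kZ k ^+ 2 + 1.
have DZ1 : 1 <= DZ by rewrite /DZ lerDr sqr_ge0.
(* Where the two ranges overlap [Dist] can reach [kZ^2 + 1] instead of 1, and the gain [kU * eta]
   has to cover that too. *)
set kap := Num.min (2 / 5) (kU / DZ).
have kap0 : 0 < kap by rewrite /kap lt_min !divr_gt0// (lt_le_trans ltr01).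
have kap1 : kap <= 2 / 5 by rewrite /kap ge_min lexx.
have kap2 : kap * DZ <= kU.
  by rewrite -ler_pdivlMr ?(lt_le_trans ltr01)// /kap ge_min lexx orbT.
have [M1 M1ge M1P] := upper_const [:: MU; MV; 64 * kF k / ka k; cep c * vt / (32 * Sm)].
exists Sm, M1, kap, C; split=> //.
  move=> eta e P Pi F e0 e1 P0 eP PiP F0; rewrite /lyapunov le_min sqr_ge0/= /scaled_deficit.
  rewrite mulr_ge0//.
    by rewrite !divr_ge0 ?sqr_ge0// mulr_ge0 ?sqr_ge0// ltW.
  rewrite /deficit; have h1 := penalty_ge0 P e0; have h2 := hSm _ _ _ _ _ e0 e1 P0 eP PiP F0.
  by clear -h1 h2 Sm0; lra.
move=> eta eta' e P Pi F e' P' Pi' xi F' D dpi st PiP' eta_le.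
have eta'0 := ss_eta'_gt0 st; have eta'le := ss_eta'_le st.
have eta0 : 0 < eta by exact: lt_le_trans eta'le.
have small K : K <= M1 -> K * eta <= 1.
  by move=> CM; apply: le_trans eta_le; rewrite ler_pM2r.
have e1 : eta <= 1 by rewrite -[eta]mul1r small.
have ee : eta ^+ 2 <= eta by rewrite expr2 ler_piMl// ltW.
have sU : MU * eta <= 1 by apply: small; apply: M1P; rewrite !inE eqxx ?orbT.
have sV : MV * eta <= 1 by apply: small; apply: M1P; rewrite !inE eqxx ?orbT.
have s2 : eta * kF k <= ka k / 64.
  have : 64 * kF k / ka k * eta <= 1 by apply: small; apply: M1P; rewrite !inE eqxx ?orbT.
  by rewrite mulrAC ler_pdivrMr// mul1r => h; clear -h; lra.
have s3 : cep c * vt * eta ^+ 2 <= 32 * Sm.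
  have : cep c * vt / (32 * Sm) * eta <= 1 by apply: small; apply: M1P; rewrite !inE eqxx ?orbT.
  rewrite mulrAC ler_pdivrMr ?mulr_gt0// mul1r; apply: le_trans.
  by rewrite ler_wpM2l// mulr_ge0// ltW.
have F1 := ss_F_ge1 st; have F0 : 0 <= F by apply: le_trans F1.
have P0 := ss_P_ge0 st; have D0 := ss_D_ge0 st.
have S_le := hSm _ _ _ _ _ eta0 e1 P0 (ss_e_le st) (ss_Pi_le st) F0.
have e20 : 0 < eta ^+ 2 by rewrite exprn_gt0.
have Ce0 : 0 <= C * eta ^+ 3 by rewrite mulr_ge0// exprn_ge0// ltW.
have DistDZ : Dist eta P D <= DZ.
  rewrite /Dist; case: ifP => [P2|_]; last exact: DZ1.
  apply: lerD; last by apply: le_trans P2 _; lra.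
  rewrite ler_pdivrMr// -exprMn ler_sqr ?nnegrE ?mulr_ge0 ?(ltW eta0)//.
  exact: (ss_near st).
have Ustep : 1 / 64 <= P ^+ 2 ->
  avg (fun i => lyapunov Sm eta' (e' i) (P' i) (Pi' i) F') <=
  scaled_deficit Sm eta e P Pi F - kap * eta * Dist eta P D + C * eta ^+ 3.
  move=> P2.
  apply: (@le_trans _ _ (avg (fun i => scaled_deficit Sm eta' (e' i) (P' i) (Pi' i) F'))).
    by apply: avg_le => i; rewrite /lyapunov ge_min lexx orbT.
  apply: le_trans (hU _ _ _ _ _ _ _ _ _ _ _ _ _ st PiP' sU P2) _.
  have h1 : kap * eta * Dist eta P D <= kap * eta * DZ.
    by rewrite ler_wpM2l// mulr_ge0// ltW.
  have h2 := ler_wpM2r (ltW eta0) kap2.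
  by clear -h1 h2 Ce0; lra.
have Vstep : P ^+ 2 <= 1 / 16 ->
  avg (fun i => lyapunov Sm eta' (e' i) (P' i) (Pi' i) F') <=
  energy k eta P F ^+ 2 - kap * eta * Dist eta P D + C * eta ^+ 3.
  move=> P2.
  apply: (@le_trans _ _ (avg (fun i => energy k eta' (P' i) F' ^+ 2))).
    by apply: avg_le => i; rewrite /lyapunov ge_min lexx.
  apply: le_trans (hV _ _ _ _ _ _ _ _ _ _ _ _ _ st sV P2) _.
  rewrite /Dist P2.
  have h1 : CV * eta ^+ 3 <= C * eta ^+ 3 by rewrite ler_wpM2r// exprn_ge0// ltW.
  have h2 : kap * eta * (D ^+ 2 / eta ^+ 2 + P ^+ 2) <= 2 / 5 * eta * (D ^+ 2 / eta ^+ 2 + P ^+ 2).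
    by rewrite ler_wpM2r ?addr_ge0 ?divr_ge0 ?sqr_ge0// ler_wpM2r// ltW.
  have h3 : 2 / 5 * eta * (D ^+ 2 / eta ^+ 2 + P ^+ 2) =
     2 / 5 * (D ^+ 2 / eta) + 2 / 5 * (eta * P ^+ 2) by field; rewrite gt_eqF.
  have h4 : 0 <= eta * P ^+ 2 by rewrite mulr_ge0 ?sqr_ge0// ltW.
  by clear -h1 h2 h3 h4; lra.
have [P64|P64] := leP (P ^+ 2) (1 / 64).
  rewrite {2}/lyapunov min_l; last exact: energy_sq_le_deficit (ss_F_le st) S_le P64 s2.
  by apply: Vstep; apply: le_trans P64 _; lra.
have [P16|P16] := leP (P ^+ 2) (1 / 16).
  rewrite {2}/lyapunov; case: (leP (energy k eta P F ^+ 2) (scaled_deficit Sm eta e P Pi F)) => _.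
    exact: Vstep.
  by apply: Ustep; exact: ltW.
rewrite {2}/lyapunov min_r; last by apply: scaled_deficit_le_energy_sq => //; exact: ltW.
by apply: Ustep; exact: ltW.
Qed.

End Lyapunov.

(** * Choice of the constants *)

Lemma small_factor (R : realType) (X Y : R) : 0 <= X -> 0 < Y ->
  exists2 t0 : R, 0 < t0 & forall t, 0 <= t -> t <= t0 -> t * X <= Y.
Proof.
move=> X0 Y0; have X1 : 0 < X + 1 by rewrite ltr_wpDl.
exists (Y / (X + 1)) => [|t t0]; first by rewrite divr_gt0.
rewrite ler_pdivlMr// mulrDr mulr1 => h; apply: le_trans h.
by rewrite lerDl.
Qed.

Lemma cost_consts_exist (R : realType) (n : nat) (k : storm_consts R) : (0 < n)%N ->
  96 * kL k * kE k <= kc k * kp k -> 72 * kL k * kS k <= kc k ->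
  exists (c : cost_consts k) (MSL : R),
    forall eta eta' e P Pi F (e' P' Pi' xi : 'I_n -> R) F' D dpi,
    storm_step k eta eta' e P Pi F e' P' Pi' xi F' D dpi ->
    MSL * eta <= 1 -> cP c <= P ->
    (1 + kc k * eta ^+ 2 * (lth (cl c) / 32)) * score_lin (cl c) eta e P Pi <=
    avg (fun i => score_lin (cl c) eta' (e' i) (P' i) (Pi' i)).
Proof.
move=> n_gt0 hE hS.
have kc0 := kc_gt0 k; have kL0 := kL_gt0 k; have kp0 := kp_gt0 k; have kC0 := kC_ge0 k.
have kX0 := kX_ge0 k; have kG0 := kG_ge0 k; have kD20 := sqr_ge0 (kD k).
have a0 := ka_gt0 k; have kF1 := kF_ge1 k.
have sh2 : 2 <= outer_shift k by rewrite /outer_shift lerDr noise_max_ge0.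
have sh0 : 0 <= outer_shift k by apply: le_trans sh2.
have far0 : 0 <= outer_far k by rewrite /outer_far le_max sh0 orbT.
have slope0 : 0 < outer_slope k.
  by rewrite /outer_slope divr_gt0// ltr_wpDl// divr_gt0.
have X10 : 0 <= 2 * kL k * kD k ^+ 2 * (outer_shift k + outer_far k).
  apply: mulr_ge0; last exact: addr_ge0.
  by apply: mulr_ge0 => //; apply: mulr_ge0 => //; exact: ltW.
have X20 : 0 <= 4 * (kL k * kD k ^+ 2 + kC k).
  by apply: mulr_ge0 => //; apply: addr_ge0 => //; apply: mulr_ge0 => //; exact: ltW.
have [t1 t1p t1P] := small_factor X10 (mulr_gt0 kc0 slope0).
have [t2 t2p t2P] := small_factor X20 kc0.
pose ot0 := Num.min 1 (Num.min t1 t2).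
have ot_gt0 : 0 < ot0 by rewrite /ot0 !lt_min ltr01 t1p.
have ot_1 : ot0 <= 1 by rewrite /ot0 ge_min lexx.
have ot_t1 : ot0 <= t1 by rewrite /ot0 !ge_min lexx orbT.
have ot_t2 : ot0 <= t2 by rewrite /ot0 !ge_min lexx !orbT.
(* The smallest value allowed by [lb_kp]; with it the condition [lb_kE] is exactly
   [96 * kL * kE <= kc * kp]. *)
pose b := 24 * kL k / kp k.
have b0 : 0 < b by rewrite /b divr_gt0// mulr_gt0.
pose K := b ^+ 2 * kX k ^+ 2 + 1.
have K0 : 0 < K by rewrite /K ltr_wpDl// mulr_ge0 ?sqr_ge0.
have X30 : 0 <= 3 + b * kG k / kc k.
  by apply: addr_ge0 => //; apply: divr_ge0; [apply: mulr_ge0 => //|]; exact: ltW.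
pose tt := 8 / ot0 + 1.
have tt0 : 0 <= tt by apply: addr_ge0 => //; apply: divr_ge0 => //; exact: ltW.
have X40 : 0 <= mid_edge k ^+ 2 + b * (kX k * tt) + K * tt ^+ 2.
  apply: addr_ge0; first apply: addr_ge0; first exact: sqr_ge0.
    by apply: mulr_ge0; [exact: ltW|exact: mulr_ge0].
  by apply: mulr_ge0; [exact: ltW|exact: sqr_ge0].
have p32 : 0 < 1 / 32 :> R by rewrite divr_gt0.
have [t3 t3p t3P] := small_factor X30 p32; have [t4 t4p t4P] := small_factor X40 p32.
pose th := Num.min (1 / 8) (Num.min t3 t4).
have th0 : 0 < th by rewrite /th !lt_min t3p t4p divr_gt0.
have th_8 : th <= 1 / 8 by rewrite /th ge_min lexx.
have th_t3 : th <= t3 by rewrite /th !ge_min lexx orbT.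
have th_t4 : th <= t4 by rewrite /th !ge_min lexx !orbT.
have oz0 : 0 < th / 64 by rewrite divr_gt0.
have oz1 : th / 64 <= 1 by clear -th_8; lra.
pose o := @OuterConsts R k ot0 (th / 64) ot_gt0 ot_1 oz0 oz1 hS (t1P _ (ltW ot_gt0) ot_t1)
  (t2P _ (ltW ot_gt0) ot_t2).
have b_kp : 24 * kL k <= b * kp k by rewrite /b divfK// gt_eqF.
have b_kE : b * kE k <= kc k / 4.
  by rewrite /b mulrAC ler_pdivrMr// -subr_ge0; clear -hE; lra.
have K_ge : b ^+ 2 * kX k ^+ 2 <= K by rewrite /K lerDl.
pose l := @LinearConsts R k b K th b0 b_kp b_kE K0 K_ge th0 th_8 (t3P _ (ltW th0) th_t3).
have [MSL [P0 hSL]] := score_lin_submartingale l n_gt0.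
have X50 : 0 <= kL k * kD k ^+ 2 + kC k by apply: addr_ge0 => //; apply: mulr_ge0 => //; exact: ltW.
have Y50 : 0 < th / 32 * kc k / 4.
  by apply: divr_gt0 => //; apply: mulr_gt0 => //; exact: divr_gt0.
have [t5 t5p t5P] := small_factor X50 Y50.
pose v := Num.min ot0 t5.
have v0 : 0 < v by rewrite /v lt_min ot_gt0.
have v_ot : v <= ot0 by rewrite /v ge_min lexx.
have v_t5 : v <= t5 by rewrite /v ge_min lexx orbT.
have ep0 : 0 < glue_const o.
  by rewrite /glue_const; apply: divr_gt0 => //; apply: powR_gt0; rewrite ltr_wpDr//; apply: divr_ge0 => //; exact: ltW.
pose PP := Num.max P0 0.
have PP0 : 0 <= PP by rewrite le_max lexx orbT.
have cM0 : 0 < (ka k * PP ^+ 2 + kF k + ka k) ^+ 3 * (32 / 3) ^+ 3.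
  rewrite mulr_gt0 ?exprn_gt0// ?divr_gt0//.
  rewrite ltr_wpDl// addr_ge0 ?(le_trans _ kF1)// mulr_ge0 ?sqr_ge0//; exact: ltW.
pose c := @CostConsts R k o l _ _ v PP erefl (t4P _ (ltW th0) th_t4) ep0 cM0 v0 v_ot
  (t5P _ (ltW v0) v_t5) (lexx _) PP0 (lexx _).
exists c, MSL => eta eta' e P Pi F e' P' Pi' xi F' D dpi st M1 P1.
apply: (hSL _ _ _ _ _ _ _ _ _ _ _ _ _ st M1).
by apply: le_trans P1; rewrite /= /PP le_max lexx.
Qed.

Theorem storm_lyapunov (R : realType) (n : nat) (k : storm_consts R) : (0 < n)%N ->
  96 * kL k * kE k <= kc k * kp k -> 72 * kL k * kS k <= kc k ->
  exists (lyapunov : R -> R -> R -> R -> R -> R) (M kap C : R), [/\ 0 < kap, 0 <= C,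
  forall eta e P Pi F, 0 < eta -> eta <= 1 -> 0 <= P -> `|e| <= P ->
    `|Pi| <= kX k * P -> 0 <= F -> 0 <= lyapunov eta e P Pi F &
  forall eta eta' e P Pi F (e' P' Pi' xi : 'I_n -> R) F' D dpi,
  storm_step k eta eta' e P Pi F e' P' Pi' xi F' D dpi ->
  (forall i, `|Pi' i| <= kX k * P' i) -> M * eta <= 1 ->
  avg (fun i => lyapunov eta' (e' i) (P' i) (Pi' i) F') <=
  lyapunov eta e P Pi F - kap * eta * Dist eta P D + C * eta ^+ 3].
Proof.
move=> n_gt0 hE hS.
have [c [MSL hSL]] := cost_consts_exist n_gt0 hE hS.
have [Sm [M [kap [C H]]]] := lyapunov_supermartingale n_gt0 hSL.
by exists (lyapunov c Sm), M, kap, C.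
Qed.

(** * Regularity of the losses and of the objective *)

Section Vectors.
Variables (R : realType) (d : nat).
Implicit Types (a b c : 'rV[R]_d) (x y z : 'rV[R]_d * R).

Lemma dotvC a b : dotv a b = dotv b a.
Proof. by apply: eq_bigr => j _; rewrite mulrC. Qed.

Lemma dotvDl a b c : dotv (a + b) c = dotv a c + dotv b c.
Proof. by rewrite -big_split; apply: eq_bigr => j _; rewrite mxE mulrDl. Qed.

Lemma dotvZl (t : R) a b : dotv (t *: a) b = t * dotv a b.
Proof. by rewrite mulr_sumr; apply: eq_bigr => j _; rewrite mxE mulrA. Qed.

Lemma dotvNl a b : dotv (- a) b = - dotv a b.
Proof. by rewrite -scaleN1r dotvZl mulN1r. Qed.

Lemma dotv_ge0 a : 0 <= dotv a a.
Proof. by apply: sumr_ge0 => j _; rewrite -expr2 sqr_ge0. Qed.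

Lemma dotv0l a : dotv 0 a = 0.
Proof. by rewrite -[0 in LHS](scale0r 0) dotvZl mul0r. Qed.

Definition scaleX (t : R) x : 'rV[R]_d * R := (t *: x.1, t * x.2).

Lemma dotXC x y : dotX x y = dotX y x.
Proof. by rewrite /dotX dotvC mulrC. Qed.

Lemma dotXDl x y z : dotX (x + y) z = dotX x z + dotX y z.
Proof. by rewrite /dotX dotvDl mulrDl addrACA. Qed.

Lemma dotXZl t x y : dotX (scaleX t x) y = t * dotX x y.
Proof. by rewrite /dotX dotvZl -mulrA -mulrDr. Qed.

Lemma scaleXN x : scaleX (-1) x = - x.
Proof. by rewrite /scaleX scaleN1r mulN1r. Qed.

Lemma dotXNl x y : dotX (- x) y = - dotX x y.
Proof. by rewrite -scaleXN dotXZl mulN1r. Qed.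

Lemma dotXBl x y z : dotX (x - y) z = dotX x z - dotX y z.
Proof. by rewrite dotXDl dotXNl. Qed.

Lemma dotXDr x y z : dotX z (x + y) = dotX z x + dotX z y.
Proof. by rewrite ![dotX z _]dotXC dotXDl. Qed.

Lemma dotXBr x y z : dotX z (x - y) = dotX z x - dotX z y.
Proof. by rewrite ![dotX z _]dotXC dotXBl. Qed.

Lemma dotXZr t x y : dotX x (scaleX t y) = t * dotX x y.
Proof. by rewrite dotXC dotXZl dotXC. Qed.

Lemma dotX0l x : dotX 0 x = 0.
Proof. by rewrite /dotX dotv0l mul0r addr0. Qed.

Lemma dotX_ge0 x : 0 <= dotX x x.
Proof. by rewrite /dotX addr_ge0 ?dotv_ge0// -expr2 sqr_ge0. Qed.

Lemma enormX_ge0 x : 0 <= enormX x.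
Proof. exact: sqrtr_ge0. Qed.

Lemma enormX_sq x : enormX x ^+ 2 = dotX x x.
Proof. by rewrite sqr_sqrtr// dotX_ge0. Qed.

Lemma enorm_ge0 a : 0 <= enorm a.
Proof. exact: sqrtr_ge0. Qed.

Lemma enorm_sq a : enorm a ^+ 2 = dotv a a.
Proof. by rewrite sqr_sqrtr// dotv_ge0. Qed.

Lemma dotX_eq0 x y : dotX y y = 0 -> dotX x y = 0.
Proof.
rewrite /dotX => /eqP; rewrite paddr_eq0 ?dotv_ge0// -?expr2 ?sqr_ge0// => /andP[h1].
rewrite sqrf_eq0 => /eqP ->; rewrite mulr0 addr0.
rewrite /dotv big1// => j _; move: h1.
rewrite /dotv psumr_eq0; last by move=> i _; rewrite -expr2 sqr_ge0.
by move=> /allP /(_ j); rewrite mem_index_enum -expr2 sqrf_eq0 => /(_ isT) /eqP ->; rewrite mulr0.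
Qed.

Lemma dotX_le x y : `|dotX x y| <= enormX x * enormX y.
Proof.
rewrite -ler_sqr ?nnegrE ?mulr_ge0 ?enormX_ge0// exprMn !enormX_sq real_normK ?num_real//.
have [/eqP y0|y0] := boolP (dotX y y == 0).
  by rewrite (dotX_eq0 x y0) y0 expr0n/= mulr0.
have yp : 0 < dotX y y by rewrite lt_def y0 dotX_ge0.
have := dotX_ge0 (scaleX (dotX y y) x - scaleX (dotX x y) y).
rewrite dotXBl !dotXBr !dotXZl !dotXZr (dotXC y x) => h.
rewrite -(ler_pM2l yp); clear -h; lra.
Qed.

Lemma dotX_le_norm x y : dotX x y <= enormX x * enormX y.
Proof. by apply: le_trans (dotX_le x y); exact: ler_norm. Qed.

Lemma enormXD x y : enormX (x + y) <= enormX x + enormX y.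
Proof.
rewrite -ler_sqr ?nnegrE ?addr_ge0 ?enormX_ge0// enormX_sq dotXDl !dotXDr.
have h := dotX_le_norm x y; have e1 := enormX_sq x; have e2 := enormX_sq y.
have e3 := dotXC y x; clear -h e1 e2 e3; lra.
Qed.

Lemma enormXZ t x : enormX (scaleX t x) = `|t| * enormX x.
Proof.
rewrite /enormX dotXZl dotXZr mulrA -expr2 sqrtrM ?sqr_ge0//.
by rewrite sqrtr_sqr.
Qed.

Lemma enormXN x : enormX (- x) = enormX x.
Proof. by rewrite -scaleXN enormXZ normrN1 mul1r. Qed.

Lemma enormXB x y : enormX (x - y) <= enormX x + enormX y.
Proof. by rewrite -(enormXN y); exact: enormXD. Qed.

Lemma enormXC x y : enormX (x - y) = enormX (y - x).
Proof. by rewrite -enormXN opprB. Qed.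

Lemma enormX_le x : enormX x <= enorm x.1 + `|x.2|.
Proof.
rewrite -ler_sqr ?nnegrE ?addr_ge0 ?enormX_ge0 ?enorm_ge0// enormX_sq.
rewrite sqrrD enorm_sq real_normK ?num_real// /dotX expr2 -expr2 -addrA lerD2l expr2 lerDr.
by rewrite mulrn_wge0// mulr_ge0 ?enorm_ge0.
Qed.

Lemma enorm_le_X x : enorm x.1 <= enormX x.
Proof. by rewrite ler_wsqrtr// /dotX lerDl -expr2 sqr_ge0. Qed.

Lemma norm2_le_X x : `|x.2| <= enormX x.
Proof. by rewrite -sqrtr_sqr ler_wsqrtr// /dotX expr2 lerDr dotv_ge0. Qed.

Lemma enorm_X a : enorm a = enormX (a, 0).
Proof. by rewrite /enorm /enormX /dotX/= mulr0 addr0. Qed.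

Lemma dotv_le a b : `|dotv a b| <= enorm a * enorm b.
Proof.
have -> : dotv a b = dotX (a, 0) (b, 0) by rewrite /dotX mulr0 addr0.
by rewrite !enorm_X; exact: dotX_le.
Qed.

Lemma enormD a b : enorm (a + b) <= enorm a + enorm b.
Proof.
rewrite !enorm_X; have := enormXD (a, 0) (b, 0).
by have -> : ((a, 0) + (b, 0) : 'rV[R]_d * R) = (a + b, 0) by congr pair; exact: addr0.
Qed.

Lemma enormZ t a : enorm (t *: a) = `|t| * enorm a.
Proof. by rewrite !enorm_X -enormXZ /scaleX mulr0. Qed.

End Vectors.

Record losses (R : realType) (d n : nat) := Losses {
  dW : set 'rV[R]_d;
  dl : 'I_n -> 'rV[R]_d -> R;
  dgl : 'I_n -> 'rV[R]_d -> 'rV[R]_d;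
  lam0 : R; rho : R; dR : R; dG : R; dC : R; dL : R;
  d_n : (0 < n)%N;
  dW_ne : dW !=set0;
  dW_cv : convex_set dW;
  d_grad : forall i, is_gradient (dl i) (dgl i);
  d_ge0 : forall i w, dW w -> 0 <= dl i w;
  lam0_gt0 : 0 < lam0; rho_gt0 : 0 < rho;
  d_R : forall w, dW w -> enorm w <= dR;
  d_G : forall i w, dW w -> enorm (dgl i w) <= dG;
  d_C : forall i w, dW w -> `|dl i w| <= dC;
  d_L : forall i w1 w2, dW w1 -> dW w2 ->
    enorm (dgl i w1 - dgl i w2) <= dL * enorm (w1 - w2) }.

Lemma segment_mvt (R : realType) (d : nat) (f : 'rV[R]_d -> R)
    (gf : 'rV[R]_d -> 'rV[R]_d) (a h : 'rV[R]_d) : is_gradient f gf ->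
  exists2 t : R, 0 <= t <= 1 & f (a + h) - f a = dotv (gf (a + t *: h)) h.
Proof.
move=> Hf; pose q := fun t : R => f (a + t *: h).
have dq t : is_derive (t : R^o) 1 (q : R^o -> R^o) (dotv (gf (a + t *: h)) h).
  have [df Df] := Hf (a + t *: h).
  (* The difference quotient of the restriction to the line is that of [f] in direction [h], so
     differentiability carries over without a chain rule. *)
  have qE : (fun k : R => k^-1 *: ((q \o shift t) (k *: (1 : R^o)) - q t : R^o)) =
      (fun k : R => k^-1 *: ((f \o shift (a + t *: h)) (k *: h) - f (a + t *: h) : R^o)).
    apply/funext => k /=; congr (_ *: (_ - _)).
    by rewrite /q /shift/= [k%:A]mulr1 scalerDl addrCA addrA.
  have dfh : derivable f (a + t *: h) h by exact: diff_derivable.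
  apply: DeriveDef.
    by move: dfh; rewrite /derivable -qE.
  have -> : 'D_1 (q : R^o -> R^o) t = 'D_h f (a + t *: h) by rewrite /derive -qE.
  by rewrite deriveE// Df.
have qc : {within `[0, 1], continuous q}.
  apply: derivable_within_continuous => t _.
  by case: (dq t).
have [t t01 E] := MVT_segment ler01 (fun t _ => dq t) qc.
exists t; first by move: t01; rewrite in_itv.
by move: E; rewrite /q scale1r scale0r addr0 subr0 mulr1.
Qed.

Section ScalarBounds.
Variable R : realType.
Implicit Types a b x y m u v C : R.

Lemma expR_lip (M x y : R) : x <= M -> y <= M ->
  `|expR y - expR x| <= expR M * `|y - x|.
Proof.
move=> xM yM; wlog xy : x y xM yM / x <= y => [h|].
  have [xy|/ltW xy] := leP x y; first exact: h.
  by rewrite distrC [`|y - x|]distrC; exact: h.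
rewrite !ger0_norm ?subr_ge0 ?ler_expR//.
have h := expR_ge1Dx (x - y).
have -> : expR y - expR x = expR y * (1 - expR (x - y)).
  by rewrite mulrBr mulr1 -expRD addrCA subrr addr0.
apply: ler_pM; rewrite ?expR_ge0 ?ler_expR//; last by clear -h; lra.
by rewrite subr_ge0 -expR0 ler_expR subr_le0.
Qed.

Lemma expR_quad (M x y : R) : x <= M -> y <= M ->
  `|expR y - expR x - expR x * (y - x)| <= expR M * (y - x) ^+ 2.
Proof.
move=> xM yM.
have h0 : 0 <= expR y - expR x - expR x * (y - x).
  have h := expR_ge1Dx (y - x).
  have -> : expR y - expR x - expR x * (y - x) = expR x * (expR (y - x) - (1 + (y - x))).
    by rewrite [RHS]mulrBr -expRD addrCA subrr addr0; ring.
  by rewrite mulr_ge0 ?expR_ge0// subr_ge0.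
rewrite ger0_norm//.
have h1 : expR y - expR x <= expR y * (y - x).
  have h := expR_ge1Dx (x - y).
  have -> : expR y - expR x = expR y * (1 - expR (x - y)).
    by rewrite mulrBr mulr1 -expRD addrCA subrr addr0.
  by rewrite ler_pM2l ?expR_gt0//; lra.
apply: (@le_trans _ _ ((expR y - expR x) * (y - x))).
  by clear -h1; lra.
have := expR_lip xM yM; move=> h2.
apply: (@le_trans _ _ (`|expR y - expR x| * `|y - x|)).
  by rewrite -normrM ler_norm.
rewrite -[(y - x) ^+ 2]real_normK ?num_real// expr2 mulrA.
by rewrite ler_wpM2r.
Qed.

Lemma mul_dist (a a' b b' A B : R) : `|a| <= A -> `|b'| <= B ->
  `|a' * b' - a * b| <= B * `|a' - a| + A * `|b' - b|.
Proof.
move=> aA bB.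
have -> : a' * b' - a * b = (a' - a) * b' + a * (b' - b) by ring.
apply: le_trans (ler_normD _ _) _; rewrite !normrM [B * _]mulrC.
by apply: lerD; [rewrite ler_wpM2l|rewrite ler_wpM2r].
Qed.

Variables (C m : R).
Hypotheses (C0 : 0 <= C) (m0 : 0 <= m).
Variables (a a' u u' : R).
Hypotheses (ha : 0 <= a <= C) (ha' : 0 <= a' <= C) (hu : 0 <= u <= m) (hu' : 0 <= u' <= m).
Local Notation E := (expR (C * m)).

Lemma au_dist : `|a' * u' - a * u| <= m * `|a' - a| + C * `|u' - u|.
Proof.
case/andP: ha => a1 a2; case/andP: hu' => u1 u2.
by apply: mul_dist; rewrite ger0_norm.
Qed.

Lemma exp_au_dist : `|expR (a' * u') - expR (a * u)| <=
  E * (m * `|a' - a| + C * `|u' - u|).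
Proof.
case/andP: ha => a1 a2; case/andP: hu => u1 u2.
case/andP: ha' => a1' a2'; case/andP: hu' => u1' u2'.
apply: (@le_trans _ _ (E * `|a' * u' - a * u|)).
  by apply: expR_lip; apply: ler_pM.
by rewrite ler_pM2l ?expR_gt0// au_dist.
Qed.

Lemma exp_au_le : `|expR (a * u)| <= E.
Proof.
case/andP: ha => a1 a2; case/andP: hu => u1 u2.
by rewrite ger0_norm ?expR_ge0// ler_expR ler_pM.
Qed.

Lemma exp_au_le' : `|expR (a' * u')| <= E.
Proof.
case/andP: ha' => a1 a2; case/andP: hu' => u1 u2.
by rewrite ger0_norm ?expR_ge0// ler_expR ler_pM.
Qed.

(** With [a] a loss and [u = 1 / lambda], this is the scalar factor of the [w]-gradient of [g_i];
    the coefficients enter [LA] and [LB]. *)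
Lemma u_exp_dist : `|u' * expR (a' * u') - u * expR (a * u)| <=
  E * (m ^+ 2 * `|a' - a| + (1 + C * m) * `|u' - u|).
Proof.
case/andP: hu => u1 u2.
have um : `|u| <= m by rewrite ger0_norm.
apply: le_trans (mul_dist _ _ um exp_au_le') _.
have h : m * `|expR (a' * u') - expR (a * u)| <= m * (E * (m * `|a' - a| + C * `|u' - u|)).
  by rewrite ler_wpM2l// exp_au_dist.
by lra.
Qed.

(** Up to sign, the [lambda]-derivative of [g_i] in the same variables; the coefficients become
    those of [LC] and [LD]. *)
Lemma auu_exp_dist : `|a' * u' ^+ 2 * expR (a' * u') - a * u ^+ 2 * expR (a * u)| <=
  E * ((m ^+ 2 + C * m ^+ 3) * `|a' - a| + (2 * (C * m) + C ^+ 2 * m ^+ 2) * `|u' - u|).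
Proof.
case/andP: ha => a1 a2; case/andP: hu => u1 u2.
case/andP: ha' => a1' a2'; case/andP: hu' => u1' u2'.
have um2 : `|a * u ^+ 2| <= C * m ^+ 2.
  rewrite ger0_norm ?mulr_ge0 ?sqr_ge0//; apply: ler_pM => //; first exact: sqr_ge0.
  by rewrite ler_sqr ?nnegrE.
apply: le_trans (mul_dist _ _ um2 exp_au_le') _.
have h : C * m ^+ 2 * `|expR (a' * u') - expR (a * u)| <=
    C * m ^+ 2 * (E * (m * `|a' - a| + C * `|u' - u|)).
  by apply: ler_wpM2l; [rewrite mulr_ge0 ?sqr_ge0|exact: exp_au_dist].
have h2 : `|a' * u' ^+ 2 - a * u ^+ 2| <= m ^+ 2 * `|a' - a| + C * `|u' ^+ 2 - u ^+ 2|.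
  apply: mul_dist; rewrite ger0_norm ?sqr_ge0//.
  by rewrite ler_sqr ?nnegrE.
have h3 : `|u' ^+ 2 - u ^+ 2| <= 2 * m * `|u' - u|.
  have -> : u' ^+ 2 - u ^+ 2 = (u' + u) * (u' - u) by ring.
  rewrite normrM ler_wpM2r// ger0_norm ?addr_ge0//; lra.
have h4 : C * `|u' ^+ 2 - u ^+ 2| <= C * (2 * m * `|u' - u|) by rewrite ler_wpM2l.
have h5 : E * `|a' * u' ^+ 2 - a * u ^+ 2| <=
    E * (m ^+ 2 * `|a' - a| + C * (2 * m * `|u' - u|)).
  by rewrite ler_pM2l ?expR_gt0//; lra.
by lra.
Qed.

End ScalarBounds.

Section Smooth.
Variables (R : realType) (d n : nat) (p : losses R d n).
Local Notation G := (dG p).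
Local Notation C := (dC p).
Local Notation L := (dL p).
Local Notation l0 := (lam0 p).
Local Notation lT := (lamt (dC p) (lam0 p) (rho p)).
Local Notation X := (Xset (dW p) (lam0 p) lT).
Local Notation g i := (gi (dl p) i).

Definition grad_gi (i : 'I_n) (x : 'rV[R]_d * R) : 'rV[R]_d * R :=
  (gwi (dl p) (dgl p) i x, gli (dl p) i x).

Lemma dC_ge0 : 0 <= C.
Proof. by have [w Ww] := dW_ne p; exact: le_trans (d_C (Ordinal (d_n p)) Ww). Qed.

Lemma dG_ge0 : 0 <= G.
Proof.
have [w Ww] := dW_ne p; apply: le_trans (d_G (Ordinal (d_n p)) Ww).
exact: enorm_ge0.
Qed.

Lemma W_segment (w w' : 'rV[R]_d) (t : R) : dW p w -> dW p w' -> 0 <= t <= 1 ->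
  dW p (w + t *: (w' - w)).
Proof.
move=> Ww Ww' /andP[t0 t1].
have := @dW_cv _ _ _ p w' w (Itv01 t0 t1); rewrite !inE => /(_ Ww' Ww).
suff -> : w + t *: (w' - w) = t *: w' + (1 - t) *: w by [].
by rewrite scalerBr scalerBl scale1r addrCA; congr (_ + _); rewrite addrC.
Qed.

Lemma dl_mvt i (w w' : 'rV[R]_d) : dW p w -> dW p w' ->
  exists u t, [/\ dW p u, 0 <= t <= 1, u - w = t *: (w' - w) &
    dl p i w' - dl p i w = dotv (dgl p i u) (w' - w)].
Proof.
move=> Ww Ww'; have [t t01 E] := segment_mvt w (w' - w) (d_grad p i).
exists (w + t *: (w' - w)), t; split=> //; first exact: W_segment.
  by rewrite addrAC subrr add0r.
by rewrite -E addrCA subrr addr0.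
Qed.

Lemma dl_lip i (w w' : 'rV[R]_d) : dW p w -> dW p w' ->
  `|dl p i w' - dl p i w| <= G * enorm (w' - w).
Proof.
move=> Ww Ww'; have [u [t [Wu _ _ ->]]] := dl_mvt i Ww Ww'.
apply: le_trans (dotv_le _ _) _; rewrite ler_wpM2r ?enorm_ge0//; exact: d_G.
Qed.

Lemma dL_norm_ge0 (w w' : 'rV[R]_d) : dW p w -> dW p w' -> 0 <= L * enorm (w' - w).
Proof.
move=> Ww Ww'; apply: le_trans (d_L (Ordinal (d_n p)) Ww' Ww); exact: enorm_ge0.
Qed.

(** One mean value point on the segment replaces integration of the gradient, which gives the
    constant [L] instead of [L / 2]. *)
Lemma dl_quad i (w w' : 'rV[R]_d) : dW p w -> dW p w' ->
  `|dl p i w' - dl p i w - dotv (dgl p i w) (w' - w)| <= L * enorm (w' - w) ^+ 2.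
Proof.
move=> Ww Ww'; have [u [t [Wu /andP[t0 t1] uw ->]]] := dl_mvt i Ww Ww'.
have -> : dotv (dgl p i u) (w' - w) - dotv (dgl p i w) (w' - w) =
  dotv (dgl p i u - dgl p i w) (w' - w).
  by rewrite dotvDl dotvNl.
apply: le_trans (dotv_le _ _) _; rewrite expr2 mulrA ler_wpM2r ?enorm_ge0//.
apply: le_trans (d_L i Wu Ww) _; rewrite uw enormZ ger0_norm// mulrCA.
by rewrite ler_piMl// dL_norm_ge0.
Qed.

Lemma X_inv (x : 'rV[R]_d * R) : X x -> 0 <= x.2^-1 <= l0^-1.
Proof.
have l00 := lam0_gt0 p; move=> [_ /andP[h1 h2]].
have x0 : 0 < x.2 by exact: lt_le_trans h1.
by rewrite invr_ge0 (ltW x0) lef_pV2 ?posrE.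
Qed.

Lemma X_ell i (x : 'rV[R]_d * R) : X x -> 0 <= dl p i x.1 <= C.
Proof.
move=> [Wx _]; rewrite d_ge0//=; apply: le_trans (d_C i Wx); exact: ler_norm.
Qed.

Lemma X_gt0 (x : 'rV[R]_d * R) : X x -> 0 < x.2.
Proof. by move=> [_ /andP[h1 h2]]; apply: lt_le_trans h1; exact: lam0_gt0. Qed.

Lemma inv_dist (x x' : 'rV[R]_d * R) : X x -> X x' ->
  `|x'.2^-1 - x.2^-1| <= l0^-1 ^+ 2 * `|x'.2 - x.2|.
Proof.
move=> Xx Xx'; have x0 := X_gt0 Xx; have x'0 := X_gt0 Xx'.
have -> : x'.2^-1 - x.2^-1 = - (x'.2^-1 * x.2^-1) * (x'.2 - x.2).
  by field; rewrite !gt_eqF.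
rewrite normrM normrN ler_wpM2r//.
have /andP[h1 h2] := X_inv Xx; have /andP[h1' h2'] := X_inv Xx'.
by rewrite ger0_norm ?mulr_ge0// expr2 ler_pM.
Qed.

Lemma ell_distX i (x x' : 'rV[R]_d * R) : X x -> X x' ->
  `|dl p i x'.1 - dl p i x.1| <= G * enorm (x' - x).1.
Proof. by move=> [Wx _] [Wx' _]; exact: dl_lip. Qed.

Lemma eC_exp : eC C l0 = expR (C * l0^-1). Proof. by []. Qed.

Lemma gi_lip i (x x' : 'rV[R]_d * R) : X x -> X x' ->
  `|g i x' - g i x| <= Lg G C l0 * enormX (x' - x).
Proof.
move=> Xx Xx'; have l00 := lam0_gt0 p; have C0 := dC_ge0; have G0 := dG_ge0.
have li0 : 0 <= l0^-1 by rewrite invr_ge0 ltW.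
apply: le_trans (exp_au_dist (X_ell i Xx) (X_ell i Xx') (X_inv Xx) (X_inv Xx')) _.
rewrite /Lg eC_exp -[leRHS]mulrA ler_pM2l ?expR_gt0//.
have h1 := ell_distX i Xx Xx'; have h2 := inv_dist Xx Xx'.
have h3 := enorm_le_X (x' - x); have h4 := norm2_le_X (x' - x).
set D := enormX _ in h3 h4 *.
have u1 : l0^-1 * `|dl p i x'.1 - dl p i x.1| <= l0^-1 * (G * D).
  by rewrite ler_wpM2l//; apply: le_trans h1 _; rewrite ler_wpM2l.
have u2 : C * `|x'.2^-1 - x.2^-1| <= C * (l0^-1 ^+ 2 * D).
  by rewrite ler_wpM2l//; apply: le_trans h2 _; rewrite ler_wpM2l// sqr_ge0.
rewrite exprVn in u2; clear -u1 u2; lra.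
Qed.

Lemma gw_lip i (x x' : 'rV[R]_d * R) : X x -> X x' ->
  enorm (grad_gi i x' - grad_gi i x).1 <=
  LA G C L l0 * enorm (x' - x).1 + LB G C l0 * `|(x' - x).2|.
Proof.
move=> Xx Xx'; have l00 := lam0_gt0 p; have C0 := dC_ge0; have G0 := dG_ge0.
have li0 : 0 <= l0^-1 by rewrite invr_ge0 ltW.
have [Wx _] := Xx; have [Wx' _] := Xx'.
have -> : (grad_gi i x' - grad_gi i x).1 =
   (g i x' / x'.2) *: (dgl p i x'.1 - dgl p i x.1) +
   (g i x' / x'.2 - g i x / x.2) *: dgl p i x.1.
  by rewrite /= /gwi scalerBr scalerBl addrA subrK.
apply: le_trans (enormD _ _) _; rewrite !enormZ.
have h1 := ell_distX i Xx Xx'; have h2 := inv_dist Xx Xx'.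
set Dw := enorm (x' - x).1 in h1 *; set Dl := `|(x' - x).2|.
have Dw0 : 0 <= Dw by exact: enorm_ge0.
have Dl0 : 0 <= Dl by exact: normr_ge0.
have h3 := u_exp_dist li0 (X_ell i Xx) (X_ell i Xx') (X_inv Xx) (X_inv Xx').
have E0 : 0 <= expR (C * l0^-1) by exact: expR_ge0.
have h4 : `|g i x' / x'.2 - g i x / x.2| <=
   expR (C * l0^-1) * (l0^-1 ^+ 2 * (G * Dw) + (1 + C * l0^-1) * (l0^-1 ^+ 2 * Dl)).
  rewrite [g i x' / _]mulrC [g i x / _]mulrC; apply: le_trans h3 _.
  rewrite ler_wpM2l//; apply: lerD; rewrite ler_wpM2l ?sqr_ge0//.
  by rewrite addr_ge0// mulr_ge0.
have h5 : `|g i x' / x'.2| <= expR (C * l0^-1) * l0^-1.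
  rewrite normrM; apply: ler_pM => //.
    exact: (exp_au_le' (X_ell i Xx') (X_inv Xx')).
  by have /andP[u1 u2] := X_inv Xx'; rewrite ger0_norm.
have h6 : enorm (dgl p i x'.1 - dgl p i x.1) <= L * Dw by exact: d_L.
have h7 : enorm (dgl p i x.1) <= G by exact: d_G.
have u1 : `|g i x' / x'.2| * enorm (dgl p i x'.1 - dgl p i x.1) <=
   expR (C * l0^-1) * l0^-1 * (L * Dw) by apply: ler_pM => //; exact: enorm_ge0.
have u2 := ler_pM (normr_ge0 _) (enorm_ge0 _) h4 h7.
apply: le_trans (lerD u1 u2) _.
rewrite /LA /LB eC_exp le_eqVlt; apply/orP; left; apply/eqP; field.
by rewrite gt_eqF.
Qed.

Lemma gl_lip i (x x' : 'rV[R]_d * R) : X x -> X x' ->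
  `|(grad_gi i x' - grad_gi i x).2| <=
  LC G C l0 * enorm (x' - x).1 + LD C l0 * `|(x' - x).2|.
Proof.
move=> Xx Xx'; have l00 := lam0_gt0 p; have C0 := dC_ge0; have G0 := dG_ge0.
have li0 : 0 <= l0^-1 by rewrite invr_ge0 ltW.
have h1 := ell_distX i Xx Xx'; have h2 := inv_dist Xx Xx'.
set Dw := enorm (x' - x).1 in h1 *; set Dl := `|(x' - x).2|.
have h3 := auu_exp_dist C0 li0 (X_ell i Xx) (X_ell i Xx') (X_inv Xx) (X_inv Xx').
have -> : (grad_gi i x' - grad_gi i x).2 = -
   (dl p i x'.1 * x'.2^-1 ^+ 2 * expR (dl p i x'.1 / x'.2) -
    dl p i x.1 * x.2^-1 ^+ 2 * expR (dl p i x.1 / x.2)).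
  by rewrite /= /gli /gi !exprVn; ring.
rewrite normrN; apply: le_trans h3 _.
have E0 : 0 <= expR (C * l0^-1) by exact: expR_ge0.
apply: (@le_trans _ _ (expR (C * l0^-1) * ((l0^-1 ^+ 2 + C * l0^-1 ^+ 3) * (G * Dw) +
    (2 * (C * l0^-1) + C ^+ 2 * l0^-1 ^+ 2) * (l0^-1 ^+ 2 * Dl)))).
  rewrite ler_wpM2l//; apply: lerD; rewrite ler_wpM2l//.
    by rewrite addr_ge0 ?sqr_ge0// mulr_ge0// exprn_ge0.
  by rewrite addr_ge0 ?mulr_ge0 ?sqr_ge0.
rewrite /LC /LD eC_exp le_eqVlt; apply/orP; left; apply/eqP; field.
by rewrite gt_eqF.
Qed.

Lemma Lng_sq : Lng G C L l0 ^+ 2 =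
  LA G C L l0 ^+ 2 + LB G C l0 ^+ 2 + LC G C l0 ^+ 2 + LD C l0 ^+ 2.
Proof. by rewrite sqr_sqrtr// !addr_ge0 ?sqr_ge0. Qed.

Lemma Lng_ge0 : 0 <= Lng G C L l0. Proof. exact: sqrtr_ge0. Qed.

Lemma Lg_ge0 : 0 <= Lg G C l0.
Proof.
have l00 := lam0_gt0 p; have C0 := dC_ge0; have G0 := dG_ge0.
apply: mulr_ge0; first exact: expR_ge0.
by rewrite addr_ge0 ?divr_ge0 ?sqr_ge0// ltW.
Qed.

Lemma sq_lin_le (A B u v : R) : (A * u + B * v) ^+ 2 <= (A ^+ 2 + B ^+ 2) * (u ^+ 2 + v ^+ 2).
Proof. by have h := sqr_ge0 (A * v - B * u); clear -h; lra. Qed.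

(** [Lng] is the Frobenius norm of the matrix with rows [LA, LB] and [LC, LD], and Cauchy-Schwarz in
    each row combines the two componentwise bounds. *)
Lemma grad_gi_lip i (x x' : 'rV[R]_d * R) : X x -> X x' ->
  enormX (grad_gi i x' - grad_gi i x) <= Lng G C L l0 * enormX (x' - x).
Proof.
move=> Xx Xx'; have h1 := gw_lip i Xx Xx'; have h2 := gl_lip i Xx Xx'.
rewrite -ler_sqr ?nnegrE ?mulr_ge0 ?enormX_ge0 ?Lng_ge0// exprMn !enormX_sq Lng_sq.
rewrite /dotX -!enorm_sq -!expr2.
set a := (grad_gi i x' - grad_gi i x).1 in h1 *; set b := (grad_gi i x' - grad_gi i x).2 in h2 *.
set u := enorm (x' - x).1 in h1 h2 *; set v := (x' - x).2 in h1 h2 *.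
have a2 : enorm a ^+ 2 <= (LA G C L l0 * u + LB G C l0 * `|v|) ^+ 2.
  by rewrite ler_sqr ?nnegrE ?enorm_ge0// (le_trans (enorm_ge0 _) h1).
have b2 : b ^+ 2 <= (LC G C l0 * u + LD C l0 * `|v|) ^+ 2.
  rewrite -[b ^+ 2]real_normK ?num_real// ler_sqr ?nnegrE//.
  by rewrite (le_trans (normr_ge0 _) h2).
have s1 := sq_lin_le (LA G C L l0) (LB G C l0) u `|v|.
have s2 := sq_lin_le (LC G C l0) (LD C l0) u `|v|.
rewrite !real_normK ?num_real// in s1 s2.
clear -a2 b2 s1 s2; lra.
Qed.

Lemma grad_gi_le i (x : 'rV[R]_d * R) : X x -> enormX (grad_gi i x) <= Lg G C l0.
Proof.
move=> Xx; have [Wx _] := Xx; have l00 := lam0_gt0 p; have C0 := dC_ge0; have G0 := dG_ge0.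
have li0 : 0 <= l0^-1 by rewrite invr_ge0 ltW.
have /andP[u1 u2] := X_inv Xx; have /andP[a1 a2] := X_ell i Xx.
have e1 := exp_au_le (X_ell i Xx) (X_inv Xx).
apply: le_trans (enormX_le _) _; rewrite /Lg eC_exp mulrDr; apply: lerD.
  rewrite /= /gwi enormZ normrM ger0_norm ?expR_ge0// in e1 *.
  rewrite [G / _]mulrC mulrA; apply: ler_pM => //; rewrite ?enorm_ge0 ?d_G//.
  by rewrite ?mulr_ge0 ?expR_ge0.
  by apply: ler_pM => //; rewrite ?expR_ge0// ger0_norm.
rewrite /= /gli normrN -mulrA normrM; apply: ler_pM => //.
rewrite ger0_norm ?divr_ge0 ?sqr_ge0//; apply: ler_pM => //; first by rewrite invr_ge0 sqr_ge0.
by rewrite -!exprVn ler_sqr ?nnegrE.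
Qed.

Lemma gi_ge1 i (x : 'rV[R]_d * R) : X x -> 1 <= g i x.
Proof.
move=> Xx; have /andP[u1 u2] := X_inv Xx; have /andP[a1 a2] := X_ell i Xx.
by rewrite -expR0 ler_expR mulr_ge0.
Qed.

Lemma gi_le i (x : 'rV[R]_d * R) : X x -> g i x <= eC C l0.
Proof.
move=> Xx; have := exp_au_le (X_ell i Xx) (X_inv Xx).
by rewrite ger0_norm ?expR_ge0.
Qed.

End Smooth.

Section AverageVector.
Variables (R : realType) (d n : nat).
Implicit Types v w : 'I_n -> 'rV[R]_d * R.

Definition avgX v : 'rV[R]_d * R := scaleX n%:R^-1 (\sum_(i < n) v i).

Lemma dotX_sum (I : Type) (s : seq I) (v : I -> 'rV[R]_d * R) x :
  dotX (\sum_(i <- s) v i) x = \sum_(i <- s) dotX (v i) x.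
Proof.
by elim: s => [|i s IH]; rewrite ?big_nil ?dotX0l// !big_cons dotXDl IH.
Qed.

Lemma dotX_avg v x : dotX (avgX v) x = avg (fun i => dotX (v i) x).
Proof. by rewrite /avgX dotXZl dotX_sum. Qed.

Lemma enormX_avg v : enormX (avgX v) <= avg (fun i => enormX (v i)).
Proof.
have [/eqP z|z] := boolP (enormX (avgX v) == 0).
  by rewrite z; apply: avg_ge0 => i; exact: enormX_ge0.
have z0 : 0 < enormX (avgX v) by rewrite lt_def z enormX_ge0.
rewrite -(ler_pM2r z0) -expr2 enormX_sq dotX_avg mulrC -avgZ.
by apply: avg_le => i; rewrite mulrC; exact: dotX_le_norm.
Qed.

Lemma enormX_avg_le v (K : R) : (0 < n)%N -> (forall i, enormX (v i) <= K) ->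
  enormX (avgX v) <= K.
Proof. by move=> n0 h; apply: le_trans (enormX_avg v) _; exact: avg_bound. Qed.

Lemma avgXB v w : avgX (fun i => v i - w i) = avgX v - avgX w.
Proof.
rewrite /avgX sumrB; set a := \sum_(i < n) v i; set b := \sum_(i < n) w i.
by congr pair; [exact: scalerBr|exact: mulrBr].
Qed.

(** The variance is at most the second moment. The triangle inequality would lose a factor 4 here;
    avoiding it keeps the noise constant [kL] at [2 * LF^2]. *)
Lemma avg_centered_sq v : (0 < n)%N ->
  avg (fun i => enormX (v i - avgX v) ^+ 2) <= avg (fun i => enormX (v i) ^+ 2).
Proof.
move=> n0.
have -> : avg (fun i => enormX (v i - avgX v) ^+ 2) =
  avg (fun i => enormX (v i) ^+ 2) - enormX (avgX v) ^+ 2.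
  rewrite (@eq_avg _ _ _ (fun i => enormX (v i) ^+ 2 +
     (- (2) * dotX (v i) (avgX v) + enormX (avgX v) ^+ 2))).
    by rewrite !avgD avgZ -dotX_avg avg_cst// enormX_sq; ring.
  move=> i; rewrite !enormX_sq !dotXBl !dotXBr (dotXC (avgX v) (v i)); ring.
by rewrite gerBl sqr_ge0.
Qed.

End AverageVector.

(** * First-order expansions with quadratic remainder *)

Section SmoothOn.
Variables (R : realType) (d : nat) (X : set ('rV[R]_d * R)).
Local Notation V := ('rV[R]_d * R)%type.
Implicit Types (f h : V -> R) (gf gh : V -> V).

(** A substitute for differentiability on a set that may have empty interior: bounds, Lipschitz
    estimate and quadratic remainder with one common constant. The class is closed under sums,
    products and composition with scalar functions, so the objective is reached without second
    derivatives. *)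
Definition smooth_on f gf := exists2 K : R, 0 <= K & forall x x', X x -> X x' ->
  [/\ `|f x| <= K, enormX (gf x) <= K, `|f x' - f x| <= K * enormX (x' - x) &
      `|f x' - f x - dotX (gf x) (x' - x)| <= K * enormX (x' - x) ^+ 2].

Lemma smooth_ext f h gf gh : (forall x, X x -> f x = h x) ->
  (forall x, X x -> gf x = gh x) -> smooth_on f gf -> smooth_on h gh.
Proof.
move=> fh gfh [K K0 H]; exists K => // x x' Xx Xx'.
by rewrite -!fh// -!gfh//; exact: H.
Qed.

Lemma smooth_comp (phi dphi : R -> R) (S : set R) f gf (K : R) : 0 <= K ->
  (forall x, X x -> S (f x)) ->
  (forall b b', S b -> S b' -> [/\ `|phi b| <= K, `|dphi b| <= K,
     `|phi b' - phi b| <= K * `|b' - b| &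
     `|phi b' - phi b - dphi b * (b' - b)| <= K * (b' - b) ^+ 2]) ->
  smooth_on f gf -> smooth_on (fun x => phi (f x)) (fun x => scaleX (dphi (f x)) (gf x)).
Proof.
move=> K0 fS HP [M M0 H]; exists (K + K * M + K * M ^+ 2).
  by rewrite !addr_ge0 ?mulr_ge0 ?sqr_ge0.
move=> x x' Xx Xx'.
have [h1 h2 h3 h4] := H _ _ Xx Xx'; have [p1 p2 p3 p4] := HP _ _ (fS _ Xx) (fS _ Xx').
set D := enormX (x' - x) in h3 h4 *.
have D0 : 0 <= D by exact: enormX_ge0.
have KM0 : 0 <= K * M by rewrite mulr_ge0.
have KM20 : 0 <= K * M ^+ 2 by rewrite mulr_ge0 ?sqr_ge0.
have u1 : K * `|f x' - f x| <= K * (M * D) by rewrite ler_wpM2l.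
split.
- by clear -p1 KM0 KM20; lra.
- rewrite enormXZ.
  have u := ler_pM (normr_ge0 _) (enormX_ge0 _) p2 h2.
  by clear -u KM20 K0; lra.
- have v1 := mulr_ge0 K0 D0; have v2 := mulr_ge0 KM20 D0.
  by clear -p3 u1 v1 v2; lra.
rewrite dotXZl.
have -> : phi (f x') - phi (f x) - dphi (f x) * dotX (gf x) (x' - x) =
  phi (f x') - phi (f x) - dphi (f x) * (f x' - f x) +
  dphi (f x) * (f x' - f x - dotX (gf x) (x' - x)) by ring.
apply: le_trans (ler_normD _ _) _; rewrite normrM.
have u2 := ler_pM (normr_ge0 _) (normr_ge0 _) p2 h4.
have u3 : (f x' - f x) ^+ 2 <= (M * D) ^+ 2.
  by rewrite -[leLHS]real_normK ?num_real// ler_sqr ?nnegrE// mulr_ge0.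
have u4 := ler_wpM2l K0 u3.
have v1 := mulr_ge0 K0 (sqr_ge0 D).
by clear -p4 u2 u4 v1; lra.
Qed.

Lemma smoothM f h gf gh : smooth_on f gf -> smooth_on h gh ->
  smooth_on (fun x => f x * h x) (fun x => scaleX (f x) (gh x) + scaleX (h x) (gf x)).
Proof.
move=> [A A0 HA] [B B0 HB]; exists (3 * (A * B)); first by rewrite !mulr_ge0.
move=> x x' Xx Xx'.
have [a1 a2 a3 a4] := HA _ _ Xx Xx'; have [b1 b2 b3 b4] := HB _ _ Xx Xx'.
have [a1' _ _ _] := HA _ _ Xx' Xx'.
set D := enormX (x' - x) in a3 a4 b3 b4 *.
have D0 : 0 <= D by exact: enormX_ge0.
have AB : 0 <= A * B by rewrite mulr_ge0.
split.
- by rewrite normrM; have := ler_pM (normr_ge0 _) (normr_ge0 _) a1 b1; clear -AB; lra.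
- apply: le_trans (enormXD _ _) _; rewrite !enormXZ.
  have u1 := ler_pM (normr_ge0 _) (enormX_ge0 _) a1 b2.
  have u2 := ler_pM (normr_ge0 _) (enormX_ge0 _) b1 a2.
  by clear -u1 u2 AB; lra.
- have -> : f x' * h x' - f x * h x = f x' * (h x' - h x) + (f x' - f x) * h x by ring.
  apply: le_trans (ler_normD _ _) _; rewrite !normrM.
  have u1 := ler_pM (normr_ge0 _) (normr_ge0 _) a1' b3.
  have u2 := ler_pM (normr_ge0 _) (normr_ge0 _) a3 b1.
  have u3 := mulr_ge0 AB D0.
  by clear -u1 u2 u3; lra.
have -> : f x' * h x' - f x * h x - dotX (scaleX (f x) (gh x) + scaleX (h x) (gf x)) (x' - x) =
  f x * (h x' - h x - dotX (gh x) (x' - x)) + h x * (f x' - f x - dotX (gf x) (x' - x)) +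
  (f x' - f x) * (h x' - h x) by rewrite dotXDl !dotXZl; ring.
apply: le_trans (ler_normD _ _) _; apply: le_trans (lerD (ler_normD _ _) (lexx _)) _.
rewrite !normrM.
have u1 := ler_pM (normr_ge0 _) (normr_ge0 _) a1 b4.
have u2 := ler_pM (normr_ge0 _) (normr_ge0 _) b1 a4.
have u3 := ler_pM (normr_ge0 _) (normr_ge0 _) a3 b3.
by clear -u1 u2 u3; lra.
Qed.

Lemma smoothD f h gf gh : smooth_on f gf -> smooth_on h gh ->
  smooth_on (fun x => f x + h x) (fun x => gf x + gh x).
Proof.
move=> [A A0 HA] [B B0 HB]; exists (A + B); first by rewrite addr_ge0.
move=> x x' Xx Xx'.
have [a1 a2 a3 a4] := HA _ _ Xx Xx'; have [b1 b2 b3 b4] := HB _ _ Xx Xx'.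
split.
- by apply: le_trans (ler_normD _ _) _; exact: lerD.
- by apply: le_trans (enormXD _ _) _; exact: lerD.
- have -> : f x' + h x' - (f x + h x) = (f x' - f x) + (h x' - h x) by ring.
  by apply: le_trans (ler_normD _ _) _; rewrite mulrDl; exact: lerD.
have -> : f x' + h x' - (f x + h x) - dotX (gf x + gh x) (x' - x) =
  (f x' - f x - dotX (gf x) (x' - x)) + (h x' - h x - dotX (gh x) (x' - x)).
  by rewrite dotXDl; ring.
by apply: le_trans (ler_normD _ _) _; rewrite mulrDl; exact: lerD.
Qed.

Lemma smooth0 : smooth_on (fun=> 0) (fun=> 0).
Proof.
exists 0 => // x x' _ _.
by rewrite normr0 !mul0r subrr normr0 dotX0l subrr normr0 /enormX dotX0l sqrtr0.
Qed.

Lemma smooth_sum (I : Type) (s : seq I) (f : I -> V -> R) (gf : I -> V -> V) :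
  (forall i, smooth_on (f i) (gf i)) ->
  smooth_on (fun x => \sum_(i <- s) f i x) (fun x => \sum_(i <- s) gf i x).
Proof.
move=> H; elim: s => [|i s IH].
  by apply: smooth_ext smooth0 => x _; rewrite big_nil.
by apply: smooth_ext (smoothD (H i) IH) => x _; rewrite big_cons.
Qed.

Lemma smoothZ (t : R) f gf : smooth_on f gf ->
  smooth_on (fun x => t * f x) (fun x => scaleX t (gf x)).
Proof.
move=> [A A0 HA]; exists (`|t| * A); first by rewrite mulr_ge0.
move=> x x' Xx Xx'; have [a1 a2 a3 a4] := HA _ _ Xx Xx'; split.
- by rewrite normrM ler_wpM2l.
- by rewrite enormXZ ler_wpM2l.
- by rewrite -mulrBr normrM -mulrA ler_wpM2l.
by rewrite dotXZl -!mulrBr normrM -mulrA ler_wpM2l.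
Qed.

End SmoothOn.

(** * Smoothness of the objective *)

Section Objective.
Variables (R : realType) (d n : nat) (p : losses R d n).
Local Notation G := (dG p).
Local Notation C := (dC p).
Local Notation L := (dL p).
Local Notation lT := (lamt (dC p) (lam0 p) (rho p)).
Local Notation X := (Xset (dW p) (lam0 p) lT).

Definition grad_gavg (x : 'rV[R]_d * R) : 'rV[R]_d * R :=
  (gwavg (dl p) (dgl p) x, glavg (dl p) x).

Lemma grad_gavgE x : grad_gavg x = avgX (fun i => grad_gi p i x).
Proof.
rewrite /avgX /scaleX /grad_gavg /gwavg /glavg; congr pair.
  by rewrite (big_morph fst (id1 := 0) (op1 := +%R)).
by rewrite (big_morph snd (id1 := 0) (op1 := +%R)).
Qed.

Lemma smooth_lam : smooth_on X (fun x => x.2) (fun=> (0, 1)).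
Proof.
have l00 := lam0_gt0 p.
exists (1 + lT) => [|x x' Xx Xx'].
  have [w Ww] := dW_ne p; rewrite addr_ge0// /lamt addr_ge0 ?(ltW l00)//.
  by rewrite divr_ge0 ?(ltW (rho_gt0 p))//; exact: dC_ge0.
have x0 := X_gt0 Xx; have [_ /andP[_ x1]] := Xx.
have lT0 : 0 < lT by exact: lt_le_trans x1.
have D0 : 0 <= enormX (x' - x) by exact: enormX_ge0.
split.
- by rewrite ger0_norm ?(ltW x0)//; clear -x1; lra.
- rewrite /enormX /dotX/= dotv0l add0r mulr1 sqrtr1; clear -lT0; lra.
- have h := norm2_le_X (x' - x); rewrite /= in h.
  have h2 := mulr_ge0 (ltW lT0) D0; clear -h h2; lra.
rewrite /dotX/= dotv0l add0r mul1r subrr normr0 mulr_ge0 ?sqr_ge0//; clear -lT0; lra.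
Qed.

Lemma smooth_ell i : smooth_on X (fun x => dl p i x.1) (fun x => (dgl p i x.1, 0)).
Proof.
have C0 := dC_ge0 p; have G0 := dG_ge0 p.
exists (C + G + `|L|) => [|x x' Xx Xx']; first by rewrite !addr_ge0.
have [Wx _] := Xx; have [Wx' _] := Xx'.
have h1 := dl_lip i Wx Wx'; have h2 := dl_quad i Wx Wx'.
have h3 := enorm_le_X (x' - x); rewrite /= in h3.
set D := enormX _ in h3 *.
have D0 : 0 <= D by exact: enormX_ge0.
have e0 := enorm_ge0 (x'.1 - x.1).
have L0 : 0 <= `|L| by [].
split.
- by have := d_C i Wx; clear -G0 L0; lra.
- by rewrite -enorm_X; have := d_G i Wx; clear -C0 L0; lra.
- have u := ler_wpM2l G0 h3; have v1 := mulr_ge0 C0 D0; have v2 := mulr_ge0 L0 D0.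
  by clear -h1 u v1 v2; lra.
have -> : dotX (dgl p i x.1, 0) (x' - x) = dotv (dgl p i x.1) (x'.1 - x.1).
  by rewrite /dotX mul0r addr0.
have u1 : enorm (x'.1 - x.1) ^+ 2 <= D ^+ 2 by rewrite ler_sqr ?nnegrE.
have u2 : L * enorm (x'.1 - x.1) ^+ 2 <= `|L| * D ^+ 2.
  apply: (@le_trans _ _ (`|L| * enorm (x'.1 - x.1) ^+ 2)); last by rewrite ler_wpM2l.
  by rewrite ler_wpM2r ?sqr_ge0// ler_norm.
have v := mulr_ge0 (addr_ge0 C0 G0) (sqr_ge0 D).
by clear -h2 u2 v; lra.
Qed.

End Objective.

Lemma ln_dist (R : realType) (m a b : R) : 0 < m -> m <= a -> m <= b ->
  `|ln b - ln a| <= m^-1 * `|b - a|.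
Proof.
move=> m0 ma mb; wlog ab : a b ma mb / a <= b => [h|].
  have [ab|/ltW ab] := leP a b; first exact: h.
  by rewrite distrC [`|b - a|]distrC; exact: h.
have a0 : 0 < a by exact: lt_le_trans ma.
have b0 : 0 < b by exact: lt_le_trans mb.
rewrite !ger0_norm ?subr_ge0 ?ler_ln ?posrE// -ln_div ?posrE//.
have -> : b / a = 1 + (b / a - 1) by ring.
have r0 : 0 < b / a by rewrite divr_gt0.
apply: le_trans (le_ln1Dx _) _; first by clear -r0; lra.
have -> : b / a - 1 = a^-1 * (b - a) by field; rewrite gt_eqF.
by rewrite ler_wpM2r ?subr_ge0// lef_pV2 ?posrE.
Qed.

Lemma ln_quad (R : realType) (a b : R) : 1 <= a -> 1 <= b ->
  `|ln b - ln a - a^-1 * (b - a)| <= (b - a) ^+ 2.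
Proof.
move=> a1 b1.
have a0 : 0 < a by exact: lt_le_trans ltr01 a1.
have b0 : 0 < b by exact: lt_le_trans ltr01 b1.
have up (x y : R) : 0 < x -> 0 < y -> ln y - ln x <= x^-1 * (y - x).
  move=> x0 y0; rewrite -ln_div ?posrE//.
  have -> : y / x = 1 + (y / x - 1) by ring.
  have r0 : 0 < y / x by rewrite divr_gt0.
  apply: le_trans (le_ln1Dx _) _; first by clear -r0; lra.
  by rewrite le_eqVlt; apply/orP; left; apply/eqP; field; rewrite gt_eqF.
have h1 := up _ _ a0 b0; have h2 := up _ _ b0 a0.
have h3 : (a^-1 - b^-1) * (b - a) <= (b - a) ^+ 2.
  have -> : (a^-1 - b^-1) * (b - a) = (a * b)^-1 * (b - a) ^+ 2.
    by field; rewrite !gt_eqF.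
  rewrite ler_piMl ?sqr_ge0// invf_le1 ?mulr_gt0//.
  by rewrite -[1]mulr1 ler_pM.
rewrite ler_norml; apply/andP; split; last first.
  by have h4 := sqr_ge0 (b - a); clear -h1 h4; lra.
by clear -h2 h3; lra.
Qed.

Lemma inv_quad (R : realType) (m a b : R) : 0 < m -> m <= a -> m <= b ->
  [/\ `|a^-1| <= m^-1, `|- a^-2| <= m^-1 ^+ 2, `|b^-1 - a^-1| <= m^-1 ^+ 2 * `|b - a| &
    `|b^-1 - a^-1 - - a^-2 * (b - a)| <= m^-1 ^+ 3 * (b - a) ^+ 2].
Proof.
move=> m0 ma mb.
have a0 : 0 < a by exact: lt_le_trans ma.
have b0 : 0 < b by exact: lt_le_trans mb.
have ia : a^-1 <= m^-1 by rewrite lef_pV2 ?posrE.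
have ib : b^-1 <= m^-1 by rewrite lef_pV2 ?posrE.
have ia0 : 0 <= a^-1 by rewrite invr_ge0 ltW.
have ib0 : 0 <= b^-1 by rewrite invr_ge0 ltW.
split.
- by rewrite ger0_norm.
- by rewrite normrN -exprVn ger0_norm ?sqr_ge0// ler_sqr ?nnegrE// (le_trans ia0).
- have -> : b^-1 - a^-1 = - (a^-1 * b^-1) * (b - a) by field; rewrite !gt_eqF.
  rewrite normrM normrN ler_wpM2r// ger0_norm ?mulr_ge0// expr2; exact: ler_pM.
have -> : b^-1 - a^-1 - - a^-2 * (b - a) = (a^-1 * a^-1 * b^-1) * (b - a) ^+ 2.
  by field; rewrite !gt_eqF.
rewrite ger0_norm; last exact: mulr_ge0 (mulr_ge0 (mulr_ge0 ia0 ia0) ib0) (sqr_ge0 _).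
rewrite ler_wpM2r ?sqr_ge0// exprS expr2 mulrA.
by apply: ler_pM => //; [exact: mulr_ge0|exact: ler_pM].
Qed.

Section Objective2.
Variables (R : realType) (d n : nat) (p : losses R d n).
Local Notation G := (dG p).
Local Notation C := (dC p).
Local Notation L := (dL p).
Local Notation l0 := (lam0 p).
Local Notation lT := (lamt (dC p) (lam0 p) (rho p)).
Local Notation X := (Xset (dW p) (lam0 p) lT).
Local Notation g i := (gi (dl p) i).
Local Notation gav := (gavg (dl p)).
Local Notation Fo := (Fobj (dl p) (rho p)).

Lemma gavg_ge1 x : X x -> 1 <= gav x.
Proof.
move=> Xx; rewrite -[1](@avg_cst _ n 1 (d_n p)); apply: avg_le => i; exact: gi_ge1.
Qed.

Lemma gavg_le x : X x -> gav x <= eC C l0.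
Proof.
move=> Xx; apply: avg_bound => [|i]; [exact: (d_n p)|exact: gi_le].
Qed.

Definition grad_F (x : 'rV[R]_d * R) : 'rV[R]_d * R :=
  scaleX (x.2 / gav x) (grad_gavg p x) + (0, ln (gav x) + rho p).

Lemma smooth_inv : smooth_on X (fun x => x.2^-1) (fun x => scaleX (- x.2^-2) (0, 1)).
Proof.
have l00 := lam0_gt0 p; have li : 0 <= l0^-1 by rewrite invr_ge0 ltW.
set K := l0^-1 + l0^-1 ^+ 2 + l0^-1 ^+ 3.
have i2 : 0 <= l0^-1 ^+ 2 by exact: sqr_ge0.
have i3 : 0 <= l0^-1 ^+ 3 by exact: exprn_ge0.
apply: (@smooth_comp _ _ _ (fun b => b^-1) (fun b => - b^-2) [set b | l0 <= b] _ _ K); last exact: smooth_lam.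
- by rewrite /K !addr_ge0.
- by move=> x [_ /andP[]].
move=> b b' /= hb hb'; have [h1 h2 h3 h4] := inv_quad l00 hb hb'; split.
- by apply: le_trans h1 _; rewrite /K; clear -i2 i3; lra.
- by apply: le_trans h2 _; rewrite /K; clear -li i3; lra.
- by apply: le_trans h3 _; rewrite ler_wpM2r// /K; clear -li i3; lra.
by apply: le_trans h4 _; rewrite ler_wpM2r ?sqr_ge0// /K; clear -li i2; lra.
Qed.

Lemma smooth_gi i : smooth_on X (g i) (grad_gi p i).
Proof.
have l00 := lam0_gt0 p; have C0 := dC_ge0 p.
have h := smoothM (smooth_ell p i) smooth_inv.
have h2 : smooth_on X (fun x => expR (dl p i x.1 * x.2^-1)) (fun x =>
   scaleX (expR (dl p i x.1 * x.2^-1)) (scaleX (dl p i x.1) (scaleX (- x.2^-2) (0, 1)) +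
     scaleX x.2^-1 (dgl p i x.1, 0))).
  apply: (@smooth_comp _ _ _ (@expR R) (@expR R) [set b | b <= C * l0^-1] _ _ (expR (C * l0^-1))).
  - exact: expR_ge0.
  - move=> x Xx /=; have /andP[a1 a2] := X_ell i Xx; have /andP[b1 b2] := X_inv Xx.
    exact: ler_pM.
  - move=> b b' /= hb hb'; split.
    + by rewrite ger0_norm ?expR_ge0// ler_expR.
    + by rewrite ger0_norm ?expR_ge0// ler_expR.
    + exact: expR_lip.
    + exact: expR_quad.
  exact: h.
apply: smooth_ext h2 => // x Xx; have x0 := X_gt0 Xx.
rewrite /grad_gi /gwi /gli /gi /scaleX; congr pair => /=.
  by rewrite !scaler0 add0r scalerA.
by field; rewrite gt_eqF.
Qed.

Lemma smooth_gavg : smooth_on X gav (grad_gavg p).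
Proof.
have h := smoothZ n%:R^-1 (smooth_sum (index_enum 'I_n) smooth_gi).
by apply: smooth_ext h => // x _; rewrite grad_gavgE.
Qed.

Lemma smooth_ln : smooth_on X (fun x => ln (gav x) + rho p)
  (fun x => scaleX (gav x)^-1 (grad_gavg p x)).
Proof.
have C0 := dC_ge0 p; have l00 := lam0_gt0 p; have r0 := rho_gt0 p.
pose K := C / l0 + rho p + 1.
have Cl0 : 0 <= C / l0 by rewrite divr_ge0// ltW.
have K1 : 1 <= K by rewrite /K; clear -Cl0 r0; lra.
apply: (@smooth_comp _ _ _ (fun b => ln b + rho p) (fun b => b^-1)
  [set b | 1 <= b <= eC C l0] _ _ K); last exact: smooth_gavg.
- by rewrite (le_trans _ K1).
- by move=> x Xx /=; rewrite gavg_ge1 ?gavg_le.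
move=> b b' /= /andP[b1 b2] /andP[b1' b2'].
have bp : 0 < b by exact: lt_le_trans ltr01 b1.
split.
- have h0 : 0 <= ln b by rewrite ln_ge0.
  have h1 : ln b <= C / l0.
    by rewrite -[leRHS]expRK ler_ln ?posrE ?expR_gt0.
  by rewrite ger0_norm ?addr_ge0 ?(ltW r0)// /K; clear -h1; lra.
- rewrite ger0_norm ?invr_ge0 ?(ltW bp)//; apply: le_trans K1; by rewrite invf_le1.
- have -> : ln b' + rho p - (ln b + rho p) = ln b' - ln b by ring.
  apply: le_trans (ln_dist ltr01 b1 b1') _; by rewrite invr1 ler_wpM2r.
have -> : ln b' + rho p - (ln b + rho p) = ln b' - ln b by ring.
apply: le_trans (ln_quad b1 b1') _; by rewrite ler_peMl ?sqr_ge0.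
Qed.

Lemma FobjE x : Fo x = x.2 * (ln (gav x) + rho p).
Proof. by rewrite /Fobj mulrDr. Qed.

Lemma smooth_F : smooth_on X Fo grad_F.
Proof.
apply: smooth_ext (smoothM (smooth_lam p) smooth_ln) => x Xx; first by rewrite FobjE.
rewrite /grad_F /scaleX; congr pair => /=; first by rewrite scaler0 scalerA.
by rewrite mulr1 mulrA.
Qed.

Lemma grad_gavg_lip x x' : X x -> X x' ->
  enormX (grad_gavg p x' - grad_gavg p x) <= Lng G C L l0 * enormX (x' - x).
Proof.
move=> Xx Xx'; rewrite !grad_gavgE -avgXB; apply: enormX_avg_le => [|i]; first exact: (d_n p).
exact: grad_gi_lip.
Qed.

Lemma grad_gavg_le x : X x -> enormX (grad_gavg p x) <= Lg G C l0.
Proof.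
move=> Xx; rewrite grad_gavgE; apply: enormX_avg_le => [|i]; [exact: (d_n p)|exact: grad_gi_le].
Qed.

Lemma enormX_snd (t : R) : enormX ((0, t) : 'rV[R]_d * R) = `|t|.
Proof. by rewrite /enormX /dotX/= dotv0l add0r -expr2 sqrtr_sqr. Qed.

(** Only the bound and the Lipschitz estimate of the quotient are used afterwards, so its gradient
    field is left existential. *)
Lemma smooth_ratio : exists2 gf, True & smooth_on X (fun x => x.2 / gav x) gf.
Proof.
have h : smooth_on X (fun x => (gav x)^-1) (fun x => scaleX (- (gav x)^-2) (grad_gavg p x)).
  apply: (@smooth_comp _ _ _ (fun b => b^-1) (fun b => - b^-2) [set b | 1 <= b] _ _ 1) => //.
  - by move=> x Xx; exact: gavg_ge1.
  - move=> b b' /= hb hb'; have [] := inv_quad ltr01 hb hb'.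
    by rewrite invr1 !expr1n.
  - exact: smooth_gavg.
by exists (fun x => scaleX x.2 (scaleX (- (gav x)^-2) (grad_gavg p x)) + scaleX (gav x)^-1 (0, 1));
  [|exact: smoothM (smooth_lam p) h].
Qed.

Lemma grad_F_lip : exists2 K, 0 <= K & forall x x', X x -> X x' ->
  enormX (grad_F x) <= K /\ enormX (grad_F x' - grad_F x) <= K * enormX (x' - x).
Proof.
have [gr _ [A A0 HA]] := smooth_ratio; have [B B0 HB] := smooth_ln.
have Lg0 := Lg_ge0 p; have Ln0 := Lng_ge0 p.
set l1 := Lg G C l0 in Lg0 *; set l2 := Lng G C L l0 in Ln0 *.
exists (A * l1 + A * l2 + B).
  by apply: addr_ge0 => //; apply: addr_ge0; apply: mulr_ge0.
move=> x x' Xx Xx'; have [a1 _ a3 _] := HA _ _ Xx Xx'; have [b1 _ b3 _] := HB _ _ Xx Xx'.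
have [a1' _ _ _] := HA _ _ Xx' Xx'.
have g1 := grad_gavg_le Xx; have g2 := grad_gavg_lip Xx Xx'.
rewrite -/l1 -/l2 in g1 g2.
have Al2 : 0 <= A * l2 by rewrite mulr_ge0.
split.
  rewrite /grad_F; apply: le_trans (enormXD _ _) _; rewrite enormXZ enormX_snd.
  have u := ler_pM (normr_ge0 _) (enormX_ge0 _) a1 g1.
  by clear -u b1 Al2; lra.
set D := enormX (x' - x) in a3 b3 g2 *.
set r := x.2 / gav x in a1 a3 *; set r' := x'.2 / gav x' in a1' a3 *.
set u := ln (gav x) + rho p in b1 b3 *; set u' := ln (gav x') + rho p in b3 *.
have -> : grad_F x' - grad_F x = scaleX r' (grad_gavg p x' - grad_gavg p x) +
   scaleX (r' - r) (grad_gavg p x) + (0, u' - u).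
  rewrite /grad_F -/r -/r' -/u -/u' /scaleX; congr pair => /=.
    by rewrite !addr0 scalerBr scalerBl addrA subrK.
  by ring.
apply: le_trans (enormXD _ _) _; apply: le_trans (lerD (enormXD _ _) (lexx _)) _.
rewrite !enormXZ enormX_snd.
have v1 := ler_pM (normr_ge0 _) (enormX_ge0 _) a1' g2.
have v2 := ler_pM (normr_ge0 _) (enormX_ge0 _) a3 g1.
by clear -v1 v2 b3; lra.
Qed.

Lemma Fobj_ge0 x : X x -> 0 <= Fo x.
Proof.
move=> Xx; rewrite FobjE mulr_ge0 ?(ltW (X_gt0 Xx))//.
by rewrite addr_ge0 ?(ltW (rho_gt0 p))// ln_ge0// gavg_ge1.
Qed.

End Objective2.

(** * One step of the algorithm *)

(** A logarithm grows slower than any power, so [eps] is arbitrary. This is what makes the constants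
    [kE] and [kS] of the scalar recursion free to choose. *)
Lemma ln_growth (R : realType) (r eps : R) : 0 < r -> 0 < eps ->
  exists2 K, 0 <= K & forall s, 3 / 4 <= s -> s * (`|ln s| + r) ^+ 2 <= K + eps * s ^+ 2.
Proof.
move=> r0 eps0; set A := 32 + 2 * r ^+ 2.
have A0 : 0 < A by rewrite /A ltr_wpDr// mulr_ge0// sqr_ge0.
have t0 : 0 <= A * (A / eps) ^+ 3.
  by apply: mulr_ge0; [exact: ltW|apply: exprn_ge0; apply: divr_ge0; exact: ltW].
have r1 : 0 <= (1 + r) ^+ 2 by exact: sqr_ge0.
exists (A * (A / eps) ^+ 3 + (1 + r) ^+ 2); first exact: addr_ge0.
move=> s s34; have es0 : 0 <= eps * s ^+ 2 by rewrite mulr_ge0 ?sqr_ge0// ltW.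
have [s1|s1] := leP s 1.
  have h : `|ln s| <= 1.
    have := @ln_dist _ (3 / 4) 1 s _ _ s34; rewrite ln1 subr0 => /(_ _ _)/le_trans; apply.
    - by rewrite divr_gt0.
    - by rewrite ler_pdivrMr// mul1r ler_nat.
    have h : `|s - 1| <= 1 / 4 by rewrite ler_norml; apply/andP; split; clear -s34 s1; lra.
    have -> : (3 / 4)^-1 = 4 / 3 :> R by field.
    by clear -h; lra.
  have h2 : s * (`|ln s| + r) ^+ 2 <= 1 * (1 + r) ^+ 2.
    apply: ler_pM; rewrite ?sqr_ge0//; first by clear -s34; lra.
    rewrite ler_sqr ?nnegrE ?addr_ge0 ?(ltW r0)//; clear -h; lra.
  by clear -h2 t0 es0; lra.
have s0 : 0 < s by exact: lt_trans ltr01 s1.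
(* With [q = s^(1/4)] one has [ln s = 4 ln q <= 4 q], and a multiple of [q^6] has to be compared
   with [eps * q^8]. *)
set q := Num.sqrt (Num.sqrt s).
have q2 : q ^+ 2 = Num.sqrt s by rewrite sqr_sqrtr ?sqrtr_ge0.
have q4 : q ^+ 4 = s by rewrite -[4%N]/(2 * 2)%N exprM q2 sqr_sqrtr// ltW.
have q1 : 1 <= q.
  by rewrite -(@sqrtr1 R) ler_wsqrtr// -(@sqrtr1 R) ler_wsqrtr// ltW.
have q0 : 0 < q by exact: lt_le_trans ltr01 q1.
have lns : `|ln s| <= 4 * q.
  rewrite ger0_norm ?ln_ge0 ?(ltW s1)// -q4 lnXn// -(mulr_natl (ln q)) ler_wpM2l//.
  exact/ltW/ln_sublinear.
have h1 : (`|ln s| + r) ^+ 2 <= A * q ^+ 2.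
  have u1 : (`|ln s| + r) ^+ 2 <= (4 * q + r) ^+ 2.
    by rewrite ler_sqr ?nnegrE ?addr_ge0 ?mulr_ge0 ?(ltW r0) ?(ltW q0)// lerD2r.
  have u2 := sqr_ge0 (4 * q - r).
  have u3 : r ^+ 2 * 1 <= r ^+ 2 * q ^+ 2.
    by rewrite ler_wpM2l ?sqr_ge0// exprn_ege1.
  by rewrite /A; clear -u1 u2 u3; lra.
have h2 : s * (`|ln s| + r) ^+ 2 <= A * (q ^+ 2) ^+ 3.
  have u := ler_wpM2l (ltW s0) h1; apply: le_trans u _.
  by rewrite -q4 le_eqVlt; apply/orP; left; apply/eqP; ring.
apply: le_trans h2 _.
have sE : s ^+ 2 = (q ^+ 2) ^+ 4 by rewrite -q4; ring.
rewrite sE in es0 *.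
set x := q ^+ 2 in es0 *.
have x0 : 0 <= x by exact: sqr_ge0.
have [xA|xA] := leP (A / eps) x.
  have u : A * x ^+ 3 <= eps * x ^+ 4.
    have -> : eps * x ^+ 4 = eps * x * x ^+ 3 by ring.
    apply: ler_wpM2r; first exact: exprn_ge0.
    by move: xA; rewrite ler_pdivrMr// mulrC.
  by clear -u t0 r1; lra.
have u : A * x ^+ 3 <= A * (A / eps) ^+ 3.
  by rewrite ler_pM2l// lerXn2r ?nnegrE// ?(ltW xA)// (le_trans x0)// ltW.
by clear -u es0 r1; lra.
Qed.

Definition is_projection (R : realType) (d : nat) (X : set ('rV[R]_d * R))
  (Pr : 'rV[R]_d * R -> 'rV[R]_d * R) :=
  forall y, X (Pr y) /\ forall x, X x -> enormX (y - Pr y) <= enormX (y - x).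

(** * Projected steps *)

Section Projection.
Variables (R : realType) (d : nat).
Local Notation V := ('rV[R]_d * R)%type.

Lemma dotX_subZ (a b : V) (t : R) : dotX (a - scaleX t b) (a - scaleX t b) =
  dotX a a - 2 * t * dotX a b + t ^+ 2 * dotX b b.
Proof. by rewrite dotXBl !dotXBr !dotXZl !dotXZr (dotXC b a); ring. Qed.

Lemma projection_angle (X : set V) (Pr : V -> V) (x y : V) :
  (forall x x' t, X x -> X x' -> 0 <= t <= 1 -> X (x + scaleX t (x' - x))) ->
  is_projection X Pr -> X x -> dotX (y - Pr y) (x - Pr y) <= 0.
Proof.
move=> cX /(_ y)[XP HP] Xx; set a := y - Pr y; set b := x - Pr y.
rewrite leNgt; apply/negP => c0; set c := dotX a b in c0.
have B0 := dotX_ge0 b; set B := dotX b b in B0.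
have Bc : 0 < B + c by rewrite ltr_wpDl.
(* Any [t] in the interval from 0 (excluded) to 1 with [t * B < 2 * c] contradicts minimality; this
   one satisfies [t * B <= c]. *)
set t := c / (B + c).
have t0 : 0 < t by rewrite /t divr_gt0.
have t1 : t <= 1 by rewrite /t ler_pdivrMr// mul1r lerDr.
have := HP _ (cX _ _ t XP Xx _); rewrite (ltW t0) t1 => /(_ isT).
have -> : y - (Pr y + scaleX t (x - Pr y)) = a - scaleX t b.
  by rewrite /a opprD addrA.
rewrite -ler_sqr ?nnegrE ?enormX_ge0// !enormX_sq -/a.
rewrite dotX_subZ -/c -/B => h.
have h1 : t * (2 * c) <= t * (t * B) by clear -h; lra.
rewrite ler_pM2l// in h1.
have h2 : t * B <= c.
  by rewrite /t mulrAC ler_pdivrMr// ler_wpM2l ?(ltW c0)// lerDl ltW.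
by clear -h1 h2 c0; lra.
Qed.

(** Tested at [x], the obtuse angle at the projection gives the decrease along [z]. Tested at all
    points, it says that [(x - x') / eta - z] is normal to [X] at [x'], which is where the
    subgradient at the new iterate comes from. *)
Lemma projection_step (X : set V) (Pr : V -> V) (x z : V) (eta : R) :
  (forall x x' t, X x -> X x' -> 0 <= t <= 1 -> X (x + scaleX t (x' - x))) ->
  is_projection X Pr -> X x -> 0 < eta ->
  let x' := Pr (x - scaleX eta z) in
  [/\ X x', eta * dotX z (x' - x) <= - enormX (x' - x) ^+ 2,
    enormX (x' - x) <= eta * enormX z &
    forall y, X y -> dotX (scaleX eta^-1 (x - x') - z) (y - x') <= 0].
Proof.
move=> cX HP Xx e0 x'.
have [Xx' _] := HP (x - scaleX eta z).
have angle y : X y -> dotX (x - scaleX eta z - x') (y - x') <= 0.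
  exact: projection_angle.
have h1 : eta * dotX z (x' - x) <= - enormX (x' - x) ^+ 2.
  have := angle x Xx.
  have -> : x - scaleX eta z - x' = (x - x') - scaleX eta z by rewrite addrAC.
  rewrite dotXBl dotXZl enormX_sq.
  have -> : x' - x = - (x - x') by rewrite opprB.
  have -> : dotX z (- (x - x')) = - dotX z (x - x') by rewrite dotXC dotXNl dotXC.
  rewrite dotXNl (dotXC (x - x') (- _)) dotXNl => h.
  by clear -h; lra.
split=> //.
  have [->|n0] := eqVneq (enormX (x' - x)) 0.
    by rewrite mulr_ge0 ?enormX_ge0// ltW.
  have n1 : 0 < enormX (x' - x) by rewrite lt_def n0 enormX_ge0.
  rewrite -(ler_pM2r n1) -expr2.
  have h2 := dotX_le z (x' - x).
  have h3 : eta * - (enormX z * enormX (x' - x)) <= eta * dotX z (x' - x).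
    rewrite ler_pM2l//; have /ler_normlP[u _] := h2; clear -u; lra.
  by clear -h1 h3; lra.
move=> y Xy; have h := angle y Xy.
rewrite -(ler_pM2l e0) mulr0 -dotXZl.
suff -> : scaleX eta (scaleX eta^-1 (x - x') - z) = x - scaleX eta z - x' by [].
rewrite /scaleX; congr pair => /=.
  by rewrite scalerBr scalerA divff ?gt_eqF// scale1r addrAC.
by field; rewrite gt_eqF.
Qed.

End Projection.

Section ConvexX.
Variables (R : realType) (d n : nat) (p : losses R d n).
Local Notation lT := (lamt (dC p) (lam0 p) (rho p)).
Local Notation X := (Xset (dW p) (lam0 p) lT).

Lemma X_segment (x x' : 'rV[R]_d * R) (t : R) : X x -> X x' -> 0 <= t <= 1 ->
  X (x + scaleX t (x' - x)).
Proof.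
move=> [Wx /andP[a1 a2]] [Wx' /andP[b1 b2]] t01; split; first exact: W_segment.
have /andP[t0 t1] := t01; rewrite /=.
have u1 : t * lam0 p <= t * x'.2 by rewrite ler_wpM2l.
have u2 : t * x'.2 <= t * lT by rewrite ler_wpM2l.
have t1' : 0 <= 1 - t by rewrite subr_ge0.
have u3 := ler_wpM2l t1' a1; have u4 := ler_wpM2l t1' a2.
by apply/andP; split; clear -u1 u2 u3 u4; lra.
Qed.

Lemma lT_ge : lam0 p <= lT.
Proof.
by rewrite /lamt lerDl divr_ge0 ?dC_ge0// ltW// rho_gt0.
Qed.

Lemma lT_gt0 : 0 < lT.
Proof. exact: lt_le_trans (lam0_gt0 p) lT_ge. Qed.

Lemma dR_ge0 : 0 <= dR p.
Proof. by have [w Ww] := dW_ne p; apply: le_trans (d_R Ww); exact: enorm_ge0. Qed.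

Lemma X_bounded (x : 'rV[R]_d * R) : X x -> enormX x <= dR p + lT.
Proof.
move=> Xx; have x0 := X_gt0 Xx; have [Wx /andP[_ h]] := Xx.
by apply: le_trans (enormX_le _) _; rewrite lerD ?d_R// gtr0_norm.
Qed.

End ConvexX.

(** * Estimation errors and the search direction *)

Section Errors.
Variables (R : realType) (d n : nat) (p : losses R d n).
Local Notation V := ('rV[R]_d * R)%type.
Local Notation C := (dC p).
Local Notation l0 := (lam0 p).
Local Notation lT := (lamt (dC p) (lam0 p) (rho p)).
Local Notation X := (Xset (dW p) (lam0 p) lT).
Local Notation gav := (gavg (dl p)).
Local Notation Lgp := (Lg (dG p) (dC p) (lam0 p)).
Local Notation Lngp := (Lng (dG p) (dC p) (dL p) (lam0 p)).
Local Notation LFp := (LF (dG p) (dC p) (dL p) (lam0 p) (rho p)).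

(** The sensitivity of the search direction to the error of [s]: [lT * Lg] through the quotient that
    multiplies the gradient of [g], and 1 through the logarithm. Being at least 1, it also gives
    [|e| <= P]. *)
Definition err_weight : R := lT * Lgp + 1.

Lemma err_weight_ge1 : 1 <= err_weight.
Proof. by rewrite /err_weight lerDr mulr_ge0 ?Lg_ge0// ltW// lT_gt0. Qed.

Lemma err_weight_ge0 : 0 <= err_weight. Proof. exact: le_trans ler01 err_weight_ge1. Qed.

Definition wnorm (a : V) (b : R) : R := Num.sqrt (lT ^+ 2 * dotX a a + err_weight ^+ 2 * b ^+ 2).

Lemma wnorm_sq a b : wnorm a b ^+ 2 = lT ^+ 2 * dotX a a + err_weight ^+ 2 * b ^+ 2.
Proof.
by rewrite sqr_sqrtr//; apply: addr_ge0; apply: mulr_ge0; rewrite ?sqr_ge0 ?dotX_ge0.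
Qed.

Lemma wnorm_ge0 a b : 0 <= wnorm a b. Proof. exact: sqrtr_ge0. Qed.

Lemma wnorm_ge_p a b : lT * enormX a <= wnorm a b.
Proof.
have l := lT_gt0 p.
rewrite -ler_sqr ?nnegrE ?wnorm_ge0 ?mulr_ge0 ?enormX_ge0 ?(ltW l)//.
rewrite exprMn enormX_sq wnorm_sq lerDl.
by apply: mulr_ge0; exact: sqr_ge0.
Qed.

Lemma wnorm_ge_we a b : err_weight * `|b| <= wnorm a b.
Proof.
rewrite -ler_sqr ?nnegrE ?wnorm_ge0 ?mulr_ge0 ?err_weight_ge0// exprMn real_normK ?num_real//.
rewrite wnorm_sq lerDr; apply: mulr_ge0; [exact: sqr_ge0|exact: dotX_ge0].
Qed.

Lemma wnorm_ge_e a b : `|b| <= wnorm a b.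
Proof.
by apply: le_trans (wnorm_ge_we a b); rewrite ler_peMl// err_weight_ge1.
Qed.

Lemma wnorm_le a b : wnorm a b <= lT * enormX a + err_weight * `|b|.
Proof.
have l := ltW (lT_gt0 p); have e0 := err_weight_ge0; have a0 := enormX_ge0 a.
have A0 : 0 <= lT * enormX a by rewrite mulr_ge0.
have B0 : 0 <= err_weight * `|b| by rewrite mulr_ge0.
have w1 : wnorm a b ^+ 2 = (lT * enormX a) ^+ 2 + (err_weight * `|b|) ^+ 2.
  by rewrite wnorm_sq !exprMn enormX_sq real_normK ?num_real.
rewrite -ler_sqr ?nnegrE ?wnorm_ge0 ?(addr_ge0 A0 B0)// w1.
by have h := mulr_ge0 A0 B0; clear -h; lra.
Qed.

Lemma wnorm_dot a b a' b' :
  `|lT ^+ 2 * dotX a a' + err_weight ^+ 2 * (b * b')| <= wnorm a b * wnorm a' b'.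
Proof.
have l := ltW (lT_gt0 p); have e0 := err_weight_ge0.
set A := lT * enormX a; set B := err_weight * `|b|; set A' := lT * enormX a'; set B' := err_weight * `|b'|.
have A0 : 0 <= A by rewrite mulr_ge0 ?enormX_ge0.
have B0 : 0 <= B by rewrite mulr_ge0.
have A0' : 0 <= A' by rewrite mulr_ge0 ?enormX_ge0.
have B0' : 0 <= B' by rewrite mulr_ge0.
apply: (@le_trans _ _ (A * A' + B * B')).
  apply: le_trans (ler_normD _ _) _; apply: lerD.
    rewrite normrM ger0_norm ?sqr_ge0//.
    have h := ler_wpM2l (sqr_ge0 lT) (dotX_le a a').
    by rewrite /A /A'; clear -h; lra.
  rewrite !normrM ger0_norm ?sqr_ge0// /B /B'.
  by rewrite le_eqVlt; apply/orP; left; apply/eqP; ring.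
have w1 : wnorm a b ^+ 2 = A ^+ 2 + B ^+ 2.
  by rewrite wnorm_sq /A /B !exprMn enormX_sq real_normK ?num_real.
have w2 : wnorm a' b' ^+ 2 = A' ^+ 2 + B' ^+ 2.
  by rewrite wnorm_sq /A' /B' !exprMn enormX_sq real_normK ?num_real.
have AB0 : 0 <= A * A' + B * B' by apply: addr_ge0; exact: mulr_ge0.
rewrite -ler_sqr ?nnegrE ?mulr_ge0 ?wnorm_ge0//.
rewrite exprMn w1 w2; have h := sqr_ge0 (A * B' - B * A'); clear -h; lra.
Qed.

Lemma LF_ge : lT * Lngp + err_weight * Lgp + 1 <= LFp.
Proof.
have l := lT_gt0 p; have h1 := Lg_ge0 p.
by rewrite /LF /err_weight; clear -l h1; lra.
Qed.

Lemma LF_ge1 : 1 <= LFp.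
Proof.
apply: le_trans LF_ge; rewrite lerDr addr_ge0// mulr_ge0 ?Lng_ge0 ?Lg_ge0 ?err_weight_ge0//.
exact/ltW/lT_gt0.
Qed.

(** The weighted Lipschitz constants of the gradient and of the value of [g] stay below [LF]; this
    makes [2 * LF^2] the noise constant. *)
Lemma LF_sq_ge : lT ^+ 2 * Lngp ^+ 2 + err_weight ^+ 2 * Lgp ^+ 2 <= LFp ^+ 2.
Proof.
have h := LF_ge; have l := ltW (lT_gt0 p).
have a0 : 0 <= lT * Lngp by rewrite mulr_ge0 ?Lng_ge0.
have b0 : 0 <= err_weight * Lgp by rewrite mulr_ge0 ?Lg_ge0 ?err_weight_ge0.
have h2 : (lT * Lngp + err_weight * Lgp) ^+ 2 <= LFp ^+ 2.
  rewrite ler_sqr ?nnegrE ?(addr_ge0 a0 b0) ?(le_trans ler01 LF_ge1)//; clear -h; lra.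
by have h3 := mulr_ge0 a0 b0; clear -h2 h3; lra.
Qed.

Definition zdir (x q : V) (s : R) : V := scaleX (x.2 / s) q + (0, ln s + rho p).
Definition err (x : V) (s : R) : R := s - gav x.
Definition perr (x q : V) : V := q - grad_gavg p x.
Definition err_norm (x q : V) (s : R) : R := wnorm (perr x q) (err x s).
(** The quantity [Pi] of the scalar recursion. Its mean increment contains the pairing of the
    gradient error with the step, which has a negative drift, while boundedness of [X] keeps it
    [O(P)]. *)
Definition err_moment (x q : V) : R := lT * dotX (perr x q) x.

Lemma s_ge x s : X x -> - (1 / 4) <= err x s -> 3 / 4 <= s.
Proof. by move=> Xx; have := gavg_ge1 Xx; rewrite /err; lra. Qed.

Lemma s_le x s : X x -> s <= eC C l0 + err x s.
Proof. by move=> Xx; have := gavg_le Xx; rewrite /err; lra. Qed.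

Lemma X_le_lT (x : V) : X x -> x.2 <= lT. Proof. by move=> [_ /andP[]]. Qed.

(** For [s >= 3/4] both [1 / s] and the slope of the logarithm are at most 4/3, whence [16/9]; the 2
    comes from squaring the sum of the two errors. *)
Lemma zdir_err x q s : X x -> - (1 / 4) <= err x s ->
  enormX (zdir x q s - grad_F p x) ^+ 2 <= 2 * (16 / 9 * err_norm x q s ^+ 2).
Proof.
move=> Xx he; have s34 := s_ge Xx he; have g1 := gavg_ge1 Xx.
have x0 := X_gt0 Xx; have xT := X_le_lT Xx; have l := lT_gt0 p.
have s0 : 0 < s by apply: lt_le_trans s34; rewrite divr_gt0.
have g0 : 0 < gav x by exact: lt_le_trans ltr01 g1.
have Lg0 := Lg_ge0 p.
set e := err x s; set pe := perr x q.
have eqz : zdir x q s - grad_F p x = scaleX (x.2 / s) pe +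
   scaleX (- (x.2 / (s * gav x)) * e) (grad_gavg p x) + (0, ln s - ln (gav x)).
  have -> : - (x.2 / (s * gav x)) * e = x.2 / s - x.2 / gav x.
    by rewrite /e /err; field; rewrite !gt_eqF.
  rewrite /zdir /grad_F /scaleX; congr pair => /=; last by ring.
  by rewrite !addr0 scalerBr scalerBl addrA subrK.
have is43 : s^-1 <= 4 / 3.
  have -> : 4 / 3 = (3 / 4)^-1 :> R by field.
  by rewrite lef_pV2 ?posrE// divr_gt0.
have is0 : 0 < s^-1 by rewrite invr_gt0.
have n1 : enormX (scaleX (x.2 / s) pe) <= 4 / 3 * (lT * enormX pe).
  rewrite enormXZ ger0_norm ?divr_ge0 ?(ltW x0) ?(ltW s0)//.
  rewrite mulrA ler_wpM2r ?enormX_ge0// mulrC; apply: ler_pM; rewrite ?(ltW is0) ?(ltW x0)//.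
have n2 : enormX (scaleX (- (x.2 / (s * gav x)) * e) (grad_gavg p x)) <= 4 / 3 * (lT * Lgp * `|e|).
  have u3 : 0 <= x.2 / (s * gav x).
    by apply: divr_ge0; [exact: ltW|apply: mulr_ge0; exact: ltW].
  rewrite enormXZ normrM normrN (ger0_norm u3).
  have ig : (gav x)^-1 <= 1 by rewrite invf_le1.
  have ig0 : 0 <= (gav x)^-1 by rewrite invr_ge0 ltW.
  have u1 : x.2 / (s * gav x) <= 4 / 3 * lT.
    rewrite invfM mulrCA mulrA [4 / 3 * _]mulrC.
    have v : x.2 * (gav x)^-1 <= lT by rewrite -[lT]mulr1; apply: ler_pM => //; exact: ltW.
    rewrite -mulrA mulrC; apply: ler_pM => //; first exact: ltW.
    by rewrite mulr_ge0// ltW.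
  have u2 := grad_gavg_le Xx.
  have u4 : x.2 / (s * gav x) * `|e| <= 4 / 3 * lT * `|e| by rewrite ler_wpM2r.
  have u5 := ler_pM (mulr_ge0 u3 (normr_ge0 e)) (enormX_ge0 _) u4 u2.
  apply: le_trans u5 _; rewrite le_eqVlt; apply/orP; left; apply/eqP; ring.
have n3 : enormX ((0, ln s - ln (gav x)) : V) <= 4 / 3 * `|e|.
  rewrite enormX_snd; have g34 : 3 / 4 <= gav x by clear -g1; lra.
  have m0 : 0 < 3 / 4 :> R by rewrite divr_gt0.
  have := ln_dist m0 g34 s34.
  by have -> : (3 / 4)^-1 = 4 / 3 :> R by field.
have n4 : enormX (zdir x q s - grad_F p x) <= 4 / 3 * (lT * enormX pe + err_weight * `|e|).
  rewrite eqz; apply: le_trans (enormXD _ _) _.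
  apply: le_trans (lerD (enormXD _ _) (lexx _)) _.
  by rewrite /err_weight; clear -n1 n2 n3; lra.
have n5 : enormX (zdir x q s - grad_F p x) ^+ 2 <= (4 / 3 * (lT * enormX pe + err_weight * `|e|)) ^+ 2.
  by rewrite ler_sqr ?nnegrE ?enormX_ge0// (le_trans (enormX_ge0 _) n4).
apply: le_trans n5 _; rewrite /err_norm wnorm_sq -/pe -/e -enormX_sq -[e ^+ 2]real_normK ?num_real//.
by have h := sqr_ge0 (lT * enormX pe - err_weight * `|e|); clear -h; lra.
Qed.

Lemma zdir_le x q s : X x -> s != 0 ->
  enormX (zdir x q s) <= `|s|^-1 * (lT * Lgp + err_norm x q s) + (`|ln s| + rho p).
Proof.
move=> Xx s0; have x0 := X_gt0 Xx; have xT := X_le_lT Xx; have l := lT_gt0 p.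
have r0 := rho_gt0 p.
rewrite /zdir; apply: le_trans (enormXD _ _) _; rewrite enormX_snd; apply: lerD; last first.
  by apply: le_trans (ler_normD _ _) _; rewrite (gtr0_norm r0).
rewrite enormXZ normrM normfV gtr0_norm// -mulrA mulrCA ler_wpM2l ?invr_ge0//.
have qE : q = grad_gavg p x + perr x q by rewrite /perr addrC subrK.
have h1 : enormX q <= Lgp + enormX (perr x q).
  by rewrite {1}qE; apply: le_trans (enormXD _ _) _; rewrite lerD2r; exact: grad_gavg_le.
have h2 := wnorm_ge_p (perr x q) (err x s).
apply: (@le_trans _ _ (lT * enormX q)); first by rewrite ler_wpM2r ?enormX_ge0.
have h3 := ler_wpM2l (ltW l) h1.
by rewrite /err_norm; clear -h2 h3; lra.
Qed.

End Errors.

Section StepBounds.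
Variables (R : realType) (d n : nat) (p : losses R d n).
Local Notation V := ('rV[R]_d * R)%type.
Local Notation l0 := (lam0 p).
Local Notation lT := (lamt (dC p) (lam0 p) (rho p)).
Local Notation X := (Xset (dW p) (lam0 p) lT).
Local Notation gav := (gavg (dl p)).
Local Notation Fo := (Fobj (dl p) (rho p)).
Local Notation Lgp := (Lg (dG p) (dC p) (lam0 p)).
Local Notation E0 := (eC (dC p) (lam0 p)).

(** Solving the formula of the search direction [z] for the estimate [q] expresses [q.D] as
    [A * (z.D)] plus a logarithmic term, with [A = s / x.2]. The projection gives
    [eta * (z.D) <= - |D|^2], half of which absorbs the terms linear in [D]; then [lT * A >= 3/4]
    gives 3/8. The square of the logarithmic term is of smaller order than [s^2], so [kE] may be any
    positive number. *)
Lemma drift_bound (kE : R) : 0 < kE -> exists2 kG, 0 <= kG &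
  forall (x q D : V) (s eta : R), X x -> - (1 / 4) <= err p x s -> 0 < eta ->
  eta * dotX (zdir p x q s) D <= - enormX D ^+ 2 ->
  eta * (lT * dotX (perr p x q) D) <=
    - (3 / 8 * enormX D ^+ 2) + eta ^+ 2 * (kG + kE * err p x s ^+ 2).
Proof.
move=> kE0; have l := lT_gt0 p; have l00 := lam0_gt0 p; have r0 := rho_gt0 p.
pose ep := kE * l0 / (2 * lT).
have ep0 : 0 < ep by rewrite /ep divr_gt0 ?mulr_gt0.
have [K1 K10 HK] := ln_growth r0 ep0.
have Lg0 := Lg_ge0 p.
pose kG := lT * (K1 + ep * (2 * E0 ^+ 2)) / l0 + lT * (4 / 3 * lT * Lgp ^+ 2).
have kG0 : 0 <= kG.
  apply: addr_ge0; last first.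
    by apply: mulr_ge0; [exact: ltW|apply: mulr_ge0; [exact: mulr_ge0 (ltW _)|exact: sqr_ge0]].
  apply: divr_ge0; last exact: ltW.
  apply: mulr_ge0; first exact: ltW.
  apply: addr_ge0 => //; apply: mulr_ge0; first exact: ltW.
  by apply: mulr_ge0 => //; exact: sqr_ge0.
exists kG => // x q D s eta Xx he eta0 hz.
have s34 := s_ge Xx he; have sl := s_le s Xx; have x0 := X_gt0 Xx; have xT := X_le_lT Xx.
have s0 : 0 < s by apply: lt_le_trans s34; rewrite divr_gt0.
set e := err p x s in he sl *; set z := zdir p x q s in hz *.
set N := enormX D in hz *.
have N0 : 0 <= N by exact: enormX_ge0.
pose A := s / x.2; have A0 : 0 < A by rewrite divr_gt0.
set m := `|ln s| + rho p.
have m0 : 0 <= m by rewrite addr_ge0 ?(ltW r0).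
have pE : dotX (perr p x q) D = A * dotX z D - A * ((ln s + rho p) * D.2) - dotX (grad_gavg p x) D.
  rewrite /perr dotXBl; congr (_ - _).
  rewrite /z /zdir dotXDl dotXZl /dotX/= dotv0l add0r /A; field.
  by rewrite !gt_eqF.
have b1 : - ((ln s + rho p) * D.2) <= m * N.
  rewrite -mulrN; apply: le_trans (ler_norm _) _; rewrite normrM normrN.
  apply: ler_pM => //; last exact: norm2_le_X.
  by apply: le_trans (ler_normD _ _) _; rewrite (gtr0_norm r0).
have b2 : - dotX (grad_gavg p x) D <= Lgp * N.
  have h := dotX_le (grad_gavg p x) D; have g := grad_gavg_le Xx; rewrite -/N in h.
  have h2 := ler_wpM2r N0 g.
  by have /ler_normlP[u _] := h; clear -u h2; lra.
have eA0 : 0 < eta * A by rewrite mulr_gt0.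
have c1 := ler_wpM2l (ltW eA0) b1; have c2 := ler_wpM2l (ltW eta0) b2.
have c3 := ler_wpM2l (ltW A0) hz.
have d1 : eta * A * (m * N) <= A * N ^+ 2 / 4 + eta ^+ 2 * (A * m ^+ 2).
  have h := mulr_ge0 (ltW A0) (sqr_ge0 (N / 2 - eta * m)); clear -h; lra.
have d2 : eta * (Lgp * N) <= A * N ^+ 2 / 4 + eta ^+ 2 * (A^-1 * Lgp ^+ 2).
  have iA0 : 0 <= A^-1 by rewrite invr_ge0 ltW.
  have h := mulr_ge0 iA0 (sqr_ge0 (A * N / 2 - eta * Lgp)).
  have -> : eta * (Lgp * N) = A * A^-1 * (eta * (Lgp * N)) by rewrite divff ?mul1r// gt_eqF.
  have E1 : A * N ^+ 2 / 4 = A * A^-1 * (A * N ^+ 2 / 4) by rewrite divff ?mul1r// gt_eqF.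
  by rewrite E1; clear -h; lra.
have iA : A^-1 <= 4 / 3 * lT.
  rewrite /A invf_div [4 / 3 * _]mulrC; apply: ler_pM => //; rewrite ?(ltW x0) ?invr_ge0 ?(ltW s0)//.
  have -> : 4 / 3 = (3 / 4)^-1 :> R by field.
  by rewrite lef_pV2 ?posrE// divr_gt0.
have lA : 3 / 4 <= lT * A.
  rewrite /A mulrA ler_pdivlMr// [lT * s]mulrC; apply: ler_pM => //; exact: ltW.
have Am : A * m ^+ 2 <= (K1 + ep * s ^+ 2) / l0.
  have h := HK s s34; rewrite -/m in h.
  have -> : A * m ^+ 2 = s * m ^+ 2 * x.2^-1 by rewrite /A mulrAC.
  have /andP[i0 i1] := X_inv Xx.
  by apply: ler_pM => //; rewrite mulr_ge0 ?sqr_ge0// ltW.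
have s2 : s ^+ 2 <= 2 * E0 ^+ 2 + 2 * e ^+ 2.
  have h1 : s ^+ 2 <= (E0 + e) ^+ 2.
    by rewrite ler_sqr ?nnegrE ?(ltW s0)// (le_trans (ltW s0)).
  by have h2 := sqr_ge0 (E0 - e); clear -h1 h2; lra.
have e20 : 0 <= eta ^+ 2 by exact: sqr_ge0.
have m1 : eta * dotX (perr p x q) D <= - (A / 2 * N ^+ 2) +
    eta ^+ 2 * (A * m ^+ 2 + A^-1 * Lgp ^+ 2).
  by rewrite pE; clear -c1 c2 c3 d1 d2; lra.
have m2 : A * m ^+ 2 + A^-1 * Lgp ^+ 2 <= (K1 + ep * (2 * E0 ^+ 2 + 2 * e ^+ 2)) / l0 +
    4 / 3 * lT * Lgp ^+ 2.
  apply: lerD; last by rewrite ler_wpM2r ?sqr_ge0.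
  by apply: le_trans Am _; rewrite ler_pM2r ?invr_gt0// lerD2l ler_pM2l.
have m3 := ler_wpM2l e20 m2.
have m4 : eta * dotX (perr p x q) D <= - (A / 2 * N ^+ 2) +
  eta ^+ 2 * ((K1 + ep * (2 * E0 ^+ 2 + 2 * e ^+ 2)) / l0 + 4 / 3 * lT * Lgp ^+ 2).
  by clear -m1 m3; lra.
have m5 := ler_wpM2l (ltW l) m4.
have m6 : 3 / 8 * N ^+ 2 <= lT * (A / 2 * N ^+ 2).
  have h := ler_wpM2r (sqr_ge0 N) lA; clear -h; lra.
have kEE : kE = lT * (2 * ep) / l0 by rewrite /ep; field; rewrite !gt_eqF.
have -> : kG + kE * e ^+ 2 = lT * ((K1 + ep * (2 * E0 ^+ 2 + 2 * e ^+ 2)) / l0 +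
    4 / 3 * lT * Lgp ^+ 2) by rewrite kEE /kG; field; rewrite gt_eqF.
by clear -m5 m6; lra.
Qed.

Lemma E0_ge1 : 1 <= E0.
Proof.
by rewrite /eC -expR0 ler_expR divr_ge0 ?dC_ge0// ltW// lam0_gt0.
Qed.

Lemma err_abs_s x s : X x -> `|err p x s| - E0 <= `|s|.
Proof.
move=> Xx; have h := gavg_le Xx; have h1 := gavg_ge1 Xx.
rewrite /err; have := ler_normB s (gav x).
have -> : `|gav x| = gav x by rewrite ger0_norm// (le_trans ler01).
by move=> u; clear -h u; lra.
Qed.

(** For large [|e|] one has [|s| >= |e| / 2], so a step has length at most
    [eta * O((1 + P) / |e| + |ln s| + 1)]. After squaring and multiplying by [|e|], the first part
    is [eta^2 * O((1 + P^2) / |e|)] and the second is controlled by [ln_growth]; both are small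
    relative to [1 + eta^2 * P^2]. *)
Lemma far_bound (kS' : R) : 0 < kS' -> exists kR' M, 0 <= kR' /\
  forall (x q : V) (s eta N : R), X x -> 0 < eta -> M * eta <= 1 -> kR' <= `|err p x s| ->
  0 <= N -> N <= eta * enormX (zdir p x q s) ->
  `|err p x s| * N ^+ 2 <= kS' * (1 + eta ^+ 2 * err_norm p x q s ^+ 2).
Proof.
move=> kS0; have l := lT_gt0 p; have r0 := rho_gt0 p; have E1 := E0_ge1; have Lg0 := Lg_ge0 p.
have ep0 : 0 < kS' / 32 by rewrite divr_gt0.
have [K1 K10 HK] := ln_growth r0 ep0.
set Q := (lT * Lgp) ^+ 2.
have Q0 : 0 <= Q by exact: sqr_ge0.
set R1 := 32 / kS' * (Q + 1).
have R10 : 0 <= R1 by rewrite /R1 mulr_ge0 ?addr_ge0// divr_ge0// ltW.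
have [M1 M1ge M1P] := upper_const [:: 8 * K1 / kS'].
exists (2 * E0 + R1), M1; split.
  by rewrite addr_ge0// mulr_ge0// (le_trans ler01).
move=> x q s eta N Xx eta0 eta_le far N0 Nle.
have small c : c <= M1 -> c * eta <= 1.
  by move=> cM; apply: le_trans eta_le; rewrite ler_pM2r.
have e1 : eta <= 1 by rewrite -[eta]mul1r small.
have ee : eta ^+ 2 <= eta by rewrite expr2 ler_piMl// ltW.
have e20 := sqr_ge0 eta.
have sK : 8 * K1 * eta <= kS'.
  have : 8 * K1 / kS' * eta <= 1 by apply: small; apply: M1P; rewrite !inE eqxx.
  by rewrite mulrAC ler_pdivrMr// mul1r.
set e := err p x s in far *; set P := err_norm p x q s.
have P0 : 0 <= P by exact: wnorm_ge0.
have eP : `|e| <= P by exact: wnorm_ge_e.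
have se := err_abs_s s Xx; rewrite -/e in se.
set a := `|e| in far eP se *.
have a2 : 2 * E0 <= a by clear -far R10; lra.
have aR : R1 <= a by clear -far E1; lra.
have s2 : a / 2 <= `|s| by clear -se a2; lra.
have s1 : 1 <= `|s| by clear -s2 a2 E1; lra.
have a0 : 0 < a by clear -a2 E1; lra.
have s_neq : s != 0 by rewrite -normr_gt0 (lt_le_trans ltr01).
have sp : 0 < `|s| by rewrite normr_gt0.
have z1 := zdir_le q Xx s_neq; rewrite -/P in z1.
set m := `|ln s| + rho p in z1.
have m0 : 0 <= m by rewrite addr_ge0// ltW.
set B := lT * Lgp + P in z1.
have B0 : 0 <= B by rewrite addr_ge0// mulr_ge0// ltW.
have is2 : `|s|^-1 <= 2 / a.
  have -> : 2 / a = (a / 2)^-1 by rewrite invf_div.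
  by rewrite lef_pV2 ?posrE// divr_gt0.
have z2 : enormX (zdir p x q s) <= 2 / a * B + m.
  by apply: le_trans z1 _; rewrite lerD2r ler_wpM2r.
have N2 : N ^+ 2 <= eta ^+ 2 * (2 * (2 / a * B) ^+ 2 + 2 * m ^+ 2).
  have h1 : N <= eta * (2 / a * B + m) by apply: le_trans Nle _; rewrite ler_pM2l.
  have h2 : N ^+ 2 <= (eta * (2 / a * B + m)) ^+ 2.
    by rewrite ler_sqr ?nnegrE// (le_trans N0).
  apply: le_trans h2 _; rewrite exprMn ler_wpM2l//.
  by have h := sqr_ge0 (2 / a * B - m); clear -h; lra.
have am : a * m ^+ 2 <= 2 * (K1 + kS' / 32 * (4 * P ^+ 2)).
  (* [ln] vanishes on nonpositive reals, so there only [rho] remains of the second part and the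
     growth bound at [a] is more than enough. *)
  have [sn|sn] := leP s 0.
    have mE : m = rho p by rewrite /m ln0// normr0 add0r.
    have h : a * (`|ln a| + rho p) ^+ 2 <= K1 + kS' / 32 * a ^+ 2.
      by apply: HK; clear -a2 E1; lra.
    have h1 : m ^+ 2 <= (`|ln a| + rho p) ^+ 2.
      by rewrite mE ler_sqr ?nnegrE ?addr_ge0 ?(ltW r0)// lerDr.
    have h2 := ler_wpM2l (ltW a0) h1.
    have h3 : a ^+ 2 <= P ^+ 2 by rewrite ler_sqr ?nnegrE ?(ltW a0).
    have h4 := ler_wpM2l (ltW ep0) h3.
    have h5 := mulr_ge0 (ltW ep0) (sqr_ge0 P).
    by clear -h h2 h4 h5 K10; lra.
  rewrite gtr0_norm// in s1 s2.
  have h : s * m ^+ 2 <= K1 + kS' / 32 * s ^+ 2 by apply: HK; clear -s1; lra.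
  have h1 : a / 2 * m ^+ 2 <= s * m ^+ 2 by rewrite ler_wpM2r ?sqr_ge0.
  have sle : s <= 2 * P.
    have := s_le s Xx; rewrite -/e => u.
    have u2 : e <= a by exact: ler_norm.
    by clear -u u2 a2 eP E1; lra.
  have h3 : s ^+ 2 <= (2 * P) ^+ 2 by rewrite ler_sqr ?nnegrE ?(ltW sn) ?mulr_ge0.
  have h4 := ler_wpM2l (ltW ep0) h3.
  by clear -h h1 h4; lra.
have aB : a * (2 / a * B) ^+ 2 <= kS' / 4 * (Q + P ^+ 2) / (Q + 1).
  have -> : a * (2 / a * B) ^+ 2 = 4 * B ^+ 2 / a by field; rewrite gt_eqF.
  have Q1 : 0 < Q + 1 by rewrite ltr_wpDl.
  have B2 : B ^+ 2 <= 2 * (Q + P ^+ 2).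
    by rewrite /B /Q; have h := sqr_ge0 (lT * Lgp - P); clear -h; lra.
  have QP : 0 <= Q + P ^+ 2 by rewrite addr_ge0 ?sqr_ge0.
  rewrite ler_pdivrMr//.
  have h : R1 * (kS' / 4 * (Q + P ^+ 2) / (Q + 1)) <= a * (kS' / 4 * (Q + P ^+ 2) / (Q + 1)).
    rewrite ler_wpM2r//; apply: divr_ge0; last exact: ltW.
    by apply: mulr_ge0 => //; apply: divr_ge0 => //; exact: ltW.
  have hR : R1 * (kS' / 4 * (Q + P ^+ 2) / (Q + 1)) = 8 * (Q + P ^+ 2).
    by rewrite /R1; field; rewrite !gt_eqF.
  by rewrite hR in h; clear -h B2; lra.
have Qd : (Q + P ^+ 2) / (Q + 1) * eta ^+ 2 <= 1 + eta ^+ 2 * P ^+ 2.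
  have Q1 : 0 < Q + 1 by rewrite ltr_wpDl.
  rewrite mulrAC ler_pdivrMr//.
  have e21 : eta ^+ 2 <= 1 by apply: le_trans ee e1.
  have u1 := ler_wpM2r Q0 e21.
  have u2 := mulr_ge0 Q0 (mulr_ge0 e20 (sqr_ge0 P)).
  by clear -u1 u2; lra.
have f1 := ler_wpM2l (ltW a0) N2.
have f2 := ler_wpM2l e20 am.
have f3 := ler_wpM2l e20 aB.
have f4 := ler_wpM2l (ltW kS0) Qd.
have f5 : 8 * K1 * eta ^+ 2 <= kS'.
  by apply: le_trans sK; rewrite ler_wpM2l// mulr_ge0.
have f6 : 0 <= kS' * (eta ^+ 2 * P ^+ 2).
  by apply: mulr_ge0; [exact: ltW|apply: mulr_ge0; exact: sqr_ge0].
clear -f1 f2 f3 f4 f5 f6; lra.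
Qed.

Lemma near_bound : exists2 kZ', 0 <= kZ' & forall (x q : V) (s : R), X x ->
  err_norm p x q s ^+ 2 <= 1 / 16 -> - (1 / 4) <= err p x s /\ enormX (zdir p x q s) <= kZ'.
Proof.
have l := lT_gt0 p; have r0 := rho_gt0 p; have E1 := E0_ge1; have Lg0 := Lg_ge0 p.
exists (4 / 3 * (lT * Lgp + 1) + (4 / 3 * (E0 + 1) + rho p)).
  have h : 0 <= lT * Lgp by apply: mulr_ge0 => //; exact: ltW.
  by clear -h E1 r0; lra.
move=> x q s Xx hP.
have P0 : 0 <= err_norm p x q s by exact: wnorm_ge0.
have P4 : err_norm p x q s <= 1 / 4.
  rewrite -ler_sqr ?nnegrE ?divr_ge0//; apply: le_trans hP _.
  by rewrite le_eqVlt; apply/orP; left; apply/eqP; field.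
have eP : `|err p x s| <= 1 / 4 by apply: le_trans P4; exact: wnorm_ge_e.
have /ler_normlP[e1 e2] := eP.
have he : - (1 / 4) <= err p x s by clear -e1; lra.
split=> //; have s34 := s_ge Xx he; have sl := s_le s Xx.
have s0 : 0 < s by apply: lt_le_trans s34; rewrite divr_gt0.
apply: le_trans (zdir_le q Xx _) _; first by rewrite gt_eqF.
rewrite (gtr0_norm s0); apply: lerD.
  have is43 : s^-1 <= 4 / 3.
    have -> : 4 / 3 = (3 / 4)^-1 :> R by field.
    by rewrite lef_pV2 ?posrE// divr_gt0.
  have i0 : 0 <= s^-1 by rewrite invr_ge0 ltW.
  have h : 0 <= lT * Lgp by apply: mulr_ge0 => //; exact: ltW.
  have B1 : lT * Lgp + err_norm p x q s <= lT * Lgp + 1 by clear -P4; lra.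
  exact: ler_pM i0 (addr_ge0 h P0) is43 B1.
rewrite lerD2r.
have m0 : 0 < 3 / 4 :> R by rewrite divr_gt0.
have m1 : 3 / 4 <= 1 :> R by rewrite ler_pdivrMr// mul1r ler_nat.
have := ln_dist m0 m1 s34; rewrite ln1 subr0.
have -> : (3 / 4)^-1 = 4 / 3 :> R by field.
have h : `|s - 1| <= E0 + 1 by rewrite ler_norml; apply/andP; split; clear -s34 sl e2 E1; lra.
by move=> u; clear -u h; lra.
Qed.

(** Of the decrease [|x' - x|^2], one half goes to the error of the direction by Young's inequality
    and 1/16 to the curvature, as [16 * K * eta <= 1]; 7/16 remains. *)
Lemma descent_bound : exists M, forall (x x' q : V) (s eta : R), X x -> X x' ->
  - (1 / 4) <= err p x s -> 0 < eta -> M * eta <= 1 ->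
  eta * dotX (zdir p x q s) (x' - x) <= - enormX (x' - x) ^+ 2 ->
  eta * Fo x' <= eta * Fo x - 7 / 16 * enormX (x' - x) ^+ 2 +
    16 / 9 * eta ^+ 2 * err_norm p x q s ^+ 2.
Proof.
have [K K0 HK] := smooth_F p.
exists (16 * K) => x x' q s eta Xx Xx' he eta0 small hz.
have [_ _ _ h4] := HK _ _ Xx Xx'.
have ze := zdir_err q Xx he.
set D := x' - x in hz h4 *; set N := enormX D in hz h4 *.
set z := zdir p x q s in hz ze *; set P := err_norm p x q s in ze *.
have N0 : 0 <= N by exact: enormX_ge0.
have F1 : Fo x' <= Fo x + dotX (grad_F p x) D + K * N ^+ 2.
  by have := ler_norm (Fo x' - Fo x - dotX (grad_F p x) D); clear -h4; lra.
have F2 : dotX (grad_F p x) D = dotX z D - dotX (z - grad_F p x) D by rewrite dotXBl; ring.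
have F3 : - dotX (z - grad_F p x) D <= enormX (z - grad_F p x) * N.
  by have /ler_normlP[u _] := dotX_le (z - grad_F p x) D; rewrite -/N in u; clear -u; lra.
have F4 : eta * (enormX (z - grad_F p x) * N) <= N ^+ 2 / 2 + eta ^+ 2 * enormX (z - grad_F p x) ^+ 2 / 2.
  by have h := sqr_ge0 (N - eta * enormX (z - grad_F p x)); clear -h; lra.
have F5 := ler_wpM2l (sqr_ge0 eta) ze.
have F6 : eta * (K * N ^+ 2) <= N ^+ 2 / 16.
  by have h := ler_wpM2r (sqr_ge0 N) small; clear -h; lra.
have F7 := ler_wpM2l (ltW eta0) F1.
have F8 := ler_wpM2l (ltW eta0) F3.
rewrite F2 in F7.
by clear -hz F4 F5 F6 F7 F8; lra.
Qed.

End StepBounds.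

(** * Noise of the recursive estimates *)

Section Noise.
Variables (R : realType) (d n : nat) (p : losses R d n).
Local Notation V := ('rV[R]_d * R)%type.
Local Notation lT := (lamt (dC p) (lam0 p) (rho p)).
Local Notation g i := (gi (dl p) i).
Local Notation gav := (gavg (dl p)).

Definition nextq (be : R) (x x' q : V) (i : 'I_n) : V :=
  grad_gi p i x' + scaleX (1 - be) (q - grad_gi p i x).
Definition nexts (be : R) (x x' : V) (s : R) (i : 'I_n) : R :=
  g i x' + (1 - be) * (s - g i x).

Definition noise_grad (be : R) (x x' : V) (i : 'I_n) : V :=
  (grad_gi p i x' - grad_gavg p x') - scaleX (1 - be) (grad_gi p i x - grad_gavg p x).
Definition noise_val (be : R) (x x' : V) (i : 'I_n) : R :=
  (g i x' - gav x') - (1 - be) * (g i x - gav x).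
Definition noise_norm (be : R) (x x' : V) (i : 'I_n) : R := wnorm p (noise_grad be x x' i) (noise_val be x x' i).

Lemma perr_next be x x' q i :
  perr p x' (nextq be x x' q i) = scaleX (1 - be) (perr p x q) + noise_grad be x x' i.
Proof.
rewrite /perr /nextq /noise_grad /scaleX; congr pair => /=; last by ring.
by apply/rowP => j; move: (gwi _ _ _ x') (gwi _ _ _ x) (gwavg _ _ x') (gwavg _ _ x) => *;
  rewrite !mxE; ring.
Qed.

Lemma err_next be x x' s i :
  err p x' (nexts be x x' s i) = (1 - be) * err p x s + noise_val be x x' i.
Proof. by rewrite /err /nexts /noise_val; ring. Qed.

Lemma avg_dg_dot x y : avg (fun i => dotX (grad_gi p i x) y) = dotX (grad_gavg p x) y.
Proof. by rewrite grad_gavgE dotX_avg. Qed.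

Lemma avg_noise_grad be x x' y : avg (fun i => dotX (noise_grad be x x' i) y) = 0.
Proof.
have n0 := d_n p.
rewrite (@eq_avg _ _ _ (fun i => (dotX (grad_gi p i x') y - dotX (grad_gavg p x') y) -
   (1 - be) * (dotX (grad_gi p i x) y - dotX (grad_gavg p x) y))).
  by rewrite !avgB avgZ avgB !avg_cst// !avg_dg_dot !subrr mulr0 subrr.
by move=> i; rewrite /noise_grad dotXBl dotXZl !dotXBl.
Qed.

Lemma avg_noise_val be x x' : avg (noise_val be x x') = 0.
Proof.
have key (a b : R) (f h : 'I_n -> R) : avg (fun i => (f i - a) - (1 - be) * (h i - b)) =
    (avg f - a) - (1 - be) * (avg h - b).
  by rewrite !avgB avgZ avgB !avg_cst// (d_n p).
apply: etrans (key (gav x') (gav x) (fun i => g i x') (fun i => g i x)) _.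
by rewrite !subrr mulr0 subrr.
Qed.

Lemma wnorm_comb (t e f : R) (a b : V) : wnorm p (scaleX t a + b) (t * e + f) ^+ 2 =
  t ^+ 2 * wnorm p a e ^+ 2 + 2 * t * (lT ^+ 2 * dotX b a + err_weight p ^+ 2 * (e * f)) + wnorm p b f ^+ 2.
Proof.
by rewrite !wnorm_sq dotXDl !dotXDr !dotXZl !dotXZr (dotXC a b); ring.
Qed.

Lemma avg_wnorm_next be x x' q s :
  avg (fun i => err_norm p x' (nextq be x x' q i) (nexts be x x' s i) ^+ 2) =
  (1 - be) ^+ 2 * err_norm p x q s ^+ 2 + avg (fun i => noise_norm be x x' i ^+ 2).
Proof.
have n0 := d_n p.
rewrite (@eq_avg _ _ _ (fun i => ((1 - be) ^+ 2 * err_norm p x q s ^+ 2 + noise_norm be x x' i ^+ 2) +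
   (2 * (1 - be) * lT ^+ 2 * dotX (noise_grad be x x' i) (perr p x q) +
    2 * (1 - be) * err_weight p ^+ 2 * err p x s * noise_val be x x' i))).
  by rewrite !avgD avg_cst// !avgZ avg_noise_grad avg_noise_val !mulr0 !addr0.
by move=> i; rewrite /err_norm perr_next err_next wnorm_comb -/(noise_norm be x x' i); ring.
Qed.

Lemma dev_wnorm_next be x x' q s i : 0 <= be <= 1 ->
  `|err_norm p x' (nextq be x x' q i) (nexts be x x' s i) ^+ 2 - (1 - be) ^+ 2 * err_norm p x q s ^+ 2|
  <= noise_norm be x x' i * (2 * err_norm p x q s + noise_norm be x x' i).
Proof.
move=> /andP[b0 b1].
have -> : err_norm p x' (nextq be x x' q i) (nexts be x x' s i) ^+ 2 - (1 - be) ^+ 2 * err_norm p x q s ^+ 2 =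
  2 * (1 - be) * (lT ^+ 2 * dotX (perr p x q) (noise_grad be x x' i) +
      err_weight p ^+ 2 * (err p x s * noise_val be x x' i)) + noise_norm be x x' i ^+ 2.
  by rewrite /err_norm perr_next err_next wnorm_comb -/(noise_norm be x x' i) (dotXC (noise_grad _ _ _ _)); ring.
have h := wnorm_dot p (perr p x q) (err p x s) (noise_grad be x x' i) (noise_val be x x' i).
rewrite -/(err_norm p x q s) -/(noise_norm be x x' i) in h.
apply: le_trans (ler_normD _ _) _.
rewrite normrM (ger0_norm (sqr_ge0 _)) (ger0_norm (_ : 0 <= 2 * (1 - be))); last first.
  by rewrite mulr_ge0// subr_ge0.
set u := `|_| in h *.
have u0 : 0 <= u by exact: normr_ge0.
have v : be * u >= 0 by rewrite mulr_ge0.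
by clear -h v; lra.
Qed.

(** Variance reduction: the centered increment is of the order of the step, and the sampling error
    itself enters only with the factor [be]. *)
Lemma noise_gradE be x x' i : noise_grad be x x' i =
  ((grad_gi p i x' - grad_gi p i x) - (grad_gavg p x' - grad_gavg p x)) + scaleX be (grad_gi p i x - grad_gavg p x).
Proof.
rewrite /noise_grad /scaleX; congr pair => /=; last by ring.
by apply/rowP => j; move: (gwi _ _ _ x') (gwi _ _ _ x) (gwavg _ _ x') (gwavg _ _ x) => *;
  rewrite !mxE; ring.
Qed.

Lemma noise_valE be x x' i : noise_val be x x' i =
  ((g i x' - g i x) - (gav x' - gav x)) + be * (g i x - gav x).
Proof. by rewrite /noise_val; ring. Qed.

End Noise.

Section NoiseSize.
Variables (R : realType) (d n : nat) (p : losses R d n).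
Local Notation V := ('rV[R]_d * R)%type.
Local Notation C := (dC p).
Local Notation l0 := (lam0 p).
Local Notation lT := (lamt (dC p) (lam0 p) (rho p)).
Local Notation X := (Xset (dW p) (lam0 p) lT).
Local Notation g i := (gi (dl p) i).
Local Notation gav := (gavg (dl p)).
Local Notation Fo := (Fobj (dl p) (rho p)).
Local Notation Lgp := (Lg (dG p) (dC p) (lam0 p)).
Local Notation Lngp := (Lng (dG p) (dC p) (dL p) (lam0 p)).
Local Notation LFp := (LF (dG p) (dC p) (dL p) (lam0 p) (rho p)).
Local Notation E0 := (eC (dC p) (lam0 p)).

Lemma gav_lip x x' : X x -> X x' -> `|gav x' - gav x| <= Lgp * enormX (x' - x).
Proof.
move=> Xx Xx'.
have -> : gav x' - gav x = avg (fun i => g i x' - g i x) by rewrite avgB.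
rewrite ler_norml; apply/andP; split.
  rewrite lerNl -avgN; apply: avg_bound => [|i]; first exact: (d_n p).
  by have /ler_normlP[] := gi_lip i Xx Xx'.
apply: avg_bound => [|i]; first exact: (d_n p).
by have /ler_normlP[] := gi_lip i Xx Xx'.
Qed.

Lemma grad_gi_dev i x : X x -> enormX (grad_gi p i x - grad_gavg p x) <= 2 * Lgp.
Proof.
move=> Xx; apply: le_trans (enormXB _ _) _.
by have h1 := grad_gi_le i Xx; have h2 := grad_gavg_le Xx; clear -h1 h2; lra.
Qed.

Lemma g_dev i x : X x -> `|g i x - gav x| <= E0.
Proof.
move=> Xx; have h1 := gi_ge1 i Xx; have h2 := gavg_ge1 Xx.
have h3 := gi_le i Xx; have h4 := gavg_le Xx.
by rewrite ler_norml; apply/andP; split; clear -h1 h2 h3 h4; lra.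
Qed.

Lemma noise_norm_le be x x' i : X x -> X x' -> 0 <= be ->
  noise_norm p be x x' i <= (lT * (2 * Lngp) + err_weight p * (2 * Lgp)) * enormX (x' - x) +
    be * (lT * (2 * Lgp) + err_weight p * E0).
Proof.
move=> Xx Xx' b0; have l := ltW (lT_gt0 p); have w := err_weight_ge0 p.
set D := enormX (x' - x).
have h1 : enormX (noise_grad p be x x' i) <= 2 * Lngp * D + be * (2 * Lgp).
  rewrite noise_gradE; apply: le_trans (enormXD _ _) _; apply: lerD.
    apply: le_trans (enormXB _ _) _.
    by have u1 := grad_gi_lip i Xx Xx'; have u2 := grad_gavg_lip Xx Xx'; rewrite /D; clear -u1 u2; lra.
  by rewrite enormXZ ger0_norm// ler_wpM2l// grad_gi_dev.
have h2 : `|noise_val p be x x' i| <= 2 * Lgp * D + be * E0.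
  rewrite noise_valE; apply: le_trans (ler_normD _ _) _; apply: lerD.
    apply: le_trans (ler_normB _ _) _.
    by have u1 := gi_lip i Xx Xx'; have u2 := gav_lip Xx Xx'; rewrite /D; clear -u1 u2; lra.
  by rewrite normrM (ger0_norm b0) ler_wpM2l// g_dev.
apply: le_trans (wnorm_le p _ _) _.
by have u1 := ler_wpM2l l h1; have u2 := ler_wpM2l w h2; clear -u1 u2; lra.
Qed.

Lemma noise_moment be x x' : X x -> X x' ->
  avg (fun i => noise_norm p be x x' i ^+ 2) <= 2 * LFp ^+ 2 * enormX (x' - x) ^+ 2 +
    be ^+ 2 * (lT ^+ 2 * (8 * Lgp ^+ 2) + err_weight p ^+ 2 * (2 * E0 ^+ 2)).
Proof.
move=> Xx Xx'; have n0 := d_n p; set D := enormX (x' - x).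
have lT2 := sqr_ge0 lT; have w2 := sqr_ge0 (err_weight p); have be2 := sqr_ge0 be.
pose A i := grad_gi p i x' - grad_gi p i x.
have dgx : avgX A = grad_gavg p x' - grad_gavg p x by rewrite !grad_gavgE -avgXB.
have h1 : avg (fun i => enormX (noise_grad p be x x' i) ^+ 2) <=
    2 * (Lngp ^+ 2 * D ^+ 2) + be ^+ 2 * (8 * Lgp ^+ 2).
  apply: (@le_trans _ _ (avg (fun i => 2 * enormX (A i - avgX A) ^+ 2 + be ^+ 2 * (8 * Lgp ^+ 2)))).
    apply: avg_le => i; rewrite noise_gradE -/(A i) -dgx.
    set a := A i - avgX A; set b := grad_gi p i x - grad_gavg p x.
    have u1 : enormX (a + scaleX be b) <= enormX a + `|be| * enormX b.
      by apply: le_trans (enormXD _ _) _; rewrite enormXZ.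
    have u2 : enormX (a + scaleX be b) ^+ 2 <= (enormX a + `|be| * enormX b) ^+ 2.
      by rewrite ler_sqr ?nnegrE ?enormX_ge0// (le_trans (enormX_ge0 _) u1).
    have u3 : enormX b ^+ 2 <= (2 * Lgp) ^+ 2.
      have p2 : 0 <= 2 * Lgp by apply: mulr_ge0 => //; exact: Lg_ge0.
      by rewrite ler_sqr ?nnegrE ?enormX_ge0//; exact: grad_gi_dev.
    have u4 := ler_wpM2l be2 u3.
    have u5 := sqr_ge0 (enormX a - `|be| * enormX b).
    have u6 : `|be| ^+ 2 = be ^+ 2 by rewrite real_normK ?num_real.
    by rewrite -u6 in u4 *; clear -u2 u4 u5; lra.
  rewrite avgD avgZ avg_cst// lerD2r ler_wpM2l//.
  apply: le_trans (avg_centered_sq _ n0) _; apply: avg_bound => // i.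
  have p2 : 0 <= Lngp * D by apply: mulr_ge0; [exact: Lng_ge0|exact: enormX_ge0].
  by rewrite -exprMn ler_sqr ?nnegrE ?enormX_ge0//; exact: grad_gi_lip.
pose B i := g i x' - g i x.
have gx : avg B = gav x' - gav x by rewrite /B avgB.
have h2 : avg (fun i => noise_val p be x x' i ^+ 2) <=
    2 * (Lgp ^+ 2 * D ^+ 2) + be ^+ 2 * (2 * E0 ^+ 2).
  apply: (@le_trans _ _ (avg (fun i => 2 * (B i ^+ 2 + (- (2 * avg B) * B i + avg B ^+ 2)) +
      be ^+ 2 * (2 * E0 ^+ 2)))).
    apply: avg_le => i; rewrite noise_valE -/(B i) -gx.
    have u3 : (g i x - gav x) ^+ 2 <= E0 ^+ 2.
      rewrite -[leLHS]real_normK ?num_real// ler_sqr ?nnegrE ?g_dev//.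
      exact: le_trans ler01 (E0_ge1 p).
    set b := g i x - gav x in u3 *.
    have u4 := ler_wpM2l be2 u3.
    have u5 := sqr_ge0 ((B i - avg B) - be * b).
    by clear -u4 u5; lra.
  rewrite avgD avgZ avg_cst// lerD2r ler_wpM2l// avgD avgD avgZ avg_cst//.
  have b2 : avg (fun i => B i ^+ 2) <= Lgp ^+ 2 * D ^+ 2.
    apply: avg_bound => // i.
    have p2 : 0 <= Lgp * D by apply: mulr_ge0; [exact: Lg_ge0|exact: enormX_ge0].
    by rewrite -exprMn -[leLHS]real_normK ?num_real// ler_sqr ?nnegrE//; exact: gi_lip.
  by have u := sqr_ge0 (avg B); clear -b2 u; lra.
rewrite (@eq_avg _ _ _ (fun i => lT ^+ 2 * enormX (noise_grad p be x x' i) ^+ 2 +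
    err_weight p ^+ 2 * noise_val p be x x' i ^+ 2)); last by move=> i; rewrite wnorm_sq enormX_sq.
rewrite avgD !avgZ.
have u1 := ler_wpM2l lT2 h1; have u2 := ler_wpM2l w2 h2.
have u3 := ler_wpM2r (sqr_ge0 D) (LF_sq_ge p).
by clear -u1 u2 u3; lra.
Qed.

Lemma err_moment_dev be x x' q i : X x' ->
  `|err_moment p x' (nextq p be x x' q i) - (1 - be) * (err_moment p x q + lT * dotX (perr p x q) (x' - x))|
  <= (dR p + lT) * noise_norm p be x x' i.
Proof.
move=> Xx'; have l := ltW (lT_gt0 p).
have -> : err_moment p x' (nextq p be x x' q i) -
   (1 - be) * (err_moment p x q + lT * dotX (perr p x q) (x' - x)) = lT * dotX (noise_grad p be x x' i) x'.
  by rewrite /err_moment perr_next; move: (perr p x q) => r; rewrite dotXDl dotXZl dotXBr; ring.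
rewrite normrM ger0_norm//.
have h1 := dotX_le (noise_grad p be x x' i) x'; have h2 := X_bounded Xx'.
have h3 := wnorm_ge_p p (noise_grad p be x x' i) (noise_val p be x x' i).
have h4 : lT * enormX (noise_grad p be x x' i) * enormX x' <= noise_norm p be x x' i * (dR p + lT).
  by apply: ler_pM => //; rewrite ?mulr_ge0 ?enormX_ge0.
have h5 := ler_wpM2l l h1.
by clear -h4 h5; lra.
Qed.

Lemma avg_err_moment be x x' q :
  avg (fun i => err_moment p x' (nextq p be x x' q i)) =
  (1 - be) * (err_moment p x q + lT * dotX (perr p x q) (x' - x)).
Proof.
have n0 := d_n p.
rewrite (@eq_avg _ _ _ (fun i => (1 - be) * (err_moment p x q + lT * dotX (perr p x q) (x' - x)) +
   lT * dotX (noise_grad p be x x' i) x')).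
  by rewrite avgD avg_cst// avgZ avg_noise_grad mulr0 addr0.
by move=> i; rewrite /err_moment perr_next; move: (perr p x q) => r; rewrite dotXDl dotXZl dotXBr; ring.
Qed.

Lemma err_moment_le x q s : X x -> `|err_moment p x q| <= (dR p + lT) * err_norm p x q s.
Proof.
move=> Xx; have l := ltW (lT_gt0 p); rewrite /err_moment normrM ger0_norm//.
have h1 := dotX_le (perr p x q) x; have h2 := X_bounded Xx.
have h3 := wnorm_ge_p p (perr p x q) (err p x s).
have h4 : lT * enormX (perr p x q) * enormX x <= err_norm p x q s * (dR p + lT).
  by apply: ler_pM => //; rewrite ?mulr_ge0 ?enormX_ge0.
have h5 := ler_wpM2l l h1.
by clear -h4 h5; lra.
Qed.

Lemma Fobj_le x : X x -> Fo x <= lT * (C / l0 + rho p).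
Proof.
move=> Xx; rewrite FobjE; have g1 := gavg_ge1 Xx; have g2 := gavg_le Xx.
have r0 := ltW (rho_gt0 p).
apply: ler_pM; rewrite ?(ltW (X_gt0 Xx)) ?addr_ge0 ?ln_ge0//.
  exact: X_le_lT.
rewrite lerD2r -[leRHS]expRK ler_ln ?posrE ?expR_gt0//; exact: lt_le_trans ltr01 g1.
Qed.

(** Outside [X] the extended objective is infinite and nothing has to be shown; on [X] the normal
    vector has the favourable sign and the quadratic remainder is at most [eps * |y - x|] within the
    chosen radius. *)
Lemma subdiff_normal x w : X x -> (forall y, X y -> dotX w (y - x) <= 0) ->
  reg_subdiff (Fbar Fo X) x (grad_F p x + w).
Proof.
move=> Xx hw; have [K K0 HK] := smooth_F p.
have xX : x \in X by rewrite inE.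
have FxE : Fbar Fo X x = (Fo x)%:E by rewrite /Fbar xX.
split; first by rewrite FxE.
move=> eps eps0; exists (eps / (K + 1)).
  by rewrite divr_gt0// ltr_wpDl.
move=> y /andP[y0 y1]; rewrite FxE.
have [yX|yX] := boolP (y \in X); last first.
  by rewrite /Fbar (negbTE yX); exact: leey.
rewrite /Fbar yX -!EFinB lee_fin.
have Xy : X y by rewrite inE in yX.
have [_ _ _ h] := HK _ _ Xx Xy; have h2 := hw y Xy.
rewrite dotXDl.
set N := enormX (y - x) in y0 y1 h *.
have N1 : (K + 1) * N <= eps.
  by move: y1; rewrite ltr_pdivlMr ?ltr_wpDl// mulrC => /ltW.
have N2 := ler_wpM2r (ltW y0) N1.
have N3 := sqr_ge0 N.
have /ler_normlP[u _] := h.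
by clear -u h2 N2 N3; lra.
Qed.

Lemma dist0_sq_le (S : set V) (v : V) (K : R) : S v -> enormX v ^+ 2 <= K ->
  (dist0_sq S <= K%:E)%E.
Proof.
move=> Sv vK; rewrite /dist0_sq.
set e := ereal_inf _.
have e0 : (0 <= e)%E.
  by apply: le_ereal_inf_tmp => _ [w _ <-]; rewrite lee_fin enormX_ge0.
have ev : (e <= (enormX v)%:E)%E by apply: ereal_inf_lbound; exists v.
apply: (@le_trans _ _ ((enormX v)%:E * (enormX v)%:E)%E); last by rewrite -EFinM lee_fin -expr2.
by apply: lee_pmul.
Qed.

End NoiseSize.

(** * The algorithm as an instance of the scalar recursion *)

Section Assembly.
Variables (R : realType) (d n : nat) (p : losses R d n).
Local Notation V := ('rV[R]_d * R)%type.
Local Notation C := (dC p).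
Local Notation l0 := (lam0 p).
Local Notation lT := (lamt (dC p) (lam0 p) (rho p)).
Local Notation X := (Xset (dW p) (lam0 p) lT).
Local Notation Fo := (Fobj (dl p) (rho p)).
Local Notation Lgp := (Lg (dG p) (dC p) (lam0 p)).
Local Notation Lngp := (Lng (dG p) (dC p) (dL p) (lam0 p)).
Local Notation LFp := (LF (dG p) (dC p) (dL p) (lam0 p) (rho p)).
Local Notation E0 := (eC (dC p) (lam0 p)).

Definition next_x (Pr : V -> V) (eta : R) (x q : V) (s : R) : V :=
  Pr (x - scaleX eta (zdir p x q s)).

Lemma storm_step_exists (Pr : V -> V) (c kT' : R) : is_projection X Pr ->
  130 * LFp ^+ 4 <= c -> 0 <= kT' ->
  exists (k : storm_consts R) (M : R),
  [/\ kc k = c, 96 * kL k * kE k <= kc k * kp k, 72 * kL k * kS k <= kc k,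
    kX k = dR p + lT &
  forall (x q : V) (s eta eta' : R), X x -> 0 < eta' -> eta' <= eta ->
    eta <= eta' * (1 + kT' * eta ^+ 3) -> M * eta <= 1 ->
    let x' := next_x Pr eta x q s in let be := c * eta ^+ 2 in
    storm_step k eta eta' (err p x s) (err_norm p x q s) (err_moment p x q) (Fo x + 1)
      (fun i => err p x' (nexts p be x x' s i))
      (fun i => err_norm p x' (nextq p be x x' q i) (nexts p be x x' s i))
      (fun i => err_moment p x' (nextq p be x x' q i)) (noise_norm p be x x') (Fo x' + 1)
      (enormX (x' - x)) (lT * dotX (perr p x q) (x' - x))].
Proof.
move=> HP hc kT0.
have L1 := LF_ge1 p; have Lp : 0 < LFp by exact: lt_le_trans ltr01 L1.
have L2 : 0 < LFp ^+ 2 by rewrite exprn_gt0.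
have L4 : LFp ^+ 2 <= LFp ^+ 4.
  by rewrite -[4%N]/(2 + 2)%N exprD ler_peMl ?(ltW L2)// exprn_ege1.
have c0 : 0 < c by apply: lt_le_trans hc; rewrite mulr_gt0 ?exprn_gt0.
have l := lT_gt0 p; have lw := ltW l; have wp := err_weight_ge0 p; have l00 := lam0_gt0 p.
have r0 := rho_gt0 p; have C0 := dC_ge0 p; have R0 := dR_ge0 p.
have E1 := E0_ge1 p; have Lg0 := Lg_ge0 p; have Ln0 := Lng_ge0 p.
have E00 : 0 <= E0 by exact: le_trans ler01 E1.
(* The largest values of [kE] and [kS] allowed by the two inequalities to be proved, which then hold
   with equality. *)
pose kE' := c * (3 / 8) / (96 * (2 * LFp ^+ 2)).
pose kS' := c / (72 * (2 * LFp ^+ 2)).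
have den1 : 0 < 96 * (2 * LFp ^+ 2) by apply: mulr_gt0 => //; exact: mulr_gt0.
have den2 : 0 < 72 * (2 * LFp ^+ 2) by apply: mulr_gt0 => //; exact: mulr_gt0.
have kE0 : 0 < kE' by apply: divr_gt0 => //; apply: mulr_gt0 => //; exact: divr_gt0.
have kS0 : 0 < kS' by apply: divr_gt0.
have [kG' kG0 HG] := drift_bound p kE0.
have [kR' [MR [kR0 HR]]] := far_bound p kS0.
have [kZ' kZ0 HZ] := near_bound p.
have [MF HF] := descent_bound p.
pose kB1 := lT * (2 * Lngp) + err_weight p * (2 * Lgp).
pose kB2 := lT * (2 * Lgp) + err_weight p * E0.
have kB10 : 0 <= kB1 by apply: addr_ge0; apply: mulr_ge0 => //; exact: mulr_ge0.
have kB20 : 0 <= kB2 by apply: addr_ge0; apply: mulr_ge0 => //; exact: mulr_ge0.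
pose N0 := lT ^+ 2 * (8 * Lgp ^+ 2) + err_weight p ^+ 2 * (2 * E0 ^+ 2).
have N00 : 0 <= N0.
  by apply: addr_ge0; apply: mulr_ge0; rewrite ?sqr_ge0//; apply: mulr_ge0; rewrite ?sqr_ge0.
have xb : 0 <= dR p + lT by exact: addr_ge0.
have f_kB : 0 <= kB1 + c * kB2 by apply: addr_ge0 => //; apply: mulr_ge0 => //; exact: ltW.
have f_kD : 0 <= 2 * (dR p + lT) by exact: mulr_ge0.
have f_kL : 0 < 2 * LFp ^+ 2 by exact: mulr_gt0.
have f_kC : 0 <= c ^+ 2 * N0 by apply: mulr_ge0 => //; exact: sqr_ge0.
have f_kp : 0 < 3 / 8 :> R by exact: divr_gt0.
have f_kF : 1 <= lT * (C / l0 + rho p) + 1.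
  rewrite lerDr; apply: mulr_ge0 => //; apply: addr_ge0; last exact: ltW.
  by apply: divr_ge0 => //; exact: ltW.
(* With this energy weight, [ka * kL] is exactly 1/16, and [c >= 130 * LF^4] gives
   [ka * kc >= 130/32 * LF^2], hence at least 4. *)
have f_ka : 0 < 1 / (32 * LFp ^+ 2) by apply: divr_gt0 => //; exact: mulr_gt0.
have f1 : 1 / (32 * LFp ^+ 2) * (2 * LFp ^+ 2) <= 1 / 16.
  by rewrite le_eqVlt; apply/orP; left; apply/eqP; field; rewrite gt_eqF.
have f2 : 4 <= 1 / (32 * LFp ^+ 2) * c.
  rewrite mulrAC mul1r ler_pdivlMr ?mulr_gt0//; clear -hc L4 L2; lra.
pose k := @StormConsts R (kB1 + c * kB2) (2 * (dR p + lT)) (dR p + lT) c (2 * LFp ^+ 2)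
  (c ^+ 2 * N0) (3 / 8) (lT * (C / l0 + rho p) + 1) kZ' kT' kG' kE' kS' kR'
  (1 / (32 * LFp ^+ 2)) f_kB f_kD xb c0 f_kL f_kC f_kp f_kF kZ0 kT0 kG0 (ltW kE0)
  (ltW kS0) kR0 f_ka f1 f2.
have [M1 M1ge M1P] := upper_const [:: MR; MF; c].
exists k, M1; split=> //=.
- rewrite /kE' le_eqVlt; apply/orP; left; apply/eqP; field; rewrite gt_eqF//.
- rewrite /kS' le_eqVlt; apply/orP; left; apply/eqP; field; rewrite gt_eqF//.
move=> x q s eta eta' Xx eta'0 eta'le slow eta_le.
set be := c * eta ^+ 2; set x' := next_x Pr eta x q s.
have eta0 : 0 < eta by exact: lt_le_trans eta'le.
have small K : K <= M1 -> K * eta <= 1.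
  by move=> KM; apply: le_trans eta_le; rewrite ler_pM2r.
have e1 : eta <= 1 by rewrite -[eta]mul1r small.
have ee : eta ^+ 2 <= eta by rewrite expr2 ler_piMl// ltW.
have sR : MR * eta <= 1 by apply: small; apply: M1P; rewrite !inE eqxx ?orbT.
have sF : MF * eta <= 1 by apply: small; apply: M1P; rewrite !inE eqxx ?orbT.
have sc : c * eta <= 1 by apply: small; apply: M1P; rewrite !inE eqxx ?orbT.
have be0 : 0 <= be by rewrite mulr_ge0 ?sqr_ge0// ltW.
have be1 : be <= 1 by apply: le_trans sc; rewrite ler_pM2l.
have [Xx' hz hD _] := projection_step (zdir p x q s) (@X_segment _ _ _ p) HP Xx eta0.
rewrite -/(next_x Pr eta x q s) -/x' in Xx' hz hD.
have D0 := enormX_ge0 (x' - x); have P0 : 0 <= err_norm p x q s by exact: wnorm_ge0.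
have Fb y : X y -> 1 <= Fo y + 1 /\ Fo y + 1 <= lT * (C / l0 + rho p) + 1.
  by move=> Xy; rewrite lerDr Fobj_ge0// lerD2r Fobj_le.
have [Fx1 Fx2] := Fb x Xx; have [Fx'1 Fx'2] := Fb x' Xx'.
split=> //=; rewrite -/be.
- by move=> i; exact: wnorm_ge0.
- exact: wnorm_ge_e.
- by move=> i; exact: wnorm_ge_e.
- exact: err_moment_le.
- apply: le_trans (enormXB _ _) _; have h1 := X_bounded Xx; have h2 := X_bounded Xx'.
  by clear -h1 h2; lra.
- rewrite normrM ger0_norm//.
  have h := ler_wpM2l lw (dotX_le (perr p x q) (x' - x)).
  have h2 := ler_wpM2r D0 (wnorm_ge_p p (perr p x q) (err p x s)).
  by rewrite /err_norm; clear -h h2; lra.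
- rewrite (@eq_avg _ _ _ (fun i => (1 - be) * err p x s + noise_val p be x x' i)); last first.
    by move=> i; exact: err_next.
  by rewrite avgD avg_cst ?(d_n p)// avg_noise_val addr0.
- exact: avg_wnorm_next.
- exact: avg_err_moment.
- by move=> i; exact: wnorm_ge0.
- move=> i; apply: le_trans (noise_norm_le i Xx Xx' be0) _; rewrite -/kB1 -/kB2 /be.
  have h1 := mulr_ge0 kB10 (sqr_ge0 eta).
  have h2 := mulr_ge0 (mulr_ge0 (ltW c0) kB20) D0.
  by clear -h1 h2; lra.
- apply: le_trans (noise_moment _ Xx Xx') _; rewrite -/N0 /be lerD2l.
  by rewrite le_eqVlt; apply/orP; left; apply/eqP; ring.
- move=> i; rewrite err_next addrAC subrr add0r; exact: wnorm_ge_e.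
- by move=> i; apply: dev_wnorm_next; rewrite be0.
- by move=> i; exact: err_moment_dev.
- move=> he; have h := HF _ _ q s eta Xx Xx' he eta0 sF hz.
  by clear -h; lra.
- by move=> he; exact: HG.
- by move=> far; exact: (HR _ _ _ _ _ Xx eta0 sR far D0 hD).
- move=> hP; have [_ hZ] := HZ _ _ _ Xx hP.
  by apply: le_trans hD _; rewrite mulrC ler_pM2r.
Qed.

(** The subgradient at [x'] splits into the change of the gradient, [(x - x') / eta] and the error
    of the search direction, controlled by [D], [D / eta] and [P]. The constant 11 exceeds
    [3 * 32/9], from the square of three terms and [zdir_err]. For inaccurate estimates the gradient
    alone serves as a bounded subgradient. *)
Lemma dist_bound (Pr : V -> V) : is_projection X Pr ->
  exists2 K, 0 <= K & (forall x, X x ->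
    (dist0_sq (reg_subdiff (Fbar Fo X) x) <= K%:E)%E) /\
  forall (x q : V) (s eta : R), X x -> 0 < eta -> eta <= 1 ->
    (dist0_sq (reg_subdiff (Fbar Fo X) (next_x Pr eta x q s)) <=
      (K * Dist eta (err_norm p x q s) (enormX (next_x Pr eta x q s - x)))%:E)%E.
Proof.
move=> HP; have [K K0 HK] := grad_F_lip p.
have K2 := sqr_ge0 K.
exists (3 * K ^+ 2 + 11); first by rewrite addr_ge0// mulr_ge0.
have base x : X x -> (dist0_sq (reg_subdiff (Fbar Fo X) x) <= (3 * K ^+ 2 + 11)%:E)%E.
  move=> Xx; apply: (@dist0_sq_le _ _ _ (grad_F p x + 0)).
    by apply: subdiff_normal => // y _; rewrite dotX0l.
  rewrite addr0; have [h _] := HK x x Xx Xx.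
  have h2 : enormX (grad_F p x) ^+ 2 <= K ^+ 2 by rewrite ler_sqr ?nnegrE ?enormX_ge0.
  by clear -h2 K2; lra.
split=> // x q s eta Xx eta0 e1; set x' := next_x Pr eta x q s.
have [Xx' hz hD hn] := projection_step (zdir p x q s) (@X_segment _ _ _ p) HP Xx eta0.
rewrite -/(next_x Pr eta x q s) -/x' in Xx' hz hD hn.
rewrite /Dist; case: ifP => [hP|_]; last by rewrite mulr1; exact: base.
have P0 : 0 <= err_norm p x q s by exact: wnorm_ge0.
have he : - (1 / 4) <= err p x s.
  have P4 : err_norm p x q s <= 1 / 4.
    rewrite -ler_sqr ?nnegrE ?divr_ge0//; apply: le_trans hP _.
    by rewrite le_eqVlt; apply/orP; left; apply/eqP; field.
  have /ler_normlP[u _] : `|err p x s| <= 1 / 4 by apply: le_trans P4; exact: wnorm_ge_e.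
  by clear -u; lra.
have ze := zdir_err q Xx he.
have [_ lip] := HK x x' Xx Xx'.
set z := zdir p x q s in hz hD hn ze; set P := err_norm p x q s in P0 hP ze *.
set D := enormX (x' - x) in hz hD lip *.
have D0 : 0 <= D by exact: enormX_ge0.
apply: (@dist0_sq_le _ _ _ (grad_F p x' + (scaleX eta^-1 (x - x') - z))).
  exact: subdiff_normal.
have -> : grad_F p x' + (scaleX eta^-1 (x - x') - z) =
  (grad_F p x' - grad_F p x) + (scaleX eta^-1 (x - x') - (z - grad_F p x)).
  by rewrite opprB [RHS]addrCA subrKA addrCA.
set a := grad_F p x' - grad_F p x in lip *; set b := scaleX _ _; set r := z - grad_F p x in ze *.
have n1 : enormX (a + (b - r)) <= enormX a + (enormX b + enormX r).
  by apply: le_trans (enormXD _ _) _; rewrite lerD2l; exact: enormXB.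
have nb : enormX b = D / eta.
  by rewrite /b enormXZ ger0_norm ?invr_ge0 ?(ltW eta0)// enormXC mulrC.
have a0 := enormX_ge0 a; have b0 := enormX_ge0 b; have rr0 := enormX_ge0 r.
have n2 : enormX (a + (b - r)) ^+ 2 <= (enormX a + (enormX b + enormX r)) ^+ 2.
  by rewrite ler_sqr ?nnegrE ?enormX_ge0// (le_trans (enormX_ge0 _) n1).
have n3 : enormX a ^+ 2 <= K ^+ 2 * (D ^+ 2 / eta ^+ 2).
  have u1 : enormX a <= K * (D / eta).
    apply: le_trans lip _; rewrite ler_wpM2l// ler_pdivlMr// ler_piMr//.
  rewrite -expr_div_n -exprMn ler_sqr ?nnegrE//; exact: le_trans u1.
have n4 : enormX b ^+ 2 = D ^+ 2 / eta ^+ 2 by rewrite nb expr_div_n.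
have De : 0 <= D ^+ 2 / eta ^+ 2 by rewrite -n4 sqr_ge0.
have s1 := sqr_ge0 (enormX a - enormX b); have s2 := sqr_ge0 (enormX a - enormX r).
have s3 := sqr_ge0 (enormX b - enormX r).
have KP := mulr_ge0 K2 (sqr_ge0 P).
have P2 := sqr_ge0 P.
by clear -n2 n3 n4 s1 s2 s3 ze KP P2 De; lra.
Qed.

End Assembly.

(** * Expectations and the convergence rate *)

Section Expectation.
Variables (R : realType) (n T : nat).
Hypothesis n_gt0 : (0 < n)%N.
Implicit Types (idx : nat -> 'I_n) (Phi : (nat -> 'I_n) -> R).

Definition draw (f : {ffun 'I_T.+1 -> 'I_n}) : nat -> 'I_n := fun j => f (inord j).

Definition expect Phi : R := n%:R ^- T.+1 * \sum_(f : {ffun 'I_T.+1 -> 'I_n}) Phi (draw f).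

Definition update idx (j : nat) (i : 'I_n) : nat -> 'I_n := fun m => if m == j then i else idx m.

Definition local Phi := forall a b, (forall m, (m <= T)%N -> a m = b m) -> Phi a = Phi b.

Lemma expectD Phi Phi' : expect (fun idx => Phi idx + Phi' idx) = expect Phi + expect Phi'.
Proof. by rewrite /expect big_split mulrDr. Qed.

Lemma expectZ (c : R) Phi : expect (fun idx => c * Phi idx) = c * expect Phi.
Proof. by rewrite /expect -mulr_sumr mulrCA. Qed.

Lemma expect_weight_ge0 : 0 <= n%:R ^- T.+1 :> R.
Proof. by rewrite invr_ge0 exprn_ge0. Qed.

Lemma expect_le Phi Phi' : (forall idx, Phi idx <= Phi' idx) -> expect Phi <= expect Phi'.
Proof. by move=> h; rewrite /expect ler_wpM2l ?expect_weight_ge0// ler_sum. Qed.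

Lemma expect_cst (c : R) : expect (fun=> c) = c.
Proof.
rewrite /expect sumr_const card_ffun !card_ord -[c *+ _]mulr_natl natrX mulrA mulVf ?mul1r//.
by rewrite expf_neq0// pnatr_eq0 -lt0n.
Qed.

Lemma eq_expect Phi Phi' : (forall idx, Phi idx = Phi' idx) -> expect Phi = expect Phi'.
Proof. by move=> h; rewrite /expect; congr (_ * _); apply: eq_bigr. Qed.

(* Swapping the value of the j-th draw with an independent fresh index is an
   involution of the joint sample space. *)
Lemma expect_resample (j : nat) Phi : (j <= T)%N -> local Phi ->
  expect Phi = expect (fun idx => avg (fun i => Phi (update idx j i))).
Proof.
move=> jT lPhi; rewrite /expect; congr (_ * _).
pose fu (f : {ffun 'I_T.+1 -> 'I_n}) (i : 'I_n) : {ffun 'I_T.+1 -> 'I_n} :=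
  [ffun m => if m == inord j then i else f m].
have updE f i : Phi (update (draw f) j i) = Phi (draw (fu f i)).
  apply: lPhi => m mT; rewrite /update /draw /fu ffunE.
  have -> : (inord m == inord j :> 'I_T.+1) = (m == j).
    by rewrite -val_eqE /= !inordK// ltnS.
  by [].
have n0 : n%:R != 0 :> R by rewrite pnatr_eq0 -lt0n.
transitivity (n%:R^-1 * \sum_(f : {ffun 'I_T.+1 -> 'I_n}) \sum_(i < n) Phi (draw f)).
  rewrite mulr_sumr; apply: eq_bigr => f _.
  by rewrite sumr_const card_ord -[Phi _ *+ n]mulr_natl mulrA mulVf// mul1r.
rewrite /avg -mulr_sumr; congr (_ * _).
rewrite [RHS](eq_bigr (fun f => \sum_(i < n) Phi (draw (fu f i)))); last first.
  by move=> f _; apply: eq_bigr => i _; rewrite updE.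
rewrite !pair_big /=.
pose sw (x : {ffun 'I_T.+1 -> 'I_n} * 'I_n) := (fu x.1 x.2, x.1 (inord j)).
have swK : involutive sw.
  move=> [f i]; rewrite /sw /=; congr pair; last by rewrite /fu ffunE eqxx.
  by apply/ffunP => m; rewrite !ffunE; case: eqP => [->|].
by rewrite (reindex_inj (inv_inj swK)).
Qed.

End Expectation.

(** * Trajectories and summation over time *)

Section Trajectory.
Variables (R : realType) (d n : nat) (p : losses R d n).
Local Notation V := ('rV[R]_d * R)%type.
Local Notation lT := (lamt (dC p) (lam0 p) (rho p)).
Variables (Pr : V -> V) (x1 : V) (eta beta : nat -> R).

Local Notation state := ((V * 'rV[R]_d * R * R)%type).

Definition trajectory (idx : nat -> 'I_n) (t : nat) : state :=
  ascdro (dl p) (dgl p) (rho p) Pr x1 eta beta idx t.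

Definition st_x (S : state) : V := S.1.1.1.
Definition st_q (S : state) : V := (S.1.1.2, S.1.2).
Definition st_s (S : state) : R := S.2.

Lemma trajectory_local a b t : (forall m, (m <= t)%N -> a m = b m) -> trajectory a t = trajectory b t.
Proof.
elim: t => [|t IH] h; rewrite /trajectory /=.
  by rewrite h.
rewrite /trajectory in IH; rewrite IH; last by move=> m mt; apply: h; exact: leqW.
by case: (ascdro _ _ _ _ _ _ _ b t) => [[[x v] u] s]; rewrite h.
Qed.

Lemma trajectory_step idx t :
  [/\ st_x (trajectory idx t.+1) = next_x p Pr (eta t.+1) (st_x (trajectory idx t)) (st_q (trajectory idx t))
        (st_s (trajectory idx t)),
    st_q (trajectory idx t.+1) = nextq p (beta t.+1) (st_x (trajectory idx t)) (st_x (trajectory idx t.+1))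
        (st_q (trajectory idx t)) (idx t.+1) &
    st_s (trajectory idx t.+1) = nexts p (beta t.+1) (st_x (trajectory idx t)) (st_x (trajectory idx t.+1))
        (st_s (trajectory idx t)) (idx t.+1)].
Proof.
rewrite /trajectory /=; case: (ascdro _ _ _ _ _ _ _ idx t) => [[[x v] u] s].
rewrite /st_x /st_q /st_s /=; split=> //.
rewrite /next_x /zdir /scaleX /=; congr (Pr (_, _)); first by rewrite addr0.
by rewrite /= addrA.
Qed.

End Trajectory.

Section Rate.
Variables (R : realType) (d n : nat) (p : losses R d n).
Local Notation V := ('rV[R]_d * R)%type.
Local Notation lT := (lamt (dC p) (lam0 p) (rho p)).
Local Notation X := (Xset (dW p) (lam0 p) lT).
Local Notation Fo := (Fobj (dl p) (rho p)).
Local Notation LFp := (LF (dG p) (dC p) (dL p) (lam0 p) (rho p)).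
Local Notation state := ((V * 'rV[R]_d * R * R)%type).
Local Notation dist2 := (fun x : V => dist0_sq (reg_subdiff (Fbar Fo X) x)).

Lemma trajectory_in_X Pr x1 eta beta idx t : is_projection X Pr -> X x1 ->
  X (st_x (trajectory p Pr x1 eta beta idx t)).
Proof.
move=> HP X1; case: t => [//|t].
have [-> _ _] := trajectory_step p Pr x1 eta beta idx t.
exact: (HP _).1.
Qed.

(** Finitely many index prefixes determine the state at time [t]. This bounds the Lyapunov function
    at the time from which it decreases, independently of [T]. *)
Lemma trajectory_bounded Pr x1 eta beta (G : state -> R) t :
  exists2 B, 0 <= B & forall idx, G (trajectory p Pr x1 eta beta idx t) <= B.
Proof.
pose absG (f : {ffun 'I_t.+1 -> 'I_n}) := `|G (trajectory p Pr x1 eta beta (draw f) t)|.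
exists (\sum_(f : {ffun 'I_t.+1 -> 'I_n}) absG f).
  by apply: sumr_ge0 => f _; exact: normr_ge0.
move=> idx; pose f : {ffun 'I_t.+1 -> 'I_n} := [ffun j => idx (nat_of_ord j)].
have -> : trajectory p Pr x1 eta beta idx t = trajectory p Pr x1 eta beta (draw f) t.
  by apply: trajectory_local => m mt; rewrite /draw /f ffunE /= inordK.
apply: le_trans (ler_norm _) _; rewrite -/(absG f) (bigD1 f)//= lerDl.
by apply: sumr_ge0 => h _; exact: normr_ge0.
Qed.

Lemma Dist_ge0 (eta P D : R) : 0 <= Dist eta P D.
Proof. by rewrite /Dist; case: ifP => // _; rewrite addr_ge0 ?divr_ge0 ?sqr_ge0. Qed.

(** The Lyapunov argument starts at a time [t0] after which the steps are small enough; earlier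
    iterates contribute a constant. As [eta] decreases, the weight of every gain is at least
    [eta T], which can be taken out of the sum. *)
Theorem ascdro_rate (Pr : V -> V) (x1 : V) (eta : nat -> R) (c kT' : R) :
  is_projection X Pr -> X x1 -> 130 * LFp ^+ 4 <= c -> 0 <= kT' ->
  (forall t, 0 < eta t) -> (forall t, eta t.+1 <= eta t) ->
  (forall t, eta t <= eta t.+1 * (1 + kT' * eta t ^+ 3)) ->
  (forall M, exists t0, forall t, (t0 <= t)%N -> M * eta t <= 1) ->
  exists2 A, 0 <= A & forall T, (0 < T)%N ->
    (expect_tau T (fun idx t =>
        (ascdro (dl p) (dgl p) (rho p) Pr x1 eta (fun t => (c * eta t ^+ 2)%R) idx t).1.1.1) dist2
     <= (T%:R^-1 * (A + A / eta T * (1 + \sum_(t < T) eta t.+1 ^+ 3)))%:E)%E.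
Proof.
move=> HP X1 hc kT0 eta0 eta_dec eta_slow eta_small.
have n0 := d_n p.
set beta := fun t => c * eta t ^+ 2.
have [k [M1 [kcE hE hS kXE Hst]]] := storm_step_exists HP hc kT0.
have [Ps [M2 [kap [C0 [kap0 C00 Ps0 HPs]]]]] := storm_lyapunov n0 hE hS.
have [K K0 [Kb Kd]] := dist_bound HP.
have [M3 M3ge M3P] := upper_const [:: M1; M2].
have [t0 ht0] := eta_small M3.
pose S idx t := trajectory p Pr x1 eta beta idx t.
have SX idx t : X (st_x (S idx t)) by exact: trajectory_in_X.
(* State [t] is iterate [t + 1] of the algorithm, and the step leaving it uses [eta t.+1]. *)
pose PsS t (s : state) := Ps (eta t.+1) (err p (st_x s) (st_s s))
  (err_norm p (st_x s) (st_q s) (st_s s)) (err_moment p (st_x s) (st_q s)) (Fo (st_x s) + 1).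
pose DiS t (s : state) := Dist (eta t.+1) (err_norm p (st_x s) (st_q s) (st_s s))
  (enormX (next_x p Pr (eta t.+1) (st_x s) (st_q s) (st_s s) - st_x s)).
have sm t M : (t0 <= t)%N -> M <= M3 -> M * eta t <= 1.
  by move=> ht hM; apply: le_trans (ht0 t ht); rewrite ler_pM2r.
have e1 t : (t0 <= t)%N -> eta t <= 1.
  by move=> ht; rewrite -[eta t]mul1r; exact: sm.
have PsS0 idx t : (t0 <= t)%N -> 0 <= PsS t (S idx t).
  move=> ht; apply: Ps0; rewrite ?e1 ?leqW//.
  - exact: wnorm_ge0.
  - exact: wnorm_ge_e.
  - by rewrite kXE; exact: err_moment_le.
  - by rewrite addr_ge0// Fobj_ge0.
have stepS idx t : (t0 <= t)%N ->
    avg (fun i => PsS t.+1 (S (update idx t.+1 i) t.+1)) <=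
    PsS t (S idx t) - kap * eta t.+1 * DiS t (S idx t) + C0 * eta t.+1 ^+ 3.
  move=> ht.
  have Su i : S (update idx t.+1 i) t = S idx t.
    by apply: trajectory_local => m mt; rewrite /update ltn_eqF.
  have st1 : M1 * eta t.+1 <= 1.
    by apply: sm; [exact: leqW|apply: M3P; rewrite !inE eqxx].
  have st2 : M2 * eta t.+1 <= 1.
    by apply: sm; [exact: leqW|apply: M3P; rewrite !inE eqxx orbT].
  have H := Hst _ (st_q (S idx t)) (st_s (S idx t)) _ _ (SX idx t) (eta0 t.+2) (eta_dec t.+1)
    (eta_slow t.+1) st1.
  have Xn : X (next_x p Pr (eta t.+1) (st_x (S idx t)) (st_q (S idx t)) (st_s (S idx t))).
    exact: (HP _).1.
  have := HPs _ _ _ _ _ _ _ _ _ _ _ _ _ H _ st2; rewrite kXE => /(_ (fun i => _))-/(_ (fun i => err_moment_le _ _ Xn)).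
  apply: le_trans; rewrite le_eqVlt; apply/orP; left; apply/eqP; apply: eq_avg => i.
  have [] := trajectory_step p Pr x1 eta beta (update idx t.+1 i) t.
  rewrite -/(S _ _) -/(S _ _) Su /PsS => -> -> ->.
  by rewrite /update eqxx.
have [B B0 HB] := trajectory_bounded Pr x1 eta beta (PsS t0) t0.
set A := K * t0.+1%:R + K * (B + C0) / kap.
have A0 : 0 <= A.
  apply: addr_ge0; first exact: mulr_ge0.
  by apply: divr_ge0; [apply: mulr_ge0 => //; exact: addr_ge0|exact: ltW].
exists A => // T T0.
have decr s t : (s <= t)%N -> eta t <= eta s.
  move=> /subnK <-; elim: (t - s)%N => [//|m IH]; rewrite addSn.
  exact: le_trans (eta_dec _) IH.
(* The distance at time [tau] is governed by the step that led there, hence by the state at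
   [tau.-1]. *)
pose rr tau idx := if (tau <= t0)%N then K else K * DiS tau.-1 (S idx tau.-1).
pose r tau := expect T (rr tau).
have exstep t : (t0 <= t)%N -> (t < T)%N ->
    expect T (fun idx => PsS t.+1 (S idx t.+1)) + kap * eta t.+1 * expect T (fun idx => DiS t (S idx t)) <=
    expect T (fun idx => PsS t (S idx t)) + C0 * eta t.+1 ^+ 3.
  move=> ht tT.
  have lo : local T (fun idx => PsS t.+1 (S idx t.+1)).
    move=> a b ab; congr (PsS _ _); apply: trajectory_local => m mt; apply: ab.
    exact: leq_trans mt tT.
  rewrite (@expect_resample _ _ _ n0 t.+1)// -expectZ -expectD -[C0 * _](@expect_cst _ n T)// -expectD.
  by apply: expect_le => idx; have := stepS idx t ht; lra.
set Sg := \sum_(t < T) eta t.+1 ^+ 3.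
have Sg0 : 0 <= Sg by apply: sumr_ge0 => t _; rewrite exprn_ge0// ltW.
have eT := eta0 T.
have rsum : \sum_(tau < T) r tau <= A + A / eta T * (1 + Sg).
  have Ae : 0 <= A / eta T * (1 + Sg).
    by apply: mulr_ge0; [apply: divr_ge0 => //; exact: ltW|exact: addr_ge0].
  have KA : K * t0.+1%:R <= A.
    rewrite /A lerDl; apply: divr_ge0; last exact: ltW.
    by apply: mulr_ge0 => //; exact: addr_ge0.
  have rK tau : (tau <= t0)%N -> r tau = K.
    by move=> h; rewrite /r /rr h expect_cst.
  have [Tt|Tt] := leqP T t0.
    have -> : \sum_(tau < T) r tau = K * T%:R.
      rewrite (eq_bigr (fun=> K)) => [|i _]; last first.
        by rewrite rK// (leq_trans (ltnW (ltn_ord i)) Tt).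
      by rewrite sumr_const card_ord mulr_natr.
    have : K * T%:R <= K * t0.+1%:R by rewrite ler_wpM2l// ler_nat leqW.
    by move=> h; clear -h KA Ae; lra.
  have tele m : (t0 + m <= T)%N ->
     kap * eta T * \sum_(tau < (t0 + m).+1) r tau + K * expect T (fun idx => PsS (t0 + m)%N (S idx (t0 + m)%N))
     <= kap * eta T * (K * t0.+1%:R) + K * (B + C0 * \sum_(t < t0 + m) eta t.+1 ^+ 3).
    elim: m => [_|m IH hm].
      rewrite addn0 (eq_bigr (fun=> K)) => [|i _]; last by rewrite rK// -ltnS.
      rewrite sumr_const card_ord mulr_natr lerD2l ler_wpM2l//.
      apply: (@le_trans _ _ B).
        by rewrite -[B](@expect_cst _ n T)//; apply: expect_le => idx; exact: HB.
      rewrite lerDl; apply: mulr_ge0 => //.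
      by apply: sumr_ge0 => t _; rewrite exprn_ge0// ltW.
    rewrite addnS in hm *; have {}IH := IH (ltnW hm).
    have q1 : \sum_(tau < (t0 + m).+2) r tau = \sum_(tau < (t0 + m).+1) r tau + r (t0 + m).+1.
      by rewrite big_ord_recr.
    have q2 : \sum_(t < (t0 + m).+1) eta t.+1 ^+ 3 =
        \sum_(t < t0 + m) eta t.+1 ^+ 3 + eta (t0 + m).+1 ^+ 3 by rewrite big_ord_recr.
    rewrite q1 q2 {q1 q2}.
    have st := exstep (t0 + m)%N (leq_addr _ _) hm.
    have rE : r (t0 + m).+1 = K * expect T (fun idx => DiS (t0 + m)%N (S idx (t0 + m)%N)).
      rewrite /r -expectZ; apply: eq_expect => idx; rewrite /rr ifF//.
      by apply/negbTE; rewrite -ltnNge ltnS leq_addr.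
    rewrite rE; set De := expect T (fun idx => DiS _ _) in st *.
    have De0 : 0 <= De.
      rewrite -[0](@expect_cst _ n T)//; apply: expect_le => idx; exact: Dist_ge0.
    have ee : eta T <= eta (t0 + m).+1 by exact: decr.
    have u1 : kap * De * eta T <= kap * De * eta (t0 + m).+1.
      by rewrite ler_wpM2l// mulr_ge0// ltW.
    have u2 := ler_wpM2l K0 u1; have u3 := ler_wpM2l K0 st.
    by clear -IH u2 u3; lra.
  have /tele h : (t0 + (T - t0.+1) <= T)%N.
    by rewrite -ltnS -addSn subnKC// ltnS.
  have TE : (t0 + (T - t0.+1)).+1 = T by rewrite -addSn subnKC.
  rewrite TE in h.
  have P0 : 0 <= K * expect T (fun idx => PsS (t0 + (T - t0.+1))%N (S idx (t0 + (T - t0.+1))%N)).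
    apply: mulr_ge0 => //; rewrite -[0](@expect_cst _ n T)//; apply: expect_le => idx.
    exact: PsS0 (leq_addr _ _).
  have Sle : \sum_(t < t0 + (T - t0.+1)) eta t.+1 ^+ 3 <= Sg.
    rewrite /Sg -[in leRHS]TE big_ord_recr /= lerDl exprn_ge0// ltW//.
  have u1 : C0 * \sum_(t < t0 + (T - t0.+1)) eta t.+1 ^+ 3 <= C0 * Sg by rewrite ler_wpM2l.
  have u2 := ler_wpM2l K0 u1.
  have ke : 0 < kap * eta T by rewrite mulr_gt0.
  rewrite -(ler_pM2l ke).
  have -> : kap * eta T * (A + A / eta T * (1 + Sg)) = kap * eta T * A + kap * A * (1 + Sg).
    by field; rewrite gt_eqF.
  have kA : K * (B + C0) <= kap * A.
    have -> : kap * A = kap * (K * t0.+1%:R) + K * (B + C0).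
      by rewrite /A; move: (t0.+1%:R) => tt; field; rewrite gt_eqF.
    rewrite lerDr.
    by apply: mulr_ge0; [exact: ltW|exact: mulr_ge0].
  have u3 := ler_wpM2r (addr_ge0 ler01 Sg0) kA.
  have u4 := ler_wpM2l (ltW ke) KA.
  have u5 := mulr_ge0 (mulr_ge0 K0 B0) Sg0.
  have u6 := mulr_ge0 K0 C00.
  by clear -h P0 u2 u3 u4 u5 u6; lra.
have pt tau idx : (dist2 (st_x (S idx tau)) <= (rr tau idx)%:E)%E.
  rewrite /rr; case: ifP => [_|h]; first exact: Kb.
  have {h} h : (t0 < tau)%N by rewrite ltnNge h.
  case: tau h => [//|t] h; rewrite /=.
  have [-> _ _] := trajectory_step p Pr x1 eta beta idx t.
  apply: Kd => //; apply: e1; exact: ltnW.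
rewrite /expect_tau.
apply: (@le_trans _ _ ((T%:R^-1 * n%:R ^- T.+1)%:E *
    \sum_(f : {ffun 'I_T.+1 -> 'I_n}) \sum_(tau < T) (rr tau (draw f))%:E)%E).
  apply: lee_wpmul2l.
    by rewrite lee_fin mulr_ge0 ?invr_ge0// expect_weight_ge0.
  by apply: lee_sum => f _; apply: lee_sum => tau _; exact: pt.
under eq_bigr => f _ do rewrite sumEFin.
rewrite sumEFin -EFinM lee_fin -[leLHS]mulrA.
apply: ler_wpM2l; first by rewrite invr_ge0.
apply: le_trans rsum; rewrite exchange_big /= mulr_sumr.
by rewrite le_eqVlt; apply/orP; left; apply/eqP; apply: eq_bigr.
Qed.

End Rate.

(** * Step sizes and the final rate *)

Section StepSizes.
Variables (R : realType) (k omega q : R).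
Hypotheses (k_gt0 : 0 < k) (omega_gt0 : 0 < omega) (q_gt0 : 0 < q).

Definition step_size (t : nat) : R := k / powR (omega + t%:R * q) (1 / 3).

Lemma step_base_gt0 t : 0 < omega + t%:R * q.
Proof. by rewrite ltr_pwDl// mulr_ge0// ltW. Qed.

Lemma step_size_gt0 t : 0 < step_size t.
Proof. by rewrite divr_gt0// powR_gt0// step_base_gt0. Qed.

Lemma powR3_cube (x : R) : 0 <= x -> (powR x (1 / 3)) ^+ 3 = x.
Proof.
move=> x0; rewrite -powR_mulrn ?powR_ge0// -powRrM.
have -> : 1 / 3 * 3%:R = 1 :> R by field.
by rewrite powRr1.
Qed.

Lemma step_size_cube t : step_size t ^+ 3 = k ^+ 3 / (omega + t%:R * q).
Proof. by rewrite /step_size expr_div_n powR3_cube// ltW// step_base_gt0. Qed.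

Lemma step_size_dec t : step_size t.+1 <= step_size t.
Proof.
have b0 := step_base_gt0 t; have b1 := step_base_gt0 t.+1.
rewrite /step_size ler_pM2l// lef_pV2 ?posrE ?powR_gt0//.
rewrite ge0_ler_powR ?nnegrE ?divr_ge0 ?(ltW b0) ?(ltW b1)//.
by rewrite lerD2l ler_wpM2r ?(ltW q_gt0)// ler_nat.
Qed.

(** With [b] and [b' = b + q] the consecutive bases, the ratio is the cube root of [b' / b], at most
    [b' / b = 1 + q / b], and [1 / b] is [step_size t ^+ 3 / k ^+ 3]. *)
Lemma step_size_slow t :
  step_size t <= step_size t.+1 * (1 + q / k ^+ 3 * step_size t ^+ 3).
Proof.
have b0 := step_base_gt0 t; have b1 := step_base_gt0 t.+1.
rewrite step_size_cube.
set b := omega + t%:R * q in b0 *; set b' := omega + t.+1%:R * q in b1 *.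
have b'E : b' = b + q by rewrite /b' /b -natr1; ring.
have -> : 1 + q / k ^+ 3 * (k ^+ 3 / b) = b' / b.
  by rewrite b'E; field; rewrite !gt_eqF.
have r1 : 1 <= b' / b by rewrite ler_pdivlMr// mul1r b'E lerDl ltW.
have r0 : 0 < b' / b by exact: lt_le_trans ltr01 r1.
rewrite /step_size -/b -/b' -mulrA ler_pM2l//.
have p0 : 0 < powR b (1 / 3) by rewrite powR_gt0.
have p1 : 0 < powR b' (1 / 3) by rewrite powR_gt0.
have h : powR b' (1 / 3) <= b' / b * powR b (1 / 3).
  have -> : powR b' (1 / 3) = powR (b' / b) (1 / 3) * powR b (1 / 3).
    by rewrite -powRM ?(ltW r0) ?(ltW b0)// divfK// gt_eqF.
  rewrite ler_wpM2r ?powR_ge0//.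
  have t1 : 1 / 3 <= 1 :> R by rewrite ler_pdivrMr// mul1r ler1n.
  by have := ler_powR r1 t1; rewrite powRr1 ?(ltW r0).
by rewrite [leRHS]mulrC ler_pdivlMr// [leLHS]mulrC ler_pdivrMr.
Qed.

Lemma step_size_small (M : R) : exists t0, forall t, (t0 <= t)%N -> M * step_size t <= 1.
Proof.
have x0 : 0 <= `|M| * k by rewrite mulr_ge0// ltW.
exists (Num.bound ((`|M| * k) ^+ 3 / q)) => t ht.
have b0 := step_base_gt0 t.
apply: (@le_trans _ _ (`|M| * step_size t)).
  by rewrite ler_wpM2r ?(ltW (step_size_gt0 t))// ler_norm.
rewrite /step_size mulrA ler_pdivrMr ?powR_gt0// [leRHS]mul1r.
suff c : (`|M| * k) ^+ 3 <= powR (omega + t%:R * q) (1 / 3) ^+ 3.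
  by move: c; rewrite ler_pXn2r ?nnegrE ?powR_ge0.
rewrite powR3_cube ?(ltW b0)//.
have h : (`|M| * k) ^+ 3 / q <= t%:R.
  have u : (Num.bound ((`|M| * k) ^+ 3 / q))%:R <= t%:R :> R by rewrite ler_nat.
  apply: le_trans u; apply/ltW/archi_boundP; apply: divr_ge0; [exact: exprn_ge0|exact: ltW].
by rewrite ler_pdivrMr// in h; apply: le_trans h _; rewrite lerDr ltW.
Qed.

Lemma harmonic_le T : (0 < T)%N -> \sum_(t < T) (t.+1%:R)^-1 <= 1 + ln (T%:R) :> R.
Proof.
case: T => [//|T] _; elim: T => [|T IH].
  by rewrite big_ord_recl big_ord0 /= invr1 addr0 ln1 addr0.
rewrite big_ord_recr /=.
have h : (T.+2%:R)^-1 <= ln (T.+2%:R) - ln (T.+1%:R) :> R.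
  have t1 : 0 < T.+1%:R :> R by rewrite ltr0n.
  have t2 : 0 < T.+2%:R :> R by rewrite ltr0n.
  have u : ln (T.+1%:R / T.+2%:R) <= T.+1%:R / T.+2%:R - 1 :> R.
    have -> : T.+1%:R / T.+2%:R = 1 + (T.+1%:R / T.+2%:R - 1) :> R by ring.
    apply: le_trans (le_ln1Dx _) _; last by rewrite addrCA subrr addr0.
    by rewrite -subr_gt0 opprK subrK divr_gt0.
  rewrite ln_div ?posrE// in u.
  have e : T.+1%:R / T.+2%:R - 1 = - (T.+2%:R)^-1 :> R.
    have e2 : T.+2%:R = T.+1%:R + 1 :> R by rewrite natr1.
    rewrite e2 in t2 *; move: (T.+1%:R) t2 => a t2.
    by field; rewrite gt_eqF.
  by rewrite e lerNr opprB in u.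
apply: le_trans (lerD IH h) _.
by rewrite -addrA [ln T.+1%:R + _]addrC subrK.
Qed.

Lemma step_size_inv T : (0 < T)%N ->
  (step_size T)^-1 <= powR (omega + q) (1 / 3) / k * powR T%:R (1 / 3).
Proof.
move=> T0; have T1 : 1 <= T%:R :> R by rewrite ler1n.
have oq : 0 <= omega + q by rewrite addr_ge0 ?ltW.
rewrite /step_size invf_div mulrAC ler_pM2r ?invr_gt0// -powRM//.
rewrite ge0_ler_powR ?nnegrE ?divr_ge0 ?(ltW (step_base_gt0 T)) ?mulr_ge0//.
have h : omega * 1 <= omega * T%:R by rewrite ler_pM2l.
lra.
Qed.

Lemma rate_bound (A : R) : 0 <= A -> exists K : R, exists T0 : nat, forall T, (T0 <= T)%N ->
  (0 < T)%N /\
  T%:R^-1 * (A + A / step_size T * (1 + \sum_(t < T) step_size t.+1 ^+ 3)) <=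
  K * ln T%:R / powR T%:R (2 / 3).
Proof.
move=> A0; set w := powR (omega + q) (1 / 3) / k; set v := k ^+ 3 / q.
have w0 : 0 <= w by rewrite divr_ge0 ?powR_ge0// ltW.
have v0 : 0 <= v by rewrite divr_ge0 ?exprn_ge0// ltW.
(* From this threshold on [ln T >= 1], so that constants are absorbed by the logarithm; the
   successor excludes [T = 0]. *)
exists (A + A * w * (1 + 2 * v)), (Num.bound (expR 1 : R)).+1 => T hT.
have T0 : (0 < T)%N by exact: leq_trans hT.
split=> //.
have T1 : 1 <= T%:R :> R by rewrite ler1n.
have Tp : 0 < T%:R :> R by exact: lt_le_trans ltr01 T1.
have lnT : 1 <= ln (T%:R) :> R.
  rewrite -[leLHS]expRK ler_ln ?posrE ?expR_gt0//.
  apply: le_trans (ltW (archi_boundP (expR_ge0 1))) _.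
  by rewrite ler_nat ltnW.
set l := ln _ in lnT *.
pose c1 : R := powR (T%:R : R) (1 / 3).
have c1p : 0 < c1 by rewrite powR_gt0.
have c11 : 1 <= c1 by rewrite -(@powRr0 _ (T%:R : R)) ler_powR// divr_ge0.
have c2p : 0 < powR T%:R (2 / 3) :> R by rewrite powR_gt0.
have cc : T%:R = c1 * powR T%:R (2 / 3).
  rewrite -powRD ?(gt_eqF Tp) ?implybT//.
  by have -> : 1 / 3 + 2 / 3 = 1 :> R by [field]; rewrite powRr1 ?ltW.
have S1 : \sum_(t < T) step_size t.+1 ^+ 3 <= v * (1 + l).
  apply: (@le_trans _ _ (v * \sum_(t < T) (t.+1%:R)^-1)).
    rewrite mulr_sumr; apply: ler_sum => t _; rewrite step_size_cube /v -mulrA.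
    rewrite ler_pM2l ?exprn_gt0// -invfM lef_pV2 ?posrE ?step_base_gt0 ?mulr_gt0//.
    by rewrite mulrC lerDr ltW.
  by rewrite ler_wpM2l// harmonic_le.
set S := \sum_(t < T) _ in S1 *.
have S0 : 0 <= S by apply: sumr_ge0 => t _; rewrite exprn_ge0// ltW// step_size_gt0.
have S2 : 1 + S <= (1 + 2 * v) * l.
  have h := ler_wpM2l v0 lnT; clear -S1 lnT h; lra.
have E1 : A / step_size T * (1 + S) <= A * (w * c1) * ((1 + 2 * v) * l).
  apply: ler_pM => //.
  - by rewrite divr_ge0// ltW// step_size_gt0.
  - by rewrite addr_ge0.
  - by rewrite ler_wpM2l// step_size_inv.
have E2 : A <= A * (c1 * l).
  by rewrite ler_peMr// -[1]mulr1 ler_pM.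
rewrite ler_pdivlMr// -[leLHS]mulrA ler_pdivrMl//.
have -> : T%:R * ((A + A * w * (1 + 2 * v)) * l) =
  powR T%:R (2 / 3) * (A * (c1 * l) + A * (w * c1) * ((1 + 2 * v) * l)).
  by rewrite {1}cc; ring.
rewrite [leLHS]mulrC ler_pM2l//; exact: lerD.
Qed.

End StepSizes.

Unset Implicit Arguments.
Set Strict Implicit.
Set Printing Implicit Defensive.

Theorem theorem2 (R : realType) (d n : nat) (hn : (0 < n)%N)
  (W : set 'rV[R]_d) (hWne : W !=set0) (hWcl : closed W) (hWcv : convex_set W)
  (ell : 'I_n -> 'rV[R]_d -> R) (gl : 'I_n -> 'rV[R]_d -> 'rV[R]_d)
  (* l_i twice differentiable: gl i is its gradient and is itself differentiable *)
  (hgrad : forall i, is_gradient (ell i) (gl i))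
  (hgrad2 : forall i w, differentiable (gl i) w)
  (hell0 : forall i w, W w -> 0 <= ell i w)
  (lam0 rho : R) (hlam0 : 0 < lam0) (hrho : 0 < rho)
  (Rb G C L Delta : R)
  (* Assumption A *)
  (hA_a : forall w, W w -> enorm w <= Rb)
  (hA_bG : forall i w, W w -> enorm (gl i w) <= G)
  (hA_bC : forall i w, W w -> `|ell i w| <= C)
  (hA_c : forall i w1 w2, W w1 -> W w2 ->
            enorm (gl i w1 - gl i w2) <= L * enorm (w1 - w2))
  (x1 : 'rV[R]_d * R)
  (hx1 : Xset W lam0 (lamt C lam0 rho) x1)
  (hA_d : forall w lam, W w -> lam0 <= lam ->
            Fobj ell rho x1 - Fobj ell rho (w, lam) <= Delta)
  (* Euclidean projection onto X *)
  (projX : 'rV[R]_d * R -> 'rV[R]_d * R)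
  (hproj : forall y, Xset W lam0 (lamt C lam0 rho) (projX y) /\
             forall x, Xset W lam0 (lamt C lam0 rho) x ->
               enormX (y - projX y) <= enormX (y - x))
  (* Assumption B *)
  (sig_g sig_dg : R) (hsg : 0 <= sig_g) (hsdg : 0 <= sig_dg)
  (hB_g : forall x, Xset W lam0 (lamt C lam0 rho) x ->
     n%:R^-1 * \sum_(i < n) (gi ell i x - gavg ell x) ^+ 2 <= sig_g ^+ 2)
  (hB_dg : forall x, Xset W lam0 (lamt C lam0 rho) x ->
     n%:R^-1 * \sum_(i < n) enormX ((gwi ell gl i x, gli ell i x)
                                    - (gwavg ell gl x, glavg ell x)) ^+ 2
       <= sig_dg ^+ 2)
  (hsig : 0 < Num.max sig_g sig_dg)
  (alpha : R) (halpha : 1 < alpha) :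
  let sig2 := Num.max (sig_g ^+ 2) (sig_dg ^+ 2) in
  let sigma := Num.sqrt sig2 in
  let LFc := LF G C L lam0 rho in
  let k := alpha * powR sigma (2 / 3) / LFc in
  let omega := Num.max (2 * sig2) ((16 * LFc ^+ 2 * k) ^+ 3) in
  let c := sig2 / (14 * LFc * k ^+ 3) + 130 * LFc ^+ 4 in
  let eta := fun t : nat => k / powR (omega + t%:R * sig2) (1 / 3) in
  let beta := fun t : nat => c * eta t ^+ 2 in
  let X := Xset W lam0 (lamt C lam0 rho) in
  exists K : R, exists T0 : nat, forall T : nat, (T0 <= T)%N ->
    (expect_tau T
       (fun idx t => (ascdro ell gl rho projX x1 eta beta idx t).1.1.1)
       (fun x => dist0_sq (reg_subdiff (Fbar (Fobj ell rho) X) x))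
     <= (K * ln T%:R / powR T%:R (2 / 3))%:E)%E.
Proof.
move=> sig2 sigma LFc k omega c eta beta X.
pose p := @Losses R d n W ell gl lam0 rho Rb G C L hn hWne hWcv hgrad hell0 hlam0 hrho
  hA_a hA_bG hA_bC hA_c.
have sig2_gt0 : 0 < sig2.
  move: hsig; rewrite /sig2 !lt_max => /orP[h|h]; apply/orP; [left|right];
    exact: exprn_gt0.
have sigma_gt0 : 0 < sigma by rewrite sqrtr_gt0.
have LF_gt0 : 0 < LFc by exact: lt_le_trans ltr01 (LF_ge1 p).
have k_gt0 : 0 < k.
  apply: divr_gt0 => //; apply: mulr_gt0; first exact: lt_trans ltr01 halpha.
  exact: powR_gt0.
have omega_gt0 : 0 < omega by rewrite /omega lt_max mulr_gt0.
have hc : 130 * LFc ^+ 4 <= c.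
  rewrite /c lerDr; apply: divr_ge0; first exact: ltW.
  by apply: mulr_ge0; [apply: mulr_ge0 => //; exact: ltW|apply: exprn_ge0; exact: ltW].
have kT_ge0 : 0 <= sig2 / k ^+ 3.
  by apply: divr_ge0; [exact: ltW|apply: exprn_ge0; exact: ltW].
have [A A0 HA] := @ascdro_rate R d n p projX x1 eta c (sig2 / k ^+ 3) hproj hx1 hc kT_ge0
  (step_size_gt0 k_gt0 omega_gt0 sig2_gt0) (step_size_dec k_gt0 omega_gt0 sig2_gt0)
  (step_size_slow k_gt0 omega_gt0 sig2_gt0) (step_size_small k_gt0 omega_gt0 sig2_gt0).
have [K [T0 HK]] := rate_bound k_gt0 omega_gt0 sig2_gt0 A0.
exists K, T0 => T hT; have [T_gt0 le] := HK T hT.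
by apply: le_trans (HA T T_gt0) _; rewrite lee_fin.
Qed.
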